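(* Let $d\ge2$, $0<\lambda_-<\lambda_+<\infty$, $\mathcal K=\{\Sigma\in\mathcal S^{++}(d):\lambda_- I\preceq\Sigma\preceq\lambda_+ I\}$, and $(\mu_0,\Sigma_0)\in\mathbb H^d\times\operatorname{int}(\mathcal K)$, and assume that the Fisher information matrix $\mathcal I(\vartheta_0)$ of the anisotropic HWN family is positive definite. For $h\in\mathbb R^p$ let $\vartheta_{n,h}=\vartheta_0+h/\sqrt n$, and define $$\Lambda_n(h)=\log\frac{dP^n_{\vartheta_{n,h}}}{dP^n_{\vartheta_0}}=\sum_{i=1}^n\bigl(m_{\vartheta_{n,h}}(X_i)-m_{\vartheta_0}(X_i)\bigr),\qquad\Delta_n=\frac1{\sqrt n}\sum_{i=1}^n\mathsf s_{\vartheta_0}(X_i).$$ Then, uniformly for $h$ ranging over compact subsets of $\mathbb R^p$, $$\Lambda_n(h)=h^\top\Delta_n-\tfrac12h^\top\mathcal I(\vartheta_0)h+o_{P_{\vartheta_0}}(1),$$ i.e. for every compact $C\subset\mathbb R^p$ the supremum over $h\in C$ of the absolute remainder tends to $0$ in $P^n_{\vartheta_0}$-probability; and $\Delta_n\Rightarrow N(0,\mathcal I(\vartheta_0))$ under $P^n_{\vartheta_0}$.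
   Context: Hyperbolic space (Lorentz model): for $x,y\in\mathbb R^{d+1}$ let $\langle x,y\rangle_L=-x_0y_0+\sum_{j=1}^d x_jy_j$, and $\mathbb H^d=\{x\in\mathbb R^{d+1}:\langle x,x\rangle_L=-1,\ x_0>0\}$ with the Riemannian metric induced by $\langle\cdot,\cdot\rangle_L$ on tangent spaces. Let $o=(1,0,\dots,0)$. $\operatorname{Exp}_\mu:T_\mu\mathbb H^d\to\mathbb H^d$ is the Riemannian exponential map (a global diffeomorphism), $\operatorname{Log}_\mu$ its inverse, $PT_{x\to y}:T_x\mathbb H^d\to T_y\mathbb H^d$ parallel transport along the unique geodesic from $x$ to $y$. $T_o\mathbb H^d$ is identified with $\mathbb R^d$ by $(0,v)\leftrightarrow v$, and $T_{\mu_0}\mathbb H^d$ with $\mathbb R^d$ by a fixed linear isometry. Set $\mathsf T_\mu(x)=PT_{o\to\mu}^{-1}(\operatorname{Log}_\mu(x))\in\mathbb R^d$. $\mathcal S^{++}(d)$ is the set of real symmetric positive definite $d\times d$ matrices; $\preceq$ is the Loewner order. For $\mu\in\mathbb H^d$, $\Sigma\in\mathcal S^{++}(d)$, $\mathrm{HWN}_d(\mu,\Sigma)$ is the law of $\operatorname{Exp}_\mu(PT_{o\to\mu}Z)$ with $Z\sim N_d(0,\Sigma)$. Let $\varphi(v)=\log(\sinh\|v\|/\|v\|)$ for $v\in\mathbb R^d\setminus\{0\}$, $\varphi(0)=0$. The log-density with respect to Riemannian volume, up to the additive constant $-(d/2)\log(2\pi)$, is $$m_{\mu,\Sigma}(x)=-\tfrac12\log\det\Sigma-\tfrac12\mathsf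 T_\mu(x)^\top\Sigma^{-1}\mathsf T_\mu(x)-(d-1)\varphi(\mathsf T_\mu(x)).$$ Charts: $\alpha=\operatorname{Log}_{\mu_0}(\mu)\in\mathbb R^d$, $\mu(\alpha)=\operatorname{Exp}_{\mu_0}(\alpha)$; $\beta=\operatorname{vech}(\log\Sigma)\in\mathbb R^{d(d+1)/2}$, $\Sigma(\beta)=\exp(\operatorname{mat}(\beta))$, where $\operatorname{vech}$ is half-vectorization and $\operatorname{mat}$ its inverse onto symmetric matrices. Put $\vartheta=(\alpha,\beta)\in\mathbb R^p$, $p=d+d(d+1)/2$, $\vartheta_0=(0,\operatorname{vech}(\log\Sigma_0))$, $m_\vartheta=m_{\mu(\alpha),\Sigma(\beta)}$. $P_\vartheta=\mathrm{HWN}_d(\mu(\alpha),\Sigma(\beta))$, and $P_\vartheta^n$ is its $n$-fold product, the law of the i.i.d. sample $(X_1,\dots,X_n)$. The score is $\mathsf s_\vartheta(x)=\partial_\vartheta m_\vartheta(x)$ and the Fisher information is $\mathcal I(\vartheta)=\mathbb E_\vartheta[\mathsf s_\vartheta(X)\mathsf s_\vartheta(X)^\top]$, with $X\sim P_\vartheta$ under $\mathbb E_\vartheta$. $\Rightarrow$ is convergence in distribution. *)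

(* Defs.v *)
From HB Require Import structures.
From mathcomp Require Import all_boot all_order all_algebra.
From mathcomp Require Import all_classical all_reals all_analysis.

Set Implicit Arguments.
Unset Strict Implicit.
Unset Printing Implicit Defensive.

Import Order.TTheory GRing.Theory Num.Theory.
Import numFieldNormedType.Exports.

Local Open Scope classical_set_scope.
Local Open Scope ring_scope.

(* Conventions.  Vectors are row vectors.  The norm `|v| that MathComp-Analysis
   puts on matrices is the sup norm; it is used here only for its topology.
   The Euclidean norm is [enorm].
   Objects characterized by a property that has exactly one solution (the end
   point of a geodesic, an inverse map, ...) are picked by [xget]; the default
   value is never reached under the hypotheses for which they are meant. *)

Section LinearAlgebra.
Variable R : realType.

Definition dot k (u v : 'rV[R]_k) : R := \sum_i u 0 i * v 0 i.

Definition enorm k (v : 'rV[R]_k) : R := Num.sqrt (dot v v).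

Definition quad k (A : 'M[R]_k) (v : 'rV[R]_k) : R := dot (v *m A) v.

Definition symmetric k (A : 'M[R]_k) : Prop := A^T = A.

Definition posdef k (A : 'M[R]_k) : Prop :=
  symmetric A /\ forall v, v != 0 -> 0 < quad A v.

Definition loewner k (A B : 'M[R]_k) : Prop :=
  forall v, 0 <= quad (B - A) v.

Definition calK k (lm lp : R) : set 'M[R]_k :=
  [set S | [/\ posdef S, loewner lm%:M S & loewner S lp%:M]].

Definition mexp k (A : 'M[R]_k) : 'M[R]_k :=
  lim (series (fun i => (i`!%:R)^-1 *: A ^+ i) @ \oo).

Definition mlog k (S : 'M[R]_k) : 'M[R]_k :=
  xget 0 [set A | symmetric A /\ mexp A = S].

Definition vdim (k : nat) : nat := (k * k.+1)./2.

(* Column-major: (a_11, ..., a_k1, a_22, ..., a_k2, ..., a_kk). *)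
Definition vech k (A : 'M[R]_k) : 'rV[R]_(vdim k) :=
  \row_l nth 0 (flatten [seq [seq A i j | i : 'I_k <- enum 'I_k & (j <= i)%N]
                        | j <- enum 'I_k]) l.

Definition mat k (b : 'rV[R]_(vdim k)) : 'M[R]_k :=
  xget 0 [set A | symmetric A /\ vech A = b].

End LinearAlgebra.

(* Interior of A relative to the subspace D. *)
Definition relative_interior (T : topologicalType) (D A : set T) : set T :=
  [set x | D x /\ within D (nbhs x) A].

Section HyperbolicGeometry.
Variables (R : realType) (d : nat).
Implicit Types (x y v w mu : 'rV[R]_d.+1) (g V : R -> 'rV[R]_d.+1).

Definition lorentz x y : R :=
  - (x 0 0 * y 0 0) + \sum_(j < d) x 0 (lift ord0 j) * y 0 (lift ord0 j).

Definition hyperboloid : set 'rV[R]_d.+1 :=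
  [set x | lorentz x x = -1 /\ 0 < x 0 0].

Definition tangent x : set 'rV[R]_d.+1 := [set v | lorentz x v = 0].

(* The Levi-Civita covariant derivative of a tangent field along a curve of
   the hyperboloid is the Lorentz-orthogonal projection of the ambient
   derivative onto the tangent space; it vanishes iff the ambient derivative
   is Lorentz-orthogonal to the tangent space. *)
Definition covariantly_constant g V : Prop :=
  forall t, [/\ tangent (g t) (V t), derivable V t 1 &
                forall w, tangent (g t) w -> lorentz (V^`()%classic t) w = 0].

Definition geodesic g : Prop :=
  [/\ forall t, hyperboloid (g t), forall t, derivable g t 1 &
      covariantly_constant g (g^`()%classic)].

Definition Exp mu v : 'rV[R]_d.+1 :=
  xget 0 [set x | exists g, [/\ geodesic g, g 0 = mu, g^`()%classic 0 = v
                              & g 1 = x]].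

Definition Log mu x : 'rV[R]_d.+1 :=
  xget 0 [set v | tangent mu v /\ Exp mu v = x].

Definition PT x y v : 'rV[R]_d.+1 :=
  xget 0 [set w | exists g V, [/\ geodesic g, g 0 = x, g 1 = y,
                                  covariantly_constant g V
                                & V 0 = v /\ V 1 = w]].

Definition origin : 'rV[R]_d.+1 := row_mx (1 : 'rV[R]_1) (0 : 'rV[R]_d).

Definition of_coord (z : 'rV[R]_d) : 'rV[R]_d.+1 := row_mx (0 : 'rV[R]_1) z.

(* iota is a linear isometry of R^d onto the tangent space at mu. *)
Definition tangent_isometry mu (iota : {linear 'rV[R]_d -> 'rV[R]_d.+1}) : Prop :=
  range iota = tangent mu /\ forall u z, lorentz (iota u) (iota z) = dot u z.

Definition Tcoord mu x : 'rV[R]_d :=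
  xget 0 [set z | PT origin mu (of_coord z) = Log mu x].

Definition sinhR (r : R) : R := (expR r - expR (- r)) / 2.

Definition phi (v : 'rV[R]_d) : R :=
  if v == 0 then 0 else ln (sinhR (enorm v) / enorm v).

(* Log-density of HWN(mu, S) w.r.t. Riemannian volume, up to the additive
   constant - (d / 2) ln (2 pi). *)
Definition logdens mu (S : 'M[R]_d) x : R :=
  - (2^-1 * ln (\det S)) - 2^-1 * quad (invmx S) (Tcoord mu x)
  - (d%:R - 1) * phi (Tcoord mu x).

End HyperbolicGeometry.
Arguments origin {R d}.

(* Borel sigma-algebra on matrices. *)
Section BorelMatrix.
Variables (R : realType) (m n : nat).

HB.instance Definition _ := @isMeasurable.Build
  (sigma_display (@open 'M[R]_(m, n))) 'M[R]_(m, n)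
  <<s (@open 'M[R]_(m, n)) >> (@sigma_algebra0 _ setT _) (@sigma_algebraC _ _)
  (@sigma_algebra_bigcup _ setT _).

End BorelMatrix.

Section Probability.
Variable R : realType.

(* Image law of P under f.  The default is only there to make the definition
   total: it is used when f is not measurable. *)
Definition law d1 d2 (T1 : measurableType d1) (T2 : measurableType d2)
    (P : probability T1 R) (y0 : T2) (f : T1 -> T2) : probability T2 R :=
  match pselect (measurable_fun setT f) with
  | left mf => distribution P (HB.pack_for {mfun T1 >-> T2} f
                 (isMeasurableFun.Build _ _ _ _ f mf))
  | right _ => dirac y0
  end.

Fixpoint prodprob d1 (T : measurableType d1) (P : probability T R) (n : nat) :
    probability (n.-tuple T) R :=
  match n with
  | 0 => dirac [tuple]
  | k.+1 => distribution (P \x prodprob P k)%E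
      (HB.pack_for {mfun _ >-> _}
        (fun z : T * k.-tuple T => [tuple of z.1 :: z.2])
        (isMeasurableFun.Build _ _ _ _ _
          (measurable_cons measurable_fst measurable_snd)))
  end.

(* N_k(0, S): law of L G for G standard Gaussian and any L with L L^T = S;
   it does not depend on the choice of L. *)
Definition mnormal k (S : 'M[R]_k) : probability 'rV[R]_k R :=
  law (prodprob (normal_prob 0 1) k) (0 : 'rV[R]_k)
    (fun G => (\row_i (tnth G i : R)) *m (xget 0 [set L | L *m L^T = S])^T).

Definition cvg_in_distribution d1 (T : nat -> measurableType d1) k
    (P : forall n, probability (T n) R) (Y : forall n, T n -> 'rV[R]_k)
    (Q : probability 'rV[R]_k R) : Prop :=
  forall f : 'rV[R]_k -> R, continuous f -> (exists M, forall y, `|f y| <= M) ->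
    ('E_(P n)[f \o Y n] @[n --> \oo] --> 'E_Q[f])%E.

Definition cvg0_in_probability d1 (T : nat -> measurableType d1)
    (P : forall n, probability (T n) R) (Y : forall n, T n -> \bar R) : Prop :=
  forall e : R, 0 < e ->
    P n [set x | (e%:E < Y n x)%E] @[n --> \oo] --> 0%E.

End Probability.

Section WrappedNormal.
Variables (R : realType) (d : nat).

(* A law on the hyperboloid is seen as a Borel law on the ambient R^(d+1). *)
Definition HWN (mu : 'rV[R]_d.+1) (S : 'M[R]_d) : probability 'rV[R]_d.+1 R :=
  law (mnormal S) origin (fun z => Exp mu (PT origin mu (of_coord z))).

Variables (iota : {linear 'rV[R]_d -> 'rV[R]_d.+1}) (mu0 : 'rV[R]_d.+1).
Implicit Types (theta h : 'rV[R]_(d + vdim d)).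

Definition mu_of theta : 'rV[R]_d.+1 := Exp mu0 (iota (lsubmx theta)).

Definition Sigma_of theta : 'M[R]_d := mexp (mat (rsubmx theta)).

Definition model theta : probability 'rV[R]_d.+1 R :=
  HWN (mu_of theta) (Sigma_of theta).

Definition modeln theta n : probability (n.-tuple 'rV[R]_d.+1) R :=
  prodprob (model theta) n.

Definition mdens theta (x : 'rV[R]_d.+1) : R :=
  logdens (mu_of theta) (Sigma_of theta) x.

Definition score theta (x : 'rV[R]_d.+1) : 'rV[R]_(d + vdim d) :=
  \row_i 'D_(delta_mx 0 i) (fun t : 'rV[R]_(d + vdim d) => mdens t x) theta.

Definition fisher theta : 'M[R]_(d + vdim d) :=
  \matrix_(i, j)
    fine ('E_(model theta)[(fun x => score theta x 0 i * score theta x 0 j)%R])%E.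

Definition local_param theta n h : 'rV[R]_(d + vdim d) :=
  theta + (Num.sqrt n%:R)^-1 *: h.

Definition loglik_ratio theta n h (X : n.-tuple 'rV[R]_d.+1) : R :=
  \sum_(i < n) (mdens (local_param theta n h) (tnth X i)
                - mdens theta (tnth X i)).

Definition central_seq theta n (X : n.-tuple 'rV[R]_d.+1) :
    'rV[R]_(d + vdim d) :=
  (Num.sqrt n%:R)^-1 *: \sum_(i < n) score theta (tnth X i).

Definition LAN_remainder theta n h (X : n.-tuple 'rV[R]_d.+1) : R :=
  loglik_ratio theta h X
  - (dot h (central_seq theta X) - 2^-1 * quad (fisher theta) h).

End WrappedNormal.

(* Main.v *)
(* Geodesics and parallel transport of the hyperboloid are explicit, so a point
   drawn from HWN(mu, S) is the Lorentz boost taking the origin to mu applied to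
   (cosh |z|, sinh |z| z / |z|) with z normal.  Polar coordinates and the boost
   invariance of the hyperbolic volume du / sqrt (1 + |u|^2) then give its
   density, and likelihood ratios are exponentials of differences of mdens.

   The coordinate T_mu(x) is (r / sinh r) times a linear function of x, where
   cosh r = - <mu, x>, and mdens involves mu only through <mu, x>, T_mu(x) and
   S = exp B.  Hence log-likelihood ratios at theta0 + u expand as
   L(x, u) + Q(x, u) + O(w(x)^k |u|^3) with L linear, Q quadratic in u and
   w(x) = 1 + d(mu0, x), whose moments are bounded near theta0.  Expanding
   E exp (log-likelihood ratio) = 1 to second order gives E L = 0 and
   E Q = - E L^2 / 2; the remainder of the LAN expansion is then controlled by
   the centred sums of the coefficients of Q and by the cubic term, all small in
   mean uniformly over bounded h.

   For the central limit theorem, test functions are first averaged over a small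
   Gaussian shift.  Such an average has a Taylor expansion whose error is uniform
   in the (merely measurable, bounded) test function, so the n summands can be
   replaced one at a time by Gaussian ones with the same covariance; the
   stability of the Gaussian law and tightness conclude. *)
Require Import Defs.
From HB Require Import structures.
From mathcomp Require Import all_boot all_order all_algebra fingroup perm.
From mathcomp Require Import all_classical all_reals all_analysis.
From mathcomp Require Import measurable_realfun.
From mathcomp Require Import ring lra.

Set Implicit Arguments.
Unset Strict Implicit.
Unset Printing Implicit Defensive.

Import Order.TTheory GRing.Theory Num.Theory.
Import numFieldNormedType.Exports.

Local Open Scope classical_set_scope.
Local Open Scope charge_scope.
Local Open Scope ring_scope.

(** * Lebesgue measure on row vectors *)

(** The objects of the model are picked by [xget], and the score is a directional derivative of such
    an object. Smoothness is never studied for its own sake: closed forms of [Exp], [PT] and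
    [Tcoord] lead to one cubic expansion at theta0, with explicit dependence on x, and the score is
    recovered as its linear coefficient.

    The obstacle to that expansion is that the coordinates of x grow exponentially with the distance
    to mu0, so they have no polynomial bound. Perturbations are therefore taken relative to the cosh
    of the distance, and every coordinate is kept multiplied by r / sinh r. Exponential moments of
    the weight are avoided by reading the integral of |l|^3 exp l, for a log-likelihood ratio l, as
    the integral of |l|^3 under the neighbouring law.

    The event about the supremum over h is not known to be measurable. Its probability is bounded
    through the monotonicity of the product probability on arbitrary sets and an explicit measurable
    majorant of the remainder. *)

Section RowMeasurability.
Variable R : realType.

Lemma open_measurable_mx m n (U : set 'M[R]_(m, n)) : open U -> measurable U.
Proof. by move=> oU; apply: sub_sigma_algebra. Qed.

Lemma continuous_measurable_mx m n (f : 'M[R]_(m, n) -> R) :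
  continuous f -> measurable_fun setT f.
Proof.
move=> /continuousP cf; apply: (measurability _ (measurable_realfun.RGenOpens.measurableE R)).
move=> _ [_ [a [b ->] <-]]; rewrite setTI.
by apply: open_measurable_mx; apply: cf; exact: interval_open.
Qed.

Lemma measurable_coord m n (i : 'I_m) (j : 'I_n) :
  measurable_fun setT (fun v : 'M[R]_(m, n) => v i j).
Proof. apply: continuous_measurable_mx; exact: coord_continuous. Qed.

(** An open set is the union of the countably many boxes with rational corners that it contains, and
    the preimage of a box is a finite intersection of preimages of intervals under the
    coordinates. *)
Lemma measurable_row d (T : measurableType d) k (f : T -> 'rV[R]_k) :
  (forall j, measurable_fun setT (fun x => f x 0 j)) -> measurable_fun setT f.
Proof.
move=> mf.
apply: (@measurability _ _ _ _ _ _ (@open 'rV[R]_k)) => //.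
move=> _ [U oU <-]; rewrite setTI.
pose box (q : 'rV[rat]_k * 'rV[rat]_k) :=
  [set v : 'rV[R]_k | forall j, v 0 j \in `]ratr (q.1 0 j), ratr (q.2 0 j)[].
have -> : f @^-1` U =
    \bigcup_(q in [set q | box q `<=` U]) (f @^-1` (box q)).
  apply/seteqP; split=> [x Ux|x [q qU]]; last exact: qU.
  have /nbhs_ballP[e /= e0 eU] : nbhs (f x) U by apply: open_nbhs_nbhs.
  pose a j := xget 0 [set q : rat | f x 0 j - e / 2 < ratr q < f x 0 j].
  pose b j := xget 0 [set q : rat | f x 0 j < ratr q < f x 0 j + e / 2].
  have aP j : f x 0 j - e / 2 < ratr (a j) < f x 0 j.
    have /rat_in_itvoo[q] : f x 0 j - e / 2 < f x 0 j by lra.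
    rewrite in_itv/= => qP.
    exact: (@xgetPex _ 0 [set q : rat | _] (ex_intro _ q qP)).
  have bP j : f x 0 j < ratr (b j) < f x 0 j + e / 2.
    have /rat_in_itvoo[q] : f x 0 j < f x 0 j + e / 2 by lra.
    rewrite in_itv/= => qP.
    exact: (@xgetPex _ 0 [set q : rat | _] (ex_intro _ q qP)).
  exists (\row_j a j, \row_j b j) => /=.
    move=> v vq; apply: eU; split=> // i j; rewrite /ball/= (ord1 i).
    have := vq j; rewrite in_itv/= !mxE => /andP[h1 h2].
    have /andP[h3 h4] := aP j; have /andP[h5 h6] := bP j.
    by rewrite ltr_norml; apply/andP; split; lra.
  move=> j; rewrite in_itv/= !mxE.
  by have /andP[_ ->] := aP j; have /andP[-> _] := bP j.
rewrite bigcup_mkcond; apply: countable_bigcupT_measurable => // q.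
case: ifPn => // _.
rewrite (_ : _ @^-1` _ = \bigcap_(j in [set: 'I_k])
    ((fun x => f x 0 j) @^-1` `]ratr (q.1 0 j), ratr (q.2 0 j)[)); last first.
  by apply/seteqP; split=> x /= h j => [_|]; exact: h.
apply: fin_bigcap_measurable => // j _.
by rewrite -[X in measurable X]setTI; exact: mf.
Qed.

Lemma measurable_rsum d (T : measurableType d) (I : Type) (r : seq I)
    (P : pred I) (F : I -> T -> R) :
  (forall i, measurable_fun setT (F i)) ->
  measurable_fun setT (fun x => \sum_(i <- r | P i) F i x).
Proof.
move=> mF; elim: r => [|i r IH].
  by under eq_fun do rewrite big_nil; exact: measurable_cst.
have [Pi|nPi] := boolP (P i).
  by under eq_fun do rewrite big_cons Pi; exact: measurable_funD.
by under eq_fun do rewrite big_cons (negbTE nPi).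
Qed.

Lemma measurable_rowE d (T : measurableType d) m n (f : T -> 'M[R]_(m, n)) i j :
  measurable_fun setT f -> measurable_fun setT (fun x => f x i j).
Proof. by move=> mf; exact: measurableT_comp (measurable_coord i j) mf. Qed.

Lemma measurable_mulmx d (T : measurableType d) k m (f : T -> 'rV[R]_k)
    (M : 'M[R]_(k, m)) :
  measurable_fun setT f -> measurable_fun setT (fun x => f x *m M).
Proof.
move=> mf; apply: measurable_row => j.
under eq_fun do rewrite mxE; apply: measurable_rsum => i.
by apply: measurable_funM; [exact: measurable_rowE|exact: measurable_cst].
Qed.

Lemma measurable_rowD d (T : measurableType d) k (f g : T -> 'rV[R]_k) :
  measurable_fun setT f -> measurable_fun setT g ->
  measurable_fun setT (fun x => f x + g x).
Proof.
move=> mf mg; apply: measurable_row => j; under eq_fun do rewrite mxE.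
by apply: measurable_funD; exact: measurable_rowE.
Qed.

Lemma measurable_rowZ d (T : measurableType d) k (a : T -> R) (f : T -> 'rV[R]_k) :
  measurable_fun setT a -> measurable_fun setT f ->
  measurable_fun setT (fun x => a x *: f x).
Proof.
move=> ma mf; apply: measurable_row => j; under eq_fun do rewrite mxE.
by apply: measurable_funM => //; exact: measurable_rowE.
Qed.

Lemma measurable_dot d (T : measurableType d) k (f g : T -> 'rV[R]_k) :
  measurable_fun setT f -> measurable_fun setT g ->
  measurable_fun setT (fun x => dot (f x) (g x)).
Proof.
move=> mf mg; apply: measurable_rsum => i.
by apply: measurable_funM; exact: measurable_rowE.
Qed.

Lemma measurable_quad d (T : measurableType d) k (A : 'M[R]_k) (f : T -> 'rV[R]_k) :
  measurable_fun setT f -> measurable_fun setT (fun x => quad A (f x)).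
Proof. by move=> mf; apply: measurable_dot => //; exact: measurable_mulmx. Qed.

Lemma measurable_sqrt d (T : measurableType d) (f : T -> R) :
  measurable_fun setT f -> measurable_fun setT (fun x => Num.sqrt (f x)).
Proof.
move=> mf; apply: (measurableT_comp _ mf).
by apply: continuous_measurable_fun; exact: sqrt_continuous.
Qed.

Lemma measurable_enorm d (T : measurableType d) k (f : T -> 'rV[R]_k) :
  measurable_fun setT f -> measurable_fun setT (fun x => enorm (f x)).
Proof. by move=> mf; apply/measurable_sqrt/measurable_dot. Qed.

(** The inverse is written f (f^2)^(-1): the real power -1 is measurable but agrees with the inverse
    on nonnegative arguments only. Where f vanishes both sides are 0 by convention. *)
Lemma measurable_inv d (T : measurableType d) (f : T -> R) :
  measurable_fun setT f -> measurable_fun setT (fun x => (f x)^-1).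
Proof.
move=> mf; rewrite (_ : (fun _ => _) = fun x => f x * ((f x) ^+ 2) `^ (-1)).
  apply: measurable_funM => //.
  by apply: (measurableT_comp (measurable_powR (-1))); exact: measurable_funX.
apply/funext => x; have [->|fx0] := eqVneq (f x) 0; first by rewrite invr0 mul0r.
by rewrite powR_inv1 ?sqr_ge0// expr2 invfM mulrA mulfV ?mul1r.
Qed.

Definition row_cons k (x : R) (v : 'rV[R]_k) : 'rV[R]_k.+1 :=
  row_mx (x%:M : 'rV[R]_1) v.

Definition row_behead k (w : 'rV[R]_k.+1) : 'rV[R]_k :=
  rsubmx (w : 'rV[R]_(1 + k)).

Lemma row_cons0 k x (v : 'rV[R]_k) : row_cons x v 0 0 = x.
Proof.
have -> : (0 : 'I_k.+1) = lshift k (0 : 'I_1) by exact: val_inj.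
by apply: etrans (row_mxEl _ _ _ _) _; rewrite mxE eqxx mulr1n.
Qed.

Lemma row_consS k x (v : 'rV[R]_k) j : row_cons x v 0 (lift ord0 j) = v 0 j.
Proof.
have -> : lift ord0 j = rshift 1 j by exact: val_inj.
exact: etrans (row_mxEr _ _ _ _) _.
Qed.

Lemma row_beheadE k (w : 'rV[R]_k.+1) j : row_behead w 0 j = w 0 (lift ord0 j).
Proof. by rewrite mxE; congr (w _ _); exact: val_inj. Qed.

Lemma row_consK k (w : 'rV[R]_k.+1) : row_cons (w 0 0) (row_behead w) = w.
Proof.
apply/rowP => i; case: (unliftP ord0 i) => [j|] ->; last by rewrite row_cons0.
by rewrite row_consS row_beheadE.
Qed.

Lemma row_behead_cons k x (v : 'rV[R]_k) : row_behead (row_cons x v) = v.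
Proof. by apply/rowP => i; rewrite row_beheadE row_consS. Qed.

Lemma measurable_row_cons d (T : measurableType d) k (f : T -> R) (g : T -> 'rV[R]_k) :
  measurable_fun setT f -> measurable_fun setT g ->
  measurable_fun setT (fun x => row_cons (f x) (g x)).
Proof.
move=> mf mg; apply: measurable_row => i; case: (unliftP ord0 i) => [j|] ->.
  by under eq_fun do rewrite row_consS; exact: measurable_rowE.
by under eq_fun do rewrite row_cons0.
Qed.

Lemma measurable_row_behead k :
  measurable_fun setT (@row_behead k).
Proof.
by apply: measurable_row => i; under eq_fun do rewrite row_beheadE;
  exact: measurable_coord.
Qed.

End RowMeasurability.

Section RowProduct.
Variable R : realType.
Local Open Scope ereal_scope.

Definition row_cons_pair k (z : measurableTypeR R * 'rV[R]_k) : 'rV[R]_k.+1 := row_cons z.1 z.2.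

Lemma measurable_row_cons_pair k : measurable_fun setT (@row_cons_pair k).
Proof. by apply: measurable_row_cons. Qed.

Section Cons.
Variables (m : {sigma_finite_measure set (measurableTypeR R) -> \bar R}) (k : nat).
Variable mk : {sigma_finite_measure set 'rV[R]_k -> \bar R}.

(** The product measure is carried over to row vectors, so that Lebesgue measure lives on the type
    used by the model and can be peeled one coordinate at a time, in either order of integration. *)
Definition cons_measure : set 'rV[R]_k.+1 -> \bar R :=
  pushforward (m \x mk)%E (@row_cons_pair k).

Let mcons A : measurable A -> measurable (@row_cons_pair k @^-1` A).
Proof.
by move=> mA; rewrite -[X in measurable X]setTI; exact: measurable_row_cons_pair.
Qed.

Let cons_measure0 : cons_measure set0 = 0.
Proof. by rewrite /cons_measure /pushforward preimage_set0 measure0. Qed.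

Let cons_measure_ge0 A : 0 <= cons_measure A.
Proof. exact: (measure_ge0 (product_measure1 m mk)). Qed.

Let cons_measure_sigma_additive : semi_sigma_additive cons_measure.
Proof.
move=> F mF tF mUF; rewrite /cons_measure /pushforward preimage_bigcup.
apply: measure_semi_sigma_additive.
- by move=> n; exact: mcons.
- apply/trivIsetP => /= i j _ _ ij; rewrite -preimage_setI.
  by move/trivIsetP : tF => /(_ _ _ _ _ ij) ->//; rewrite preimage_set0.
- by rewrite -preimage_bigcup; exact: mcons.
Qed.

HB.instance Definition _ := isMeasure.Build _ _ _ cons_measure
  cons_measure0 cons_measure_ge0 cons_measure_sigma_additive.

Let cons_measure_sigma_finite : sigma_finite setT cons_measure.
Proof.
have /sigma_finiteP[F [TF ndF Foo]] := sigma_finiteT m.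
have /sigma_finiteP[G [TG ndG Goo]] := sigma_finiteT mk.
pose u (w : 'rV[R]_k.+1) : measurableTypeR R * 'rV[R]_k :=
  (w 0%R 0%R, row_behead w).
have mu : measurable_fun setT u.
  apply: measurable_fun_pair; first exact: measurable_coord.
  exact: measurable_row_behead.
exists (fun n => u @^-1` (F n `*` G n)).
  rewrite -preimage_bigcup; apply/seteqP; split=> // w _ /=.
  have : setT (u w).1 by []. have : setT (u w).2 by [].
  rewrite {1}TG TF => -[a _ Ga] [b _ Fb]; exists (maxn a b) => //; split.
  - by move: Fb; exact/subsetPset/ndF/leq_maxr.
  - by move: Ga; exact/subsetPset/ndG/leq_maxl.
move=> n; have [mF Fn] := Foo n; have [mG Gn] := Goo n; split.
  by rewrite -[X in measurable X]setTI; apply: mu => //; exact: measurableX.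
rewrite /cons_measure /pushforward -comp_preimage.
rewrite (_ : u \o _ = id); last first.
  by apply/funext => -[x v]; rewrite /u/= row_cons0 row_behead_cons.
by rewrite preimage_id product_measure1E// lte_mul_pinfty// ge0_fin_numE.
Qed.

HB.instance Definition _ := Measure_isSigmaFinite.Build _ _ _ cons_measure
  cons_measure_sigma_finite.

Lemma integral_cons_measure (f : 'rV[R]_k.+1 -> \bar R) :
  measurable_fun setT f -> (forall w, 0 <= f w) ->
  \int[cons_measure]_w f w = \int[m]_x \int[mk]_v f (row_cons x v).
Proof.
move=> mf f0.
rewrite ge0_integral_pushforward//; last exact: measurable_row_cons_pair.
rewrite fubini_tonelli1//; last by move=> z; exact: f0.
exact: measurableT_comp mf (@measurable_row_cons_pair k).
Qed.

Lemma integral_cons_measure_swap (f : 'rV[R]_k.+1 -> \bar R) :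
  measurable_fun setT f -> (forall w, 0 <= f w) ->
  \int[cons_measure]_w f w = \int[mk]_v \int[m]_x f (row_cons x v).
Proof.
move=> mf f0.
rewrite ge0_integral_pushforward//; last exact: measurable_row_cons_pair.
rewrite fubini_tonelli2//; last by move=> z; exact: f0.
exact: measurableT_comp mf (@measurable_row_cons_pair k).
Qed.

End Cons.

Fixpoint row_measure (m : {sigma_finite_measure set (measurableTypeR R) -> \bar R}) (k : nat) :
    {sigma_finite_measure set 'rV[R]_k -> \bar R} :=
  match k with
  | 0%N => \d_(0%R : 'rV[R]_0)
  | k.+1 => cons_measure m (row_measure m k)
  end.

Lemma integral_row_measureS m k (f : 'rV[R]_k.+1 -> \bar R) :
  measurable_fun setT f -> (forall w, 0 <= f w) ->
  \int[row_measure m k.+1]_w f w =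
  \int[m]_x \int[row_measure m k]_v f (row_cons x v).
Proof. exact: integral_cons_measure. Qed.

Lemma integral_row_measureS_swap m k (f : 'rV[R]_k.+1 -> \bar R) :
  measurable_fun setT f -> (forall w, 0 <= f w) ->
  \int[row_measure m k.+1]_w f w =
  \int[row_measure m k]_v \int[m]_x f (row_cons x v).
Proof. exact: integral_cons_measure_swap. Qed.

Lemma integral_row_measure0 m (f : 'rV[R]_0 -> \bar R) :
  measurable_fun setT f -> \int[row_measure m 0]_w f w = f 0%R.
Proof. by move=> mf; rewrite integral_dirac//= diracT mul1e. Qed.

Definition leb k := row_measure (@lebesgue_measure R) k.

Lemma integral_lebS k (f : 'rV[R]_k.+1 -> \bar R) :
  measurable_fun setT f -> (forall w, 0 <= f w) ->
  \int[leb k.+1]_w f w =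
  \int[@lebesgue_measure R]_x \int[leb k]_v f (row_cons x v).
Proof. exact: integral_row_measureS. Qed.

Lemma integral_lebS_swap k (f : 'rV[R]_k.+1 -> \bar R) :
  measurable_fun setT f -> (forall w, 0 <= f w) ->
  \int[leb k.+1]_w f w =
  \int[leb k]_v \int[@lebesgue_measure R]_x f (row_cons x v).
Proof. exact: integral_row_measureS_swap. Qed.

Lemma measurable_integral_row_cons (m : {sigma_finite_measure set (measurableTypeR R) -> \bar R})
    k (f : 'rV[R]_k.+1 -> \bar R) :
  measurable_fun setT f -> (forall w, 0 <= f w) ->
  measurable_fun [set: measurableTypeR R]
    (fun x => \int[row_measure m k]_v f (row_cons x v)).
Proof.
move=> mf f0; apply: (@measurable_fun_fubini_tonelli_F _ _ _ _ _ (row_measure m k)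
    (f \o (@row_cons_pair k))) => //.
  exact: measurableT_comp mf (@measurable_row_cons_pair k).
by move=> z; exact: f0.
Qed.

End RowProduct.

(** * Weighted image measures and substitution on the line *)

Section WeightedImage.
Import HBNNSimple.
Local Open Scope ereal_scope.
Context d1 d2 (T1 : measurableType d1) (T2 : measurableType d2) (R : realType).
Variables (m : {measure set T1 -> \bar R}) (phi : {mfun T1 >-> T2}).
Variable w : T1 -> R.
Hypotheses (mw : measurable_fun setT w) (w0 : forall x, (0 <= w x)%R).

Let mwE : measurable_fun setT (EFin \o w). Proof. exact/measurable_EFinP. Qed.

Let wE0 x : 0 <= (w x)%:E. Proof. by rewrite lee_fin. Qed.

Definition weighted_image (A : set T2) : \bar R :=
  \int[m]_(x in phi @^-1` A) (w x)%:E.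

Let mphi A : measurable A -> measurable (phi @^-1` A).
Proof. by move=> mA; rewrite -[X in measurable X]setTI; exact: measurable_funP. Qed.

Lemma weighted_image0 : weighted_image set0 = 0.
Proof. by rewrite /weighted_image preimage_set0 integral_set0. Qed.

Lemma weighted_image_ge0 A : 0 <= weighted_image A.
Proof. by apply: integral_ge0. Qed.

Lemma weighted_image_sigma_additive : semi_sigma_additive weighted_image.
Proof.
move=> /= F mF tF mUF; rewrite /weighted_image; apply: cvg_toP.
  apply: ereal_nondecreasing_is_cvgn => i n mn.
  by apply: lee_sum_nneg_natr => // k _ _; apply: integral_ge0.
rewrite preimage_bigcup ge0_integral_bigcup//=.
- by move=> n; exact: mphi.
- exact: measurable_funTS.
- apply/trivIsetP => /= i j _ _ ij; rewrite -preimage_setI.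
  by move/trivIsetP : tF => /(_ _ _ _ _ ij) ->//; rewrite preimage_set0.
Qed.

(** Indicators are the hypothesis; simple functions follow by linearity and the rest by monotone
    convergence. The measure [nu] is arbitrary, so that a law given by a density, such as the
    standard normal one, also qualifies, with the identity as [phi]. *)
Lemma ge0_integral_transfer (nu : {measure set T2 -> \bar R}) (f : T2 -> \bar R) :
  (forall A, measurable A -> nu A = weighted_image A) ->
  measurable_fun setT f -> (forall y, 0 <= f y) ->
  \int[nu]_y f y = \int[m]_x (f (phi x) * (w x)%:E).
Proof.
move=> nuE mf f0.
pose f_ := nnsfun_approx measurableT mf.
have cvf (y : T2) : (f_ n y)%:E @[n --> \oo] --> f y.
  by apply: cvg_nnsfun_approx => //.
have mfphi n : measurable_fun setT (fun x => (f_ n (phi x))%:E).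
  by apply/measurable_EFinP; exact: measurableT_comp.
transitivity (limn (fun n => \int[nu]_y (f_ n y)%:E)).
  rewrite -monotone_convergence//.
  - by apply: eq_integral => y _; apply/esym/cvg_lim => //; exact: cvf.
  - by move=> n; exact/measurable_EFinP/measurable_funP.
  - by move=> n y _; rewrite lee_fin.
  - by move=> y _ k n kn; rewrite lee_fin; exact/lefP/nd_nnsfun_approx.
transitivity (limn (fun n => \int[m]_x ((f_ n (phi x))%:E * (w x)%:E))); last first.
  rewrite -monotone_convergence//.
  - apply: eq_integral => x _; apply/cvg_lim => //.
    by apply: cvgeZr => //; exact: cvf.
  - by move=> n; apply: emeasurable_funM.
  - by move=> n x _; apply: mule_ge0 => //; rewrite lee_fin.
  - move=> x _ k n kn; apply: lee_wpmul2r => //.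
    by rewrite lee_fin; exact/lefP/nd_nnsfun_approx.
congr (limn _); apply/funext => n.
transitivity (\sum_(k \in range (f_ n)) \int[nu]_y (k * \1_(f_ n @^-1` [set k]) y)%:E).
  under eq_integral do rewrite fimfunE -fsumEFin//.
  rewrite ge0_integral_fsum//.
  - by move=> r; apply/measurable_EFinP/measurable_funM.
  - by move=> r x _; rewrite nnfun_muleindic_ge0.
transitivity (\sum_(k \in range (f_ n))
    \int[m]_x ((k * \1_(f_ n @^-1` [set k]) (phi x))%:E * (w x)%:E)).
  apply: eq_fsbigr => r /set_mem [y _ fyr].
  have r0 : (0 <= r)%R by rewrite -fyr.
  have mr : measurable (f_ n @^-1` [set r]) by [].
  rewrite integralZl_indic_nnsfun// integral_indic// setIT nuE//.
  under [RHS]eq_integral do rewrite EFinM -muleA.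
  rewrite ge0_integralZl_EFin//; last 2 first.
  - by move=> x _; apply: mule_ge0 => //; rewrite lee_fin.
  - apply: emeasurable_funM => //; apply/measurable_EFinP.
    by apply: measurableT_comp => //; exact: measurable_indic.
  congr (_ * _); rewrite /weighted_image integral_mkcond; apply: eq_integral => x _.
  rewrite patchE indicE; have [xA|xA] := boolP (x \in _).
    by rewrite mem_set ?mul1e//; exact: set_mem xA.
  rewrite (_ : (phi x \in _) = false) ?mul0e//.
  by apply/negbTE; move: xA; rewrite !notin_setE.
under [RHS]eq_integral => x _.
  rewrite fimfunE -fsumEFin// ge0_mule_fsuml; last first.
    by move=> r; rewrite nnfun_muleindic_ge0.
  over.
rewrite ge0_integral_fsum//.
- move=> r; apply: emeasurable_funM => //; apply/measurable_EFinP.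
  apply: measurable_funM => //.
  by apply: measurableT_comp => //; exact: measurable_indic.
- by move=> r x _; apply: mule_ge0 => //; rewrite nnfun_muleindic_ge0.
Qed.

HB.instance Definition _ := isMeasure.Build _ _ _ weighted_image
  weighted_image0 weighted_image_ge0 weighted_image_sigma_additive.

Lemma integral_weighted_image (f : T2 -> \bar R) :
  measurable_fun setT f -> (forall y, 0 <= f y) ->
  \int[weighted_image]_y f y = \int[m]_x (f (phi x) * (w x)%:E).
Proof. exact: ge0_integral_transfer. Qed.

End WeightedImage.

Section Substitution.
Variable R : realType.
Local Open Scope ereal_scope.
Notation mu := (@lebesgue_measure R).

(** The weighted image gives every half-open interval its length, hence is Lebesgue measure by
    uniqueness. Monotonicity and differentiability of [phi] are hidden in the hypothesis on
    intervals. *)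
Lemma lebesgue_substitution (phi w : R -> R) (h : R -> \bar R) :
  measurable_fun setT phi -> measurable_fun setT w -> (forall x, (0 <= w x)%R) ->
  (forall a b, (a < b)%R ->
     \int[mu]_(x in phi @^-1` `]a, b]) (w x)%:E = (b - a)%:E) ->
  measurable_fun setT h -> (forall x, 0 <= h x) ->
  \int[mu]_x (h (phi x) * (w x)%:E) = \int[mu]_x h x.
Proof.
move=> mphi mw w0 H mh h0.
pose Phi : {mfun measurableTypeR R >-> measurableTypeR R} :=
  HB.pack_for {mfun measurableTypeR R >-> measurableTypeR R} phi
    (isMeasurableFun.Build _ _ (measurableTypeR R) (measurableTypeR R) phi mphi).
rewrite -(integral_weighted_image mu Phi mw w0 mh h0).
apply: eq_measure_integral => A mA _; apply/esym; move: A mA.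
apply: lebesgue_measure_unique => /=.
move=> _ [[a b] _ <-] /=; rewrite lebesgue_measure_itv/= lte_fin.
case: ltP => ab; first by rewrite /weighted_image H.
by rewrite set_itv_ge ?measure0// -leNgt.
Qed.

Lemma ge0_integral_affine (a b : R) (h : R -> \bar R) : (a != 0)%R ->
  measurable_fun setT h -> (forall x, 0 <= h x) ->
  \int[mu]_x h (a * x + b)%R = `|a|^-1%:E * \int[mu]_x h x.
Proof.
move=> a0 mh h0.
have ma : measurable_fun setT (fun x : R => a * x + b)%R.
  by apply: measurable_funD => //; exact: measurable_funM.
have mha : measurable_fun setT (fun x : R => h (a * x + b)%R).
  exact: measurableT_comp mh ma.
rewrite -(@lebesgue_substitution (fun x => a * x + b)%R (cst `|a|%R) h)//; last first.
  have cstE D : measurable D -> \int[mu]_(x in D) (cst `|a|%R x)%:E = `|a|%R%:E * mu D.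
    by move=> mD; exact: (integral_cst mu mD `|a|%R%:E).
  move=> s t st; rewrite cstE//; last first.
    by rewrite -[X in measurable X]setTI; exact: ma.
  have [alt0|agt0|a00] := ltgtP a 0%R; last by rewrite a00 eqxx in a0.
    rewrite (_ : _ @^-1` _ = `[((t - b) / a)%R, ((s - b) / a)%R[%classic); last first.
      apply/seteqP; split=> x /=; rewrite !in_itv/= ler_ndivrMr// ltr_ndivlMr//;
        by move=> /andP[p q]; apply/andP; split; lra.
    rewrite lebesgue_measure_itv/= lte_fin ltr_nM2r ?invr_lt0// ltrD2r st.
    by rewrite -EFinD -EFinM ltr0_norm//; congr EFin; field.
  rewrite (_ : _ @^-1` _ = `]((s - b) / a)%R, ((t - b) / a)%R]%classic); last first.
    apply/seteqP; split=> x /=; rewrite !in_itv/= ler_pdivlMr// ltr_pdivrMr//;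
      by move=> /andP[p q]; apply/andP; split; lra.
  rewrite lebesgue_measure_itv/= lte_fin ltr_pM2r ?invr_gt0// ltrD2r st.
  by rewrite -EFinD -EFinM gtr0_norm//; congr EFin; field.
have -> : \int[mu]_x (h (a * x + b)%R * (cst `|a|%R x)%:E) =
    \int[mu]_x h (a * x + b)%R * `|a|%R%:E.
  by rewrite /cst; apply: ge0_integralZr => //; rewrite lee_fin.
by rewrite muleCA -EFinM mulVf ?mule1// normr_eq0.
Qed.

End Substitution.

(** * Linear changes of variables *)

Section LinearChange.
Variable R : realType.
Local Open Scope ereal_scope.
Notation mu := (@lebesgue_measure R).

Lemma row_consDl k (x y : R) (v : 'rV[R]_k) w :
  (row_cons x v + row_cons y w = row_cons (x + y) (v + w))%R.
Proof.
apply/rowP => i; rewrite mxE; case: (unliftP ord0 i) => [j|] ->.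
  by rewrite !row_consS mxE.
by rewrite !row_cons0.
Qed.

Lemma leb_translate k (a : 'rV[R]_k) (f : 'rV[R]_k -> \bar R) :
  measurable_fun setT f -> (forall v, 0 <= f v) ->
  \int[leb R k]_v f (v + a)%R = \int[leb R k]_v f v.
Proof.
elim: k a f => [|k IH] a f mf f0.
  by congr integral; apply/funext => v; congr f; apply/rowP; case.
have mfa : measurable_fun setT (fun v : 'rV[R]_k.+1 => f (v + a)%R).
  by apply: (measurableT_comp mf); apply: measurable_rowD.
rewrite (integral_lebS mfa (fun v => f0 _)) (integral_lebS mf f0).
transitivity (\int[mu]_x
   \int[leb R k]_v f (row_cons (1 * x + a 0%R 0%R) v)%R).
  apply: eq_integral => x _; rewrite -[RHS](IH (row_behead a))//.
  - by apply: eq_integral => v _; rewrite -{1}(row_consK a) row_consDl mul1r.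
  - by apply: (measurableT_comp mf); exact: measurable_row_cons.
rewrite (@ge0_integral_affine R 1 (a 0%R 0%R)
  (fun x => \int[leb R k]_v f (row_cons x v)))//.
- by rewrite normr1 invr1 mul1e.
- exact: measurable_integral_row_cons.
- by move=> x; apply: integral_ge0.
Qed.

Lemma row_cons_mulmx k x (v : 'rV[R]_k) a b c D :
  (row_cons x v *m (block_mx (a%:M : 'M[R]_1) b c D : 'M[R]_(1 + k)) =
   row_cons (x * a + (v *m c) 0 0) (x *: b + v *m D) :> 'rV[R]_k.+1)%R.
Proof.
apply: (etrans (mul_row_block (x%:M : 'M[R]_1) v (a%:M : 'M[R]_1) b c D)).
rewrite -!scalar_mxM !mul_scalar_mx; congr row_mx.
apply/matrixP => i j; rewrite !ord1 !mxE eqxx !mulr1n; congr (_ + _)%R.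
Qed.

(** The shear adds to the first coordinate a quantity that depends on the other ones only; when that
    coordinate is integrated first, this is a translation of the line. *)
Let leb_shear k (c : 'cV[R]_k) (f : 'rV[R]_k.+1 -> \bar R) :
  measurable_fun setT f -> (forall v, 0 <= f v) ->
  \int[leb R k.+1]_v f (v *m (block_mx (1%:M : 'M[R]_1) 0 c 1%:M : 'M[R]_(1 + k)))%R =
  \int[leb R k.+1]_v f v.
Proof.
move=> mf f0; rewrite [LHS]integral_lebS_swap//; last first.
  by apply: (measurableT_comp mf); exact: measurable_mulmx.
rewrite (integral_lebS_swap mf f0); apply: eq_integral => v _.
have mfv : measurable_fun [set: R] (fun x => f (row_cons x v)).
  by apply: (measurableT_comp mf); exact: measurable_row_cons.
have := ge0_integral_affine ((v *m c) 0 0)%R (oner_neq0 R) mfv (fun x => f0 _).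
rewrite normr1 invr1 mul1e => <-.
apply: eq_integral => x _; congr f.
by rewrite row_cons_mulmx scaler0 add0r mulmx1 mulr1 mul1r.
Qed.

Let leb_block_upper k (a : R) b (D : 'M[R]_k) (f : 'rV[R]_k.+1 -> \bar R) :
  (forall g : 'rV[R]_k -> \bar R,
   measurable_fun setT g -> (forall v, 0 <= g v) ->
   \int[leb R k]_v g (v *m D)%R = `|\det D|^-1%:E * \int[leb R k]_v g v) ->
  a != 0%R -> measurable_fun setT f -> (forall v, 0 <= f v) ->
  \int[leb R k.+1]_v f (v *m (block_mx (a%:M : 'M[R]_1) b 0 D : 'M[R]_(1 + k)))%R =
  (`|a|^-1 * `|\det D|^-1)%:E * \int[leb R k.+1]_v f v.
Proof.
move=> IH a0 mf f0; rewrite [in LHS]integral_lebS//; last first.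
  by apply: (measurableT_comp mf); exact: measurable_mulmx.
transitivity (\int[mu]_x (`|\det D|^-1%:E *
    \int[leb R k]_v f (row_cons (a * x + 0)%R v))).
  apply: eq_integral => x _.
  have mg : measurable_fun setT (fun v : 'rV[R]_k => f (row_cons (a * x + 0)%R v)).
    by apply: (measurableT_comp mf); exact: measurable_row_cons.
  rewrite -(leb_translate (x *: b)%R mg)// -IH//; last first.
    by apply: (measurableT_comp mg); exact: measurable_rowD.
  apply: eq_integral => v _; congr f.
  by rewrite row_cons_mulmx mulmx0 mxE addr0 addr0 mulrC [(_ *: _ + _)%R]addrC.
have mF := @measurable_integral_row_cons R mu k f mf f0.
have F0 x : 0 <= \int[leb R k]_v f (row_cons x v) by exact: integral_ge0.
have mFa : measurable_fun [set: R] (fun x => \int[leb R k]_v f (row_cons (a * x + 0)%R v)).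
  by apply: (measurableT_comp mF); apply: measurable_funD.
rewrite ge0_integralZl//.
rewrite (ge0_integral_affine 0 a0 mF F0) integral_lebS// muleA -EFinM.
by rewrite mulrC.
Qed.

(** Induction through a block LU factorization: with a nonzero pivot, the matrix is a shear times a
    block upper triangular matrix whose lower block is the Schur complement [D'], covered by the
    induction hypothesis. *)
Theorem leb_linear k (A : 'M[R]_k) (f : 'rV[R]_k -> \bar R) : A \in unitmx ->
  measurable_fun setT f -> (forall v, 0 <= f v) ->
  \int[leb R k]_v f (v *m A)%R = `|\det A|^-1%:E * \int[leb R k]_v f v.
Proof.
elim: k A f => [|k IH] A f Au mf f0.
  rewrite det_mx00 normr1 invr1 mul1e.
  by congr integral; apply/funext => v; congr f; apply/rowP; case.
have main (B : 'M[R]_(1 + k)) (g : 'rV[R]_k.+1 -> \bar R) : B \in unitmx ->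
    B 0%R 0%R != 0%R -> measurable_fun setT g -> (forall v, 0 <= g v) ->
    \int[leb R k.+1]_v g (v *m B)%R = `|\det B|^-1%:E * \int[leb R k.+1]_v g v.
  move=> Bu B00 mg g0.
  set a := (B 0%R 0%R) in B00.
  pose b := ursubmx B; pose c := dlsubmx B; pose D := drsubmx B.
  pose D' := (D - a^-1 *: (c *m b))%R.
  pose L : 'M[R]_(1 + k) := block_mx (1%:M : 'M[R]_1) 0%R (a^-1 *: c)%R 1%:M%R.
  pose U : 'M[R]_(1 + k) := block_mx (a%:M : 'M[R]_1) b 0%R D'.
  have ulB : ulsubmx B = a%:M%R.
    apply/matrixP => i j; rewrite !ord1 !mxE eqxx mulr1n /a.
    by congr (B _ _); exact: val_inj.
  have BLU : B = (L *m U)%R.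
    rewrite mulmx_block !mul0mx !mulmx0 !mul1mx !addr0 mul_mx_scalar scalerA.
    rewrite mulfV// scale1r -scalemxAl /D' addrC subrK -[LHS]submxK ulB.
    by [].
  have detB : (\det B = a * \det D')%R.
    by rewrite BLU det_mulmx det_lblock det_ublock !det1 !mul1r det_scalar1.
  have Du : D' \in unitmx.
    by move: Bu; rewrite !unitmxE detB unitrM => /andP[].
  rewrite BLU; under eq_integral do rewrite mulmxA.
  rewrite (@leb_shear k (a^-1 *: c)%R (fun v => g (v *m U)%R))//; last first.
    by apply: (measurableT_comp mg); exact: measurable_mulmx.
  rewrite leb_block_upper//; last by move=> h mh h0; exact: IH.
  by rewrite -BLU detB normrM invfM.
have [A00|A00] := eqVneq (A 0%R 0%R) 0%R; last exact: main.
have [j A0j] : exists j, A 0%R (lift ord0 j) != 0%R.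
  apply/existsP; apply: contraT; rewrite negb_exists => /forallP A0.
  have : row 0%R A = 0%R.
    apply/rowP => i; rewrite !mxE; case: (unliftP ord0 i) => [j|] ->//.
    by apply/eqP; rewrite -[_ == _]negbK.
  move=> rA; have : (row 0%R A *m invmx A = 0)%R by rewrite rA mul0mx.
  rewrite rowE -mulmxA mulmxV// mulmx1 => /matrixP/(_ 0%R 0%R).
  by rewrite !mxE !eqxx /= => /eqP; rewrite oner_eq0.
(* Right multiplication by [T] adds the column of the nonzero entry to the first column: this
   creates a pivot, and [T] is itself a shear of determinant 1. *)
pose T : 'M[R]_(1 + k) := block_mx (1%:M : 'M[R]_1) 0%R (delta_mx j 0%R) 1%:M%R.
have detT : (\det T = 1)%R by rewrite det_lblock !det1 mulr1.
have Tu : T \in unitmx by rewrite unitmxE detT unitr1.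
pose g v := f (v *m invmx T)%R.
have mg : measurable_fun setT g.
  by apply: (measurableT_comp mf); exact: measurable_mulmx.
have g0 v : 0 <= g v by exact: f0.
have gT v : g (v *m T)%R = f v by rewrite /g mulmxK.
transitivity (\int[leb R k.+1]_v g (v *m (A *m T))%R).
  by apply: eq_integral => v _; rewrite mulmxA gT.
rewrite main//.
- rewrite det_mulmx detT mulr1; congr (_ * _).
  rewrite -(@leb_shear k (delta_mx j 0%R) g)//.
  by apply: eq_integral => v _; exact: gT.
- by rewrite unitmx_mul Au.
- rewrite mxE (@big_split_ord R 0%R +%R 1 k) /= big_ord1.
  rewrite (_ : lshift k 0%R = 0%R); last exact: val_inj.
  have TE i : (T (rshift 1 i) 0 = (i == j)%:R)%R.
    have -> : (0 : 'I_(1 + k))%R = lshift k (0%R : 'I_1) by exact: val_inj.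
    by rewrite /T block_mxEdl mxE eqxx andbT.
  rewrite A00 mul0r add0r (bigD1 j)//= big1 ?addr0.
    rewrite TE eqxx mulr1 (_ : rshift 1 j = lift ord0 j)//; exact: val_inj.
  by move=> i ij; rewrite TE (negbTE ij) mulr0.
Qed.

End LinearChange.

(** * Polar coordinates *)

Section MoreMeasurability.
Context d (T : measurableType d) (R : realType).

Lemma measurable_bool_natmul (b : T -> bool) :
  measurable_fun setT b -> measurable_fun setT (fun x => (b x)%:R : R).
Proof.
move=> mb; rewrite (_ : (fun _ => _) = \1_(b @^-1` [set true])).
  by apply: measurable_indic; rewrite -[X in measurable X]setTI; exact: mb.
apply/funext => x; rewrite indicE; congr ((nat_of_bool _)%:R).
by apply/idP/idP => [bx|/set_mem//]; rewrite mem_set.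
Qed.

Lemma measurable_ltr_natmul (f g : T -> R) :
  measurable_fun setT f -> measurable_fun setT g ->
  measurable_fun setT (fun x => (f x < g x)%R%:R : R).
Proof. by move=> mf mg; apply: measurable_bool_natmul; exact: measurable_fun_ltr. Qed.

Lemma measurable_ler_natmul (f g : T -> R) :
  measurable_fun setT f -> measurable_fun setT g ->
  measurable_fun setT (fun x => (f x <= g x)%R%:R : R).
Proof. by move=> mf mg; apply: measurable_bool_natmul; exact: measurable_fun_ler. Qed.

Lemma measurable_expR_comp (f : T -> R) :
  measurable_fun setT f -> measurable_fun setT (fun x => expR (f x)).
Proof. by move=> mf; apply: measurableT_comp mf => //; exact: measurable_expR. Qed.

Lemma measurable_ln_comp (f : T -> R) :
  measurable_fun setT f -> measurable_fun setT (fun x => ln (f x)).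
Proof. by move=> mf; apply: measurableT_comp mf => //; exact: measurable_ln. Qed.

End MoreMeasurability.

Ltac meas1 := lazymatch goal with
  | |- measurable_fun _ (fun _ => ?c) => exact: measurable_cst
  | |- measurable_fun _ (fun x => x) => exact: measurable_id
  | |- measurable_fun _ (fun x => EFin (@?f x)) => apply/measurable_EFinP
  | |- measurable_fun _ (EFin \o _) => apply/measurable_EFinP
  | |- measurable_fun _ (fun x => mule (@?f x) (@?g x)) => apply: emeasurable_funM
  | |- measurable_fun _ (fun x => GRing.natmul 1 (nat_of_bool (Order.lt (@?f x) (@?g x)))) =>
      apply: measurable_ltr_natmul
  | |- measurable_fun _ (fun x => GRing.natmul 1 (nat_of_bool (Order.le (@?f x) (@?g x)))) =>
      apply: measurable_ler_natmul
  | |- measurable_fun _ (fun x => GRing.mul (@?f x) (@?g x)) => apply: measurable_funM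
  | |- measurable_fun _ expR => exact: measurable_expR
  | |- measurable_fun _ ln => exact: measurable_ln
  | |- measurable_fun _ (fun x => GRing.inv (@?f x)) => apply: measurable_inv
  | |- measurable_fun _ (fun x => GRing.exp (@?f x) _) => apply: measurable_funX
  | |- measurable_fun _ (fun x => Num.sqrt (@?f x)) => apply: measurable_sqrt
  | |- measurable_fun _ (fun x => expR (@?f x)) => apply: measurable_expR_comp
  | |- measurable_fun _ (fun x => ln (@?f x)) => apply: measurable_ln_comp
  | |- measurable_fun _ (fun x => enorm (@?f x)) => apply: measurable_enorm
  | |- measurable_fun _ (fun x => dot (@?f x) (@?g x)) => apply: measurable_dot
  | |- measurable_fun _ (fun x => quad _ (@?f x)) => apply: measurable_quad
  | |- measurable_fun _ (fun x => GRing.scale (@?f x) (@?g x)) => apply: measurable_rowZ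
  | |- measurable_fun _ (fun x => row_cons (@?f x) (@?g x)) => apply: measurable_row_cons
  | |- measurable_fun _ (fun x => mulmx (@?f x) _) => apply: measurable_mulmx
  | |- measurable_fun _ (fun x => fun_of_matrix (@?f x) _ _) => apply: measurable_rowE
  | |- measurable_fun _ (fun x => GRing.opp (@?f x)) => apply: measurable_funN
  | |- measurable_fun _ (fun x => fst (@?f x)) => apply: measurableT_comp => //
  | |- measurable_fun _ (fun x => snd (@?f x)) => apply: measurableT_comp => //
  | |- measurable_fun _ (fun x => _ (@?f x) (@?g x)) =>
      first [apply: measurable_funD | apply: measurable_rowD]
  | |- @measurable_fun _ _ ?T1 _ _ ?h =>
      lazymatch h with
      | (fun _ => _) => fail
      | _ => refine (_ : measurable_fun setT (fun x : T1 => h x))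
      end
  end.
(** A hook, redefined each time new functions receive a measurability lemma; [meas] then picks them
    up without being changed. *)
Ltac meas_ext := fail.
Ltac meas := repeat first [ assumption | meas1 | meas_ext ].

Section Enorm.
Variable R : realType.

Lemma dotE k (u v : 'rV[R]_k) : dot u v = (u *m v^T) 0 0.
Proof. by rewrite mxE; apply: eq_bigr => i _; rewrite mxE. Qed.

Lemma dotC k (u v : 'rV[R]_k) : dot u v = dot v u.
Proof. by apply: eq_bigr => i _; rewrite mulrC. Qed.

Lemma dotDl k (u v w : 'rV[R]_k) : dot (u + v) w = dot u w + dot v w.
Proof. by rewrite !dotE mulmxDl mxE. Qed.

Lemma dotZl k a (u v : 'rV[R]_k) : dot (a *: u) v = a * dot u v.
Proof. by rewrite !dotE -scalemxAl mxE. Qed.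

Lemma dotDr k (u v w : 'rV[R]_k) : dot u (v + w) = dot u v + dot u w.
Proof. by rewrite dotC dotDl !(dotC u). Qed.

Lemma dotZr k a (u v : 'rV[R]_k) : dot u (a *: v) = a * dot u v.
Proof. by rewrite dotC dotZl dotC. Qed.

Lemma dot_ge0 k (u : 'rV[R]_k) : 0 <= dot u u.
Proof. by apply: sumr_ge0 => i _; rewrite -expr2 sqr_ge0. Qed.

Lemma sqr_enorm k (u : 'rV[R]_k) : enorm u ^+ 2 = dot u u.
Proof. by rewrite sqr_sqrtr// dot_ge0. Qed.

Lemma enorm_ge0 k (u : 'rV[R]_k) : 0 <= enorm u.
Proof. exact: sqrtr_ge0. Qed.

Lemma enormZ k a (u : 'rV[R]_k) : enorm (a *: u) = `|a| * enorm u.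
Proof.
by rewrite /enorm dotZl dotZr mulrA -expr2 sqrtrM ?sqr_ge0// sqrtr_sqr.
Qed.

Lemma dot_eq0 k (u : 'rV[R]_k) : (dot u u == 0) = (u == 0).
Proof.
apply/eqP/eqP => [u0|->]; last by rewrite /dot big1// => i _; rewrite mxE mul0r.
apply/rowP => i; rewrite mxE; apply/eqP; rewrite -sqrf_eq0 expr2.
move/eqP: u0; rewrite psumr_eq0; last by move=> j _; rewrite -expr2 sqr_ge0.
by move/allP => /(_ i); rewrite mem_index_enum => /(_ isT).
Qed.

Lemma enorm_eq0 k (u : 'rV[R]_k) : (enorm u == 0) = (u == 0).
Proof. by rewrite -dot_eq0 -sqr_enorm sqrf_eq0. Qed.

Lemma enorm_gt0 k (u : 'rV[R]_k) : (0 < enorm u) = (u != 0).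
Proof. by rewrite lt_neqAle enorm_ge0 andbT eq_sym enorm_eq0. Qed.

Lemma enorm0 k : enorm (0 : 'rV[R]_k) = 0.
Proof. by apply/eqP; rewrite enorm_eq0. Qed.

End Enorm.

Section Polar.
Variable R : realType.
Local Open Scope ereal_scope.
Notation mu := (@lebesgue_measure R).

Lemma ge0_swap k (f : R -> 'rV[R]_k -> \bar R) :
  measurable_fun [set: measurableTypeR R * 'rV[R]_k] (fun z => f z.1 z.2) ->
  (forall t x, 0 <= f t x) ->
  \int[mu]_t \int[leb R k]_x f t x = \int[leb R k]_x \int[mu]_t f t x.
Proof.
move=> mf f0.
by apply: (@fubini_tonelli _ _ _ _ _ mu (leb R k) (fun z => f z.1 z.2)) => // -[].
Qed.

Lemma leb_scale k (t : R) (f : 'rV[R]_k -> \bar R) : (0 < t)%R ->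
  measurable_fun setT f -> (forall v, 0 <= f v) ->
  \int[leb R k]_v f v = (t ^+ k)%:E * \int[leb R k]_v f (t *: v)%R.
Proof.
move=> t0 mf f0.
have tu : (t%:M : 'M[R]_k) \in unitmx by rewrite unitmxE det_scalar unitrX// unitfE gt_eqF.
have := leb_linear tu mf f0; rewrite det_scalar ger0_norm ?exprn_ge0 ?ltW//.
under eq_integral do rewrite mul_mx_scalar.
move=> ->; rewrite muleA -EFinM mulfV ?mul1e// expf_eq0 gt_eqF ?andbF//.
Qed.

(** A radial window that stands in for the surface measure of a sphere: a direction is represented
    by all the vectors of norm in ]1, 2] that have it. The Lorentz norm is treated in the same way
    later. *)
Definition annulus (s : R) : R := ((1 < s)%R%:R * (s <= 2)%R%:R)%R.

Lemma annulus_ge0 s : (0 <= annulus s)%R.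
Proof. by rewrite mulr_ge0. Qed.

Lemma measurable_annulus d (T : measurableType d) (f : T -> R) :
  measurable_fun setT f -> measurable_fun setT (fun x => annulus (f x)).
Proof. by move=> mf; rewrite /annulus; meas. Qed.

Ltac meas_ext ::= lazymatch goal with
  | |- measurable_fun _ (fun x => annulus (@?f x)) => apply: measurable_annulus
  end.

(** The integral of 1/s over [1/2, 1[, that is ln 2. Only its being positive and finite matters,
    since it is cancelled between two uses of [polar_integral]. *)
Definition polar_cst : \bar R :=
  \int[mu]_s ((0 < s)%R%:R * annulus s^-1 * s^-1)%:E.

Lemma polar_cst_gt0 : 0 < polar_cst < +oo.
Proof.
have mg : measurable_fun [set: R] (fun s => ((0 < s)%R%:R * annulus s^-1 * s^-1)%:E).
  by meas.
have g0 s : (0 <= (0 < s)%R%:R * annulus s^-1 * s^-1 :> R)%R.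
  by case: ltP => [s0|]; rewrite ?mul0r// mul1r mulr_ge0 ?annulus_ge0// invr_ge0 ltW.
apply/andP; split.
  apply: (@lt_le_trans _ _ (\int[mu]_(s in `]2^-1%R, 1%R[) 1)).
    rewrite integral_cst//= lebesgue_measure_itv/= lte_fin invf_lt1 ?ltr1n//.
    by rewrite mul1e -EFinD lte_fin subr_gt0 invf_lt1 ?ltr1n.
  rewrite integral_mkcond; apply: ge0_le_integral => //.
  - by move=> s _; rewrite patchE; case: ifP.
  - by apply/(measurable_restrictT _ _).1 => //; exact: measurable_cst.
  - move=> s _; rewrite patchE; case: ifPn => [|_]; last by rewrite lee_fin g0.
    rewrite inE/= in_itv/= => /andP[s2 s1].
    have s0 : (0 < s)%R by apply: lt_trans s2; rewrite invr_gt0.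
    have s1' : (1 < s^-1)%R by rewrite invf_gt1.
    have s2' : (s^-1 <= 2)%R by rewrite -[leRHS]invrK lef_pV2 ?posrE ?invr_gt0// ltW.
    by rewrite s0 /annulus s1' s2' !mul1r lee_fin ltW.
apply: (@le_lt_trans _ _ (\int[mu]_(s in `[0%R, 1%R]) 2%:E)); last first.
  by rewrite integral_cst//= lebesgue_measure_itv/= lte_fin ltr01 -EFinD -EFinM ltry.
rewrite [leRHS]integral_mkcond; apply: ge0_le_integral => //.
- by move=> s _; rewrite lee_fin g0.
- by apply/(measurable_restrictT _ _).1 => //; exact: measurable_cst.
- move=> s _; rewrite patchE mem_setE in_itv/= (_ : point = 0 :> \bar R)//.
  have [s0|s0] := ltP 0%R s; last by rewrite !mul0r; case: ifP => _; rewrite lee_fin.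
  rewrite mul1r /annulus; have [s1|] := ltP 1%R (s^-1)%R; last by rewrite !mul0r; case: ifP => _; rewrite lee_fin.
  have [s2|] := leP (s^-1)%R 2%R; last by rewrite mulr0 mul0r; case: ifP => _; rewrite lee_fin.
  have s1' : (s <= 1)%R by rewrite -invf_ge1// ltW.
  by rewrite (ltW s0) s1' !mul1r lee_fin.
Qed.

(** For x nonzero the kernel [K t x] integrates in t to [polar_cst], by scale invariance of dt / t.
    Once it is inserted, the integrals are swapped, x is replaced by t y, and t is rescaled by the
    norm of y: the direction is then carried by y and the radius by t. *)
Lemma polar_integral k (f : 'rV[R]_k.+1 -> \bar R) :
  measurable_fun setT f -> (forall v, 0 <= f v) ->
  \int[leb R k.+1]_x (f x * (x != 0)%R%:R%:E) * polar_cst =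
  \int[leb R k.+1]_y ((annulus (enorm y) * (enorm y) ^- k.+1)%:E *
     \int[mu]_t (f (t *: ((enorm y)^-1 *: y))%R * ((0 < t)%R%:R * t ^+ k)%:E)).
Proof.
move=> mf f0.
pose K (t : R) (x : 'rV[R]_k.+1) : R := ((0 < t)%R%:R * annulus (enorm x / t) * t^-1)%R.
have K0 t x : (0 <= K t x)%R.
  rewrite /K; case: ltP => [t0|]; rewrite ?mul0r// mul1r mulr_ge0 ?annulus_ge0//.
  by rewrite invr_ge0 ltW.
have mK d (T : measurableType d) (g : T -> R) (h : T -> 'rV[R]_k.+1) :
    measurable_fun setT g -> measurable_fun setT h ->
    measurable_fun setT (fun x => K (g x) (h x)).
  by move=> mg mh; rewrite /K; meas.
have annu0 : annulus 0 = 0%R by rewrite /annulus ltNge ler01 mul0r.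
have cE x : (x != 0)%R%:R%:E * polar_cst = \int[mu]_t (K t x)%:E.
  have [->|x0] := eqVneq x 0%R.
    by rewrite mul0e integral0_eq// => t _; rewrite /K enorm0 mul0r annu0 mulr0 mul0r.
  have nx0 : (0 < enorm x)%R by rewrite enorm_gt0.
  have mKx : measurable_fun [set: R] (fun t => (K t x)%:E).
    by apply/measurable_EFinP/mK; meas.
  have := ge0_integral_affine 0 (lt0r_neq0 nx0) mKx (fun t => K0 t x).
  rewrite gtr0_norm// mul1e => /(congr1 (fun z => (enorm x)%:E * z)).
  rewrite muleA -EFinM mulfV ?gt_eqF// mul1e => <-.
  rewrite -ge0_integralZl//; last 3 first.
  - by apply/measurable_EFinP/mK; meas.
  - by move=> s _; rewrite lee_fin.
  - by rewrite lee_fin ltW.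
  apply: eq_integral => s _; rewrite -EFinM addr0 /K pmulr_rgt0//; congr EFin.
  have -> : (enorm x / (enorm x * s) = s^-1)%R by rewrite invfM mulrA mulfV ?mul1r// gt_eqF.
  by rewrite invfM [RHS]mulrCA [(enorm x * _)%R]mulrA mulfV ?mul1r// gt_eqF.
have mnz : measurable_fun setT (fun x : 'rV[R]_k.+1 => (x != 0)%R%:R : R).
  have -> : (fun x : 'rV[R]_k.+1 => (x != 0)%R%:R : R) = (fun x => (0 < enorm x)%R%:R).
    by apply/funext => x; rewrite enorm_gt0.
  by meas.
have c0 : 0 <= polar_cst by case/andP: polar_cst_gt0 => /ltW.
transitivity (\int[leb R k.+1]_x \int[mu]_t (f x * (K t x)%:E)).
  rewrite -ge0_integralZr//; last 2 first.
  - by meas.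
  - by move=> x _; rewrite mule_ge0.
  apply: eq_integral => x _; rewrite -muleA cE ge0_integralZl//.
  - by apply/measurable_EFinP/mK; meas.
  - by move=> t _; rewrite lee_fin.
rewrite -(@ge0_swap _ (fun t x => f x * (K t x)%:E)); last 2 first.
- apply: emeasurable_funM; first exact: measurableT_comp mf measurable_snd.
  by apply/measurable_EFinP/mK; meas.
- by move=> t x; rewrite mule_ge0// lee_fin.
transitivity (\int[mu]_t \int[leb R k.+1]_y (f (t *: y)%R *
    ((0 < t)%R%:R * (annulus (enorm y) * t ^+ k))%:E)).
  apply: eq_integral => t _; have [t0|t0] := ltP 0%R t; last first.
    by rewrite !integral0_eq// => x _; rewrite /K ?(ltNge 0%R t) ?t0/= !mul0r mule0.
  have mg : measurable_fun setT (fun x => f x * (K t x)%:E).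
    by apply: emeasurable_funM => //; apply/measurable_EFinP/mK; meas.
  rewrite (leb_scale t0 mg); last by move=> v; rewrite mule_ge0// lee_fin.
  have mgt : measurable_fun setT (fun x : 'rV[R]_k.+1 => f (t *: x)%R * (K t (t *: x))%:E).
    by apply: (measurableT_comp mg); meas.
  rewrite -ge0_integralZl//; last 2 first.
  - by move=> x _; rewrite mule_ge0// lee_fin.
  - by rewrite lee_fin exprn_ge0// ltW.
  apply: eq_integral => y _; rewrite muleCA -EFinM; congr (_ * _%:E).
  have ty : (enorm (t *: y) / t = enorm y)%R.
    by rewrite enormZ gtr0_norm// mulrAC mulfV ?mul1r// gt_eqF.
  by rewrite /K ty t0 !mul1r exprS; field; rewrite gt_eqF.
rewrite (@ge0_swap _ (fun t y => f (t *: y)%R *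
    ((0 < t)%R%:R * (annulus (enorm y) * t ^+ k))%:E)); last 2 first.
- apply: emeasurable_funM; last by meas.
  by apply: (measurableT_comp mf); meas.
- move=> t y; rewrite mule_ge0// lee_fin; case: ltP => t0; rewrite ?mul0r//.
  by rewrite mul1r mulr_ge0 ?annulus_ge0// exprn_ge0// ltW.
apply: eq_integral => y _.
have [->|y0] := eqVneq y 0%R.
  rewrite enorm0 annu0 mul0r mul0e integral0_eq// => t _.
  by rewrite mul0r mulr0 mule0.
have ny0 : (0 < enorm y)%R by rewrite enorm_gt0.
pose g (t : R) := f (t *: y)%R * ((0 < t)%R%:R * (annulus (enorm y) * t ^+ k))%:E.
have mg : measurable_fun [set: R] g.
  apply: emeasurable_funM; last by meas.
  by apply: (measurableT_comp mf); meas.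
have g0 t : 0 <= g t.
  rewrite mule_ge0// lee_fin; case: ltP => t0; rewrite ?mul0r//.
  by rewrite mul1r mulr_ge0 ?annulus_ge0// exprn_ge0// ltW.
have iny0 : ((enorm y)^-1 != 0)%R by rewrite invr_eq0 gt_eqF.
have := ge0_integral_affine 0 iny0 mg g0.
rewrite gtr0_norm ?invr_gt0// invrK => /(congr1 (fun z => (enorm y)^-1%R%:E * z)).
rewrite muleA -EFinM mulVf ?gt_eqF// mul1e => <-.
rewrite -!ge0_integralZl//; last 5 first.
- apply: emeasurable_funM; last by meas.
  by apply: (measurableT_comp mf); meas.
- move=> t _; rewrite mule_ge0// lee_fin; case: ltP => t0; rewrite ?mul0r//.
  by rewrite mul1r exprn_ge0// ltW.
- by rewrite lee_fin mulr_ge0 ?annulus_ge0// invr_ge0 exprn_ge0// ltW.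
- by apply: (measurableT_comp mg); meas.
- by rewrite lee_fin invr_ge0 ltW.
apply: eq_integral => t _; rewrite addr0 /g scalerA [(t * _)%R]mulrC.
rewrite pmulr_rgt0 ?invr_gt0// !(muleCA _ (f _)) -!EFinM; congr (_ * _%:E).
by rewrite exprMn exprVn exprS invfM; ring.
Qed.

End Polar.

(** * Substitution on a half-line *)

Section HalfLine.
Variable R : realType.
Local Open Scope ereal_scope.
Notation mu := (@lebesgue_measure R).

(** An increasing surjection pulls half-open intervals back to half-open intervals, so the weight
    only has to be integrated over those. *)
Lemma bijective_substitution (phi w : R -> R) (h : R -> \bar R) :
  {homo phi : x y / (x < y)%R} -> (forall y, exists x, phi x = y) ->
  measurable_fun setT w -> (forall x, (0 <= w x)%R) ->
  (forall s t, (s < t)%R -> \int[mu]_(x in `]s, t]) (w x)%:E = (phi t - phi s)%:E) ->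
  measurable_fun setT h -> (forall x, 0 <= h x) ->
  \int[mu]_x (h (phi x) * (w x)%:E) = \int[mu]_x h x.
Proof.
move=> phi_inc phi_surj mw w0 H mh h0.
have phi_le : {mono phi : x y / (x <= y)%R} := le_mono phi_inc.
have phi_mono : {mono phi : x y / (x < y)%R} := leW_mono phi_le.
apply: lebesgue_substitution => //.
  by apply: nondecreasing_measurable => // x y xy; rewrite phi_le.
move=> a b ab; have [s sa] := phi_surj a; have [t tb] := phi_surj b.
rewrite (_ : phi @^-1` `]a, b] = `]s, t]%classic); last first.
  by apply/seteqP; split=> x /=; rewrite !in_itv/= -sa -tb phi_mono phi_le.
by rewrite H ?sa ?tb// -phi_mono sa tb.
Qed.

Lemma FTC_itvoc (phi w : R -> R) (s t : R) : (s < t)%R ->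
  (forall x : R, is_derive x 1%R phi (w x)) -> continuous w ->
  \int[mu]_(x in `]s, t]) (w x)%:E = (phi t - phi s)%:E.
Proof.
move=> st dphi cw; rewrite integral_itv_obnd_cbnd; last first.
  by apply/measurable_EFinP/measurable_funTS; exact: continuous_measurable_fun.
have cphi : continuous phi.
  by move=> x; apply: differentiable_continuous; apply/derivable1_diffP.
rewrite (@continuous_FTC2 _ w phi)//.
- by apply: continuous_subspaceT.
- split.
  + by move=> x _; apply: ex_derive.
  + by apply: cvg_at_right_filter; exact: cphi.
  + by apply: cvg_at_left_filter; exact: cphi.
- by move=> x _; rewrite derive1E derive_val.
Qed.

Lemma half_line_substitution (phi w : R -> R) (h : R -> \bar R) :
  (forall x : R, is_derive x 1%R phi (w x)) -> continuous w ->
  (forall x, (0 < x)%R -> (0 < w x)%R) -> (forall y, exists2 x, (0 < x)%R & (y <= phi x)%R) ->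
  measurable_fun setT h -> (forall x, 0 <= h x) ->
  \int[mu]_x (h (phi x) * ((0 < x)%R%:R * w x)%:E) =
  \int[mu]_x (h x * (phi 0%R < x)%R%:R%:E).
Proof.
move=> dphi cw w0 phi_oo mh h0.
(* [phi] is continued to the left of 0 with slope one, which yields an increasing bijection of the
   line. The added part contributes nothing, because [k] vanishes up to phi 0. *)
pose Phi (x : R) := if (0 < x)%R then phi x else (phi 0%R + x)%R.
pose W (x : R) : R := if (0 < x)%R then w x else 1%R.
have inc0 x y : (0 <= x)%R -> (x < y)%R -> (phi x < phi y)%R.
  move=> x0 xy.
  have cphi z : {for z, continuous phi}.
    by apply: differentiable_continuous; apply/derivable1_diffP.
  have [c /itvP cxy] := @MVT _ phi w x y xy (fun z _ => dphi z)
    (continuous_subspaceT cphi).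
  move=> /eqP; rewrite subr_eq => /eqP ->; rewrite ltrDr mulr_gt0 ?subr_gt0//.
  by apply: w0; apply: le_lt_trans x0 _; rewrite cxy.
have inc : {homo Phi : x y / (x < y)%R}.
  move=> x y xy; rewrite /Phi; case: (ltP 0%R x) => x0; case: (ltP 0%R y) => y0.
  - by apply: inc0 => //; exact: ltW.
  - by have := lt_trans (lt_le_trans xy y0) x0; rewrite ltxx.
  - apply: (@le_lt_trans _ _ (phi 0%R)); first by rewrite gerDl.
    by apply: inc0.
  - by rewrite ltrD2l.
have mw : measurable_fun [set: R] w by exact: continuous_measurable_fun.
have mW : measurable_fun [set: R] W.
  by apply: measurable_fun_ifT => //; exact: measurable_fun_ltr.
have W0 x : (0 <= W x)%R by rewrite /W; case: (ltP 0%R x) => // /w0/ltW.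
have Phi0 : Phi 0%R = phi 0%R by rewrite /Phi ltxx addr0.
pose k x := h x * (phi 0%R < x)%R%:R%:E.
have mk : measurable_fun [set: R] k by rewrite /k; meas.
have k0 x : 0 <= k x by rewrite mule_ge0.
rewrite -[RHS]/(\int[mu]_x k x) -(@bijective_substitution Phi W k)//.
- apply: eq_integral => x _; rewrite /k /W /Phi; case: (ltP 0%R x) => x0.
    by rewrite mul1r inc0// mule1.
  by rewrite mul0r mule0 ltNge gerDl x0 mule0 mul0e.
- move=> y; have [y0|y0] := leP y (phi 0%R).
    exists (y - phi 0)%R; rewrite /Phi ltNge subr_le0 y0/= addrC subrK//.
  have [x x0 yx] := phi_oo y.
  have [||c /itvP c0x cy] := @IVT _ phi 0%R x y (ltW x0).
  - by apply: continuous_subspaceT => z; apply: differentiable_continuous; apply/derivable1_diffP.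
  - by rewrite minEle maxEle (ltW (inc0 _ _ (lexx _) x0)) (ltW y0) yx.
  exists c; rewrite /Phi -cy; case: (ltP 0%R c) => // cle.
  by move: y0; rewrite -cy (_ : c = 0%R) ?ltxx//; apply/eqP; rewrite eq_le cle c0x.
- have pos s t : (0 <= s)%R -> (s < t)%R ->
      \int[mu]_(x in `]s, t]) (W x)%:E = (Phi t - Phi s)%:E.
    move=> s0 st; rewrite /Phi (le_lt_trans s0 st).
    have -> : (if (0 < s)%R then phi s else phi 0%R + s)%R = phi s.
      by case: (ltP 0%R s) => // s0'; rewrite (_ : s = 0%R) ?addr0//; apply/eqP; rewrite eq_le s0 s0'.
    rewrite -(FTC_itvoc st dphi cw); apply: eq_integral => x; rewrite inE/= in_itv/= => /andP[sx _].
    by rewrite /W (le_lt_trans s0 sx).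
  have neg s t : (t <= 0)%R -> (s < t)%R ->
      \int[mu]_(x in `]s, t]) (W x)%:E = (Phi t - Phi s)%:E.
    move=> t0 st; rewrite (eq_integral (cst 1)); last first.
      move=> x; rewrite inE/= in_itv/= => /andP[_ xt]; rewrite /W ltNge.
      by rewrite (le_trans xt t0).
    rewrite integral_cst//= mul1e lebesgue_measure_itv/= lte_fin st -EFinD.
    rewrite /Phi !ltNge t0 (le_trans (ltW st) t0)/=; congr EFin; ring.
  move=> s t st; have [s0|s0] := leP 0%R s; first exact: pos.
  have [t0|t0] := leP t 0%R; first exact: neg.
  rewrite (@itv_bndbnd_setU _ _ _ (BRight 0%R)) ?bnd_simp ?(ltW s0) ?(ltW t0)//.
  rewrite ge0_integral_setU//=.
  + rewrite neg// pos// -EFinD; congr EFin; ring.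
  + by apply/measurable_EFinP/measurable_funTS.
  + by move=> x _; rewrite lee_fin.
  + apply/disj_setPRL => x /=; rewrite !in_itv/= => /andP[x0 _].
    by rewrite leNgt x0 andbF.
Qed.

End HalfLine.

(** * Hyperbolic volume *)

Section Hyperbolic.
Variable R : realType.
Implicit Types r s t : R.

Definition coshR r : R := (expR r + expR (- r)) / 2.

Lemma is_derive_sinhR r : is_derive r 1 (@sinhR R) (coshR r).
Proof.
rewrite /sinhR /coshR; apply: is_derive_eq.
by rewrite !(scaler0, add0r, addr0) /GRing.scale/=; lra.
Qed.

Lemma is_derive_coshR r : is_derive r 1 (@coshR) (sinhR r).
Proof.
rewrite /sinhR /coshR; apply: is_derive_eq.
by rewrite !(scaler0, add0r, addr0) /GRing.scale/=; lra.
Qed.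

Lemma continuous_coshR : continuous coshR.
Proof.
move=> x; apply: differentiable_continuous; apply/derivable1_diffP.
by have [] := is_derive_coshR x.
Qed.

Lemma sqr_coshR r : coshR r ^+ 2 = 1 + sinhR r ^+ 2.
Proof.
have E : expR r * expR (- r) = 1 by rewrite expRN mulfV// gt_eqF// expR_gt0.
by rewrite /coshR /sinhR !exprMn !sqrrD !sqrrN; lra.
Qed.

Lemma coshR_gt0 r : 0 < coshR r.
Proof. by rewrite divr_gt0// addr_gt0// expR_gt0. Qed.

Lemma coshR_ge1 r : 1 <= coshR r.
Proof.
rewrite -(@ler_pXn2r _ 2) ?nnegrE ?ler01 ?(ltW (coshR_gt0 r))// expr1n sqr_coshR.
by rewrite lerDl sqr_ge0.
Qed.

Lemma sinhR0 : sinhR 0 = 0 :> R.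
Proof. by rewrite /sinhR oppr0 subrr mul0r. Qed.

Lemma coshR0 : coshR 0 = 1.
Proof. by rewrite /coshR oppr0 expR0; lra. Qed.

Lemma sinhRN r : sinhR (- r) = - sinhR r.
Proof. by rewrite /sinhR opprK; lra. Qed.

Lemma sinhR_gt0 r : 0 < r -> 0 < sinhR r.
Proof. by move=> r0; rewrite divr_gt0// subr_gt0 ltr_expR gtrN. Qed.

Lemma sinhR_ge_half r : 0 <= r -> r / 2 <= sinhR r.
Proof.
move=> r0; have := expR_ge1Dx r; have : expR (- r) <= 1 by rewrite -expR0 ler_expR oppr_le0.
by rewrite /sinhR; lra.
Qed.

Lemma expR_coshR_sinhR r : expR r = coshR r + sinhR r.
Proof. by rewrite /coshR /sinhR; lra. Qed.

Definition sinhc r : R := if r == 0 then 1 else sinhR r / r.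

Lemma sinhc_mul r : sinhc r * r = sinhR r.
Proof.
by rewrite /sinhc; case: eqVneq => [->|r0]; rewrite ?mulr0 ?sinhR0// divfK.
Qed.

Lemma sinhc_gt0 r : 0 < sinhc r.
Proof.
rewrite /sinhc; case: eqVneq => // r0; have [rlt|rgt|r00] := ltgtP r 0.
- rewrite -[r in sinhR r]opprK sinhRN mulNr -mulrN -invrN divr_gt0 ?oppr_gt0//.
  by rewrite sinhR_gt0// oppr_gt0.
- by rewrite divr_gt0// sinhR_gt0.
- by rewrite r00 eqxx in r0.
Qed.

Lemma measurable_sinhR_comp d (T : measurableType d) (f : T -> R) :
  measurable_fun setT f -> measurable_fun setT (fun x => sinhR (f x)).
Proof. by move=> mf; rewrite /sinhR; meas. Qed.

Lemma measurable_coshR_comp d (T : measurableType d) (f : T -> R) :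
  measurable_fun setT f -> measurable_fun setT (fun x => coshR (f x)).
Proof. by move=> mf; rewrite /coshR; meas. Qed.

Lemma measurable_sinhc_comp d (T : measurableType d) (f : T -> R) :
  measurable_fun setT f -> measurable_fun setT (fun x => sinhc (f x)).
Proof.
move=> mf; rewrite /sinhc; apply: measurable_fun_ifT.
- by apply: measurable_fun_eqr => //; meas.
- by meas.
- by apply: measurable_funM; [exact: measurable_sinhR_comp|meas].
Qed.

End Hyperbolic.

Ltac meas_ext ::= lazymatch goal with
  | |- measurable_fun _ (fun x => annulus (@?f x)) => apply: measurable_annulus
  | |- measurable_fun _ (fun x => sinhR (@?f x)) => apply: measurable_sinhR_comp
  | |- measurable_fun _ (fun x => coshR (@?f x)) => apply: measurable_coshR_comp
  | |- measurable_fun _ (fun x => sinhc (@?f x)) => apply: measurable_sinhc_comp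
  end.

Section Radial.
Variable R : realType.
Local Open Scope ereal_scope.
Notation mu := (@lebesgue_measure R).

(** The origin lies in the slice where the first coordinate is 0, and that single value is null for
    the outer integral. *)
Lemma leb_null0 k (f : 'rV[R]_k.+1 -> \bar R) :
  measurable_fun setT f -> (forall v, 0 <= f v) ->
  \int[leb R k.+1]_x (f x * (x != 0)%R%:R%:E) = \int[leb R k.+1]_x f x.
Proof.
move=> mf f0.
have mnz : measurable_fun setT (fun x : 'rV[R]_k.+1 => f x * (x != 0)%R%:R%:E).
  have -> : (fun x : 'rV[R]_k.+1 => f x * (x != 0)%R%:R%:E) =
     (fun x => f x * (0 < enorm x)%R%:R%:E).
    by apply/funext => x; rewrite enorm_gt0.
  by meas.
have nz0 x : 0 <= f x * (x != 0%R :> 'rV[R]_k.+1)%:R%:E by rewrite mule_ge0.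
rewrite (integral_lebS mnz nz0) (integral_lebS mf f0).
apply: ge0_ae_eq_integral => //.
- exact: (measurable_integral_row_cons mu mnz nz0).
- exact: (measurable_integral_row_cons mu mf f0).
- by move=> x _; apply: integral_ge0.
- by move=> x _; apply: integral_ge0.
- exists [set 0%R]; split => //; first exact: lebesgue_measure_set1.
  move=> x /= xN; apply: contrapT => x0; apply: xN => _.
  apply: eq_integral => v _; rewrite (_ : row_cons x v != 0%R) ?mule1//.
  apply/eqP => /rowP/(_ 0%R); rewrite row_cons0 mxE => xe; exact: x0.
Qed.

Lemma sinh_substitution (h : R -> \bar R) :
  measurable_fun setT h -> (forall x, 0 <= h x) ->
  \int[mu]_x (h (sinhR x) * ((0 < x)%R%:R * coshR x)%:E) =
  \int[mu]_x (h x * (0 < x)%R%:R%:E).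
Proof.
move=> mh h0.
have := @half_line_substitution R (@sinhR R) (@coshR R) h (@is_derive_sinhR R)
  (@continuous_coshR R).
rewrite sinhR0; apply => //.
- by move=> x _; exact: coshR_gt0.
- move=> y; exists (2 * `|y| + 1)%R; first by rewrite ltr_wpDl// mulr_ge0.
  have : (0 <= 2 * `|y| + 1)%R by rewrite addr_ge0// mulr_ge0.
  by move/sinhR_ge_half; have := ler_norm y; lra.
Qed.

(** The map z -> sinhc(|z|) z keeps directions and sends the radius r to sinh r, so polar
    coordinates on both sides reduce it to [sinh_substitution] on each ray. The weight is its
    Jacobian, the factor sinhc^k coming from the k transverse directions. *)
Lemma radial_substitution k (f : 'rV[R]_k.+1 -> \bar R) :
  measurable_fun setT f -> (forall v, 0 <= f v) ->
  \int[leb R k.+1]_z (f (sinhc (enorm z) *: z)%R *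
     (sinhc (enorm z) ^+ k * coshR (enorm z))%:E) =
  \int[leb R k.+1]_x f x.
Proof.
move=> mf f0.
pose g (z : 'rV[R]_k.+1) := f (sinhc (enorm z) *: z)%R *
     (sinhc (enorm z) ^+ k * coshR (enorm z))%:E.
have mg : measurable_fun setT g.
  apply: emeasurable_funM; last by meas.
  by apply: (measurableT_comp mf); meas.
have g0 z : 0 <= g z.
  by rewrite mule_ge0// lee_fin mulr_ge0 ?exprn_ge0// ltW// ?sinhc_gt0 ?coshR_gt0.
rewrite -[LHS]/(\int[leb R k.+1]_z g z) -(leb_null0 mg g0) -(leb_null0 mf f0).
have /andP[c0 coo] := polar_cst_gt0 R.
have cf : polar_cst R \is a fin_num by rewrite ge0_fin_numE// ltW.
have : forall a b : \bar R, a * polar_cst R = b * polar_cst R -> a = b.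
  move: c0 cf; case: (polar_cst R) => [c| |]// c0 _ a b.
  by move/(congr1 (fun z => z * c^-1%:E)); rewrite -!muleA -EFinM mulfV ?mule1// gt_eqF.
apply; rewrite (polar_integral mg g0) (polar_integral mf f0).
apply: eq_integral => y _.
have [->|y0] := eqVneq y 0%R.
  by rewrite enorm0 /annulus ltNge ler01/= !mul0r !mul0e.
congr (_ * _); set u := ((enorm y)^-1 *: y)%R.
have u1 : enorm u = 1%R.
  rewrite enormZ ger0_norm ?invr_ge0 ?enorm_ge0// mulVf//.
  by rewrite enorm_eq0.
pose h (t : R) := f (t *: u)%R * ((0 < t)%R%:R * t ^+ k)%:E.
have mh : measurable_fun [set: R] h.
  apply: emeasurable_funM; last by meas.
  by apply: (measurableT_comp mf); meas.
have h0 t : 0 <= h t.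
  rewrite mule_ge0// lee_fin; case: (ltP 0%R t) => t0; rewrite ?mul0r// mul1r.
  by rewrite exprn_ge0// ltW.
transitivity (\int[mu]_x (h x * (0 < x)%R%:R%:E)); last first.
  apply: eq_integral => t _; rewrite /h; case: ltP => t0; rewrite ?mule1//.
  by rewrite mul0r !mule0.
rewrite -(sinh_substitution mh h0); apply: eq_integral => t _.
rewrite /h /g; have [t0|t0] := ltP 0%R t; last by rewrite !mul0r !mule0.
rewrite (sinhR_gt0 t0) !mul1r enormZ u1 mulr1 gtr0_norm// scalerA sinhc_mul.
rewrite -!muleA -!EFinM; congr (_ * _%:E).
by rewrite -(sinhc_mul t) exprMn; ring.
Qed.

End Radial.

(** * The Lorentz form and the invariance of hyperbolic volume *)

Section LorentzForm.
Variables (R : realType) (d : nat).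
Implicit Types (x y : 'rV[R]_d.+1) (u v : 'rV[R]_d).

Lemma dot_sqr_le u v : dot u v ^+ 2 <= dot u u * dot v v.
Proof.
have [->|v0] := eqVneq v 0.
  by rewrite dotC -(scale0r (0 : 'rV[R]_d)) !dotZl !mul0r expr0n mulr0.
have v_gt0 : 0 < dot v v by rewrite lt_neqAle dot_ge0 andbT eq_sym dot_eq0.
have := dot_ge0 (dot v v *: u - dot u v *: v).
rewrite -scaleNr !dotDl !dotDr !dotZl !dotZr (dotC v u) => H.
rewrite -(ler_pM2l v_gt0) -subr_ge0; move: H.
by congr (0 <= _); ring.
Qed.

Lemma dot_le_enorm u v : `|dot u v| <= enorm u * enorm v.
Proof.
rewrite -(@ler_pXn2r _ 2) ?nnegrE ?normr_ge0 ?mulr_ge0 ?enorm_ge0//.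
by rewrite exprMn !sqr_enorm real_normK ?num_real// dot_sqr_le.
Qed.

Lemma lorentz_cons a b u v :
  lorentz (row_cons a u) (row_cons b v) = dot u v - a * b.
Proof.
rewrite /lorentz !row_cons0 addrC; congr (_ - _).
by apply: eq_bigr => j _; rewrite !row_consS.
Qed.

Lemma lorentzC x y : lorentz x y = lorentz y x.
Proof. by rewrite -(row_consK x) -(row_consK y) !lorentz_cons dotC mulrC. Qed.

Lemma lorentzDl x y z : lorentz (x + y) z = lorentz x z + lorentz y z.
Proof.
rewrite -(row_consK x) -(row_consK y) -(row_consK z) row_consDl !lorentz_cons dotDl.
by rewrite mulrDl; ring.
Qed.

Lemma row_consZ k a b (u : 'rV[R]_k) : a *: row_cons b u = row_cons (a * b) (a *: u).
Proof.
apply/rowP => i; rewrite mxE; case: (unliftP ord0 i) => [j|] ->.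
  by rewrite !row_consS mxE.
by rewrite !row_cons0.
Qed.

Lemma lorentzZl a x y : lorentz (a *: x) y = a * lorentz x y.
Proof.
rewrite -(row_consK x) -(row_consK y) row_consZ !lorentz_cons dotZl.
by ring.
Qed.

Lemma lorentzDr x y z : lorentz x (y + z) = lorentz x y + lorentz x z.
Proof. by rewrite !(lorentzC x) lorentzDl. Qed.

Lemma lorentzZr a x y : lorentz x (a *: y) = a * lorentz x y.
Proof. by rewrite !(lorentzC x) lorentzZl. Qed.

Definition timelike x : bool := (0 < x 0 0) && (lorentz x x < 0).

Lemma timelike_cons a u : timelike (row_cons a u) = (enorm u < a).
Proof.
rewrite /timelike row_cons0 lorentz_cons subr_lt0 -sqr_enorm -expr2.
apply/andP/idP => [[a0]|ua].
  by rewrite ltr_pXn2r ?nnegrE ?enorm_ge0// ltW.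
have a0 := le_lt_trans (enorm_ge0 u) ua.
by rewrite ltr_pXn2r ?nnegrE ?enorm_ge0// ltW.
Qed.

Definition lorentz_norm x : R := Num.sqrt (- lorentz x x).

Definition hyp_lift u : 'rV[R]_d.+1 := row_cons (Num.sqrt (1 + dot u u)) u.

Local Open Scope ereal_scope.

(* Riemannian volume of the hyperboloid, in the vertical projection. *)
Definition hyp_integral (F : 'rV[R]_d.+1 -> \bar R) : \bar R :=
  \int[leb R d]_u (F (hyp_lift u) * (Num.sqrt (1 + dot u u))^-1%:E).

Let cone_weight (r : R) : R := (annulus r * r ^- d)%R.

(** The extension of F, constant on rays, to the future cone, with a radial weight that gives mass
    one to each ray. It turns integrals over the hyperboloid into Lebesgue integrals, on which
    linear maps act by their determinant. *)
Let cone_fun (F : 'rV[R]_d.+1 -> \bar R) x : \bar R :=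
  F ((lorentz_norm x)^-1 *: x)%R *
  ((timelike x)%:R * cone_weight (lorentz_norm x))%:E.

Let cone_weight_ge0 r : (0 <= cone_weight r)%R.
Proof.
rewrite /cone_weight /annulus; case: (ltP 1%R r) => r1; last by rewrite !mul0r.
by rewrite mulr_ge0 ?mulr_ge0// invr_ge0 exprn_ge0// ltW// (lt_trans _ r1).
Qed.

Let cone_fun_ge0 F x : (forall y, 0 <= F y) -> 0 <= cone_fun F x.
Proof. by move=> F0; rewrite mule_ge0// lee_fin mulr_ge0. Qed.

Lemma measurable_lorentz e (T : measurableType e) (f g : T -> 'rV[R]_d.+1) :
  measurable_fun setT f -> measurable_fun setT g ->
  measurable_fun setT (fun z => lorentz (f z) (g z)).
Proof.
move=> mf mg; rewrite /lorentz; apply: measurable_funD.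
  by meas.
by apply: measurable_rsum => j; meas.
Qed.

Lemma measurable_lorentz_norm e (T : measurableType e) (f : T -> 'rV[R]_d.+1) :
  measurable_fun setT f -> measurable_fun setT (fun z => lorentz_norm (f z)).
Proof.
by move=> mf; apply/measurable_sqrt/measurable_funN/measurable_lorentz.
Qed.

Let measurable_cone_fun F : measurable_fun setT F -> measurable_fun setT (cone_fun F).
Proof.
move=> mF; apply: emeasurable_funM.
  apply: (measurableT_comp mF); apply: measurable_rowZ; last by meas.
  by apply: measurable_inv; apply: measurable_lorentz_norm; meas.
apply/measurable_EFinP/measurable_funM.
  have -> : (fun x => (timelike x)%:R : R) =
      (fun x => (0 < x 0 0)%R%:R * (lorentz x x < 0)%R%:R)%R.
    by apply/funext => x; rewrite /timelike; case: (0 < _)%R; rewrite ?mul1r ?mul0r.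
  apply: measurable_funM; first by meas.
  by apply: measurable_ltr_natmul; [apply: measurable_lorentz|]; meas.
apply: measurable_funM.
  by apply: measurable_annulus; apply: measurable_lorentz_norm; meas.
by apply/measurable_inv/measurable_funX; apply: measurable_lorentz_norm; meas.
Qed.

Lemma measurable_hyp_lift : measurable_fun setT hyp_lift.
Proof.
apply: measurable_row_cons; last by meas.
by apply/measurable_sqrt/measurable_funD; meas.
Qed.


Let mu := @lebesgue_measure R.

Lemma integral_annulus : \int[mu]_r (annulus r)%:E = 1.
Proof.
transitivity (\int[mu]_(r in `]1%R, 2%R]) (cst 1 r)).
  rewrite [RHS]integral_mkcond; apply: eq_integral => r _.
  rewrite patchE mem_setE in_itv/= /annulus.
  by case: ltP => _; case: leP => _; rewrite ?mul0r ?mulr0 ?mul1r.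
rewrite integral_cst//= mul1e lebesgue_measure_itv/= lte_fin ltr1n -EFinD.
by congr EFin; ring.
Qed.

(** At a fixed spatial part v, the time coordinate is sqrt(r^2 + |v|^2), where r is the Lorentz
    norm. The case v = 0 is apart, since this square root is then not differentiable at r = 0. *)
Let cone_slice F v : measurable_fun setT F -> (forall y, 0 <= F y) ->
  \int[mu]_t cone_fun F (row_cons t v) =
  \int[mu]_r (F (row_cons (Num.sqrt (r ^+ 2 + dot v v) / r) (r^-1 *: v))%R *
    (cone_weight r * (r / Num.sqrt (r ^+ 2 + dot v v)))%:E).
Proof.
move=> mF F0; pose h t := cone_fun F (row_cons t v).
have mh : measurable_fun [set: R] h.
  by apply: (measurableT_comp (measurable_cone_fun mF)); meas.
have h0 t : 0 <= h t by exact: cone_fun_ge0.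
have hE (r : R) : (0 < r)%R ->
    h (Num.sqrt (r ^+ 2 + dot v v)) =
    F (row_cons (Num.sqrt (r ^+ 2 + dot v v) / r) (r^-1 *: v))%R * (cone_weight r)%:E.
  move=> r0; have s0 : (0 < r ^+ 2 + dot v v)%R.
    by rewrite ltr_pwDl ?dot_ge0// exprn_gt0.
  have Ln : lorentz_norm (row_cons (Num.sqrt (r ^+ 2 + dot v v)) v) = r.
    rewrite /lorentz_norm lorentz_cons -expr2 sqr_sqrtr ?ltW// opprB addrK.
    by rewrite sqrtr_sqr gtr0_norm.
  rewrite /h /cone_fun Ln row_consZ timelike_cons mulrC.
  have -> : (enorm v < Num.sqrt (r ^+ 2 + dot v v))%R.
    by rewrite ltr_sqrt// ltrDr exprn_gt0.
  by rewrite mul1r.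
have w_neg (r : R) : (r <= 0)%R -> cone_weight r = 0%R.
  by move=> r0; rewrite /cone_weight /annulus ltNge (le_trans r0 ler01)/= !mul0r.
pose w r : R := (r / Num.sqrt (r ^+ 2 + dot v v))%R.
have rhsE : \int[mu]_r (F (row_cons (Num.sqrt (r ^+ 2 + dot v v) / r) (r^-1 *: v))%R *
    (cone_weight r * (r / Num.sqrt (r ^+ 2 + dot v v)))%:E) =
    \int[mu]_r (h (Num.sqrt (r ^+ 2 + dot v v)) * ((0 < r)%R%:R * w r)%:E).
  apply: eq_integral => r _; have [r0|r0] := ltP 0%R r; last first.
    by rewrite w_neg// !mul0r !mule0.
  by rewrite mul1r hE// -muleA -EFinM.
rewrite rhsE.
have [v0|v0] := eqVneq v 0%R.
  apply: eq_integral => r _; rewrite /w v0 -[dot _ _]sqr_enorm enorm0.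
  rewrite (expr2 0%R) mulr0 addr0 sqrtr_sqr.
  have [r0|r0] := ltP 0%R r.
    by rewrite gtr0_norm// mul1r mulfV ?gt_eqF// mule1 /h v0.
  rewrite mul0r mule0 /h /cone_fun timelike_cons enorm0 ltNge r0/=.
  by rewrite mul0r mule0.
have dv : (0 < dot v v)%R by rewrite lt_neqAle dot_ge0 andbT eq_sym dot_eq0.
have s0 r : (0 < r ^+ 2 + dot v v)%R by rewrite ltr_wpDl// sqr_ge0.
have dphi (r : R) : is_derive r 1%R (fun r => Num.sqrt (r ^+ 2 + dot v v)) (w r).
  have H : is_derive r 1%R (fun r : R => r ^+ 2 + dot v v)%R (2 * r)%R.
    apply: is_derive_eq; rewrite /GRing.scale/= ?addr0 ?mulr1; ring.
  have := @is_derive1_comp R Num.sqrt (fun r : R => r ^+ 2 + dot v v)%R r _ _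
    (is_derive1_sqrt (s0 r)) H.
  move/is_derive_eq; apply; rewrite /w invfM; field.
  by rewrite sqrtr_eq0 -ltNge s0.
have cw : continuous w.
  move=> r; apply: cvgM; first exact: cvg_id.
  apply: cvgV; first by rewrite sqrtr_eq0 -ltNge s0.
  apply: (@continuous_comp _ _ _ (fun r : R => r ^+ 2 + dot v v)%R Num.sqrt).
    by apply: cvgD; [exact: exprn_continuous|exact: cvg_cst].
  exact: sqrt_continuous.
rewrite (@half_line_substitution R (fun r => Num.sqrt (r ^+ 2 + dot v v)) w h)//.
- apply: eq_integral => t _; rewrite expr0n add0r /h /cone_fun timelike_cons.
  by case: ltP => _; rewrite ?mule1// mul0r !mule0.
- by move=> x x0; rewrite divr_gt0// sqrtr_gt0.
- move=> y; exists (`|y| + 1)%R; first by rewrite ltr_wpDl.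
  apply: (@le_trans _ _ (Num.sqrt ((`|y| + 1) ^+ 2))).
    by rewrite sqrtr_sqr ger0_norm ?addr_ge0// (le_trans (ler_norm y))// lerDl.
  by rewrite ler_wsqrtr// lerDl dot_ge0.
Qed.

(** Scaling v = r u turns the slices into multiples of [hyp_lift u]; the factor r^d so produced
    cancels that of [cone_weight], and what remains in r is [annulus], of total mass 1. *)
Lemma hyp_integral_cone F : measurable_fun setT F -> (forall y, 0 <= F y) ->
  hyp_integral F = \int[leb R d.+1]_x cone_fun F x.
Proof.
move=> mF F0; rewrite (integral_lebS_swap (measurable_cone_fun mF)); last first.
  by move=> x; exact: cone_fun_ge0.
pose K r (v : 'rV[R]_d) := F (row_cons (Num.sqrt (r ^+ 2 + dot v v) / r) (r^-1 *: v))%R *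
    (cone_weight r * (r / Num.sqrt (r ^+ 2 + dot v v)))%:E.
have K0 r v : 0 <= K r v.
  rewrite mule_ge0// lee_fin; have [r0|r0] := leP r 0%R.
    by rewrite /cone_weight /annulus ltNge (le_trans r0 ler01)/= !mul0r.
  by rewrite mulr_ge0// divr_ge0 ?sqrtr_ge0// ltW.
have mK : measurable_fun [set: measurableTypeR R * 'rV[R]_d] (fun z => K z.1 z.2).
  apply: emeasurable_funM; last by rewrite /cone_weight; meas.
  by apply: (measurableT_comp mF); meas.
transitivity (\int[leb R d]_v \int[mu]_r K r v); last first.
  by apply: eq_integral => v _; rewrite cone_slice.
rewrite -ge0_swap//.
have mhl : measurable_fun setT (fun u : 'rV[R]_d => F (hyp_lift u) * (Num.sqrt (1 + dot u u))^-1%:E).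
  apply: emeasurable_funM; last by meas.
  exact: (measurableT_comp mF measurable_hyp_lift).
have hl0 (u : 'rV[R]_d) : 0 <= F (hyp_lift u) * (Num.sqrt (1 + dot u u))^-1%:E.
  by rewrite mule_ge0// lee_fin invr_ge0.
transitivity (\int[mu]_r ((annulus r)%:E * hyp_integral F)).
  rewrite ge0_integralZr//.
  - by rewrite integral_annulus mul1e.
  - by apply/measurable_EFinP; apply: measurable_annulus; meas.
  - by move=> r _; rewrite lee_fin annulus_ge0.
  - exact: integral_ge0.
apply: eq_integral => r _; have [r0|r0] := leP r 0%R.
  rewrite /annulus ltNge (le_trans r0 ler01)/= mul0r mul0e integral0_eq// => v _.
  by rewrite /K /cone_weight /annulus ltNge (le_trans r0 ler01)/= !mul0r mule0.
have mKr : measurable_fun setT (K r).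
  apply: emeasurable_funM; last by meas.
  by apply: (measurableT_comp mF); meas.
rewrite (leb_scale r0 mKr (K0 r)) /hyp_integral -!ge0_integralZl//.
- apply: eq_integral => u _.
  have sq : (Num.sqrt (r ^+ 2 + dot (r *: u) (r *: u)) = r * Num.sqrt (1 + dot u u))%R.
    rewrite dotZl dotZr mulrA -expr2 -[X in (X + _)%R]mulr1 -mulrDr.
    by rewrite sqrtrM ?sqr_ge0// sqrtr_sqr gtr0_norm.
  rewrite /K sq scalerA mulVf ?gt_eqF// scale1r mulrAC mulfV ?gt_eqF// mul1r.
  rewrite !(muleCA _ (F _)) -!EFinM /cone_weight; congr (F _ * _%:E).
  have sn0 : (Num.sqrt (1 + dot u u) != 0)%R.
    by rewrite sqrtr_eq0 -ltNge ltr_pwDl ?dot_ge0.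
  have rd : (r ^+ d != 0)%R by rewrite expf_eq0 (gt_eqF r0) andbF.
  by field; rewrite ?sn0 ?rd ?(gt_eqF r0).
- by apply: (measurableT_comp mKr); apply: measurable_rowZ; meas.
- by rewrite lee_fin exprn_ge0// ltW.
- by rewrite lee_fin annulus_ge0.
Qed.

(** On the cone integral, B changes neither the Lorentz norm nor the set of future timelike vectors,
    and Lebesgue measure is preserved because the determinant is 1 in absolute value. *)
Theorem hyp_integral_invariant (B : 'M[R]_d.+1) F :
  (forall x y, lorentz (x *m B) (y *m B) = lorentz x y) ->
  (forall x, lorentz x x < 0 -> (0 < (x *m B) 0 0) = (0 < x 0 0))%R ->
  `|\det B|%R = 1%R -> measurable_fun setT F -> (forall y, 0 <= F y) ->
  hyp_integral (fun x => F (x *m B)%R) = hyp_integral F.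
Proof.
move=> HB HB0 detB mF F0.
have mFB : measurable_fun setT (fun x : 'rV[R]_d.+1 => F (x *m B)%R).
  by apply: (measurableT_comp mF); meas.
rewrite !hyp_integral_cone//.
transitivity (\int[leb R d.+1]_x cone_fun F (x *m B)%R).
  apply: eq_integral => x _; rewrite /cone_fun /lorentz_norm /timelike HB.
  rewrite -scalemxAl; congr (_ * (_ * _)%:E).
  have [x0|x0] := ltP (lorentz x x) 0%R; last by rewrite !andbF.
  by rewrite HB0.
rewrite leb_linear//.
- by rewrite detB invr1 mul1e.
- by rewrite unitmxE unitfE -normr_eq0 detB oner_eq0.
- exact: measurable_cone_fun.
- by move=> x; exact: cone_fun_ge0.
Qed.

End LorentzForm.

(** * Geodesics, parallel transport and boosts *)

Section RowDerivatives.
Variable R : realType.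
Implicit Types (n : nat).

Lemma is_derive_rowP n (g : R -> 'rV[R]_n) (t : R) (dg : 'rV[R]_n) :
  is_derive t 1 g dg <-> forall j, is_derive t 1 (fun s => g s 0 j) (dg 0 j).
Proof.
split=> [[dt dE] j|H].
  apply: DeriveDef; first exact: (derivable_mxP _ _ _).1.
  by rewrite -dE derive_mx// mxE.
have dt : derivable g t 1.
  by apply/derivable_mxP => i j; rewrite (ord1 i); have [] := H j.
apply: DeriveDef => //; rewrite derive_mx//; apply/rowP => j; rewrite mxE.
by rewrite derive_val.
Qed.

Lemma is_derive_derive1 n (g : R -> 'rV[R]_n) (t : R) :
  derivable g t 1 -> is_derive t 1 g (g^`()%classic t).
Proof. by move=> dg; rewrite derive1E; exact: derivableP. Qed.

Lemma is_derive_dot n (f g : R -> 'rV[R]_n) (t : R) df dg :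
  is_derive t 1 f df -> is_derive t 1 g dg ->
  is_derive t 1 (fun s => dot (f s) (g s)) (dot df (g t) + dot (f t) dg).
Proof.
move=> /is_derive_rowP Hf /is_derive_rowP Hg; rewrite /dot -big_split/=.
have -> : (fun s => \sum_i f s 0 i * g s 0 i) = \sum_i (fun s => f s 0 i * g s 0 i).
  by apply/funext => s; rewrite fct_sumE.
apply: is_derive_sum => i; apply: is_derive_eq.
by rewrite /GRing.scale/= addrC mulrC; congr (_ + _); rewrite mulrC.
Qed.

Lemma is_derive_lorentz d (f g : R -> 'rV[R]_d.+1) (t : R) df dg :
  is_derive t 1 f df -> is_derive t 1 g dg ->
  is_derive t 1 (fun s => lorentz (f s) (g s)) (lorentz df (g t) + lorentz (f t) dg).
Proof.
move=> Hf Hg; have /is_derive_rowP Hf' := Hf; have /is_derive_rowP Hg' := Hg.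
have b (h : R -> 'rV[R]_d.+1) dh : is_derive t 1 h dh ->
    is_derive t 1 (fun s => row_behead (h s)) (row_behead dh).
  move=> /is_derive_rowP H; apply/is_derive_rowP => j.
  by rewrite row_beheadE; under eq_fun do rewrite row_beheadE.
have E x y : lorentz x y = dot (row_behead x) (row_behead y) - x 0 0 * y 0 0.
  by rewrite -{1}(row_consK x) -{1}(row_consK y) lorentz_cons.
under eq_fun do rewrite E; rewrite !E.
have := is_derive_dot (b _ _ Hf) (b _ _ Hg).
have H0 : is_derive t 1 (fun s => f s 0 0 * g s 0 0) (f t 0 0 * dg 0 0 + g t 0 0 * df 0 0).
  exact: (is_deriveM (Hf' 0) (Hg' 0)).
move=> H1; have := is_deriveB H1 H0; move/is_derive_eq; apply; ring.
Qed.

Lemma is_derive_scale_cst n (a : R -> R) (t da : R) (w : 'rV[R]_n) :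
  is_derive t 1 a da -> is_derive t 1 (fun s => a s *: w) (da *: w).
Proof.
move=> Ha; apply/is_derive_rowP => j; rewrite mxE.
under eq_fun do rewrite mxE mulrC.
have := @is_deriveZ R _ _ a (w 0 j) t 1 da Ha.
by move/is_derive_eq; apply; rewrite /GRing.scale/= mulrC.
Qed.

(* Solutions of f'' = k^2 f, [Sf] and [Tf] being iterated primitives of
   cosh (k t) that vanish at 0. *)
Definition Sf (k t : R) : R := if k == 0 then t else sinhR (k * t) / k.
Definition Cf (k t : R) : R := coshR (k * t).
Definition Tf (k t : R) : R := if k == 0 then t ^+ 2 / 2 else (coshR (k * t) - 1) / k ^+ 2.

Let is_derive_kt (k t : R) : is_derive t 1 (fun s : R => k * s) k.
Proof. by apply: is_derive_eq; rewrite /GRing.scale/= mulr1. Qed.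

Lemma is_derive_Cf (k t : R) : is_derive t 1 (Cf k) (k ^+ 2 * Sf k t).
Proof.
have := @is_derive1_comp R (@coshR R) (fun s : R => k * s) t _ _
  (is_derive_coshR _) (is_derive_kt k t).
move/is_derive_eq; apply; rewrite /Sf; case: eqVneq => [->|k0].
  by rewrite !mul0r sinhR0 ?mul0r ?mulr0 ?expr0n ?mul0r.
by rewrite expr2; field.
Qed.

Lemma is_derive_Sf (k t : R) : is_derive t 1 (Sf k) (Cf k t).
Proof.
rewrite /Sf /Cf; case: eqVneq => [->|k0].
  by rewrite mul0r coshR0; exact: is_derive_id.
have := @is_derive1_comp R (@sinhR R) (fun s : R => k * s) t _ _
  (is_derive_sinhR _) (is_derive_kt k t).
move=> H; have := @is_deriveZ R _ _ _ k^-1 t 1 _ H.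
rewrite (_ : k^-1 \*: _ = fun s => sinhR (k * s) / k); last first.
  by apply/funext => s; exact: mulrC.
by move/is_derive_eq; apply; rewrite /GRing.scale/=; field.
Qed.

Lemma is_derive_Tf (k t : R) : is_derive t 1 (Tf k) (Sf k t).
Proof.
rewrite /Tf /Sf; case: eqVneq => [_|k0].
  have -> : (fun t : R => t ^+ 2 / 2) = (fun t : R => 2^-1 * t ^+ 2).
    by apply/funext => s; rewrite mulrC.
  by apply: is_derive_eq; rewrite /GRing.scale/=; field.
have := @is_derive1_comp R (@coshR R) (fun s : R => k * s) t _ _
  (is_derive_coshR _) (is_derive_kt k t).
move=> H; have := @is_deriveZ R _ _ _ (k ^+ 2)^-1 t 1 _ (is_deriveB H (is_derive_cst (1 : R) t 1)).
move=> {}H; have -> : (fun t : R => (coshR (k * t) - 1) / k ^+ 2) =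
    ((k ^+ 2)^-1 \*: ((fun s : R => coshR (k * s)) - cst 1)).
  by apply/funext => s; exact: mulrC.
by apply: is_derive_eq H _; rewrite /GRing.scale/=; field.
Qed.

Lemma Cf0 k : Cf k 0 = 1. Proof. by rewrite /Cf mulr0 coshR0. Qed.
Lemma Sf0 k : Sf k 0 = 0.
Proof. by rewrite /Sf mulr0 sinhR0 mul0r; case: ifP. Qed.
Lemma Tf0 k : Tf k 0 = 0.
Proof. by rewrite /Tf mulr0 coshR0 subrr mul0r expr0n mul0r; case: ifP. Qed.
Lemma Cf1 k : Cf k 1 = coshR k. Proof. by rewrite /Cf mulr1. Qed.
Lemma Sf1 k : Sf k 1 = sinhc k. Proof. by rewrite /Sf /sinhc mulr1. Qed.

Lemma Cf_sqr (k t : R) : Cf k t ^+ 2 = 1 + k ^+ 2 * Sf k t ^+ 2.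
Proof.
rewrite /Cf sqr_coshR /Sf; case: eqVneq => [->|k0].
  by rewrite !mul0r sinhR0 expr0n mul0r.
by congr (_ + _); field.
Qed.

Lemma Tf_Cf (k t : R) : k ^+ 2 * Tf k t = Cf k t - 1.
Proof.
rewrite /Tf /Cf; case: eqVneq => [->|k0]; last by field.
by rewrite expr0n !mul0r coshR0 subrr.
Qed.

(** [H1] and [H2] are two conserved quantities, the initial data expressed through the solution at
    time s. Solving them for f uses Cf^2 - k^2 Sf^2 = 1 and makes no appeal to a uniqueness
    theorem. *)
Lemma hyperbolic_ode (f f' : R -> R) (k : R) :
  (forall t : R, is_derive t 1 f (f' t)) ->
  (forall t : R, is_derive t 1 f' (k ^+ 2 * f t)) ->
  forall t, f t = f 0 * Cf k t + f' 0 * Sf k t.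
Proof.
move=> Hf Hf' t.
have H1 s : f s * Cf k s - f' s * Sf k s = f 0.
  transitivity (f 0 * Cf k 0 - f' 0 * Sf k 0); last by rewrite Cf0 Sf0; ring.
  apply: (@is_derive_0_is_cst R (fun s => f s * Cf k s - f' s * Sf k s)) => r.
  have := is_deriveB (is_deriveM (Hf r) (is_derive_Cf k r))
    (is_deriveM (Hf' r) (is_derive_Sf k r)).
  by move/is_derive_eq; apply; rewrite /GRing.scale/=; ring.
have H2 s : f' s * Cf k s - k ^+ 2 * f s * Sf k s = f' 0.
  transitivity (f' 0 * Cf k 0 - k ^+ 2 * f 0 * Sf k 0); last by rewrite Cf0 Sf0; ring.
  apply: (@is_derive_0_is_cst R (fun s => f' s * Cf k s - k ^+ 2 * f s * Sf k s)) => r.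
  have Hk : is_derive r 1 (fun s => k ^+ 2 * f s) (k ^+ 2 * f' r).
    exact: (@is_deriveZ R _ _ f (k ^+ 2) r 1 _ (Hf r)).
  have := is_deriveB (is_deriveM (Hf' r) (is_derive_Cf k r))
    (is_deriveM Hk (is_derive_Sf k r)).
  by move/is_derive_eq; apply; rewrite /GRing.scale/=; ring.
rewrite -(H1 t) -(H2 t).
have E := Cf_sqr k t.
transitivity (f t * (Cf k t ^+ 2 - k ^+ 2 * Sf k t ^+ 2)); last by ring.
by rewrite E; ring.
Qed.

End RowDerivatives.

Section Geometry.
Variables (R : realType) (d : nat).
Implicit Types x y v w mu : 'rV[R]_d.+1.
Implicit Types u z : 'rV[R]_d.

Lemma lorentzE x y : lorentz x y = dot (row_behead x) (row_behead y) - x 0 0 * y 0 0.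
Proof. by rewrite -{1}(row_consK x) -{1}(row_consK y) lorentz_cons. Qed.

Lemma hyperboloid_neq mu : hyperboloid mu -> 0 < mu 0 0.
Proof. by case. Qed.

Lemma hyperboloid_norm mu : hyperboloid mu -> lorentz mu mu = -1.
Proof. by case. Qed.

Lemma hyperboloid_dot mu : hyperboloid mu ->
  dot (row_behead mu) (row_behead mu) = mu 0 0 ^+ 2 - 1.
Proof. by move=> [+ _]; rewrite lorentzE expr2 => H; lra. Qed.

Lemma tangent_dot mu v : tangent mu v ->
  dot (row_behead mu) (row_behead v) = mu 0 0 * v 0 0.
Proof. by rewrite /tangent/= lorentzE => H; lra. Qed.

(** Cauchy-Schwarz on the spatial parts. It is the source of the positive definiteness of the
    Lorentz form on tangent spaces. *)
Lemma tangent_time_le mu v : hyperboloid mu -> tangent mu v ->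
  v 0 0 ^+ 2 <= lorentz v v * (mu 0 0 ^+ 2 - 1).
Proof.
move=> Hm Tv; have := dot_sqr_le (row_behead mu) (row_behead v).
rewrite (hyperboloid_dot Hm) (tangent_dot Tv) exprMn lorentzE -expr2 => H.
set D := dot _ _ in H *; set a := mu 0 0 ^+ 2 in H *; set b := v 0 0 ^+ 2 in H *.
have a0 : 0 <= a by rewrite sqr_ge0.
have D0 : 0 <= D by exact: dot_ge0.
have b0 : 0 <= b by rewrite sqr_ge0.
by rewrite mulrBl mulrBr mulr1; move: H; rewrite mulrBl mul1r mulrC; lra.
Qed.

Lemma hyperboloid_ge1 mu : hyperboloid mu -> 1 <= mu 0 0.
Proof.
move=> Hm; have m0 := hyperboloid_neq Hm.
rewrite -(@ler_pXn2r _ 2) ?nnegrE ?ler01 ?(ltW m0)// expr1n -subr_ge0.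
by rewrite -(hyperboloid_dot Hm) dot_ge0.
Qed.

Lemma tangent_ge0 mu v : hyperboloid mu -> tangent mu v -> 0 <= lorentz v v.
Proof.
move=> Hm Tv; have H := tangent_time_le Hm Tv; rewrite leNgt; apply/negP => L.
have m1 := hyperboloid_ge1 Hm.
have : lorentz v v * (mu 0 0 ^+ 2 - 1) <= 0.
  by rewrite nmulr_rle0// subr_ge0 exprn_ege1.
move=> L'; have v0 : v 0 0 ^+ 2 = 0.
  by apply/eqP; rewrite eq_le sqr_ge0 andbT (le_trans H).
move: L; rewrite lorentzE -expr2 v0 subr0; have := dot_ge0 (row_behead v).
by rewrite leNgt => /negP.
Qed.

Lemma tangent_eq0 mu v : hyperboloid mu -> tangent mu v -> lorentz v v = 0 -> v = 0.
Proof.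
move=> Hm Tv L; have := tangent_time_le Hm Tv; rewrite L mul0r => v0.
have {}v0 : v 0 0 ^+ 2 = 0 by apply/eqP; rewrite eq_le sqr_ge0 andbT.
have /eqP : dot (row_behead v) (row_behead v) = 0.
  by move: L; rewrite lorentzE -expr2 v0 subr0.
rewrite dot_eq0 => /eqP b0; move/eqP: v0; rewrite sqrf_eq0 => /eqP v0.
apply/rowP => i; rewrite -(row_consK v) v0 b0.
by case: (unliftP ord0 i) => [j|] ->; rewrite ?row_consS ?row_cons0 !mxE.
Qed.

Definition tnorm v : R := Num.sqrt (lorentz v v).

Lemma sqr_tnorm mu v : hyperboloid mu -> tangent mu v -> tnorm v ^+ 2 = lorentz v v.
Proof. by move=> Hm Tv; rewrite sqr_sqrtr// (tangent_ge0 Hm Tv). Qed.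

Lemma lorentz_le_m1 x y : hyperboloid x -> hyperboloid y -> lorentz x y <= -1.
Proof.
move=> Hx Hy; have x1 := hyperboloid_ge1 Hx; have y1 := hyperboloid_ge1 Hy.
have := dot_sqr_le (row_behead x) (row_behead y).
rewrite (hyperboloid_dot Hx) (hyperboloid_dot Hy) lorentzE.
set D := dot _ _; set a := x 0 0 in x1 *; set b := y 0 0 in y1 * => H.
have ab1 : 1 <= a * b by rewrite -[1]mulr1 ler_pM.
have : D <= a * b - 1.
  apply: le_trans (ler_norm _) _.
  rewrite -(@ler_pXn2r _ 2) ?nnegrE ?normr_ge0 ?subr_ge0// real_normK ?num_real//.
  apply: le_trans H _; rewrite -subr_ge0.
  by have := sqr_ge0 (a - b); congr (0 <= _); ring.
by lra.
Qed.

(** The tangential part of w is Lorentz-orthogonal to itself, hence 0 by definiteness. This converts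
    the orthogonality in [covariantly_constant] into an explicit differential equation. *)
Lemma normal_multiple x w : hyperboloid x ->
  (forall v, tangent x v -> lorentz w v = 0) -> w = - lorentz w x *: x.
Proof.
move=> Hx Hw; set w' := w + lorentz w x *: x.
have Tw' : tangent x w'.
  rewrite /tangent/= lorentzDr lorentzZr (hyperboloid_norm Hx) lorentzC; lra.
have L : lorentz w' w' = 0.
  by rewrite {1}/w' lorentzDl lorentzZl Hw// Tw' mulr0 addr0.
have /eqP := tangent_eq0 Hx Tw' L.
by rewrite /w' addr_eq0 scaleNr => /eqP.
Qed.

(** The speed is constant, and differentiating <g', g> = 0 identifies the normal acceleration as
    |v|^2 g. Each ambient coordinate then solves the scalar equation of [hyperbolic_ode]. *)
Lemma geodesicE g : geodesic g ->
  let mu := g 0 in let v := g^`()%classic 0 in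
  [/\ hyperboloid mu, tangent mu v &
  forall t, g t = Cf (tnorm v) t *: mu + Sf (tnorm v) t *: v].
Proof.
move=> [Hg dg cc] mu v.
have dgt (t : R) : is_derive t 1 g (g^`()%classic t) by exact: is_derive_derive1.
have Tg t : tangent (g t) (g^`()%classic t) by case: (cc t).
have ddg (t : R) : is_derive t 1 (g^`()%classic) (g^`()%classic^`()%classic t).
  by apply: is_derive_derive1; case: (cc t).
have ng t w : tangent (g t) w -> lorentz (g^`()%classic^`()%classic t) w = 0.
  by case: (cc t) => _ _; exact.
have Tv : tangent mu v by exact: Tg.
have Hm : hyperboloid mu by exact: Hg.
have energy t : lorentz (g^`()%classic t) (g^`()%classic t) = lorentz v v.
  apply: (@is_derive_0_is_cst R (fun t => lorentz (g^`()%classic t) (g^`()%classic t))) => s.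
  have := is_derive_lorentz (ddg s) (ddg s).
  by move/is_derive_eq; apply; rewrite [X in _ + X]lorentzC (ng s _ (Tg s)) addr0.
have acc t : g^`()%classic^`()%classic t = tnorm v ^+ 2 *: g t.
  rewrite (sqr_tnorm Hm Tv) -(energy t).
  rewrite {1}(normal_multiple (Hg t) (ng t)); congr (_ *: _).
  have := is_derive_lorentz (ddg t) (dgt t).
  have -> : (fun s => lorentz (g^`()%classic s) (g s)) = cst 0.
    by apply/funext => s /=; rewrite lorentzC; exact: Tg.
  move=> [_]; rewrite derive_cst => /esym/eqP; rewrite addr_eq0 => /eqP ->.
  by rewrite opprK.
split=> // t; apply/rowP => j; rewrite !mxE.
have H1 (s : R) : is_derive s 1 (fun t => g t 0 j) (g^`()%classic s 0 j).
  exact: (is_derive_rowP _ _ _).1.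
have H2 (s : R) : is_derive s 1 (fun t => g^`()%classic t 0 j) (tnorm v ^+ 2 * g s 0 j).
  by have /is_derive_rowP/(_ j) := ddg s; move/is_derive_eq; apply; rewrite acc mxE.
by rewrite (hyperbolic_ode H1 H2 t) mulrC [X in _ + X]mulrC.
Qed.

Definition geodesic_from mu v (t : R) := Cf (tnorm v) t *: mu + Sf (tnorm v) t *: v.

Lemma is_derive_geodesic_from mu v (t : R) :
  is_derive t 1 (geodesic_from mu v)
    ((tnorm v ^+ 2 * Sf (tnorm v) t) *: mu + Cf (tnorm v) t *: v).
Proof.
exact: (is_deriveD (is_derive_scale_cst _ (is_derive_Cf _ _))
  (is_derive_scale_cst _ (is_derive_Sf _ _))).
Qed.

Lemma derive1_geodesic_from mu v :
  (geodesic_from mu v)^`()%classic =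
  (fun t => (tnorm v ^+ 2 * Sf (tnorm v) t) *: mu + Cf (tnorm v) t *: v).
Proof.
by apply/funext => t; rewrite derive1E; have [_ ->] := is_derive_geodesic_from mu v t.
Qed.

Lemma geodesic_from_hyperboloid mu v t : hyperboloid mu -> tangent mu v ->
  hyperboloid (geodesic_from mu v t).
Proof.
move=> Hm Tv; have Q := sqr_tnorm Hm Tv; have E := Cf_sqr (tnorm v) t.
split.
  rewrite /geodesic_from !(lorentzDl, lorentzDr, lorentzZl, lorentzZr).
  rewrite (hyperboloid_norm Hm) Tv (lorentzC v) Tv -Q.
  transitivity (- (Cf (tnorm v) t ^+ 2 - tnorm v ^+ 2 * Sf (tnorm v) t ^+ 2)); first by ring.
  by rewrite E; ring.
rewrite !mxE; set C := Cf _ t in E *; set S := Sf _ t in E *.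
have C0 : 0 < C by exact: coshR_gt0.
have m0 := hyperboloid_neq Hm.
clearbody C S.
have : (S * v 0 0) ^+ 2 < (C * mu 0 0) ^+ 2.
  apply: (@le_lt_trans _ _ (S ^+ 2 * (lorentz v v * (mu 0 0 ^+ 2 - 1)))).
    by rewrite exprMn ler_wpM2l ?sqr_ge0// tangent_time_le.
  rewrite -Q mulrA [S ^+ 2 * _]mulrC (_ : _ * S ^+ 2 = C ^+ 2 - 1); last by rewrite E; ring.
  rewrite exprMn mulrBl mulrBr mul1r mulr1.
  have : 0 < C ^+ 2 by rewrite exprn_gt0.
  have : 0 <= C ^+ 2 - 1.
    by rewrite E [1 + _]addrC addrK mulr_ge0// sqr_ge0.
  have : 1 <= mu 0 0 ^+ 2 by rewrite exprn_ege1// hyperboloid_ge1.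
  by lra.
rewrite -ltr_sqrt ?exprn_gt0 ?mulr_gt0// !sqrtr_sqr (gtr0_norm (mulr_gt0 C0 m0)).
by rewrite ltr_norml => /andP[H _]; lra.
Qed.

Lemma geodesic_from_geodesic mu v : hyperboloid mu -> tangent mu v ->
  geodesic (geodesic_from mu v).
Proof.
move=> Hm Tv; split.
- by move=> t; exact: geodesic_from_hyperboloid.
- by move=> t; have [] := is_derive_geodesic_from mu v t.
have dd (t : R) : is_derive t 1 ((geodesic_from mu v)^`()%classic)
   (tnorm v ^+ 2 *: geodesic_from mu v t).
  rewrite derive1_geodesic_from.
  have H := @is_deriveZ R _ _ _ (tnorm v ^+ 2) t 1 _ (is_derive_Sf (tnorm v) t).
  have := is_deriveD (is_derive_scale_cst mu H)
     (is_derive_scale_cst v (is_derive_Cf (tnorm v) t)).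
  move/is_derive_eq; apply.
  have -> : tnorm v ^+ 2 *: Cf (tnorm v) t = tnorm v ^+ 2 * Cf (tnorm v) t by [].
  by rewrite /geodesic_from scalerDr !scalerA.
move=> t; split.
- rewrite derive1_geodesic_from /tangent/= /geodesic_from.
  rewrite !(lorentzDl, lorentzDr, lorentzZl, lorentzZr).
  rewrite (hyperboloid_norm Hm) Tv (lorentzC v) Tv -(sqr_tnorm Hm Tv); ring.
- by have [] := dd t.
- move=> w Tw; rewrite derive1E; have [_ ->] := dd t.
  by rewrite lorentzZl Tw mulr0.
Qed.

Lemma geodesic_from0 mu v : geodesic_from mu v 0 = mu.
Proof. by rewrite /geodesic_from Cf0 Sf0 scale1r scale0r addr0. Qed.

Lemma derive1_geodesic_from0 mu v : (geodesic_from mu v)^`()%classic 0 = v.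
Proof. by rewrite derive1_geodesic_from Cf0 Sf0 mulr0 scale1r scale0r add0r. Qed.

Lemma ExpE mu v : hyperboloid mu -> tangent mu v ->
  Exp mu v = coshR (tnorm v) *: mu + sinhc (tnorm v) *: v.
Proof.
move=> Hm Tv; rewrite -Cf1 -Sf1; apply: xget_subset1.
  exists (geodesic_from mu v); split=> //.
  - exact: geodesic_from_geodesic.
  - exact: geodesic_from0.
  - exact: derive1_geodesic_from0.
move=> x y [g [Gg g0 g'0 <-]] [h [Gh h0 h'0 <-]].
have [_ _ ->] := geodesicE Gg; have [_ _ ->] := geodesicE Gh.
by rewrite g0 g'0 h0 h'0.
Qed.

Definition arcosh (c : R) : R := ln (c + Num.sqrt (c ^+ 2 - 1)).

Lemma arcosh_ge0 c : 1 <= c -> 0 <= arcosh c.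
Proof. by move=> c1; rewrite ln_ge0// (le_trans c1)// lerDl sqrtr_ge0. Qed.

Lemma arcoshK c : 1 <= c -> coshR (arcosh c) = c.
Proof.
move=> c1; have c0 : 0 < c by exact: lt_le_trans c1.
have s2 : Num.sqrt (c ^+ 2 - 1) ^+ 2 = c ^+ 2 - 1.
  by rewrite sqr_sqrtr// subr_ge0 exprn_ege1.
have cs0 : 0 < c + Num.sqrt (c ^+ 2 - 1) by rewrite ltr_wpDr ?sqrtr_ge0.
rewrite /coshR /arcosh expRN lnK ?posrE//.
rewrite (_ : (c + _)^-1 = c - Num.sqrt (c ^+ 2 - 1)); first by lra.
apply: (mulfI (lt0r_neq0 cs0)); rewrite mulfV ?gt_eqF//.
by rewrite [RHS]mulrC -subr_sqr s2; ring.
Qed.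

Lemma exists_log x y : hyperboloid x -> hyperboloid y ->
  exists v, tangent x v /\ coshR (tnorm v) *: x + sinhc (tnorm v) *: v = y.
Proof.
move=> Hx Hy; pose c := - lorentz x y.
have c1 : 1 <= c by rewrite /c; have := lorentz_le_m1 Hx Hy; lra.
pose r := arcosh c; have r0 : 0 <= r by exact: arcosh_ge0.
have cr : coshR r = c by exact: arcoshK.
have s0 := sinhc_gt0 r.
pose v := (sinhc r)^-1 *: (y - c *: x).
have vv : lorentz v v = r ^+ 2.
  rewrite /v -scaleNr !(lorentzZl, lorentzZr, lorentzDl, lorentzDr).
  rewrite (hyperboloid_norm Hx) (hyperboloid_norm Hy) (lorentzC y x).
  have E : lorentz x y = - c by rewrite opprK.
  have := sqr_coshR r; rewrite cr -sinhc_mul E => c2.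
  apply: (mulfI (lt0r_neq0 s0)); apply: (mulfI (lt0r_neq0 s0)).
  transitivity (c ^+ 2 - 1); last by rewrite c2; ring.
  by field; rewrite gt_eqF.
have tv : tnorm v = r by rewrite /tnorm vv sqrtr_sqr ger0_norm.
exists v; split.
  rewrite /tangent/= /v -scaleNr lorentzZr lorentzDr lorentzZr (hyperboloid_norm Hx).
  by rewrite /c; ring.
by rewrite tv cr /v scalerA mulfV ?gt_eqF// scale1r addrC subrK.
Qed.

Lemma exp_inj x v w : hyperboloid x -> tangent x v -> tangent x w ->
  coshR (tnorm v) *: x + sinhc (tnorm v) *: v =
  coshR (tnorm w) *: x + sinhc (tnorm w) *: w -> v = w.
Proof.
move=> Hx Tv Tw E.
have C : coshR (tnorm v) = coshR (tnorm w).
  have := congr1 (lorentz x) E.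
  rewrite !(lorentzDr, lorentzZr) Tv Tw (hyperboloid_norm Hx) !mulr0 !addr0.
  by rewrite !mulrN1 => /oppr_inj.
have tvw : tnorm v = tnorm w.
  have inc (a b : R) : 0 <= a -> a < b -> coshR a < coshR b.
    move=> a0 ab; have b0 := le_lt_trans a0 ab.
    have sinc : sinhR a < sinhR b.
      rewrite /sinhR ltr_pM2r ?invr_gt0// ltrB ?ltr_expR//.
      by rewrite ltrN2.
    rewrite -(@ltr_pXn2r _ 2) ?nnegrE ?(ltW (coshR_gt0 _))// !sqr_coshR ltrD2l.
    rewrite ltr_pXn2r ?nnegrE//; last exact: (ltW (sinhR_gt0 b0)).
    by apply: le_trans (sinhR_ge_half a0); rewrite divr_ge0.
  have [| |//] := ltgtP (tnorm v) (tnorm w).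
  - by move/(inc _ _ (sqrtr_ge0 _)); rewrite C ltxx.
  - by move/(inc _ _ (sqrtr_ge0 _)); rewrite C ltxx.
move: E; rewrite tvw => /addrI /(scalerI _); apply.
by rewrite gt_eqF// sinhc_gt0.
Qed.

Lemma Tf_Sf (k : R) : Tf k 1 * (1 + Cf k 1) = Sf k 1 ^+ 2.
Proof.
have [->|k0] := eqVneq k 0.
  by rewrite /Tf /Cf /Sf eqxx mul0r coshR0; field.
have k20 : k ^+ 2 != 0 by rewrite expf_eq0 (negbTE k0) andbF.
apply: (mulfI k20); rewrite mulrA Tf_Cf.
have := Cf_sqr k 1 => /eqP; rewrite addrC -subr_eq => /eqP <-; ring.
Qed.

(** The product <V, g'> is a constant k, so V' = k g and V is a primitive of a known curve. The
    identity T (1 + C) = S^2 eliminates the initial velocity; the formula depends on the end points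
    only, whence uniqueness of the transported vector in [PTE]. *)
Lemma parallel_transportE (g V : R -> 'rV[R]_d.+1) : geodesic g -> covariantly_constant g V ->
  V 1 = V 0 + (lorentz (V 0) (g 1) / (1 - lorentz (g 0) (g 1))) *: (g 0 + g 1).
Proof.
move=> Gg cV; have := geodesicE Gg; cbv zeta.
set mu := g 0; set v := g^`()%classic 0 => -[Hm Tv gE].
have {gE} gE : g = geodesic_from mu v by apply/funext => t; exact: gE.
have TV t : lorentz (g t) (V t) = 0 by have [] := cV t.
have dV (t : R) : is_derive t 1 V (V^`()%classic t).
  by apply: is_derive_derive1; have [] := cV t.
have nV t w : tangent (g t) w -> lorentz (V^`()%classic t) w = 0.
  by have [_ _] := cV t; exact.
have Hg t : hyperboloid (g t) by have [+ _ _] := Gg.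
pose g' t := (tnorm v ^+ 2 * Sf (tnorm v) t) *: mu + Cf (tnorm v) t *: v.
have dg (t : R) : is_derive t 1 g (g' t) by rewrite gE; exact: is_derive_geodesic_from.
have V'E t : V^`()%classic t = lorentz (V t) (g' t) *: g t.
  rewrite {1}(normal_multiple (Hg t) (nV t)); congr (_ *: _).
  have := is_derive_lorentz (dV t) (dg t).
  have -> : (fun s => lorentz (V s) (g s)) = cst 0.
    by apply/funext => s /=; rewrite lorentzC TV.
  by move=> [_]; rewrite derive_cst => /esym/eqP; rewrite addr_eq0 => /eqP ->; rewrite opprK.
pose k := lorentz (V 0) v.
have g'0 : g' 0 = v by rewrite /g' Cf0 Sf0 mulr0 scale1r scale0r add0r.
have dg' (t : R) : is_derive t 1 g' (tnorm v ^+ 2 *: g t).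
  have H := @is_deriveZ R _ _ _ (tnorm v ^+ 2) t 1 _ (is_derive_Sf (tnorm v) t).
  have := is_deriveD (is_derive_scale_cst mu H)
     (is_derive_scale_cst v (is_derive_Cf (tnorm v) t)).
  move/is_derive_eq; apply.
  have -> : tnorm v ^+ 2 *: Cf (tnorm v) t = tnorm v ^+ 2 * Cf (tnorm v) t by [].
  by rewrite gE /geodesic_from scalerDr !scalerA.
have gg' t : lorentz (g t) (g' t) = 0.
  have := geodesic_from_geodesic Hm Tv => -[_ _ cc]; have [Tg' _ _] := cc t.
  by move: Tg'; rewrite derive1_geodesic_from gE.
have kE t : lorentz (V t) (g' t) = k.
  rewrite /k -g'0.
  apply: (@is_derive_0_is_cst R (fun t => lorentz (V t) (g' t))) => s.
  have := is_derive_lorentz (dV s) (dg' s).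
  move/is_derive_eq; apply.
  by rewrite V'E lorentzZl gg' mulr0 lorentzZr (lorentzC (V s)) TV mulr0 addr0.
have VE : V 1 = V 0 + k *: (Sf (tnorm v) 1 *: mu + Tf (tnorm v) 1 *: v).
  apply/rowP => j; rewrite !mxE.
  pose F (t : R) := V t 0 j - k * (mu 0 j * Sf (tnorm v) t + v 0 j * Tf (tnorm v) t).
  have : F 1 = F 0.
    apply: (@is_derive_0_is_cst R F) => s.
    have /is_derive_rowP/(_ j) := dV s; rewrite V'E kE mxE gE !mxE => H1.
    have H2 := @is_deriveZ R _ _ _ (mu 0 j) s 1 _ (is_derive_Sf (tnorm v) s).
    have H3 := @is_deriveZ R _ _ _ (v 0 j) s 1 _ (is_derive_Tf (tnorm v) s).
    have H4 := @is_deriveZ R _ _ _ k s 1 _ (is_deriveD H2 H3).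
    have := is_deriveB H1 H4; move/is_derive_eq; apply.
    by rewrite /GRing.scale/=; ring.
  by rewrite /F Sf0 Tf0 => /eqP; rewrite subr_eq => /eqP ->; ring.
have g1 : g 1 = Cf (tnorm v) 1 *: mu + Sf (tnorm v) 1 *: v by rewrite gE.
have TV0 : lorentz (V 0) mu = 0 by rewrite lorentzC; exact: TV.
rewrite VE; congr (_ + _).
rewrite g1 !(lorentzDr, lorentzZr) TV0 Tv (hyperboloid_norm Hm) -/k.
set C := Cf _ 1; set S := Sf _ 1; set T := Tf _ 1.
have TE : T * (1 + C) = S ^+ 2 by exact: Tf_Sf.
have C0 : 0 < 1 + C by rewrite addr_gt0// coshR_gt0.
have -> : T = S ^+ 2 / (1 + C) by rewrite -TE mulfK// gt_eqF.
apply/rowP => j; rewrite !mxE; field.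
by rewrite ?mulrN1 ?opprK ?gt_eqF.
Qed.

Lemma PTE x y (z : 'rV[R]_d.+1) : hyperboloid x -> hyperboloid y -> tangent x z ->
  PT x y z = z + (lorentz z y / (1 - lorentz x y)) *: (x + y).
Proof.
move=> Hx Hy Tz; have [v [Tv vE]] := exists_log Hx Hy.
pose g := geodesic_from x v.
have g0 : g 0 = x by exact: geodesic_from0.
have g1 : g 1 = y by rewrite -vE -Cf1 -Sf1.
have Gg : geodesic g by exact: geodesic_from_geodesic.
have uniq : is_subset1 [set w | exists g V, [/\ geodesic g, g 0 = x, g 1 = y,
    covariantly_constant g V & V 0 = z /\ V 1 = w]].
  move=> w w' [h [V [Gh h0 h1 cV [V0 <-]]]] [h' [V' [Gh' h0' h1' cV' [V0' <-]]]].
  rewrite (parallel_transportE Gh cV) (parallel_transportE Gh' cV').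
  by rewrite h0 h1 V0 h0' h1' V0'.
pose k := lorentz z v.
pose V (t : R) := z + (k *: (Sf (tnorm v) t *: x + Tf (tnorm v) t *: v)).
have dV (t : R) : is_derive t 1 V (k *: g t).
  have H2 := is_derive_scale_cst x (is_derive_Sf (tnorm v) t).
  have H3 := is_derive_scale_cst v (is_derive_Tf (tnorm v) t).
  have H4 := @is_deriveZ R _ _ _ k t 1 _ (is_deriveD H2 H3).
  have := is_deriveD (is_derive_cst z t 1) H4; move/is_derive_eq; apply.
  by rewrite add0r.
have cV : covariantly_constant g V.
  move=> t; split.
  - rewrite /tangent/= /V /g /geodesic_from.
    rewrite !(lorentzDl, lorentzDr, lorentzZl, lorentzZr).
    rewrite Tz (hyperboloid_norm Hx) Tv (lorentzC v z) (lorentzC v x) Tv -/k.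
    rewrite -(sqr_tnorm Hx Tv).
    have TC := Tf_Cf (tnorm v) t.
    transitivity (k * Sf (tnorm v) t * (1 - Cf (tnorm v) t + tnorm v ^+ 2 * Tf (tnorm v) t)).
      by ring.
    by rewrite TC; ring.
  - by have [] := dV t.
  - move=> w Tw; rewrite derive1E; have [_ ->] := dV t.
    by rewrite lorentzZl Tw mulr0.
have V0 : V 0 = z by rewrite /V Sf0 Tf0 !scale0r addr0 scaler0 addr0.
apply: xget_subset1 => //; exists g, V; split=> //; split=> //.
by rewrite (parallel_transportE Gg cV) V0 g0 g1.
Qed.

End Geometry.

(** * Boosts and the exponential chart at a point *)

Section Boost.
Variables (R : realType) (d : nat).
Implicit Types x y v mu : 'rV[R]_d.+1.
Implicit Types u z : 'rV[R]_d.

Lemma originE : origin = row_cons 1 0 :> 'rV[R]_d.+1.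
Proof. by []. Qed.

Lemma of_coordE z : of_coord z = row_cons 0 z.
Proof. by rewrite /row_cons raddf0. Qed.

Lemma origin_hyperboloid : hyperboloid (origin : 'rV[R]_d.+1).
Proof.
split; last by rewrite originE row_cons0.
by rewrite originE lorentz_cons /dot big1 ?mulr1 ?sub0r// => i _; rewrite mxE mul0r.
Qed.

Lemma tangent_of_coord z : tangent origin (of_coord z).
Proof.
rewrite /tangent/= of_coordE originE lorentz_cons mulr0 subr0.
by rewrite /dot big1// => i _; rewrite mxE mul0r.
Qed.

Lemma lorentz_of_coord z u : lorentz (of_coord z) (of_coord u) = dot z u.
Proof. by rewrite !of_coordE lorentz_cons mulr0 subr0. Qed.

Lemma tnorm_of_coord z : tnorm (of_coord z) = enorm z.
Proof. by rewrite /tnorm lorentz_of_coord. Qed.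

(* The Lorentz transformation that fixes the orthogonal complement of origin
   and mu, and sends origin to mu; on the tangent space at origin it is the
   parallel transport to mu. *)
Definition boost mu : 'M[R]_d.+1 :=
  col_mx (mu : 'rV[R]_(1 + d)) (row_mx (0 : 'cV[R]_d) 1%:M +
    (1 + mu 0 0)^-1 *: ((row_behead mu)^T *m (origin + mu))).

Lemma boost_cons mu a u : row_cons a u *m boost mu =
  a *: mu + of_coord u + (dot u (row_behead mu) / (1 + mu 0 0)) *: (origin + mu).
Proof.
rewrite /row_cons /boost; apply: etrans (@mul_row_col _ 1 1 d d.+1 _ _ _ _) _.
rewrite mul_scalar_mx -addrA; congr (_ + _).
rewrite mulmxDr; congr (_ + _).
  by apply: (etrans (@mul_mx_row R 1 d 1 d u 0 1%:M)); rewrite mulmx0 mulmx1.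
rewrite -scalemxAr mulmxA (mx11_scalar (u *m _)) mul_scalar_mx scalerA -dotE mulrC.
by [].
Qed.

Let boost_row_cons_aux a u (m : R) w : row_cons a u *m boost (row_cons m w) =
  row_cons (a * m + dot u w / (1 + m) * (1 + m)) (a *: w + u + (dot u w / (1 + m)) *: w).
Proof.
rewrite boost_cons row_behead_cons row_cons0 of_coordE originE.
by rewrite row_consDl !row_consZ !row_consDl addr0 add0r.
Qed.

Lemma boost_row_cons mu a u : row_cons a u *m boost mu =
  row_cons (a * mu 0 0 + dot u (row_behead mu) / (1 + mu 0 0) * (1 + mu 0 0))
    (a *: row_behead mu + u + (dot u (row_behead mu) / (1 + mu 0 0)) *: row_behead mu).
Proof. by rewrite -boost_row_cons_aux row_consK. Qed.

Lemma boost_coord mu z : hyperboloid mu ->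
  of_coord z *m boost mu = PT origin mu (of_coord z).
Proof.
move=> Hm; rewrite (PTE origin_hyperboloid Hm (tangent_of_coord z)).
rewrite {1}of_coordE boost_cons scale0r add0r; congr (_ + _ *: _).
rewrite !lorentzE of_coordE originE row_behead_cons !row_cons0.
rewrite row_behead_cons mul0r subr0 mul1r.
by rewrite (_ : dot 0 _ = 0) ?sub0r ?opprK// /dot big1// => i _; rewrite mxE mul0r.
Qed.

Lemma lorentz_origin x : lorentz origin x = - x 0 0.
Proof.
rewrite lorentzE originE row_behead_cons row_cons0 mul1r.
by rewrite (_ : dot 0 _ = 0) ?sub0r// /dot big1// => i _; rewrite mxE mul0r.
Qed.

Lemma boost_lorentz mu x y : hyperboloid mu ->
  lorentz (x *m boost mu) (y *m boost mu) = lorentz x y.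
Proof.
move=> Hm; have m0 := hyperboloid_neq Hm.
rewrite -(row_consK x) -(row_consK y) !boost_cons.
set a := x 0 0; set b := y 0 0; set u := row_behead x; set w := row_behead y.
have Dm z : lorentz (of_coord z) mu = dot z (row_behead mu).
  by rewrite lorentzE of_coordE row_behead_cons row_cons0 mul0r subr0.
have Do z : lorentz (of_coord z) origin = 0.
  by rewrite lorentzC; exact: tangent_of_coord.
have oo : lorentz (origin : 'rV[R]_d.+1) origin = -1 by exact: hyperboloid_norm origin_hyperboloid.
rewrite !(lorentzDl, lorentzDr, lorentzZl, lorentzZr) (lorentzC mu origin).
rewrite (lorentzC mu (of_coord _)) (lorentzC origin (of_coord _)).
rewrite (lorentzC (of_coord u) (of_coord w)) !Dm !Do oo (hyperboloid_norm Hm).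
rewrite lorentz_origin lorentz_of_coord lorentz_cons (dotC w u).
by field; rewrite gt_eqF// addr_gt0.
Qed.

Lemma boost_origin mu : origin *m boost mu = mu.
Proof.
rewrite originE boost_cons scale1r of_coordE.
rewrite (_ : dot 0 _ = 0) ?mul0r ?scale0r ?addr0; last first.
  by rewrite /dot big1// => i _; rewrite mxE mul0r.
rewrite (_ : row_cons 0 0 = 0) ?addr0//; apply/rowP => i.
by case: (unliftP ord0 i) => [j|] ->; rewrite ?row_consS ?row_cons0 !mxE.
Qed.

Lemma dot_cons a b u z : dot (row_cons a u) (row_cons b z) = a * b + dot u z.
Proof.
rewrite /dot big_ord_recl !row_cons0; congr (_ + _).
by apply: eq_bigr => j _; rewrite !row_consS.
Qed.

Let J : 'M[R]_d.+1 := block_mx ((-1)%:M : 'M[R]_1) 0 0 1%:M : 'M[R]_(1 + d).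

Let lorentzJ x y : lorentz x y = (x *m J *m y^T) 0 0.
Proof.
rewrite -dotE -{2}(row_consK x) -{2}(row_consK y) row_cons_mulmx dot_cons lorentzE.
by rewrite mulmx0 mulmx1 mxE scaler0 add0r; ring.
Qed.

(** Preserving the form means B J B^T = J for its Gram matrix J, so the square of the determinant is
    1. *)
Lemma boost_det mu : hyperboloid mu -> `|\det (boost mu)| = 1.
Proof.
move=> Hm; have dM (M : 'M[R]_d.+1) i j :
    ((delta_mx 0 i : 'rV[R]_d.+1) *m M *m (delta_mx 0 j : 'rV[R]_d.+1)^T) 0 0 = M i j.
  by rewrite -rowE trmx_delta -colE !mxE.
have E : boost mu *m J *m (boost mu)^T = J.
  apply/matrixP => i j; rewrite -[LHS]dM -[RHS]dM.
  have := boost_lorentz (delta_mx 0 i) (delta_mx 0 j) Hm.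
  by rewrite !lorentzJ trmx_mul !mulmxA.
have dJ : \det J = -1.
  by apply: (etrans (@det_ublock R 1 d _ _ _)); rewrite det1 mulr1 det_scalar1.
have := congr1 determinant E; rewrite !det_mulmx det_tr dJ => H.
have {}H : \det (boost mu) ^+ 2 = 1.
  by rewrite expr2; move: H; rewrite mulrN1 mulNr => /oppr_inj.
apply/eqP; rewrite -(@pexpr_eq1 _ _ 2)//.
by rewrite real_normK ?num_real// H.
Qed.

Lemma boost_unit mu : hyperboloid mu -> boost mu \in unitmx.
Proof.
by move=> Hm; rewrite unitmxE unitfE -normr_eq0 (boost_det Hm) oner_eq0.
Qed.

Lemma boost_time mu x : hyperboloid mu -> lorentz x x < 0 ->
  (0 < (x *m boost mu) 0 0) = (0 < x 0 0).
Proof.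
move=> Hm; rewrite -(row_consK x); set a := x 0 0; set u := row_behead x.
have m0 := hyperboloid_neq Hm.
have pos (b : R) z : lorentz (row_cons b z) (row_cons b z) < 0 -> 0 < b ->
    0 < (row_cons b z *m boost mu) 0 0.
  move=> L b0; rewrite boost_row_cons row_cons0.
  rewrite divfK; last by rewrite gt_eqF// addr_gt0.
  have : `|dot z (row_behead mu)| < b * mu 0 0.
    rewrite -(@ltr_pXn2r _ 2) ?nnegrE ?normr_ge0 ?mulr_ge0 ?(ltW b0) ?(ltW m0)//.
    rewrite real_normK ?num_real//; apply: le_lt_trans (dot_sqr_le _ _) _.
    rewrite (hyperboloid_dot Hm) exprMn; move: L; rewrite lorentz_cons subr_lt0 -expr2 => L.
    apply: (@le_lt_trans _ _ (b ^+ 2 * (mu 0 0 ^+ 2 - 1))).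
      by rewrite ler_wpM2r ?(ltW L)// subr_ge0 exprn_ege1// hyperboloid_ge1.
    by rewrite ltr_pM2l ?exprn_gt0// gtrBl.
  by rewrite ltr_norml => /andP[H _]; rewrite -ltrBlDl sub0r.
rewrite row_cons0 => L; have [a0|a0|a0] := ltgtP 0 a; first exact: pos.
- apply/negbTE; rewrite -leNgt ltW//.
  have N : row_cons (- a) (- u) = - row_cons a u.
    by rewrite -[RHS]scaleN1r row_consZ scaleN1r mulN1r.
  have LN : lorentz (row_cons (- a) (- u)) (row_cons (- a) (- u)) < 0.
    by rewrite N -scaleN1r lorentzZl lorentzZr !mulN1r opprK.
  have := pos _ _ LN; rewrite oppr_gt0 => /(_ a0).
  by rewrite N mulNmx mxE oppr_gt0.
- move: L; rewrite -a0 lorentz_cons mulr0 subr0 => L.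
  by have := lt_le_trans L (dot_ge0 u); rewrite ltxx.
Qed.

(** The closed form of [Exp mu (PT origin mu (of_coord z))]: the exponential chart at the origin,
    carried to mu by the boost. *)
Definition chart mu z : 'rV[R]_d.+1 := hyp_lift (sinhc (enorm z) *: z) *m boost mu.

Lemma hyp_lift_sinhc z :
  hyp_lift (sinhc (enorm z) *: z) = row_cons (coshR (enorm z)) (sinhc (enorm z) *: z).
Proof.
rewrite /hyp_lift dotZl dotZr -sqr_enorm; congr row_cons.
rewrite -[X in X = _](_ : Num.sqrt (coshR (enorm z) ^+ 2) = _); last first.
  by congr Num.sqrt; rewrite sqr_coshR -sinhc_mul; ring.
by rewrite sqrtr_sqr gtr0_norm// coshR_gt0.
Qed.

Lemma boost_tangent mu z : hyperboloid mu -> tangent mu (of_coord z *m boost mu).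
Proof.
move=> Hm; rewrite /tangent/= -{1}(boost_origin mu) boost_lorentz//.
exact: tangent_of_coord.
Qed.

Lemma boost_tnorm mu z : hyperboloid mu -> tnorm (of_coord z *m boost mu) = enorm z.
Proof. by move=> Hm; rewrite /tnorm boost_lorentz// -/(tnorm _) tnorm_of_coord. Qed.

Lemma chart_expand mu z : hyperboloid mu ->
  chart mu z = coshR (enorm z) *: mu + sinhc (enorm z) *: (of_coord z *m boost mu).
Proof.
move=> Hm; rewrite /chart hyp_lift_sinhc.
transitivity ((coshR (enorm z) *: origin + sinhc (enorm z) *: of_coord z) *m boost mu).
  congr (_ *m _); rewrite originE of_coordE !row_consZ row_consDl.
  by rewrite mulr1 mulr0 addr0 scaler0 add0r.
by rewrite mulmxDl -!scalemxAl boost_origin.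
Qed.

Lemma chartE mu z : hyperboloid mu -> Exp mu (PT origin mu (of_coord z)) = chart mu z.
Proof.
move=> Hm; rewrite -boost_coord// ExpE//; last exact: boost_tangent.
by rewrite boost_tnorm// chart_expand.
Qed.

Lemma hyperboloid_boost mu x : hyperboloid mu -> hyperboloid x ->
  hyperboloid (x *m boost mu).
Proof.
move=> Hm [L x0]; split; first by rewrite boost_lorentz.
by rewrite boost_time// L ltrN10.
Qed.

Lemma hyp_lift_hyperboloid u : hyperboloid (hyp_lift u).
Proof.
have s0 : 0 < 1 + dot u u by rewrite ltr_pwDl ?dot_ge0.
split; last by rewrite row_cons0 sqrtr_gt0.
by rewrite lorentz_cons -expr2 sqr_sqrtr ?(ltW s0)//; ring.
Qed.

Lemma chart_hyperboloid mu z : hyperboloid mu -> hyperboloid (chart mu z).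
Proof. by move=> Hm; apply: hyperboloid_boost => //; exact: hyp_lift_hyperboloid. Qed.

Lemma chart_surj mu x : hyperboloid mu -> hyperboloid x -> exists z, x = chart mu z.
Proof.
move=> Hm Hx; have [v [Tv <-]] := exists_log Hm Hx.
pose w := v *m invmx (boost mu).
have vw : v = w *m boost mu by rewrite mulmxKV// boost_unit.
have w0 : w 0 0 = 0.
  apply: oppr_inj; rewrite -lorentz_origin oppr0 -(boost_lorentz _ _ Hm).
  by rewrite boost_origin -vw.
exists (row_behead w); rewrite chart_expand//.
have -> : of_coord (row_behead w) = w by rewrite of_coordE -[in LHS]w0 row_consK.
rewrite -vw; have <- : tnorm v = enorm (row_behead w) => //.
by rewrite vw -(boost_tnorm (row_behead w) Hm) of_coordE -[in RHS]w0 row_consK.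
Qed.

Lemma of_coord_inj z u mu : hyperboloid mu ->
  of_coord z *m boost mu = of_coord u *m boost mu -> z = u.
Proof.
move=> Hm /(congr1 (fun v => v *m invmx (boost mu))).
rewrite !mulmxK ?boost_unit// !of_coordE => /(congr1 (@row_behead R d)).
by rewrite !row_behead_cons.
Qed.

Lemma Tcoord_chart mu z : hyperboloid mu -> Tcoord mu (chart mu z) = z.
Proof.
move=> Hm.
have LogE : Log mu (chart mu z) = of_coord z *m boost mu.
  apply: xget_subset1.
    by split; [exact: boost_tangent|rewrite boost_coord// chartE].
  move=> v w [Tv Ev] [Tw Ew]; apply: (exp_inj Hm Tv Tw).
  by rewrite -!ExpE// Ev Ew.
rewrite /Tcoord LogE; apply: xget_subset1; first by rewrite /= -boost_coord.
by move=> u w /=; rewrite -!boost_coord// => Eu Ew; apply: (of_coord_inj Hm); rewrite Eu Ew.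
Qed.

(** Outside the hyperboloid no logarithm exists, so [Log] takes the default 0, whose coordinates are
    0. This value makes [Tcoord] an explicit measurable function on the whole ambient space. *)
Lemma Tcoord_out mu x : hyperboloid mu -> ~ hyperboloid x -> Tcoord mu x = 0.
Proof.
move=> Hm Hx.
have LogE : Log mu x = 0.
  apply: xgetPN => v [Tv Ev]; apply: Hx; rewrite -Ev ExpE//.
  by rewrite -Cf1 -Sf1; exact: geodesic_from_hyperboloid.
have z0 : of_coord 0 = 0 :> 'rV[R]_d.+1.
  by rewrite of_coordE -[RHS]row_consK mxE; congr row_cons; apply/rowP => i; rewrite row_beheadE !mxE.
rewrite /Tcoord LogE; apply: xget_subset1.
  by rewrite /= -boost_coord// z0 mul0mx.
by move=> u w /=; rewrite -!boost_coord// => Eu Ew; apply: (of_coord_inj Hm); rewrite Eu Ew.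
Qed.

(** On the hyperboloid, the spatial part of x pulled back by the inverse boost, written without a
    matrix inverse. It is linear in x. *)
Definition spatial mu x : 'rV[R]_d :=
  row_behead x - ((x 0 0 - lorentz mu x) / (1 + mu 0 0)) *: row_behead mu.

Lemma chart_lorentz mu z : hyperboloid mu -> lorentz mu (chart mu z) = - coshR (enorm z).
Proof.
move=> Hm; rewrite chart_expand// lorentzDr !lorentzZr (hyperboloid_norm Hm).
by rewrite boost_tangent// mulr0 addr0 mulrN1.
Qed.

Lemma chart_spatial mu z : hyperboloid mu ->
  spatial mu (chart mu z) = sinhc (enorm z) *: z.
Proof.
move=> Hm; have m0 : 0 < 1 + mu 0 0 by rewrite addr_gt0// hyperboloid_neq.
rewrite /spatial chart_lorentz// /chart hyp_lift_sinhc boost_row_cons row_behead_cons row_cons0.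
set a := coshR _; set y := _ *: z.
apply/rowP => j; rewrite !mxE.
by field; rewrite gt_eqF.
Qed.

End Boost.

(** * Gaussian laws and the density of the wrapped normal law *)

Section Laws.
Variable R : realType.
Local Open Scope ereal_scope.

Lemma ge0_integral_law d1 d2 (T1 : measurableType d1) (T2 : measurableType d2)
    (P : probability T1 R) (y0 : T2) (f : T1 -> T2) (F : T2 -> \bar R) :
  measurable_fun setT f -> measurable_fun setT F -> (forall y, 0 <= F y) ->
  \int[law P y0 f]_y F y = \int[P]_x F (f x).
Proof.
move=> mf mF F0; rewrite /law; case: pselect => [mf'|//].
by rewrite ge0_integral_distribution.
Qed.

Lemma integral_prodprobS d1 (T : measurableType d1) (P : probability T R) n
    (F : n.+1.-tuple T -> \bar R) :
  measurable_fun setT F -> (forall t, 0 <= F t) ->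
  \int[prodprob P n.+1]_t F t =
  \int[P]_x \int[prodprob P n]_t F [tuple of x :: t].
Proof.
move=> mF F0; rewrite /= ge0_integral_distribution//.
rewrite fubini_tonelli1//=.
- apply: (measurableT_comp mF).
  exact: measurable_cons measurable_fst measurable_snd.
Qed.

Lemma integral_prodprob0 d1 (T : measurableType d1) (P : probability T R)
    (F : 0.-tuple T -> \bar R) :
  measurable_fun setT F -> \int[prodprob P 0]_t F t = F [tuple].
Proof. by move=> mF; rewrite /= integral_dirac//= diracT mul1e. Qed.

Lemma measurable_cons_tuple d1 (T : measurableType d1) n (x : T) :
  measurable_fun setT (fun t : n.-tuple T => [tuple of x :: t]).
Proof. by apply: measurable_cons => //; exact: measurable_cst. Qed.

Definition tuple_row k (G : k.-tuple (measurableTypeR R)) : 'rV[R]_k :=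
  (\row_i (tnth G i : R))%R.

Lemma measurable_tuple_row k : measurable_fun setT (@tuple_row k).
Proof.
apply: measurable_row => j; rewrite /tuple_row; under eq_fun do rewrite mxE.
exact: measurable_tnth.
Qed.

Lemma tuple_row_cons k x (G : k.-tuple (measurableTypeR R)) :
  tuple_row [tuple of x :: G] = row_cons (x : R) (tuple_row G).
Proof.
apply/rowP => i; rewrite mxE; case: (unliftP ord0 i) => [j|] ->.
  by rewrite row_consS mxE tnthS.
by rewrite row_cons0 tnth0.
Qed.

Lemma ge0_integral_normal_prob (f : R -> \bar R) :
  measurable_fun setT f -> (forall x, 0 <= f x) ->
  \int[normal_prob 0 1]_x f x = \int[@lebesgue_measure R]_x (f x * (normal_pdf 0 1 x)%:E).
Proof.
move=> mf f0.
pose Phi : {mfun measurableTypeR R >-> measurableTypeR R} :=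
  HB.pack_for {mfun measurableTypeR R >-> measurableTypeR R} (fun x : R => x)
    (isMeasurableFun.Build _ _ (measurableTypeR R) (measurableTypeR R) (fun x : R => x) (@measurable_id _ _ setT)).
by rewrite (@ge0_integral_transfer _ _ _ _ R (@lebesgue_measure R) Phi (normal_pdf 0 1)
  (measurable_normal_pdf 0 1) (normal_pdf_ge0 0 1) (normal_prob 0 1)).
Qed.

Definition gauss_pdf k (v : 'rV[R]_k) : R :=
  (normal_peak 1 ^+ k * expR (- (2^-1 * dot v v)))%R.

Lemma gauss_pdf_ge0 k (v : 'rV[R]_k) : (0 <= gauss_pdf v)%R.
Proof. by rewrite mulr_ge0 ?exprn_ge0 ?normal_peak_ge0 ?expR_ge0. Qed.

Lemma measurable_gauss_pdf d (T : measurableType d) k (f : T -> 'rV[R]_k) :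
  measurable_fun setT f -> measurable_fun setT (fun x => gauss_pdf (f x)).
Proof. by move=> mf; rewrite /gauss_pdf; meas. Qed.

Lemma normal_pdf01 (x : R) : normal_pdf 0 1 x = (normal_peak 1 * expR (- (2^-1 * x ^+ 2)))%R.
Proof.
rewrite normal_pdfE ?oner_neq0// /normal_fun subr0 expr1n; congr (_ * expR _)%R.
by rewrite mulNr mulrC.
Qed.

Lemma gauss_pdf_cons k x (v : 'rV[R]_k) :
  gauss_pdf (row_cons x v) = (normal_pdf 0 1 x * gauss_pdf v)%R.
Proof.
rewrite /gauss_pdf dot_cons normal_pdf01 exprS mulrDr opprD expRD expr2; ring.
Qed.

Lemma integral_gauss k (F : 'rV[R]_k -> \bar R) :
  measurable_fun setT F -> (forall v, 0 <= F v) ->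
  \int[prodprob (normal_prob 0 1) k]_G F (tuple_row G) =
  \int[leb R k]_v (F v * (gauss_pdf v)%:E).
Proof.
elim: k F => [|k IH] F mF F0.
  rewrite integral_prodprob0; last exact: (measurableT_comp mF (@measurable_tuple_row 0)).
  rewrite integral_row_measure0; last first.
    by apply: emeasurable_funM => //; apply/measurable_EFinP/measurable_gauss_pdf; meas.
  rewrite /gauss_pdf /dot big_ord0 mulr0 oppr0 expR0 expr0 mulr1 mule1.
  by congr F; apply/rowP; case.
have mFg : measurable_fun setT (fun v => F v * (gauss_pdf v)%:E).
  by apply: emeasurable_funM => //; apply/measurable_EFinP/measurable_gauss_pdf; meas.
have Fg0 v : 0 <= F v * (gauss_pdf v)%:E by rewrite mule_ge0// lee_fin gauss_pdf_ge0.
rewrite integral_prodprobS//; last exact: (measurableT_comp mF (@measurable_tuple_row k.+1)).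
rewrite integral_lebS//.
transitivity (\int[normal_prob 0 1]_x \int[leb R k]_v (F (row_cons x v) * (gauss_pdf v)%:E)).
  apply: eq_integral => x _; rewrite -IH//; last first.
    by apply: (measurableT_comp mF); meas.
  by apply: eq_integral => G _; rewrite tuple_row_cons.
have mI : measurable_fun [set: R] (fun x => \int[leb R k]_v (F (row_cons x v) * (gauss_pdf v)%:E)).
  have := @measurable_integral_row_cons R (@lebesgue_measure R) k
    (fun w => F w * (gauss_pdf (row_behead w))%:E).
  under [X in _ -> _ -> measurable_fun _ X]eq_fun do
    under eq_integral do rewrite row_behead_cons.
  apply.
  - apply: emeasurable_funM => //; apply/measurable_EFinP/measurable_gauss_pdf.
    exact: measurable_row_behead.
  - by move=> w; rewrite mule_ge0// lee_fin gauss_pdf_ge0.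
rewrite ge0_integral_normal_prob//; last first.
  by move=> x; apply: integral_ge0 => v _; rewrite mule_ge0// lee_fin gauss_pdf_ge0.
apply: eq_integral => x _; rewrite -ge0_integralZr//.
- by apply: eq_integral => v _; rewrite gauss_pdf_cons EFinM -muleA [X in _ * X]muleC.
- apply: emeasurable_funM; last by apply/measurable_EFinP/measurable_gauss_pdf; meas.
  by apply: (measurableT_comp mF); meas.
- by move=> v _; rewrite mule_ge0// lee_fin gauss_pdf_ge0.
- by rewrite lee_fin normal_pdf_ge0.
Qed.

End Laws.

Section GaussianLaw.
Variable R : realType.

Lemma det_factor_gt0 k (L S : 'M[R]_k) : L *m L^T = S -> S \in unitmx -> 0 < \det S.
Proof.
move=> <-; rewrite unitmxE unitfE det_mulmx det_tr => d0.
by rewrite lt_neqAle eq_sym d0 -expr2 sqr_ge0.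
Qed.

Definition gauss_weight k (S : 'M[R]_k) (v : 'rV[R]_k) : R :=
  normal_peak 1 ^+ k * expR (- (2^-1 * ln (\det S)) - 2^-1 * quad (invmx S) v).

Local Open Scope ereal_scope.

(** The law is built from the factor selected by [xget], which need not be L; the existence of L
    only guarantees that the selected one is a genuine factor. *)
Lemma integral_mnormal_factor k (S L : 'M[R]_k) :
  (L *m L^T = S)%R -> exists2 L0, (L0 *m L0^T = S)%R &
  forall F : 'rV[R]_k -> \bar R, measurable_fun setT F -> (forall v, 0 <= F v) ->
  \int[mnormal S]_v F v = \int[prodprob (normal_prob 0 1) k]_G F (tuple_row G *m L0^T)%R.
Proof.
move=> LS; exists (xget 0%R [set L | (L *m L^T = S)%R]).
  by apply: (@xgetPex _ 0%R [set L | (L *m L^T = S)%R]); exists L.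
move=> F mF F0; rewrite /mnormal ge0_integral_law//.
by apply: measurable_mulmx; exact: measurable_tuple_row.
Qed.

Lemma integral_mnormal_density k (S L : 'M[R]_k) (F : 'rV[R]_k -> \bar R) :
  (L *m L^T = S)%R -> S \in unitmx ->
  measurable_fun setT F -> (forall v, 0 <= F v) ->
  \int[mnormal S]_v F v = \int[leb R k]_v (F v * (gauss_weight S v)%:E).
Proof.
move=> LS Su mF F0; have [L0 LS0 ->//] := integral_mnormal_factor LS.
have dS0 := det_factor_gt0 LS0 Su.
have dS : (\det S = \det L0 ^+ 2)%R by rewrite -LS0 det_mulmx det_tr expr2.
have L0u : L0 \in unitmx.
  by rewrite unitmxE unitfE; apply/eqP => dL; move: dS0; rewrite dS dL expr0n ltxx.
have mFL : measurable_fun setT (fun v : 'rV[R]_k => F (v *m L0^T)%R).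
  by apply: (measurableT_comp mF); apply: measurable_mulmx; exact: measurable_id.
apply: etrans (integral_gauss mFL (fun v => F0 _)) _.
rewrite (_ : \int[leb R k]_v _ =
    \int[leb R k]_v (fun w => F w * (gauss_pdf (w *m invmx L0^T))%:E) (v *m L0^T)%R); last first.
  by apply: eq_integral => v _; rewrite mulmxK ?unitmx_tr.
rewrite (@leb_linear R k L0^T (fun w => F w * (gauss_pdf (w *m invmx L0^T))%:E)) ?unitmx_tr//; last first.
- by move=> v; rewrite mule_ge0// lee_fin gauss_pdf_ge0.
- by apply: emeasurable_funM => //; apply/measurable_EFinP/measurable_gauss_pdf; meas.
rewrite -ge0_integralZl//; last first.
- by move=> v _; rewrite mule_ge0// lee_fin gauss_pdf_ge0.
- by apply: emeasurable_funM => //; apply/measurable_EFinP/measurable_gauss_pdf; meas.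
apply: eq_integral => v _; rewrite muleCA -EFinM; congr (_ * _%:E).
rewrite /gauss_weight /gauss_pdf mulrCA expRD; congr (_ * (_ * _))%R.
  have a0 : (0 < `|\det L0|)%R by rewrite normr_gt0 -unitfE -unitmxE.
  rewrite det_tr expRN; congr (_^-1)%R; rewrite dS -real_normK ?num_real//.
  by rewrite lnXn// -[(ln _ *+ 2)%R]mulr_natl mulrA mulVf// mul1r lnK.
congr (expR (- (_ * _)))%R.
rewrite /quad !dotE trmx_mul mulmxA -(mulmxA v) trmx_inv trmxK -LS0.
suff -> : (invmx L0^T *m invmx L0 = invmx (L0 *m L0^T))%R by [].
have L0tu : L0^T \in unitmx by rewrite unitmx_tr.
have Su' : (L0 *m L0^T)%R \in unitmx by rewrite LS0.
apply: (can_inj (mulmxK Su')); rewrite mulVmx//.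
by rewrite -mulmxA (mulmxA (invmx L0)) mulVmx// mul1mx mulVmx.
Qed.


End GaussianLaw.

(** * The density of the wrapped normal law *)

Section HyperbolicDensity.
Variables (R : realType) (d : nat).
Implicit Types (mu x : 'rV[R]_d.+1) (S : 'M[R]_d).

Lemma arcosh_coshR (r : R) : 0 <= r -> arcosh (coshR r) = r.
Proof.
move=> r0; rewrite /arcosh (_ : Num.sqrt _ = sinhR r) .
  by rewrite -expR_coshR_sinhR expRK.
rewrite sqr_coshR addrAC subrr add0r sqrtr_sqr ger0_norm//.
by apply: le_trans (sinhR_ge_half r0); rewrite divr_ge0.
Qed.

Lemma Tcoord_spatial mu x : hyperboloid mu -> hyperboloid x ->
  Tcoord mu x = (sinhc (arcosh (- lorentz mu x)))^-1 *: spatial mu x.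
Proof.
move=> Hm Hx; have [z ->] := chart_surj Hm Hx.
rewrite Tcoord_chart// chart_spatial// chart_lorentz// opprK.
rewrite arcosh_coshR ?enorm_ge0// scalerA mulVf ?scale1r// gt_eqF//.
exact: sinhc_gt0.
Qed.

Lemma measurable_spatial mu : measurable_fun setT (spatial mu).
Proof.
rewrite /spatial; apply: measurable_rowD; first exact: measurable_row_behead.
under eq_fun do rewrite -scaleNr.
apply: measurable_rowZ; last exact: measurable_cst.
apply: measurable_funN; apply: measurable_funM; last exact: measurable_cst.
apply: measurable_funD; first by meas.
by apply: measurable_funN; apply: measurable_lorentz; meas.
Qed.

Lemma measurable_arcosh e (T : measurableType e) (f : T -> R) :
  measurable_fun setT f -> measurable_fun setT (fun z => arcosh (f z)).
Proof. by move=> mf; rewrite /arcosh; meas. Qed.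

Lemma measurable_Tcoord mu : hyperboloid mu -> measurable_fun setT (Tcoord mu).
Proof.
move=> Hm.
rewrite (_ : Tcoord mu = fun x => if (lorentz x x == -1) && (0 < x 0 0) then
  (sinhc (arcosh (- lorentz mu x)))^-1 *: spatial mu x else 0); last first.
  apply/funext => x; case: ifPn => [/andP[/eqP Lx x0]|Nx]; first exact: Tcoord_spatial.
  by apply: Tcoord_out => // -[Lx x0]; move: Nx; rewrite Lx eqxx x0.
apply: measurable_fun_ifT; last exact: measurable_cst.
  apply: measurable_and.
    by apply: measurable_fun_eqr; last exact: measurable_cst; apply: measurable_lorentz; meas.
  by apply: measurable_fun_ltr; meas.
apply: measurable_rowZ; last exact: measurable_spatial.
apply: measurable_inv; apply: measurable_sinhc_comp; apply: measurable_arcosh.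
by apply: measurable_funN; apply: measurable_lorentz; meas.
Qed.

Lemma phi_sinhc (v : 'rV[R]_d) : phi v = ln (sinhc (enorm v)).
Proof.
rewrite /phi /sinhc enorm_eq0; case: ifPn => [_|v0]; first by rewrite ln1.
by [].
Qed.

Lemma measurable_logdens mu S : hyperboloid mu -> measurable_fun setT (logdens mu S).
Proof.
move=> Hm; rewrite /logdens; under eq_fun do rewrite phi_sinhc.
have mT := measurable_Tcoord Hm.
apply: measurable_funD.
  apply: measurable_funD.
    meas.
  meas.
meas.
Qed.

Lemma measurable_chart mu : measurable_fun setT (chart mu).
Proof.
apply: measurable_mulmx; apply: (measurableT_comp (@measurable_hyp_lift R d)).
by meas.
Qed.

Local Open Scope ereal_scope.

Lemma integral_HWN_chart mu S (F : 'rV[R]_d.+1 -> \bar R) : hyperboloid mu ->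
  measurable_fun setT F -> (forall x, 0 <= F x) ->
  \int[HWN mu S]_x F x = \int[mnormal S]_z F (chart mu z).
Proof.
move=> Hm mF F0; rewrite /HWN.
have -> : (fun z : 'rV[R]_d => Exp mu (PT origin mu (of_coord z))) = chart mu.
  by apply/funext => z; rewrite chartE.
by rewrite ge0_integral_law//; exact: measurable_chart.
Qed.

End HyperbolicDensity.

Section HyperbolicDensityS.
Variables (R : realType) (d : nat).
Implicit Types (mu x : 'rV[R]_d.+2) (S : 'M[R]_d.+1).
Local Open Scope ereal_scope.

(** Boost invariance moves the volume to the origin and [radial_substitution] passes to normal
    coordinates. The cosh in its Jacobian cancels 1 / sqrt(1 + |u|^2), and sinhc^d cancels the [phi]
    term of [logdens], leaving the Gaussian density of z. *)
Lemma integral_HWN_density mu S (L : 'M[R]_d.+1) (F : 'rV[R]_d.+2 -> \bar R) :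
  hyperboloid mu -> (L *m L^T = S)%R -> S \in unitmx ->
  measurable_fun setT F -> (forall x, 0 <= F x) ->
  \int[HWN mu S]_x F x =
  (normal_peak 1 ^+ d.+1)%:E * hyp_integral (fun x => F x * (expR (logdens mu S x))%:E).
Proof.
move=> Hm LS Su mF F0; rewrite integral_HWN_chart//.
have mlog := measurable_logdens S Hm.
have mG : measurable_fun setT (fun x => F x * (expR (logdens mu S x))%:E).
  by apply: emeasurable_funM => //; apply/measurable_EFinP; exact: measurableT_comp.
have G0 x : 0 <= F x * (expR (logdens mu S x))%:E by rewrite mule_ge0// lee_fin expR_ge0.
rewrite (integral_mnormal_density LS)//; last first.
  by apply: (measurableT_comp mF); exact: measurable_chart.
rewrite -(@hyp_integral_invariant R d.+1 (boost mu))//; last first.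
- exact: boost_det.
- by move=> x; exact: boost_time.
- by move=> x y; exact: boost_lorentz.
pose f u := F (hyp_lift u *m boost mu)%R * (expR (logdens mu S (hyp_lift u *m boost mu)))%:E
  * (Num.sqrt (1 + dot u u))^-1%:E.
have mf : measurable_fun setT f.
  apply: emeasurable_funM; last by meas.
  by apply: (measurableT_comp mG); apply: measurable_mulmx; exact: measurable_hyp_lift.
have f0 u : 0 <= f u by rewrite mule_ge0// lee_fin invr_ge0 sqrtr_ge0.
have -> : hyp_integral (fun x => F (x *m boost mu)%R * (expR (logdens mu S (x *m boost mu)))%:E) =
    \int[leb R d.+1]_z (f (sinhc (enorm z) *: z)%R *
      (sinhc (enorm z) ^+ d * coshR (enorm z))%:E) by rewrite radial_substitution.
rewrite -ge0_integralZl//; last first.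
- by rewrite lee_fin exprn_ge0// normal_peak_ge0.
- move=> z _; rewrite mule_ge0// lee_fin mulr_ge0//; last exact: ltW (coshR_gt0 _).
  by rewrite exprn_ge0// ltW// sinhc_gt0.
- apply: emeasurable_funM; last by meas.
  by apply: (measurableT_comp mf); meas.
apply: eq_integral => z _; rewrite /f -/(chart mu z).
rewrite /logdens Tcoord_chart// phi_sinhc dotZl dotZr -sqr_enorm.
rewrite [X in Num.sqrt X](_ : _ = coshR (enorm z) ^+ 2)%R; last first.
  by rewrite sqr_coshR -sinhc_mul exprMn mulrA expr2.
rewrite sqrtr_sqr gtr0_norm ?coshR_gt0// -!muleA [RHS]muleCA; congr (_ * _).
rewrite -!EFinM; congr EFin; rewrite /gauss_weight [in RHS]expRD !expRD.
have c0 := coshR_gt0 (enorm z).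
have s0 := sinhc_gt0 (enorm z).
have -> : (expR (- ((d.+1%:R - 1) * ln (sinhc (enorm z)))) = sinhc (enorm z) ^- d)%R.
  by rewrite expRN -natr1 addrK mulr_natl -lnXn ?lnK ?posrE ?exprn_gt0//.
have sd : (sinhc (enorm z) ^+ d != 0)%R by rewrite expf_neq0// gt_eqF.
by field; rewrite sd gt_eqF.
Qed.


(** The normalizing constant and the volume are common to all the laws. From here on, the volume is
    no longer used: only likelihood ratios are. *)
Lemma HWN_change_of_law mu mu' S S' (L L' : 'M[R]_d.+1) (F : 'rV[R]_d.+2 -> \bar R) :
  hyperboloid mu -> (L *m L^T = S)%R -> S \in unitmx ->
  hyperboloid mu' -> (L' *m L'^T = S')%R -> S' \in unitmx ->
  measurable_fun setT F -> (forall x, 0 <= F x) ->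
  \int[HWN mu' S']_x F x =
  \int[HWN mu S]_x (F x * (expR (logdens mu' S' x - logdens mu S x))%:E).
Proof.
move=> Hm LS Su Hm' LS' Su' mF F0.
have mD : measurable_fun setT (fun x => expR (logdens mu' S' x - logdens mu S x)).
  by apply: measurable_expR_comp; apply: measurable_funB; exact: measurable_logdens.
rewrite (integral_HWN_density Hm LS)//; last 2 first.
- by apply: emeasurable_funM => //; apply/measurable_EFinP.
- by move=> x; rewrite mule_ge0// lee_fin expR_ge0.
have G : (fun x => F x * (expR (logdens mu' S' x))%:E) =
    (fun x => F x * (expR (logdens mu' S' x - logdens mu S x))%:E * (expR (logdens mu S x))%:E).
  by apply/funext => x; rewrite -muleA -EFinM -expRD subrK.
have H := congr1 (fun f => (normal_peak 1 ^+ d.+1)%:E * hyp_integral f) G.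
exact: (etrans (integral_HWN_density Hm' LS' Su' mF F0) H).
Qed.

End HyperbolicDensityS.

(** * Matrix exponential and half-vectorization *)

Section ExpSum.
Variable R : realType.
Implicit Types (c e : R^nat) (K M : R).

(** The entries of a matrix exponential, and of each term of its expansion in a perturbation, are
    sums of this form. A bound |c n| <= K M^n gives both convergence and the estimate K exp M. *)
Definition expsum c : R := limn (series (fun n => c n / n`!%:R)).

Definition geom_bounded c K M := [/\ 0 <= K, 0 <= M & forall n, `|c n| <= K * M ^+ n].

Lemma fact_gt0R n : 0 < n`!%:R :> R.
Proof. by rewrite ltr0n fact_gt0. Qed.

Lemma expsum_normed_cvg c K M : geom_bounded c K M ->
  cvgn (series (fun n => `|c n / n`!%:R|)).
Proof.
move=> [K0 M0 cb]; apply: (@series_le_cvg _ _ (fun n => K * exp_coeff M n)) => //.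
- by move=> n; rewrite mulr_ge0// exp_coeff_ge0.
- move=> n; rewrite normrM normfV [X in _ / X]ger0_norm ?ler0n// /exp_coeff/= mulrA.
  by rewrite ler_pM2r ?invr_gt0 ?fact_gt0R.
- exact: is_cvg_seriesZ (is_cvg_series_exp_coeff M).
Qed.

Lemma expsum_cvg c K M : geom_bounded c K M -> cvgn (series (fun n => c n / n`!%:R)).
Proof. by move=> /expsum_normed_cvg; exact: normed_cvg. Qed.

Lemma expsum_le c K M : geom_bounded c K M -> `|expsum c| <= K * expR M.
Proof.
move=> cb; have cv := expsum_normed_cvg cb.
apply: (le_trans (lim_series_norm cv)).
have [K0 M0 cb'] := cb.
have -> : K * expR M = limn (series (K *: exp_coeff M)) :> R.
  by rewrite (lim_seriesZ K (is_cvg_series_exp_coeff M)).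
apply: lim_series_le => //; first exact: is_cvg_seriesZ (is_cvg_series_exp_coeff M).
move=> n /=; rewrite normrM normfV [X in _ / X]ger0_norm ?ler0n//.
rewrite -[leRHS]/(K * (M ^+ n / n`!%:R)) mulrA.
by rewrite ler_pM2r ?invr_gt0 ?fact_gt0R.
Qed.

Lemma expsumD c e K M K' M' : geom_bounded c K M -> geom_bounded e K' M' ->
  expsum (fun n => c n + e n) = expsum c + expsum e.
Proof.
move=> cb eb; rewrite /expsum -lim_seriesD; [|exact: expsum_cvg cb|exact: expsum_cvg eb].
by congr (limn (series _)); apply/funext => n; rewrite /= mulrDl.
Qed.

Lemma expsumZ a c K M : geom_bounded c K M -> expsum (fun n => a * c n) = a * expsum c.
Proof.
move=> cb; rewrite /expsum -[RHS](lim_seriesZ a (expsum_cvg cb)).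
by congr (limn (series _)); apply/funext => n; rewrite /= -mulrA.
Qed.

Lemma geom_bounded0 : geom_bounded (fun=> 0) 0 0.
Proof. by split => // n; rewrite normr0 mul0r. Qed.

Lemma expsum0 : expsum (fun=> 0) = 0.
Proof.
by apply/eqP; rewrite -normr_le0; have := expsum_le geom_bounded0; rewrite mul0r.
Qed.

Lemma geom_boundedD c e K M K' M' : geom_bounded c K M -> geom_bounded e K' M' ->
  geom_bounded (fun n => c n + e n) (K + K') (M + M').
Proof.
move=> [K0 M0 cb] [K0' M0' eb]; split; rewrite ?addr_ge0// => n.
apply: (le_trans (ler_normD _ _)); rewrite mulrDl; apply: lerD.
  by apply: (le_trans (cb n)); rewrite ler_wpM2l// lerXn2r ?nnegrE ?addr_ge0// lerDl.
by apply: (le_trans (eb n)); rewrite ler_wpM2l// lerXn2r ?nnegrE ?addr_ge0// lerDr.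
Qed.

Lemma geom_bounded_sum (I : Type) (r : seq I) (c : I -> R^nat) (K M : I -> R) :
  (forall i, geom_bounded (c i) (K i) (M i)) ->
  geom_bounded (fun n => \sum_(i <- r) c i n) (\sum_(i <- r) K i) (\sum_(i <- r) M i).
Proof.
move=> cb; elim: r => [|i r B].
  by rewrite !big_nil; under eq_fun do rewrite big_nil; exact: geom_bounded0.
by rewrite !big_cons; under eq_fun do rewrite big_cons; exact: geom_boundedD.
Qed.

Lemma expsum_sum (I : Type) (r : seq I) (c : I -> R^nat) (K M : I -> R) :
  (forall i, geom_bounded (c i) (K i) (M i)) ->
  expsum (fun n => \sum_(i <- r) c i n) = \sum_(i <- r) expsum (c i).
Proof.
move=> cb; elim: r => [|i r E].
  by rewrite !big_nil; under eq_fun do rewrite big_nil; exact: expsum0.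
rewrite !big_cons; under eq_fun do rewrite big_cons.
by rewrite (expsumD (cb i) (geom_bounded_sum r cb)) E.
Qed.

Lemma triangle_sum (V : zmodType) (G : nat -> nat -> V) N :
  \sum_(0 <= i < N) \sum_(0 <= j < N - i) G i j =
  \sum_(0 <= m < N) \sum_(0 <= i < m.+1) G i (m - i)%N.
Proof.
elim: N => [|N IH]; first by rewrite !big_nil.
rewrite [RHS]big_nat_recr//= -IH.
transitivity (\sum_(0 <= i < N.+1) (\sum_(0 <= j < N - i) G i j + G i (N - i)%N)).
  by apply: eq_big_nat => i /andP[_ iN]; rewrite subSn// big_nat_recr.
rewrite big_split/=; congr (_ + _); rewrite big_nat_recr//= subnn big_nil addr0//.
Qed.

Let term (s t : R) (F : nat -> R) i j := s ^+ i / i`!%:R * (t ^+ j / j`!%:R) * F (i + j)%N.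

Let square s t F N := \sum_(0 <= i < N) \sum_(0 <= j < N) term s t F i j.

Lemma expsum_triangle (s t : R) (F : nat -> R) N :
  \sum_(0 <= i < N) \sum_(0 <= j < N - i) term s t F i j =
  \sum_(0 <= m < N) (s + t) ^+ m * F m / m`!%:R.
Proof.
rewrite triangle_sum; apply: eq_big_nat => m _.
rewrite addrC exprDn mulr_suml mulr_suml big_mkord; apply: eq_bigr => i _.
have im : (i <= m)%N by rewrite -ltnS.
rewrite /term subnKC// -mulr_natl.
have -> : m`!%:R = 'C(m, i)%:R * i`!%:R * (m - i)`!%:R :> R.
  by rewrite -!natrM -mulnA bin_fact.
have b0 : ('C(m, i)%:R : R) != 0 by rewrite pnatr_eq0 -lt0n bin_gt0.
by field; rewrite b0 !gt_eqF ?fact_gt0R.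
Qed.

(** The terms of the square i, j < N that lie outside the triangle i + j < N are bounded one by one
    by those for the sequence M^m. For that sequence the square is a product of two exponential
    partial sums, and the difference tends to 0. *)
Lemma expsum_square_le (s t : R) F K M N : geom_bounded F K M ->
  `|square s t F N - \sum_(0 <= m < N) (s + t) ^+ m * F m / m`!%:R| <=
  K * (square `|s| `|t| (fun m => M ^+ m) N -
       \sum_(0 <= m < N) (`|s| + `|t|) ^+ m * M ^+ m / m`!%:R).
Proof.
move=> [K0 M0 FK]; rewrite -!expsum_triangle /square -!sumrB mulr_sumr.
apply: (le_trans (ler_norm_sum _ _ _)); apply: ler_sum => i _.
have E (H : nat -> R) : \sum_(0 <= j < N) H j - \sum_(0 <= j < N - i) H j =
    \sum_(N - i <= j < N) H j.
  by rewrite (@big_cat_nat _ _ _ (N - i))//= ?leq_subr// addrAC subrr add0r.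
rewrite !E mulr_sumr; apply: (le_trans (ler_norm_sum _ _ _)); apply: ler_sum => j _.
rewrite /term !normrM !normfV !normrX !(ger0_norm (ler0n _ _)) [leRHS]mulrCA ler_wpM2l//.
Qed.

Lemma square_cvg (s t M : R) :
  square s t (fun m => M ^+ m) N @[N --> \oo] --> expR ((s + t) * M).
Proof.
rewrite mulrDl expRD.
rewrite (_ : square s t _ = fun N => series (exp_coeff (s * M)) N * series (exp_coeff (t * M)) N).
  by apply: cvgM; exact: is_cvg_series_exp_coeff.
apply/funext => N; rewrite /square /series/= mulr_suml; apply: eq_bigr => i _.
rewrite mulr_sumr; apply: eq_bigr => j _; rewrite /term /exp_coeff/= exprD !exprMn; ring.
Qed.

Lemma expsum_squareE (s t : R) F K M : geom_bounded F K M ->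
  square s t F N @[N --> \oo] --> expsum (fun m => (s + t) ^+ m * F m).
Proof.
move=> FK; have [K0 M0 FK'] := FK.
have G : geom_bounded (fun m => (s + t) ^+ m * F m) K (`|s + t| * M).
  split => // [|m]; first exact: mulr_ge0.
  by rewrite normrM normrX exprMn mulrCA ler_wpM2l ?exprn_ge0.
rewrite -[X in _ --> X]addr0 -(_ : series (fun m => (s + t) ^+ m * F m / m`!%:R) \+
  (square s t F \- series (fun m => (s + t) ^+ m * F m / m`!%:R)) = square s t F); last first.
  by apply/funext => N /=; rewrite addrC subrK.
apply: cvgD; first exact: expsum_cvg G.
pose B N := K * (square `|s| `|t| (fun m => M ^+ m) N -
  \sum_(0 <= m < N) (`|s| + `|t|) ^+ m * M ^+ m / m`!%:R).
have B0 : B N @[N --> \oo] --> 0.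
  rewrite -[X in _ --> X](mulr0 K) -[X in _ --> K * X](subrr (expR ((`|s| + `|t|) * M))).
  apply: cvgMr; apply: cvgB; first exact: square_cvg.
  rewrite (_ : (fun _ => _) = series (exp_coeff ((`|s| + `|t|) * M))).
    exact: is_cvg_series_exp_coeff.
  by apply/funext => N; apply: eq_bigr => m _; rewrite /exp_coeff/= exprMn.
apply: (@squeeze_cvgr _ _ _ _ (fun N => - B N) B) => //.
  by apply: nearW => N; rewrite -ler_norml; exact: expsum_square_le.
by rewrite -[X in _ --> X]oppr0; exact: cvgN.
Qed.

End ExpSum.

Section MatrixExp.
Variables (R : realType) (k : nat).
Implicit Types (A B V : 'M[R]_k).

Definition mnorm A : R := \sum_i \sum_j `|A i j|.

Lemma mnorm_ge0 A : 0 <= mnorm A.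
Proof. by apply: sumr_ge0 => i _; exact: sumr_ge0. Qed.

Lemma le_mnorm A i j : `|A i j| <= mnorm A.
Proof.
rewrite /mnorm (bigD1 i)//= (bigD1 j)//= -addrA lerDl addr_ge0//; apply: sumr_ge0 => // l _.
exact: sumr_ge0.
Qed.

Lemma mnormD A B : mnorm (A + B) <= mnorm A + mnorm B.
Proof.
rewrite /mnorm -big_split/=; apply: ler_sum => i _; rewrite -big_split/=.
by apply: ler_sum => j _; rewrite mxE ler_normD.
Qed.

Lemma mnormM A B : mnorm (A *m B) <= mnorm A * mnorm B.
Proof.
rewrite /mnorm mulr_suml; apply: ler_sum => i _.
apply: (@le_trans _ _ (\sum_j \sum_l `|A i l| * `|B l j|)).
  apply: ler_sum => j _; rewrite mxE; apply: (le_trans (ler_norm_sum _ _ _)).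
  by apply: ler_sum => l _; rewrite normrM.
rewrite exchange_big/= mulr_suml; apply: ler_sum => l _; rewrite -mulr_sumr ler_wpM2l//.
by rewrite [leRHS](bigD1 l)//= lerDl; apply: sumr_ge0 => i' _; exact: sumr_ge0.
Qed.

Lemma mnorm1 : mnorm 1%:M = k%:R.
Proof.
rewrite /mnorm (eq_bigr (fun=> 1)) ?sumr_const ?card_ord// => i _.
rewrite (bigD1 i)//= mxE eqxx normr1 big1 ?addr0// => j ij.
by rewrite mxE eq_sym (negbTE ij) normr0.
Qed.

Lemma mnorm_exp A a n : mnorm A <= a -> mnorm (A ^+ n) <= k.+1%:R * a ^+ n.
Proof.
move=> Aa; have a0 := le_trans (mnorm_ge0 A) Aa; elim: n => [|n IH].
  by rewrite expr0 mulr1 mnorm1 ler_nat.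
rewrite exprSr -mulmxE; apply: (le_trans (mnormM _ _)).
by rewrite exprSr mulrA ler_pM ?mnorm_ge0.
Qed.

Lemma geom_mnorm (F : nat -> 'M[R]_k) K M i j : 0 <= K -> 0 <= M ->
  (forall n, mnorm (F n) <= K * M ^+ n) -> geom_bounded (fun n => F n i j) K M.
Proof. by move=> K0 M0 FK; split => // n; exact: le_trans (le_mnorm _ _ _) (FK n). Qed.

Lemma geom_exp A i j : geom_bounded (fun n => (A ^+ n) i j) k.+1%:R (mnorm A).
Proof. by apply: geom_mnorm => // [|n]; [exact: mnorm_ge0 | exact: mnorm_exp]. Qed.

Lemma mexpE A i j : mexp A i j = expsum (fun n => (A ^+ n) i j).
Proof.
suff C : series (fun n => (n`!%:R)^-1 *: A ^+ n) @ \oo -->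
    (\matrix_(i, j) expsum (fun n => (A ^+ n) i j) : 'M[R]_k).
  by rewrite /mexp (cvg_lim _ C)// mxE.
apply/cvg_ballP => e e0.
have H : forall p : 'I_k * 'I_k, \forall n \near \oo,
    ball (expsum (fun n => (A ^+ n) p.1 p.2)) e (series (fun n => (A ^+ n) p.1 p.2 / n`!%:R) n).
  move=> p; have := expsum_cvg (geom_exp A p.1 p.2).
  by move=> /cvg_ballP/(_ _ e0).
have := @filter_forall _ _ _ _ eventually_filter H.
apply: filterS => n Hn; split=> // i' j'; rewrite mxE.
have := Hn (i', j'); rewrite /series/= summxE.
by under eq_bigr do rewrite mulrC; under [in X in _ -> X]eq_bigr do rewrite mxE.
Qed.

(** The group law along one line only, where everything commutes. It suffices for the inverse, with
    opposite parameters, and for a square root, with both parameters 1/2. *)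
Lemma mexp_mul (s t : R) A : mexp (s *: A) *m mexp (t *: A) = mexp ((s + t) *: A).
Proof.
have expZ (r : R) n : (r *: A) ^+ n = r ^+ n *: A ^+ n.
  elim: n => [|n IH]; first by rewrite !expr0 scale1r.
  by rewrite !exprS IH -!mulmxE -scalemxAl -scalemxAr scalerA.
have S r i j N : series (fun n => ((r *: A) ^+ n) i j / n`!%:R) N =
    \sum_(0 <= n < N) r ^+ n / n`!%:R * (A ^+ n) i j.
  by apply: eq_bigr => n _; rewrite expZ mxE mulrAC.
apply/matrixP => i j; rewrite mexpE; under eq_fun do rewrite expZ mxE.
rewrite -(cvg_lim _ (expsum_squareE (s:=s) (t:=t) (geom_exp A i j)))//.
apply/esym/cvg_lim => //.
rewrite mxE.
under eq_bigr do rewrite !mexpE.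
rewrite (_ : (fun N => _) = fun N => \sum_l
   series (fun n => ((s *: A) ^+ n) i l / n`!%:R) N *
   series (fun n => ((t *: A) ^+ n) l j / n`!%:R) N); last first.
  apply/funext => N; under [RHS]eq_bigr do rewrite !S mulr_suml.
  rewrite [RHS]exchange_big/=; apply: eq_bigr => n _.
  under [RHS]eq_bigr do rewrite mulr_sumr.
  rewrite [RHS]exchange_big/=; apply: eq_bigr => m _.
  rewrite exprD -mulmxE mxE mulr_sumr; apply: eq_bigr => l _; ring.
apply: cvg_big => [|l _]; first exact: add_continuous.
apply: cvgM.
  exact: expsum_cvg (geom_exp _ _ _).
exact: expsum_cvg (geom_exp _ _ _).
Qed.

Lemma mexp0 : mexp (0 : 'M[R]_k) = 1%:M.
Proof.
apply/matrixP => i j; rewrite mexpE /expsum; apply: cvg_lim => //.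
rewrite -(cvg_shiftS); apply: cvg_near_cst; apply: nearW => n.
rewrite /series/= big_nat_recl//= expr0 fact0 divr1 big1 ?addr0// => m _.
by rewrite expr0n mxE mul0r.
Qed.

Lemma mexp_inv A : mexp A *m mexp (- A) = 1%:M.
Proof. by rewrite -{1}(scale1r A) -scaleN1r mexp_mul subrr scale0r mexp0. Qed.

Lemma mexp_unit A : mexp A \in unitmx.
Proof. by have [] := mulmx1_unit (mexp_inv A). Qed.

Lemma invmx_mexp A : invmx (mexp A) = mexp (- A).
Proof. by rewrite -[LHS]mulmx1 -(mexp_inv A) mulKmx// mexp_unit. Qed.

Lemma mexp_tr A : (mexp A)^T = mexp A^T.
Proof.
apply/matrixP => i j; rewrite mxE !mexpE; congr expsum; apply/funext => n.
suff -> : (A^T) ^+ n = (A ^+ n)^T by rewrite mxE.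
elim: n => [|n IH]; first by rewrite !expr0 trmx1.
by rewrite exprS IH exprSr -!mulmxE trmx_mul.
Qed.

Lemma mexp_sqrt A : Defs.symmetric A -> mexp (2^-1 *: A) *m (mexp (2^-1 *: A))^T = mexp A.
Proof.
move=> sA; rewrite mexp_tr linearZ/= sA mexp_mul.
by rewrite (_ : 2^-1 + 2^-1 = 1) ?scale1r//; lra.
Qed.

Section Expansion.
Variables (A : 'M[R]_k).

(** A and V need not commute, so (A + V)^n is sorted by the number of factors V in each word, by
    recursion on the last factor: [exp_lin] collects one V, [exp_bil] a V followed by a W, [exp_rem]
    three factors V or more. *)
Fixpoint exp_lin V n : 'M[R]_k :=
  if n is n'.+1 then exp_lin V n' *m A + A ^+ n' *m V else 0.

Fixpoint exp_bil V W n : 'M[R]_k :=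
  if n is n'.+1 then exp_bil V W n' *m A + exp_lin V n' *m W else 0.

Fixpoint exp_rem V n : 'M[R]_k :=
  if n is n'.+1 then exp_rem V n' *m (A + V) + exp_bil V V n' *m V else 0.

Lemma exp_expand V n :
  (A + V) ^+ n = A ^+ n + exp_lin V n + exp_bil V V n + exp_rem V n.
Proof.
elim: n => [|n IH]; first by rewrite !expr0 !addr0.
rewrite exprSr IH -mulmxE /= [X in _ = X + _ + _ + _]exprSr -mulmxE.
have gen (a b c e f g h l : 'M[R]_k) :
    a + b + (c + e) + (f + g) + (h + l) = a + (c + b) + (f + e) + (h + l + g).
  by apply/matrixP => i j; rewrite !mxE; ring.
by rewrite !mulmxDl !mulmxDr gen.
Qed.

(** One unit covers the factor A + V with V of norm at most 1 in [exp_rem]; the other absorbs the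
    additional term of each recursion, so that no factor n appears in the bounds. *)
Let M := mnorm A + 2.

Lemma mnorm_exp_le n : mnorm (A ^+ n) <= k.+1%:R * M ^+ n.
Proof. by apply: mnorm_exp; rewrite lerDl. Qed.

Let M0 : 0 <= M. Proof. by rewrite addr_ge0 ?mnorm_ge0. Qed.

Lemma mnorm_step (X Y Z W : 'M[R]_k) (x y n : R) : 0 <= x -> 0 <= n ->
  mnorm X <= n * x -> mnorm Y <= mnorm A + 1 ->
  mnorm (Z *m W) <= n * x -> mnorm (X *m Y + Z *m W) <= n * M * x.
Proof.
move=> x0 n0 Xx YA Zx; apply: (le_trans (mnormD _ _)).
have : mnorm (X *m Y) <= n * x * (mnorm A + 1).
  by apply: (le_trans (mnormM _ _)); rewrite ler_pM ?mnorm_ge0.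
move=> H; apply: (le_trans (lerD H Zx)).
by rewrite /M le_eqVlt; apply/orP; left; apply/eqP; ring.
Qed.

Let pM (n : nat) : (0 : R) <= k.+1%:R * M ^+ n.
Proof. by rewrite mulr_ge0// exprn_ge0. Qed.

Lemma mnorm_exp_lin V n : mnorm (exp_lin V n) <= k.+1%:R * M ^+ n * mnorm V.
Proof.
elim: n => [|n IH].
  rewrite /= (_ : mnorm 0 = 0) ?mulr_ge0 ?mnorm_ge0//.
  by rewrite /mnorm big1// => i _; rewrite big1// => j _; rewrite mxE normr0.
rewrite exprSr mulrA; apply: mnorm_step => //; rewrite ?mnorm_ge0 ?lerDl//.
apply: (le_trans (mnormM _ _)); rewrite ler_pM ?mnorm_ge0//; exact: mnorm_exp_le.
Qed.

Lemma mnorm_exp_bil V W n : mnorm (exp_bil V W n) <= k.+1%:R * M ^+ n * (mnorm V * mnorm W).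
Proof.
elim: n => [|n IH].
  rewrite /= (_ : mnorm 0 = 0) ?mulr_ge0 ?mnorm_ge0//.
  by rewrite /mnorm big1// => i _; rewrite big1// => j _; rewrite mxE normr0.
rewrite exprSr [k.+1%:R * _]mulrA; apply: mnorm_step; rewrite ?mulr_ge0 ?exprn_ge0 ?mnorm_ge0 ?lerDl//.
apply: (le_trans (mnormM _ _)); rewrite mulrA ler_pM ?mnorm_ge0//; exact: mnorm_exp_lin.
Qed.

Lemma mnorm_exp_rem V n : mnorm V <= 1 ->
  mnorm (exp_rem V n) <= k.+1%:R * M ^+ n * mnorm V ^+ 3.
Proof.
move=> V1; elim: n => [|n IH].
  rewrite /= (_ : mnorm 0 = 0) ?mulr_ge0 ?exprn_ge0 ?mnorm_ge0//.
  by rewrite /mnorm big1// => i _; rewrite big1// => j _; rewrite mxE normr0.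
rewrite exprSr mulrA; apply: mnorm_step; rewrite ?exprn_ge0 ?mnorm_ge0//.
  by apply: (le_trans (mnormD _ _)); rewrite lerD2l.
apply: (le_trans (mnormM _ _)); rewrite exprSr mulrA ler_pM ?mnorm_ge0//.
by rewrite expr2; exact: mnorm_exp_bil.
Qed.

Definition mexp_lin V : 'M[R]_k := \matrix_(i, j) expsum (fun n => exp_lin V n i j).
Definition mexp_bil V W : 'M[R]_k := \matrix_(i, j) expsum (fun n => exp_bil V W n i j).

Lemma geom_exp_lin V i j : geom_bounded (fun n => exp_lin V n i j) (k.+1%:R * mnorm V) M.
Proof.
apply: geom_mnorm => //; first by rewrite mulr_ge0// mnorm_ge0.
by move=> n; rewrite mulrAC mnorm_exp_lin.
Qed.

Lemma geom_exp_bil V W i j :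
  geom_bounded (fun n => exp_bil V W n i j) (k.+1%:R * (mnorm V * mnorm W)) M.
Proof.
apply: geom_mnorm => //; first by rewrite !mulr_ge0// mnorm_ge0.
by move=> n; rewrite mulrAC mnorm_exp_bil.
Qed.

Theorem mexp_expand V i j : mnorm V <= 1 ->
  `|mexp (A + V) i j - (mexp A i j + mexp_lin V i j + mexp_bil V V i j)| <=
  k.+1%:R * expR M * mnorm V ^+ 3.
Proof.
move=> V1; rewrite !mexpE ![fun_of_matrix (\matrix_(_, _) _) _ _]mxE.
have Gr : geom_bounded (fun n => exp_rem V n i j) (k.+1%:R * mnorm V ^+ 3) M.
  apply: geom_mnorm => //; first by rewrite mulr_ge0 ?exprn_ge0 ?mnorm_ge0.
  by move=> n; rewrite mulrAC mnorm_exp_rem.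
have G1 := geom_boundedD (geom_exp A i j) (geom_exp_lin V i j).
have G2 := geom_boundedD G1 (geom_exp_bil V V i j).
rewrite (_ : (fun n => ((A + V) ^+ n) i j) = fun n =>
  (A ^+ n) i j + exp_lin V n i j + exp_bil V V n i j + exp_rem V n i j); last first.
  by apply/funext => n; rewrite exp_expand !mxE.
rewrite (expsumD G2 Gr) (expsumD G1 (geom_exp_bil V V i j)).
rewrite (expsumD (geom_exp A i j) (geom_exp_lin V i j)) addrAC subrr add0r.
by apply: (le_trans (expsum_le Gr)); rewrite mulrAC.
Qed.

Lemma exp_lin_sum (I : Type) (r : seq I) (c : I -> R) (E : I -> 'M[R]_k) n :
  exp_lin (\sum_(i <- r) c i *: E i) n = \sum_(i <- r) c i *: exp_lin (E i) n.
Proof.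
elim: n => [|n IH] /=; first by rewrite big1// => i _; rewrite scaler0.
rewrite IH mulmx_suml mulmx_sumr -big_split/=; apply: eq_bigr => i _.
by rewrite scalerDr -scalemxAl -scalemxAr.
Qed.

Lemma exp_bil_sum (I : Type) (r : seq I) (c e : I -> R) (E : I -> 'M[R]_k) n :
  exp_bil (\sum_(i <- r) c i *: E i) (\sum_(i <- r) e i *: E i) n =
  \sum_(i <- r) \sum_(j <- r) (c i * e j) *: exp_bil (E i) (E j) n.
Proof.
elim: n => [|n IH] /=.
  by rewrite big1// => i _; rewrite big1// => j _; rewrite scaler0.
rewrite IH exp_lin_sum !mulmx_suml -big_split/=; apply: eq_bigr => i _.
rewrite mulmx_suml mulmx_sumr -big_split/=; apply: eq_bigr => j _.
by rewrite scalerDr -!scalemxAl -scalemxAr scalerA mulrC.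
Qed.

Lemma mexp_lin_sum (I : Type) (r : seq I) (c : I -> R) (E : I -> 'M[R]_k) :
  mexp_lin (\sum_(i <- r) c i *: E i) = \sum_(i <- r) c i *: mexp_lin (E i).
Proof.
apply/matrixP => i j; rewrite mxE summxE.
under eq_fun do rewrite exp_lin_sum summxE.
have G l : geom_bounded (fun n => (c l *: exp_lin (E l) n) i j)
    (`|c l| * (k.+1%:R * mnorm (E l))) M.
  have [K0 _ H] := geom_exp_lin (E l) i j.
  split; rewrite ?mulr_ge0 ?mnorm_ge0// => n.
  by rewrite mxE normrM -mulrA ler_wpM2l.
rewrite (expsum_sum r G); apply: eq_bigr => l _; rewrite !mxE.
by under eq_fun do rewrite mxE; rewrite (expsumZ _ (geom_exp_lin _ _ _)).
Qed.

Lemma mexp_bil_sum (I : Type) (r : seq I) (c e : I -> R) (E : I -> 'M[R]_k) :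
  mexp_bil (\sum_(i <- r) c i *: E i) (\sum_(i <- r) e i *: E i) =
  \sum_(i <- r) \sum_(j <- r) (c i * e j) *: mexp_bil (E i) (E j).
Proof.
apply/matrixP => i j; rewrite mxE summxE.
under eq_fun do rewrite exp_bil_sum summxE.
under eq_fun do under eq_bigr do rewrite summxE.
have G l m : geom_bounded (fun n => ((c l * e m) *: exp_bil (E l) (E m) n) i j)
    (`|c l * e m| * (k.+1%:R * (mnorm (E l) * mnorm (E m)))) M.
  have [K0 _ H] := geom_exp_bil (E l) (E m) i j.
  split; rewrite ?mulr_ge0 ?mnorm_ge0// => n.
  by rewrite mxE normrM -mulrA ler_wpM2l.
rewrite (expsum_sum r (fun l => geom_bounded_sum r (G l))); apply: eq_bigr => l _.
rewrite (expsum_sum r (G l)) summxE; apply: eq_bigr => m _; rewrite !mxE.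
by under eq_fun do rewrite mxE; rewrite (expsumZ _ (geom_exp_bil _ _ _ _)).
Qed.

End Expansion.

End MatrixExp.

Section HalfVectorization.
Variables (R : realType) (k : nat).
Implicit Types (A : 'M[R]_k) (b : 'rV[R]_(vdim k)).

(** The positions read by [vech]. That this list has length [vdim k], has no repetition and contains
    exactly the pairs with j <= i makes [vech] a bijection on symmetric matrices. *)
Let pos : seq ('I_k * 'I_k) :=
  flatten [seq [seq (i, j) | i : 'I_k <- enum 'I_k & (j <= i)%N] | j : 'I_k <- enum 'I_k].

Let size_pos : size pos = vdim k.
Proof.
rewrite size_flatten /shape -map_comp sumnE big_map big_enum/=.
under eq_bigr => j _ do rewrite size_map size_filter.
have cnt (j : 'I_k) : count (fun i : 'I_k => (j <= i)%N) (enum 'I_k) = (k - j)%N.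
  rewrite -(count_map val (fun i => (j <= i)%N)) val_enum_ord -size_filter.
  move: (nat_of_ord j) (ltnW (ltn_ord j)) => {}j jk.
  have -> : [seq i <- iota 0 k | (j <= i)%N] = iota j (k - j).
    rewrite -{1}(subnKC jk) iotaD filter_cat add0n.
    rewrite (_ : [seq i <- iota 0 j | _] = [::]) ?cat0s.
      by apply/all_filterP/allP => i; rewrite mem_iota => /andP[].
    apply/eqP; rewrite -[_ == _]negbK -has_filter; apply/hasPn => i.
    by rewrite mem_iota add0n -ltnNge.
  by rewrite size_iota.
rewrite (eq_bigr (fun j : 'I_k => (k - j)%N)); last by move=> j _; exact: cnt.
rewrite (reindex_inj rev_ord_inj)/=.
rewrite (eq_bigr (fun j : 'I_k => j.+1)); last by move=> j _; rewrite subKn.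
rewrite /vdim; elim: (k) => [|m IH]; first by rewrite big_ord0.
have -> : ((m.+1 * m.+2)./2 = (m * m.+1)./2 + m.+1)%N.
  rewrite -[m.+2]addn2 mulnDr muln2 (mulnC m.+1 m).
  by rewrite halfD odd_double andbF doubleK.
by rewrite big_ord_recr/= IH.
Qed.

Let posT : (vdim k).-tuple ('I_k * 'I_k) := tcast size_pos (in_tuple pos).

Lemma vech_tnth A l : vech A 0 l = A (tnth posT l).1 (tnth posT l).2.
Proof.
rewrite mxE (tnth_nth (tnth posT l)) /posT val_tcast /=.
have -> : flatten [seq [seq A i j | i : 'I_k <- enum 'I_k & (j <= i)%N] | j <- enum 'I_k] =
    [seq A p.1 p.2 | p <- pos].
  rewrite /pos map_flatten -map_comp; congr flatten; apply: eq_map => j /=.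
  by rewrite -map_comp.
by rewrite (nth_map (tnth posT l))// size_pos.
Qed.

Let uniq_pos : uniq pos.
Proof.
apply: allpairs_uniq_dep; first exact: enum_uniq.
  by move=> j _; apply: filter_uniq; exact: enum_uniq.
by case=> [j i] [j' i'] _ _ /= [-> ->].
Qed.

Let mem_pos i j : ((i, j) \in pos) = (j <= i)%N.
Proof.
apply/flatten_mapP/idP => [[j' _ /mapP[i']]|ji].
  by rewrite mem_filter => /andP[ji' _] [-> ->].
exists j; first exact: mem_enum.
by apply/mapP; exists i => //; rewrite mem_filter ji mem_enum.
Qed.

Lemma vech_inj A B : Defs.symmetric A -> Defs.symmetric B -> vech A = vech B -> A = B.
Proof.
move=> sA sB AB.
have L (i j : 'I_k) : (j <= i)%N -> A i j = B i j.
  move=> ji; have : (i, j) \in posT by rewrite memtE val_tcast/= mem_pos.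
  by move=> /tnthP[l E]; move: (congr1 (fun v : 'rV_(vdim k) => v 0 l) AB);
     rewrite /= !vech_tnth -E.
apply/matrixP => i j; case/orP: (leq_total j i) => [/L//|/L].
by rewrite -[in X in X -> _]sA -[in X in X -> _]sB !mxE.
Qed.

Lemma vech_surj b : exists2 A, Defs.symmetric A & vech A = b.
Proof.
have H (p : 'I_k * 'I_k) : (index p pos < vdim k)%N || (p \notin pos).
  by rewrite -size_pos index_mem orbN.
pose f (i j : 'I_k) : R := if insub (index (i, j) pos) is Some l then b 0 l else 0.
exists (\matrix_(i, j) if (j <= i)%N then f i j else f j i).
  apply/matrixP => i j; rewrite !mxE.
  by case: (ltngtP i j) => // /val_inj ->.
apply/rowP => l; rewrite vech_tnth mxE.
have pl : tnth posT l \in pos by move: (mem_tnth l posT); rewrite memtE val_tcast.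
have -> : ((tnth posT l).2 <= (tnth posT l).1)%N by rewrite -mem_pos -surjective_pairing.
rewrite /f -surjective_pairing.
have il : index (tnth posT l) pos = l.
  by rewrite (tnth_nth (tnth posT l)) /posT val_tcast/= index_uniq// size_pos.
by rewrite il; case: insubP => [l' _ ll'|/negP[]]; [congr (b 0 _); exact: val_inj|].
Qed.

Lemma mat_spec b : Defs.symmetric (mat b) /\ vech (mat b) = b.
Proof.
have [A sA vA] := vech_surj b.
exact: (@xgetPex _ 0 [set A | Defs.symmetric A /\ vech A = b] (ex_intro _ A (conj sA vA))).
Qed.

Lemma mat_vech A : Defs.symmetric A -> mat (vech A) = A.
Proof.
by move=> sA; have [sM vM] := mat_spec (vech A); exact: vech_inj.
Qed.

Lemma vech_linear a A B : vech (a *: A + B) = a *: vech A + vech B.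
Proof.
apply/rowP => l.
have -> : (a *: vech A + vech B) 0 l = a * vech A 0 l + vech B 0 l.
  by rewrite [LHS]mxE [X in X + _]mxE.
by rewrite !vech_tnth !mxE.
Qed.

Lemma mat_linear a b c : mat (a *: b + c) = a *: mat b + mat c.
Proof.
have [sb vb] := mat_spec b; have [sc vc] := mat_spec c.
have [sd vd] := mat_spec (a *: b + c).
apply: vech_inj => //; first by rewrite /Defs.symmetric linearP/= sb sc.
by rewrite vd vech_linear vb vc.
Qed.

(** Both branches of [xget] are symmetric: a chosen logarithm by its specification, the default
    because it is 0. *)
Lemma mlog_symmetric (S : 'M[R]_k) : Defs.symmetric (mlog S).
Proof.
rewrite /mlog; case: xgetP => [A _ []//|_].
by rewrite /Defs.symmetric trmx0.
Qed.

End HalfVectorization.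

(** * Second-order expansions *)

(* Second-order expansions at 0, in a parameter u, of functions of an
   observation x; the error is O(|u|^3) with a constant that may grow
   polynomially in a weight w x >= 1. *)
Section Jets.
Variables (R : realType) (e : measure_display) (X : measurableType e) (p : nat).
Variables (w : X -> R).
Hypotheses (mw : measurable_fun setT w) (w1 : forall x, 1 <= w x).
Implicit Types (c : X -> R) (f g L Q : X -> 'rV[R]_p -> R).

Definition tempered c : Prop :=
  measurable_fun setT c /\ exists C k, forall x, `|c x| <= C * w x ^+ k.

(** The radius delta is the same for all x; the dependence on x is confined to the factor w^k, which
    can be integrated. *)
Definition vanish n f : Prop := exists C k delta, [/\ 0 < delta, 0 <= C &
  forall x u, enorm u <= delta -> `|f x u| <= C * w x ^+ k * enorm u ^+ n].

Definition linear_form L : Prop := exists2 a : 'I_p -> X -> R,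
  forall i, tempered (a i) & forall x u, L x u = \sum_i u 0 i * a i x.

Definition quadratic_form Q : Prop := exists2 b : 'I_p -> 'I_p -> X -> R,
  forall i j, tempered (b i j) &
  forall x u, Q x u = \sum_i \sum_j u 0 i * u 0 j * b i j x.

Definition jet c f : Prop := tempered c /\ exists L Q,
  [/\ linear_form L, quadratic_form Q &
      vanish 3 (fun x u => f x u - (c x + L x u + Q x u))].

Lemma w_ge0 x : 0 <= w x. Proof. exact: le_trans ler01 (w1 x). Qed.
Lemma wX_ge0 x k : 0 <= w x ^+ k. Proof. exact: exprn_ge0 (w_ge0 x). Qed.
Lemma wX_ge1 x k : 1 <= w x ^+ k. Proof. exact: exprn_ege1. Qed.

Lemma wX_le x k l : (k <= l)%N -> w x ^+ k <= w x ^+ l.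
Proof. by move=> kl; rewrite ler_weXn2l. Qed.

Lemma tempered_bound c : tempered c -> exists C k, 0 <= C /\ forall x, `|c x| <= C * w x ^+ k.
Proof.
case=> _ [C [k H]]; exists `|C|, k; split => // x.
by apply: (le_trans (H x)); rewrite ler_wpM2r ?wX_ge0// ler_norm.
Qed.

Lemma temperedD c c' : tempered c -> tempered c' -> tempered (fun x => c x + c' x).
Proof.
move=> tc tc'; split; first by case: tc => ? _; case: tc' => ? _; exact: measurable_funD.
have [C [k [C0 H]]] := tempered_bound tc; have [C' [k' [C0' H']]] := tempered_bound tc'.
exists (C + C'), (k + k')%N => x; apply: (le_trans (ler_normD _ _)); rewrite mulrDl lerD//.
  by apply: (le_trans (H x)); rewrite ler_wpM2l// wX_le// leq_addr.
by apply: (le_trans (H' x)); rewrite ler_wpM2l// wX_le// leq_addl.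
Qed.

Lemma temperedM c c' : tempered c -> tempered c' -> tempered (fun x => c x * c' x).
Proof.
move=> tc tc'; split; first by case: tc => ? _; case: tc' => ? _; exact: measurable_funM.
have [C [k [C0 H]]] := tempered_bound tc; have [C' [k' [C0' H']]] := tempered_bound tc'.
exists (C * C'), (k + k')%N => x; rewrite normrM exprD mulrACA.
by rewrite ler_pM.
Qed.

Lemma tempered_cst a : tempered (fun=> a).
Proof. by split => //; exists `|a|, 0%N => x; rewrite mulr1. Qed.

Lemma tempered_sum (I : Type) (r : seq I) (c : I -> X -> R) :
  (forall i, tempered (c i)) -> tempered (fun x => \sum_(i <- r) c i x).
Proof.
move=> tc; elim: r => [|i r IH].
  by under eq_fun do rewrite big_nil; exact: tempered_cst.
by under eq_fun do rewrite big_cons; exact: temperedD.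
Qed.

Lemma le_enorm_coord (u : 'rV[R]_p) i : `|u 0 i| <= enorm u.
Proof.
rewrite -sqrtr_sqr ler_sqrt ?dot_ge0// /dot (bigD1 i)//= -expr2 lerDl.
by apply: sumr_ge0 => j _; rewrite -expr2 sqr_ge0.
Qed.

Lemma vanishD n f g : vanish n f -> vanish n g -> vanish n (fun x u => f x u + g x u).
Proof.
move=> [C [k [d [d0 C0 H]]]] [C' [k' [d' [d0' C0' H']]]].
exists (C + C'), (k + k')%N, (Num.min d d'); split; rewrite ?addr_ge0 ?lt_min ?d0//.
move=> x u; rewrite le_min => /andP[ud ud'].
apply: (le_trans (ler_normD _ _)); rewrite !mulrDl lerD//.
  apply: (le_trans (H x u ud)); rewrite ler_wpM2r ?exprn_ge0 ?enorm_ge0//.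
  by rewrite ler_wpM2l// wX_le// leq_addr.
apply: (le_trans (H' x u ud')); rewrite ler_wpM2r ?exprn_ge0 ?enorm_ge0//.
by rewrite ler_wpM2l// wX_le// leq_addl.
Qed.

Lemma vanishM n m f g : vanish n f -> vanish m g -> vanish (n + m) (fun x u => f x u * g x u).
Proof.
move=> [C [k [d [d0 C0 H]]]] [C' [k' [d' [d0' C0' H']]]].
exists (C * C'), (k + k')%N, (Num.min d d'); split; rewrite ?mulr_ge0 ?lt_min ?d0//.
move=> x u; rewrite le_min => /andP[ud ud'].
rewrite normrM !exprD (_ : C * C' * _ * _ = C * w x ^+ k * enorm u ^+ n *
  (C' * w x ^+ k' * enorm u ^+ m)); last by ring.
by rewrite ler_pM ?H ?H'.
Qed.

Lemma vanish_le n m f : (n <= m)%N -> vanish m f -> vanish n f.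
Proof.
move=> nm [C [k [d [d0 C0 H]]]].
exists C, k, (Num.min d 1); split; rewrite ?lt_min ?d0 ?ltr01//.
move=> x u; rewrite le_min => /andP[ud u1].
apply: (le_trans (H x u ud)); rewrite ler_wpM2l ?mulr_ge0 ?wX_ge0//.
by rewrite -(subnKC nm) exprD ler_piMr ?exprn_ge0 ?enorm_ge0// exprn_ile1// enorm_ge0.
Qed.

Lemma vanish_tempered c : tempered c -> vanish 0 (fun x _ => c x).
Proof.
move=> /tempered_bound[C [k [C0 H]]]; exists C, k, 1; split => // x u _.
by rewrite mulr1.
Qed.

Lemma vanish_ext n f g : (forall x u, f x u = g x u) -> vanish n f -> vanish n g.
Proof. by move=> fg; rewrite (_ : f = g)//; apply/funext => x; apply/funext. Qed.

Lemma vanish0 n : vanish n (fun _ _ => 0).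
Proof.
exists 0, 0%N, 1; split => // x u _; by rewrite normr0 !mul0r.
Qed.

Lemma vanish_sum (I : Type) (r : seq I) n (f : I -> X -> 'rV[R]_p -> R) :
  (forall i, vanish n (f i)) -> vanish n (fun x u => \sum_(i <- r) f i x u).
Proof.
move=> H; elim: r => [|i r IH].
  by apply: (vanish_ext _ (vanish0 n)) => x u; rewrite big_nil.
by apply: (vanish_ext _ (vanishD (H i) IH)) => x u; rewrite big_cons.
Qed.

Lemma vanish_coord i : vanish 1 (fun _ u => u 0 i).
Proof.
exists 1, 0%N, 1; split => // x u _; by rewrite expr0 !mul1r expr1 le_enorm_coord.
Qed.

Lemma linear_form_vanish L : linear_form L -> vanish 1 L.
Proof.
move=> [a ta LE].
apply: (@vanish_ext _ (fun x u => \sum_i u 0 i * a i x)) => //.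
apply: vanish_sum => i; exact: (vanishM (n:=1) (m:=0) (vanish_coord i) (vanish_tempered (ta i))).
Qed.

Lemma quadratic_form_vanish Q : quadratic_form Q -> vanish 2 Q.
Proof.
move=> [b tb QE].
apply: (@vanish_ext _ (fun x u => \sum_i \sum_j u 0 i * u 0 j * b i j x)) => //.
apply: vanish_sum => i; apply: vanish_sum => j.
exact: (vanishM (n:=2) (m:=0) (vanishM (vanish_coord i) (vanish_coord j)) (vanish_tempered (tb i j))).
Qed.

Lemma linear_formD L L' : linear_form L -> linear_form L' ->
  linear_form (fun x u => L x u + L' x u).
Proof.
move=> [a ta LE] [a' ta' LE']; exists (fun i x => a i x + a' i x).
  by move=> i; exact: temperedD.
move=> x u; rewrite LE LE' -big_split/=; apply: eq_bigr => i _; by rewrite mulrDr.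
Qed.

Lemma linear_formZ c L : tempered c -> linear_form L ->
  linear_form (fun x u => c x * L x u).
Proof.
move=> tc [a ta LE]; exists (fun i x => c x * a i x).
  by move=> i; exact: temperedM.
by move=> x u; rewrite LE mulr_sumr; apply: eq_bigr => i _; rewrite mulrCA.
Qed.

Lemma quadratic_formD Q Q' : quadratic_form Q -> quadratic_form Q' ->
  quadratic_form (fun x u => Q x u + Q' x u).
Proof.
move=> [a ta QE] [a' ta' QE']; exists (fun i j x => a i j x + a' i j x).
  by move=> i j; exact: temperedD.
move=> x u; rewrite QE QE' -big_split/=; apply: eq_bigr => i _.
by rewrite -big_split/=; apply: eq_bigr => j _; rewrite mulrDr.
Qed.

Lemma quadratic_formZ c Q : tempered c -> quadratic_form Q ->
  quadratic_form (fun x u => c x * Q x u).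
Proof.
move=> tc [a ta QE]; exists (fun i j x => c x * a i j x).
  by move=> i j; exact: temperedM.
move=> x u; rewrite QE mulr_sumr; apply: eq_bigr => i _.
by rewrite mulr_sumr; apply: eq_bigr => j _; rewrite mulrCA.
Qed.

Lemma linear_formM L L' : linear_form L -> linear_form L' ->
  quadratic_form (fun x u => L x u * L' x u).
Proof.
move=> [a ta LE] [a' ta' LE']; exists (fun i j x => a i x * a' j x).
  by move=> i j; exact: temperedM.
move=> x u; rewrite LE LE' mulr_suml; apply: eq_bigr => i _.
by rewrite mulr_sumr; apply: eq_bigr => j _; rewrite mulrACA.
Qed.

Lemma linear_form0 : linear_form (fun _ _ => 0).
Proof.
exists (fun _ _ => 0); first by move=> i; exact: tempered_cst.
by move=> x u; rewrite big1// => i _; rewrite mulr0.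
Qed.

Lemma quadratic_form0 : quadratic_form (fun _ _ => 0).
Proof.
exists (fun _ _ _ => 0); first by move=> i j; exact: tempered_cst.
by move=> x u; rewrite big1// => i _; rewrite big1// => j _; rewrite mulr0.
Qed.

Lemma jet_ext c c' f g : (forall x, c x = c' x) -> (forall x u, f x u = g x u) ->
  jet c f -> jet c' g.
Proof.
move=> cc fg; rewrite (_ : c = c'); last exact/funext.
by rewrite (_ : f = g)//; apply/funext => x; apply/funext.
Qed.

Lemma jet_near c f g d : 0 < d -> (forall x u, enorm u <= d -> f x u = g x u) ->
  jet c f -> jet c g.
Proof.
move=> d0 fg [tc [L [Q [lL qQ [C [k [d' [d0' C0 H]]]]]]]].
split => //; exists L, Q; split => //; exists C, k, (Num.min d d').
split; rewrite ?lt_min ?d0// => x u; rewrite le_min => /andP[ud ud'].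
by rewrite -fg// H.
Qed.

Lemma jet_tempered c : tempered c -> jet c (fun x _ => c x).
Proof.
move=> tc; split => //; exists (fun _ _ => 0), (fun _ _ => 0).
split; [exact: linear_form0|exact: quadratic_form0|].
by apply: vanish_ext (vanish0 3) => x u; rewrite !addr0 subrr.
Qed.

Lemma jet_linear L : linear_form L -> jet (fun=> 0) L.
Proof.
move=> lL; split; first exact: tempered_cst.
exists L, (fun _ _ => 0); split => //; first exact: quadratic_form0.
by apply: vanish_ext (vanish0 3) => x u; rewrite add0r addr0 subrr.
Qed.

Lemma jet_vanish f : vanish 3 f -> jet (fun=> 0) f.
Proof.
move=> Of; split; first exact: tempered_cst.
exists (fun _ _ => 0), (fun _ _ => 0); split; [exact: linear_form0|exact: quadratic_form0|].
by apply: vanish_ext Of => x u; rewrite !addr0 subr0.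
Qed.

Lemma jetD c c' f g : jet c f -> jet c' g ->
  jet (fun x => c x + c' x) (fun x u => f x u + g x u).
Proof.
move=> [tc [L [Q [lL qQ Of]]]] [tc' [L' [Q' [lL' qQ' Og]]]].
split; first exact: temperedD.
exists (fun x u => L x u + L' x u), (fun x u => Q x u + Q' x u).
split; [exact: linear_formD|exact: quadratic_formD|].
by apply: vanish_ext (vanishD Of Og) => x u; ring.
Qed.

Lemma jet_vanish0 c f : jet c f -> vanish 0 f.
Proof.
move=> [tc [L [Q [lL qQ Of]]]].
have O1 := vanishD (vanish_tempered tc) (vanish_le (leq0n 1) (linear_form_vanish lL)).
have O2 := vanishD O1 (vanish_le (leq0n 2) (quadratic_form_vanish qQ)).
by apply: vanish_ext (vanishD O2 (vanish_le (leq0n 3) Of)) => x u; ring.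
Qed.

Lemma jetM c c' f g : jet c f -> jet c' g ->
  jet (fun x => c x * c' x) (fun x u => f x u * g x u).
Proof.
move=> jf jg; have Og0 := jet_vanish0 jg.
have [tc [L [Q [lL qQ Of]]]] := jf; have [tc' [L' [Q' [lL' qQ' Og]]]] := jg.
split; first exact: temperedM.
exists (fun x u => c x * L' x u + c' x * L x u),
       (fun x u => c x * Q' x u + c' x * Q x u + L x u * L' x u).
split.
- by apply: linear_formD; exact: linear_formZ.
- by apply: quadratic_formD; [apply: quadratic_formD; exact: quadratic_formZ|exact: linear_formM].
have OL := linear_form_vanish lL; have OL' := linear_form_vanish lL'.
have OQ := quadratic_form_vanish qQ; have OQ' := quadratic_form_vanish qQ'.
have Oc := vanishD (vanishD (vanish_tempered tc) (vanish_le (leq0n 1) OL)) (vanish_le (leq0n 2) OQ).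
have H1 := vanishM Of Og0; have H2 := vanishM Oc Og.
have H3 := vanishM OL OQ'; have H4 := vanishM OQ OL'.
have H5 := vanish_le (isT : (3 <= 4)%N) (vanishM OQ OQ').
apply: vanish_ext (vanishD (vanishD H1 H2) (vanishD (vanishD H3 H4) H5)) => x u /=; ring.
Qed.

Lemma jet_sum (I : Type) (r : seq I) (c : I -> X -> R) (f : I -> X -> 'rV[R]_p -> R) :
  (forall i, jet (c i) (f i)) ->
  jet (fun x => \sum_(i <- r) c i x) (fun x u => \sum_(i <- r) f i x u).
Proof.
move=> H; elim: r => [|i r IH].
  by apply: jet_ext (jet_tempered (tempered_cst 0)) => x; rewrite ?big_nil// => u; rewrite big_nil.
by apply: jet_ext (jetD (H i) IH) => x; rewrite ?big_cons// => u; rewrite big_cons.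
Qed.

Lemma jet_prod (I : Type) (r : seq I) (c : I -> X -> R) (f : I -> X -> 'rV[R]_p -> R) :
  (forall i, jet (c i) (f i)) ->
  jet (fun x => \prod_(i <- r) c i x) (fun x u => \prod_(i <- r) f i x u).
Proof.
move=> H; elim: r => [|i r IH].
  by apply: jet_ext (jet_tempered (tempered_cst 1)) => x; rewrite ?big_nil// => u; rewrite big_nil.
by apply: jet_ext (jetM (H i) IH) => x; rewrite ?big_cons// => u; rewrite big_cons.
Qed.

Lemma jetZ a c f : jet c f -> jet (fun x => a * c x) (fun x u => a * f x u).
Proof. exact: jetM (jet_tempered (tempered_cst a)). Qed.

Lemma jet0_vanish1 f : jet (fun=> 0) f -> vanish 1 f.
Proof.
move=> [tc [L [Q [lL qQ Of]]]].
have O1 := vanishD (linear_form_vanish lL) (vanish_le (isT : (1 <= 2)%N) (quadratic_form_vanish qQ)).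
by apply: vanish_ext (vanishD O1 (vanish_le (isT : (1 <= 3)%N) Of)) => x u; ring.
Qed.

(** Smallness uniform in x, with no weight, which [vanish] does not provide. It is required before f
    is substituted into a scalar expansion that is valid for |z| <= 1/2 only. *)
Definition small f : Prop := forall eps : R, 0 < eps ->
  exists2 d, 0 < d & forall x u, enorm u <= d -> `|f x u| <= eps.

(** The Taylor polynomial of F has a jet by the algebra of jets, and the error is at most K |f|^3,
    which vanishes to order 3 because f vanishes to order 1. The outer function may depend on x. *)
Lemma jet_comp (F0 F1 F2 : X -> R) (F : X -> R -> R) (K : R) f :
  tempered F0 -> tempered F1 -> tempered F2 -> jet (fun=> 0) f -> small f ->
  (forall x z, `|z| <= 2^-1 ->
     `|F x z - (F0 x + F1 x * z + F2 x * z ^+ 2)| <= K * `|z| ^+ 3) ->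
  jet F0 (fun x u => F x (f x u)).
Proof.
move=> t0 t1 t2 jf sf FE.
pose P x z := F0 x + F1 x * z + F2 x * z ^+ 2.
have jP : jet F0 (fun x u => P x (f x u)).
  have J := jetD (jetD (jet_tempered t0) (jetM (jet_tempered t1) jf))
    (jetM (jet_tempered t2) (jetM jf jf)).
  by apply: jet_ext J => x; rewrite ?mulr0 ?addr0// => u; rewrite /P expr2.
have h0 : (0 : R) < 2^-1 by rewrite invr_gt0.
have [d d0 sd] := sf _ h0.
have J : jet (fun=> 0) (fun x u => F x (f x u) - P x (f x u)).
  apply: jet_vanish; have O1 := jet0_vanish1 jf.
  have [C [k [d' [d0' C0 H]]]] := vanishM (vanishM O1 O1) O1.
  exists (`|K| * C), k, (Num.min d d'); split; rewrite ?mulr_ge0 ?lt_min ?d0//.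
  move=> x u; rewrite le_min => /andP[ud ud'].
  apply: (le_trans (FE _ _ (sd _ _ ud))).
  rewrite -!mulrA; apply: (le_trans (ler_wpM2r _ (ler_norm K))); first by rewrite exprn_ge0.
  rewrite ler_wpM2l// mulrA; have := H x u ud'; rewrite !normrM.
  by rewrite (_ : `|f x u| ^+ 3 = `|f x u| * `|f x u| * `|f x u|) //; ring.
by apply: jet_ext (jetD jP J) => x; rewrite ?addr0// => u; rewrite addrC subrK.
Qed.

Lemma small_vanish f : (forall x y u, f x u = f y u) -> vanish 1 f -> small f.
Proof.
move=> fc [C [k [d [d0 C0 H]]]] eps e0.
have [x0|nx] := pselect (exists x0 : X, True); last first.
  by exists 1 => // x; exfalso; apply: nx; exists x.
case: x0 => x0 _.
pose M := C * w x0 ^+ k + 1; have M0 : 0 < M by rewrite ltr_wpDl// mulr_ge0// wX_ge0.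
exists (Num.min d (eps / M)); first by rewrite lt_min d0 divr_gt0.
move=> x u; rewrite le_min => /andP[ud ue]; rewrite (fc x x0).
apply: (le_trans (H x0 u ud)); rewrite expr1.
apply: (@le_trans _ _ (M * (eps / M))).
  by rewrite ler_pM ?mulr_ge0 ?wX_ge0 ?enorm_ge0// lerDl.
by rewrite mulrC divfK// gt_eqF.
Qed.

Lemma small_const f : (forall x y u, f x u = f y u) -> jet (fun=> 0) f -> small f.
Proof. by move=> fc /jet0_vanish1; exact: small_vanish. Qed.

Lemma smallD f g : small f -> small g -> small (fun x u => f x u + g x u).
Proof.
move=> sf sg eps e0; have e2 : 0 < eps / 2 by rewrite divr_gt0.
have [d d0 H] := sf _ e2; have [d' d0' H'] := sg _ e2.
exists (Num.min d d'); first by rewrite lt_min d0.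
move=> x u; rewrite le_min => /andP[ud ud']; apply: (le_trans (ler_normD _ _)).
by rewrite [leRHS]splitr lerD ?H ?H'.
Qed.

Lemma smallM f g : small f -> small g -> small (fun x u => f x u * g x u).
Proof.
move=> sf sg eps e0; have [d d0 H] := sf _ e0; have [d' d0' H'] := sg _ ltr01.
exists (Num.min d d'); first by rewrite lt_min d0.
move=> x u; rewrite le_min => /andP[ud ud']; rewrite normrM -[eps]mulr1.
by rewrite ler_pM ?H ?H'.
Qed.

Lemma small_comp (F : X -> R -> R) (K : R) f : small f ->
  (forall x z, `|z| <= 2^-1 -> `|F x z| <= K * `|z|) -> small (fun x u => F x (f x u)).
Proof.
move=> sf FK eps e0; pose M := `|K| + 1; have M0 : 0 < M by rewrite ltr_wpDl.
have m0 : 0 < Num.min 2^-1 (eps / M) by rewrite lt_min invr_gt0 ltr0n divr_gt0.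
have [d d0 H] := sf _ m0.
exists d => // x u /(H x); rewrite le_min => /andP[f2 fe].
apply: (le_trans (FK _ _ f2)); apply: (@le_trans _ _ (M * (eps / M))).
  apply: (@le_trans _ _ (M * `|f x u|)); last by rewrite ler_wpM2l// ltW.
  by rewrite ler_wpM2r// (le_trans (ler_norm K))// lerDl.
by rewrite mulrC divfK// gt_eqF.
Qed.

Lemma small_linear (a : 'I_p -> X -> R) C : (forall i x, `|a i x| <= C) ->
  small (fun x u => \sum_i u 0 i * a i x).
Proof.
move=> aC eps e0; pose M := p%:R * `|C| + 1; have M0 : 0 < M by rewrite ltr_wpDl// mulr_ge0.
exists (eps / M); first by rewrite divr_gt0.
move=> x u ue; apply: (le_trans (ler_norm_sum _ _ _)).
apply: (@le_trans _ _ (\sum_(i < p) enorm u * `|C|)).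
  apply: ler_sum => i _; rewrite normrM ler_pM ?le_enorm_coord//.
  exact: le_trans (aC i x) (ler_norm _).
rewrite sumr_const card_ord -mulr_natl mulrCA.
apply: (@le_trans _ _ (eps / M * M)); last by rewrite divfK// gt_eqF.
by rewrite ler_pM ?enorm_ge0 ?mulr_ge0// lerDl.
Qed.

Lemma jet_at0 c f : jet c f -> forall x, c x = f x 0.
Proof.
move=> [tc [L [Q [[a _ LE] [b _ QE] [C [k [d [d0 C0 H]]]]]]]] x.
have := H x 0; rewrite enorm0 expr0n mulr0 normr_le0 => /(_ (ltW d0)).
rewrite LE QE big1 ?addr0; last by move=> i _; rewrite mxE mul0r.
rewrite big1 ?addr0 ?subr_eq0; last by move=> i _; rewrite big1// => j _; rewrite !mxE !mul0r.
by move=> /eqP.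
Qed.

(** Jets assembled from many factors carry an unwieldy constant term; it is forced to be the value
    at 0 and need not be computed. *)
Lemma jet_self c f : jet c f -> jet (f ^~ 0) f.
Proof.
by move=> jf; apply: (jet_ext _ (fun _ _ => erefl) jf) => x; rewrite (jet_at0 jf).
Qed.

End Jets.

(** * Scalar Taylor bounds *)

Section ScalarExpansions.
Variable R : realType.
Implicit Types (z r : R) (h : R -> R).

(** The mean value theorem between 0 and z, without the factor 1/(n+1) that integration would give.
    Repeated use yields Taylor bounds from a bound on the last derivative. *)
Lemma derive_power_bound h (h' : R -> R) (C b : R) n :
  h 0 = 0 -> (forall t, `|t| <= b -> is_derive (t : R) 1 h (h' t)) ->
  (forall t, `|t| <= b -> `|h' t| <= C * `|t| ^+ n) ->
  forall z, `|z| <= b -> `|h z| <= C * `|z| ^+ n.+1.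
Proof.
move=> h0 dh bh z zb.
have C0 : 0 <= C * `|z| ^+ n := le_trans (normr_ge0 _) (bh _ zb).
have key (s t : R) : s <= t -> `|s| <= `|z| -> `|t| <= `|z| -> `|h t - h s| <= C * `|z| ^+ n * (t - s).
  move=> st sz tz.
  have sub (y : R) : s <= y -> y <= t -> `|y| <= `|z|.
    move=> sy yt; rewrite ler_norml; move: sz tz; rewrite !ler_norml => /andP[a1 a2] /andP[b1 b2].
    by rewrite (le_trans a1 sy) (le_trans yt b2).
  have [||c] := @MVT_segment R h h' s t st.
  - by move=> y; rewrite in_itv/= => /andP[sy yt]; apply: dh; apply: le_trans zb; apply: sub; exact: ltW.
  - apply: continuous_in_subspaceT => y'; rewrite inE/= in_itv/= => /andP[sy yt].
    have [D _] := dh y' (le_trans (sub _ sy yt) zb).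
    by apply/differentiable_continuous; apply/derivable1_diffP.
  rewrite in_itv/= => /andP[sc ct] ->; rewrite normrM [`|t - s|]ger0_norm ?subr_ge0//.
  rewrite ler_wpM2r ?subr_ge0//; apply: (le_trans (bh _ (le_trans (sub _ sc ct) zb))).
  have [C'|C'] := lerP 0 C.
    by rewrite ler_wpM2l// lerXn2r ?nnegrE// sub.
  have z00 : `|z| ^+ n = 0.
    apply/eqP; rewrite eq_le exprn_ge0// andbT.
    by rewrite -(ler_nM2l C') mulr0.
  have c0 : `|c| ^+ n = 0.
    by apply/eqP; rewrite eq_le exprn_ge0// andbT -z00 lerXn2r ?nnegrE// sub.
  by rewrite c0 z00.
rewrite exprSr mulrA; have [z0|z0] := lerP 0 z.
  have := key 0 z z0; rewrite normr0 normr_ge0 lexx h0 !subr0 => /(_ isT isT).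
  by rewrite [`|z| in X in _ -> X]ger0_norm// [`|z|]ger0_norm.
have := key z 0 (ltW z0); rewrite normr0 normr_ge0 lexx h0 sub0r normrN => /(_ isT isT).
by rewrite sub0r -[- z]ltr0_norm.
Qed.

Lemma is_derive_sqr (t : R) : is_derive t 1 (fun z => z ^+ 2) (2 * t).
Proof.
under eq_fun do rewrite expr2.
have := is_deriveM (is_derive_id t 1) (is_derive_id t 1); move/is_derive_eq; apply.
by rewrite /GRing.scale/=; ring.
Qed.

Lemma inv_expand z : `|z| <= 2^-1 ->
  `|(1 + z)^-1 - (1 + -1 * z + 1 * z ^+ 2)| <= 2 * `|z| ^+ 3.
Proof.
move=> zb; have z1 : 2^-1 <= 1 + z.
  by move: zb; rewrite ler_norml => /andP[z1 _]; lra.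
have z0 : 0 < 1 + z by apply: lt_le_trans z1; rewrite invr_gt0.
rewrite (_ : _ - _ = - (z ^+ 3 / (1 + z))); last by field; rewrite gt_eqF.
rewrite normrN normrM normfV normrX (gtr0_norm z0) mulrC ler_wpM2r ?exprn_ge0//.
by rewrite invf_ple ?posrE.
Qed.

Lemma ln_expand z : `|z| <= 2^-1 ->
  `|ln (1 + z) - (0 + 1 * z + - 2^-1 * z ^+ 2)| <= 2 * `|z| ^+ 3.
Proof.
move=> zb; pose h (z : R) := ln (1 + z) - (0 + 1 * z + - 2^-1 * z ^+ 2).
apply: (@derive_power_bound h (fun t => t ^+ 2 / (1 + t)) 2 2^-1 2) => //.
- by rewrite /h addr0 ln1 expr0n !mulr0 !addr0 subr0.
- move=> t tb; have t0 : 0 < 1 + t.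
    by move: tb; rewrite ler_norml => /andP[t1 _]; lra.
  have d1 : is_derive (t : R) 1 (fun z => 1 + z) 1.
    by have := is_deriveD (is_derive_cst (1 : R) t 1) (is_derive_id t 1);
       move/is_derive_eq; apply; rewrite add0r.
  have d2 : is_derive (t : R) 1 (fun z => ln (1 + z)) ((1 + t)^-1).
    have := @is_derive1_comp R (@ln R) (fun z => 1 + z) t _ _ (is_derive1_ln t0) d1.
    by move/is_derive_eq; apply; rewrite mulr1.
  have d3 : is_derive (t : R) 1 (fun z => 0 + 1 * z + - 2^-1 * z ^+ 2) (1 - t).
    have e1 : is_derive (t : R) 1 (fun z => 0 + 1 * z) 1.
      by under eq_fun do rewrite add0r mul1r; exact: is_derive_id.
    have e2 : is_derive (t : R) 1 (fun z => - 2^-1 * z ^+ 2) (- 2^-1 * (2 * t)).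
      exact: (is_deriveZ (- 2^-1) (is_derive_sqr t)).
    by have := is_deriveD e1 e2; move/is_derive_eq; apply; field.
  have := is_deriveB d2 d3; move/is_derive_eq; apply.
  by field; rewrite gt_eqF.
- move=> t tb; have t1 : 2^-1 <= 1 + t.
    by move: tb; rewrite ler_norml => /andP[t1 _]; lra.
  have t0 : 0 < 1 + t by apply: lt_le_trans t1; rewrite invr_gt0.
  rewrite normrM normfV normrX (gtr0_norm t0) mulrC ler_wpM2r ?exprn_ge0//.
  by rewrite invf_ple ?posrE.
Qed.

Lemma expR_expand z : `|z| <= 1 -> `|expR z - 1 - z - 2^-1 * z ^+ 2| <= expR 1 * `|z| ^+ 3.
Proof.
have E0 (t : R) : `|t| <= 1 -> `|expR t| <= expR 1 * `|t| ^+ 0.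
  by move=> /(le_trans (ler_norm _)) t1; rewrite mulr1 ger0_norm ?expR_ge0// ler_expR.
have E1 (t : R) : `|t| <= 1 -> `|expR t - 1| <= expR 1 * `|t| ^+ 1.
  move=> t1; apply: (derive_power_bound (h := fun t => expR t - 1) (h' := expR) _ _ E0 t1).
    by rewrite expR0 subrr.
  by move=> s _; have := is_deriveB (is_derive_expR s) (is_derive_cst (1 : R) s 1);
     move/is_derive_eq; apply; rewrite subr0.
have E2 (t : R) : `|t| <= 1 -> `|expR t - 1 - t| <= expR 1 * `|t| ^+ 2.
  move=> t1; apply: (derive_power_bound (h := fun t => expR t - 1 - t) (h' := fun t => expR t - 1) _ _ E1 t1).
    by rewrite expR0 subrr subr0.
  move=> s _; have d1 := is_deriveB (is_derive_expR s) (is_derive_cst (1 : R) s 1).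
  by have := is_deriveB d1 (is_derive_id s 1); move/is_derive_eq; apply; rewrite subr0.
move=> z1.
apply: (derive_power_bound (h := fun t => expR t - 1 - t - 2^-1 * t ^+ 2) (h' := fun t => expR t - 1 - t) _ _ E2 z1).
  by rewrite expR0 subrr subr0 expr0n mulr0 subr0.
move=> s _; have d1 := is_deriveB (is_derive_expR s) (is_derive_cst (1 : R) s 1).
have d2 := is_deriveB d1 (is_derive_id s 1).
have d3 : is_derive (s : R) 1 (fun t => 2^-1 * t ^+ 2) (2^-1 * (2 * s)).
  exact: (is_deriveZ 2^-1 (is_derive_sqr s)).
by have := is_deriveB d2 d3; move/is_derive_eq; apply; rewrite subr0; field.
Qed.

Lemma coshR_expand r : `|r| <= 1 -> `|coshR r - 1 - 2^-1 * r ^+ 2| <= expR 1 * `|r| ^+ 3.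
Proof.
move=> r1; have Nr1 : `|- r| <= 1 by rewrite normrN.
have := expR_expand r1; have := expR_expand Nr1.
rewrite normrN sqrrN !ler_norml /coshR => /andP[a1 a2] /andP[b1 b2].
by apply/andP; split; lra.
Qed.

Lemma sinhc_expand r : `|r| <= 1 -> `|sinhc r - 1| <= expR 1 * `|r| ^+ 2.
Proof.
move=> r1; have [->|r0] := eqVneq r 0.
  by rewrite /sinhc eqxx subrr normr0 mulr_ge0 ?expR_ge0.
have Nr1 : `|- r| <= 1 by rewrite normrN.
have nr0 : 0 < `|r| by rewrite normr_gt0.
have H : `|sinhR r - r| <= expR 1 * `|r| ^+ 3.
  have := expR_expand r1; have := expR_expand Nr1.
  rewrite normrN sqrrN !ler_norml /sinhR => /andP[a1 a2] /andP[b1 b2].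
  by apply/andP; split; lra.
by rewrite -(ler_pM2r nr0) -normrM mulrBl sinhc_mul mul1r -mulrA -exprSr.
Qed.

End ScalarExpansions.

(** * Jets of the building blocks of the model *)

Section ModelJets.
Variables (R : realType) (e : measure_display) (X : measurableType e).
Variables (w : X -> R) (d q : nat).
Hypotheses (mw : measurable_fun setT w) (w1 : forall x, 1 <= w x).
Let p := (d + q)%N.

Lemma linear_delta (V : lmodType R) (f : {linear 'rV[R]_p -> V}) u :
  f u = \sum_i u 0 i *: f (delta_mx 0 i).
Proof.
by rewrite {1}(row_sum_delta u) linear_sum; apply: eq_bigr => i _; rewrite linearZ.
Qed.

Lemma linear_form_coord i : @linear_form R e X p w (fun _ u => u 0 i).
Proof.
exists (fun j _ => (j == i)%:R); first by move=> j; exact: tempered_cst.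
move=> x u; rewrite (bigD1 i)//= eqxx mulr1 big1 ?addr0// => j /negbTE ->.
by rewrite mulr0.
Qed.

Lemma dot_submx (u : 'rV[R]_p) :
  dot u u = dot (lsubmx u) (lsubmx u) + dot (rsubmx u) (rsubmx u).
Proof.
rewrite /dot big_split_ord/=; congr (_ + _); apply: eq_bigr => i _; by rewrite !mxE.
Qed.

Lemma enorm_lsubmx (u : 'rV[R]_p) : enorm (lsubmx u) <= enorm u.
Proof. by rewrite ler_sqrt ?dot_ge0// dot_submx lerDl dot_ge0. Qed.

Lemma jet_sqr_lsubmx :
  @jet R e X p w (fun=> 0) (fun _ u => dot (lsubmx u) (lsubmx u)).
Proof.
have J i := jetM w1 (jet_linear (linear_form_coord (lshift q i)))
                       (jet_linear (linear_form_coord (lshift q i))).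
apply: (jet_ext _ _ (jet_sum w1 (index_enum _) J)) => x.
  by rewrite big1// => i _; rewrite mulr0.
by move=> u; rewrite /dot; apply: eq_bigr => i _; rewrite !mxE.
Qed.

(** The norm is not differentiable at 0, but its square is a polynomial in u, and the expansion of
    the even function cosh up to order 2 involves the square only. *)
Lemma jet_cosh : @jet R e X p w (fun=> 1) (fun _ u => coshR (enorm (lsubmx u))).
Proof.
have J := jetD w1 (jet_tempered p (tempered_cst w 1)) (jetZ w1 2^-1 jet_sqr_lsubmx).
have B : vanish w 3 (fun _ (u : 'rV[R]_p) => coshR (enorm (lsubmx u)) - 1 - 2^-1 * dot (lsubmx u) (lsubmx u)).
  exists (expR 1), 0%N, 1; split; rewrite ?expR_ge0// => x u u1.
  have l1 := le_trans (enorm_lsubmx u) u1.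
  have := @coshR_expand R (enorm (lsubmx u)); rewrite ger0_norm ?enorm_ge0// => /(_ l1).
  rewrite sqr_enorm expr0 mulr1 => /le_trans; apply; rewrite ler_wpM2l ?expR_ge0//.
  by rewrite lerXn2r ?nnegrE ?enorm_ge0// enorm_lsubmx.
apply: (jet_ext _ _ (jetD w1 J (jet_vanish B))) => x; first by rewrite mulr0 !addr0.
by move=> u; ring.
Qed.

(** The linear form already contributes one order, so the second-order bound on sinhc - 1 makes the
    correction cubic. *)
Lemma jet_sinhc (L : X -> 'rV[R]_p -> R) : linear_form w L ->
  jet w (fun=> 0) (fun x u => sinhc (enorm (lsubmx u)) * L x u).
Proof.
move=> lL; have B : vanish w 2 (fun _ (u : 'rV[R]_p) => sinhc (enorm (lsubmx u)) - 1).
  exists (expR 1), 0%N, 1; split; rewrite ?expR_ge0// => x u u1.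
  have l1 := le_trans (enorm_lsubmx u) u1.
  have := @sinhc_expand R (enorm (lsubmx u)); rewrite [`|enorm _|]ger0_norm ?enorm_ge0// => /(_ l1).
  rewrite expr0 mulr1 => /le_trans; apply; rewrite ler_wpM2l ?expR_ge0//.
  by rewrite lerXn2r ?nnegrE ?enorm_ge0// enorm_lsubmx.
have J := jet_vanish (vanishM B (linear_form_vanish w1 lL)).
apply: (jet_ext _ _ (jetD w1 (jet_linear lL) J)) => x; first by rewrite addr0.
by move=> u; ring.
Qed.

Section MexpJet.
Variables (k : nat) (A : 'M[R]_k) (V : {linear 'rV[R]_p -> 'M[R]_k}).

Lemma mnorm_linear u : mnorm (V u) <= (\sum_i mnorm (V (delta_mx 0 i))) * enorm u.
Proof.
rewrite linear_delta mulr_suml.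
have E (r : seq 'I_p) : mnorm (\sum_(i <- r) u 0 i *: V (delta_mx 0 i)) <=
    \sum_(i <- r) mnorm (V (delta_mx 0 i)) * enorm u; last exact: E.
elim: r => [|i r IH].
  rewrite !big_nil /mnorm big1// => i _; rewrite big1// => j _; by rewrite mxE normr0.
rewrite !big_cons; apply: (le_trans (mnormD _ _)); rewrite lerD//.
rewrite (_ : mnorm (_ *: _) = `|u 0 i| * mnorm (V (delta_mx 0 i))); last first.
  rewrite /mnorm mulr_sumr; apply: eq_bigr => a _; rewrite mulr_sumr; apply: eq_bigr => b _.
  by rewrite mxE normrM.
by rewrite mulrC ler_wpM2l ?mnorm_ge0// le_enorm_coord.
Qed.

Lemma jet_mexp i j : jet w (fun=> mexp A i j) (fun _ u => mexp (A + V u) i j).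
Proof.
pose K := \sum_i mnorm (V (delta_mx 0 i)).
have K0 : 0 <= K by apply: sumr_ge0 => l _; exact: mnorm_ge0.
split; first exact: tempered_cst.
exists (fun _ u => mexp_lin A (V u) i j), (fun _ u => mexp_bil A (V u) (V u) i j); split.
- exists (fun l _ => mexp_lin A (V (delta_mx 0 l)) i j); first by move=> l; exact: tempered_cst.
  move=> x u; rewrite linear_delta mexp_lin_sum summxE; apply: eq_bigr => l _.
  by rewrite mxE.
- exists (fun l m _ => mexp_bil A (V (delta_mx 0 l)) (V (delta_mx 0 m)) i j).
    by move=> l m; exact: tempered_cst.
  move=> x u; rewrite linear_delta mexp_bil_sum summxE; apply: eq_bigr => l _.
  by rewrite summxE; apply: eq_bigr => m _; rewrite mxE.
exists (k.+1%:R * expR (mnorm A + 2) * K ^+ 3), 0%N, (K + 1)^-1; split.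
- by rewrite invr_gt0 ltr_wpDl.
- by rewrite !mulr_ge0 ?exprn_ge0 ?expR_ge0.
move=> x u ub; have VK := mnorm_linear u.
have V1 : mnorm (V u) <= 1.
  apply: (le_trans VK); apply: (@le_trans _ _ ((K + 1) * (K + 1)^-1)).
    by rewrite ler_pM ?enorm_ge0// lerDl.
  by rewrite mulfV// gt_eqF// ltr_wpDl.
apply: (le_trans (mexp_expand A i j V1)).
rewrite expr0 mulr1 -mulrA -[leRHS]mulrA -[leRHS]mulrA -exprMn.
do 2!rewrite ler_wpM2l ?expR_ge0//.
by rewrite lerXn2r ?nnegrE ?mnorm_ge0// mulr_ge0// enorm_ge0.
Qed.

End MexpJet.

Lemma jet_det k (c : X -> 'M[R]_k) (f : X -> 'rV[R]_p -> 'M[R]_k) :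
  (forall i j, jet w (fun x => c x i j) (fun x u => f x u i j)) ->
  jet w (fun x => \det (c x)) (fun x u => \det (f x u)).
Proof.
move=> H.
have J (s : 'S_k) := jetZ w1 ((-1) ^+ (s : bool))
   (jet_prod w1 (index_enum _) (fun i => H i (s i))).
exact: (jet_ext _ _ (jet_sum w1 (index_enum _) J)).
Qed.

Lemma jet_ln (c0 : R) (f : 'rV[R]_p -> R) : 0 < c0 ->
  jet w (fun=> c0) (fun _ u => f u) -> jet w (fun=> ln c0) (fun _ u => ln (f u)).
Proof.
move=> c00 jf; pose z (_ : X) u := c0^-1 * f u + - 1.
have jz : jet w (fun=> 0) z.
  apply: (jet_ext _ _ (jetD w1 (jetZ w1 c0^-1 jf)
    (jet_tempered p (tempered_cst w (-1))))) => // x.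
  by rewrite mulVf ?subrr// gt_eqF.
have sz : small z by apply: small_const jz.
have J := jet_comp w1 (tempered_cst w 0) (tempered_cst w 1) (tempered_cst w (- 2^-1))
  jz sz (fun _ z => @ln_expand R z).
have J' := jetD w1 (jet_tempered p (tempered_cst w (ln c0))) J.
have h0 : (0 : R) < 2^-1 by rewrite invr_gt0.
have [dl dl0 zb] := sz _ h0.
apply: (jet_near dl0 _ (jet_ext _ (fun _ _ => erefl) J')) => x; last by rewrite addr0.
move=> u ud; have := zb x u ud; rewrite ler_norml => /andP[z1 _].
have z0 : 0 < 1 + z x u by lra.
rewrite -lnM ?posrE//; congr ln; rewrite /z; field; by rewrite gt_eqF.
Qed.

Lemma jet_inv (c0 : R) (f : 'rV[R]_p -> R) : 0 < c0 ->
  jet w (fun=> c0) (fun _ u => f u) -> jet w (fun=> c0^-1) (fun _ u => (f u)^-1).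
Proof.
move=> c00 jf; pose z (_ : X) u := c0^-1 * f u + - 1.
have jz : jet w (fun=> 0) z.
  apply: (jet_ext _ _ (jetD w1 (jetZ w1 c0^-1 jf)
    (jet_tempered p (tempered_cst w (-1))))) => // x.
  by rewrite mulVf ?subrr// gt_eqF.
have sz : small z by apply: small_const jz.
have J := jet_comp w1 (tempered_cst w 1) (tempered_cst w (-1)) (tempered_cst w 1)
  jz sz (fun _ z => @inv_expand R z).
have J' := jetZ w1 c0^-1 J.
apply: (jet_ext _ _ J') => x; first by rewrite mulr1.
by move=> u; rewrite -invfM; congr (_^-1); rewrite /z; field; rewrite gt_eqF.
Qed.

End ModelJets.

(** * Expansion of the log-density *)

(* [r / sinh r] at c = cosh r, written as an integral: every derivative in c is
   then controlled uniformly, including near c = 1. *)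
Section LogRatio.
Variable R : realType.
Implicit Types (c t z r : R).

Definition den c t : R := t ^+ 2 + 2 * c * t + 1.

(** Equal to (-c)^k / k! times the k-th derivative in c of 2 / den c t, hence the k-th Taylor
    coefficient, up to sign, in the relative increment z of c(1 + z). *)
Definition kernel k c t : R := 2 * (2 * c * t) ^+ k / den c t ^+ k.+1.

Definition moment k c : R := \int[lebesgue_measure]_(t in `[0, 1]) kernel k c t.

Lemma den_gt0 c t : 0 <= c -> 0 <= t -> 0 < den c t.
Proof. by move=> c0 t0; rewrite /den ltr_wpDl// addr_ge0 ?sqr_ge0// !mulr_ge0. Qed.

Lemma kernel_ge0 k c t : 0 <= c -> 0 <= t -> 0 <= kernel k c t.
Proof.
move=> c0 t0; rewrite /kernel divr_ge0 ?exprn_ge0 ?(ltW (den_gt0 _ _))//.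
by rewrite mulr_ge0// exprn_ge0// !mulr_ge0.
Qed.

Lemma kernel_le k c t : 0 <= c -> 0 <= t -> kernel k c t <= kernel 0 c t.
Proof.
move=> c0 t0; have D0 := den_gt0 c0 t0.
rewrite (_ : kernel k c t = kernel 0 c t * (2 * c * t / den c t) ^+ k); last first.
  by rewrite /kernel exprS expr_div_n; field; rewrite expf_neq0 gt_eqF.
rewrite ler_piMr ?kernel_ge0// exprn_ile1// ?divr_ge0 ?(ltW D0) ?mulr_ge0//.
by rewrite ler_pdivrMr// mul1r /den addrAC lerDr addr_ge0 ?sqr_ge0.
Qed.

Lemma continuous_kernel k c : 0 <= c -> {within `[0, 1], continuous (kernel k c)}.
Proof.
move=> c0; apply: continuous_in_subspaceT => t; rewrite inE/= in_itv/= => /andP[t0 _].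
have cid : {for t, continuous (fun t : R => t)} by exact: cvg_id.
have cD : {for t, continuous (den c)}.
  rewrite /den; apply: cvgD; last exact: cvg_cst.
  apply: cvgD; first by under eq_fun do rewrite expr2; exact: cvgM.
  by apply: cvgMr.
have cX (f : R -> R) n : {for t, continuous f} -> {for t, continuous (fun t => f t ^+ n)}.
  by move=> cf; elim: n => [|n IH]; [exact: cvg_cst|];
    rewrite (_ : (fun t => _) = fun t => f t * f t ^+ n); [exact: cvgM | apply/funext => ?; rewrite exprS].
rewrite /kernel; apply: cvgM.
  apply: cvgMr; apply: cX; by apply: cvgMr.
apply: cvgV; last by apply: cX.
by rewrite expf_neq0// gt_eqF// den_gt0.
Qed.

Lemma integrable_kernel k c : 0 <= c ->
  (@lebesgue_measure R).-integrable `[0, 1] (EFin \o kernel k c).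
Proof.
move=> c0; apply: continuous_compact_integrable; first exact: segment_compact.
exact: continuous_kernel.
Qed.

Let mI : measurable (`[0, 1] : set (measurableTypeR R)). Proof. exact: measurable_itv. Qed.

Lemma moment_ge0 k c : 0 <= c -> 0 <= moment k c.
Proof.
move=> c0; apply: Rintegral_ge0 => t /=; rewrite in_itv/= => /andP[t0 _].
exact: kernel_ge0.
Qed.

Lemma moment_le k c : 0 <= c -> moment k c <= moment 0 c.
Proof.
move=> c0; apply: le_Rintegral => //; try exact: integrable_kernel.
by move=> t /=; rewrite in_itv/= => /andP[t0 _]; exact: kernel_le.
Qed.

(** The denominator at c(1 + z) is den c t times 1 + s z, with s = 2 c t / den c t in [0, 1]. The
    expansion of 1 / (1 + s z) is thus uniform in c and t, which is the reason for relative
    increments. *)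
Lemma kernel_expand c t z : 0 <= c -> 0 <= t -> `|z| <= 2^-1 ->
  `|kernel 0 (c * (1 + z)) t - (kernel 0 c t - z * kernel 1 c t + z ^+ 2 * kernel 2 c t)|
  <= 2 * `|z| ^+ 3 * kernel 0 c t.
Proof.
move=> c0 t0 zb; have D0 := den_gt0 c0 t0.
pose s := 2 * c * t / den c t.
have s0 : 0 <= s by rewrite divr_ge0 ?(ltW D0) ?mulr_ge0.
have s1 : s <= 1 by rewrite ler_pdivrMr// mul1r /den addrAC lerDr addr_ge0 ?sqr_ge0.
have szb : `|s * z| <= 2^-1.
  rewrite normrM (ger0_norm s0); apply: le_trans zb.
  by rewrite ler_piMl.
have sz0 : 0 < 1 + s * z by move: szb; rewrite ler_norml => /andP[]; lra.
have DE : den (c * (1 + z)) t = den c t * (1 + s * z).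
  by rewrite /s /den; field; rewrite -/(den c t) gt_eqF.
have -> : kernel 0 (c * (1 + z)) t - (kernel 0 c t - z * kernel 1 c t + z ^+ 2 * kernel 2 c t) =
    kernel 0 c t * ((1 + s * z)^-1 - (1 + -1 * (s * z) + 1 * (s * z) ^+ 2)).
  rewrite /kernel DE /s; set D := den c t.
  field; rewrite -/D; rewrite (gt_eqF D0)/=.
  apply/eqP => E; move: sz0; rewrite /s -/D => sz0.
  move: (mulr_gt0 D0 sz0); rewrite mulrDr mulr1 -/D.
  by rewrite (_ : D * _ = 2 * c * t * z) ?E ?ltxx//; field; rewrite gt_eqF.
rewrite normrM (ger0_norm (kernel_ge0 _ c0 t0)) mulrC ler_wpM2r ?kernel_ge0//.
apply: (le_trans (inv_expand szb)); rewrite ler_wpM2l// lerXn2r ?nnegrE//.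
by rewrite normrM (ger0_norm s0) ler_piMl.
Qed.

Lemma moment_expand c z : 0 <= c -> `|z| <= 2^-1 ->
  `|moment 0 (c * (1 + z)) - (moment 0 c - z * moment 1 c + z ^+ 2 * moment 2 c)|
  <= 2 * `|z| ^+ 3 * moment 0 c.
Proof.
move=> c0 zb; have z1 : 0 <= 1 + z by move: zb; rewrite ler_norml => /andP[]; lra.
have cz0 : 0 <= c * (1 + z) by rewrite mulr_ge0.
have I k := integrable_kernel k c0; have I0 := integrable_kernel 0 cz0.
have iZ (a : R) (f : R -> R) : (@lebesgue_measure R).-integrable `[0, 1] (EFin \o f) ->
    (@lebesgue_measure R).-integrable `[0, 1] (EFin \o (fun t => a * f t)).
  by move=> If; exact: (integrableZl mI a If).
have iB (f g : R -> R) : (@lebesgue_measure R).-integrable `[0, 1] (EFin \o f) ->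
    (@lebesgue_measure R).-integrable `[0, 1] (EFin \o g) ->
    (@lebesgue_measure R).-integrable `[0, 1] (EFin \o (fun t => f t - g t)).
  by move=> If Ig; exact: (integrableB mI If Ig).
have iD (f g : R -> R) : (@lebesgue_measure R).-integrable `[0, 1] (EFin \o f) ->
    (@lebesgue_measure R).-integrable `[0, 1] (EFin \o g) ->
    (@lebesgue_measure R).-integrable `[0, 1] (EFin \o (fun t => f t + g t)).
  by move=> If Ig; exact: (integrableD mI If Ig).
have I1 := iB _ _ (I 0%N) (iZ z _ (I 1%N)).
have I2 := iD _ _ I1 (iZ (z ^+ 2) _ (I 2%N)).
have I3 := iB _ _ I0 I2.
rewrite /moment -!RintegralZl// -RintegralB//; last exact: iZ.
rewrite -RintegralD//; last exact: iZ.
rewrite -RintegralB//.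
apply: (le_trans (le_normr_Rintegral mI I3)).
apply: le_Rintegral => //.
- exact: (integrable_abse I3).
- exact: iZ.
- by move=> t /=; rewrite in_itv/= => /andP[t0 _]; exact: kernel_expand.
Qed.

Lemma measurable_moment (e : measure_display) (X : measurableType e) (c : X -> R) k :
  measurable_fun setT c -> (forall x, 0 <= c x) ->
  measurable_fun setT (fun x => moment k (c x)).
Proof.
move=> mc c0.
have mc1 : measurable_fun setT (fun z : X * measurableTypeR R => c z.1).
  have m1 : measurable_fun setT (@fst X (measurableTypeR R)) := measurable_fst.
  exact: (measurableT_comp mc m1).
have mK : measurable_fun setT (fun z : X * measurableTypeR R =>
    (((0 <= (z.2 : R))%R%:R * (((z.2 : R) <= 1)%R%:R * kernel k (c z.1) z.2))%:E)).
  by rewrite /kernel /den; meas; exact: mc1.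
rewrite /moment /Rintegral; apply: (measurableT_comp (fine_measurable _)) => //.
rewrite (_ : (fun x => _) = fun x => \int[@lebesgue_measure R]_t
   ((0 <= (t : R))%R%:R * (((t : R) <= 1)%R%:R * kernel k (c x) t))%:E)%E.
  have G0 (z : X * measurableTypeR R) :
      (0 <= ((0 <= (z.2 : R))%R%:R * (((z.2 : R) <= 1)%R%:R * kernel k (c z.1) z.2))%:E)%E.
    rewrite lee_fin; case: (lerP 0 (z.2 : R)) => t0; last by rewrite mul0r.
    by rewrite mul1r mulr_ge0// kernel_ge0.
  exact: (@measurable_fun_fubini_tonelli_F _ _ X (measurableTypeR R) R (@lebesgue_measure R) _ mK G0).
apply/funext => x; rewrite integral_mkcond; apply: eq_integral => t _.
rewrite patchE/= mem_setE in_itv/=.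
by case: (lerP 0 t) => //= t0; case: (lerP t 1) => //= t1; rewrite ?mul1r// ?mul0r ?mulr0.
Qed.

(** At c = cosh r the denominator factors as (t + exp r)(t + exp(-r)), and partial fractions give a
    logarithmic primitive. For r = 0 the root is double and the primitive is rational. *)
Lemma moment0_coshR r : 0 <= r -> moment 0 (coshR r) = (sinhc r)^-1.
Proof.
move=> r0; have c0 := ltW (coshR_gt0 r).
suff [F [dF F10]] : exists F : R -> R,
    (forall t : R, 0 <= t -> is_derive t 1 F (kernel 0 (coshR r) t)) /\
    F 1 - F 0 = (sinhc r)^-1.
  have cF (t : R) : 0 <= t -> {for t, continuous F}.
    move=> t0; have [D _] := dF t t0.
    by apply/differentiable_continuous; apply/derivable1_diffP.
  rewrite /moment /Rintegral (continuous_FTC2 (F := F)) ?ltr01//=.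
  - exact: continuous_kernel.
  - split.
    + by move=> t; rewrite in_itv/= => /andP[t0 _]; have [] := dF t (ltW t0).
    + exact: cvg_at_right_filter (cF 0 (lexx 0)).
    + exact: cvg_at_left_filter (cF 1 ler01).
  - move=> t; rewrite in_itv/= => /andP[t0 _].
    by rewrite derive1E; have [_ ->] := dF t (ltW t0).
have lnd (a t : R) : 0 < a -> 0 <= t -> is_derive t 1 (fun t => ln (t + a)) ((t + a)^-1).
  move=> a0 t0; have ta : 0 < t + a by rewrite ltr_wpDl.
  have d1 : is_derive (t : R) 1 (fun z => z + a) 1.
    by have := is_deriveD (is_derive_id t 1) (is_derive_cst a t 1);
       move/is_derive_eq; apply; rewrite addr0.
  have := @is_derive1_comp R (@ln R) (fun z => z + a) t _ _ (is_derive1_ln ta) d1.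
  by move/is_derive_eq; apply; rewrite mulr1.
have [r00|rn0] := eqVneq r 0.
  exists (fun t => - 2 * (t + 1)^-1); split; last by rewrite r00 /sinhc eqxx; field.
  move=> t t0; have t1 : t + 1 != 0 by rewrite gt_eqF// ltr_wpDl.
  have d1 : is_derive (t : R) 1 (fun z => z + 1) 1.
    by have := is_deriveD (is_derive_id t 1) (is_derive_cst (1 : R) t 1);
       move/is_derive_eq; apply; rewrite addr0.
  have d2 := is_deriveV (f := fun z : R => z + 1) t1 d1.
  have d3 : is_derive (t : R) 1 (fun z => - 2 * (z + 1)^-1) _ := is_deriveZ (- 2) d2.
  move: d3 => /is_derive_eq; apply.
  rewrite r00 coshR0 /kernel /den /GRing.scale/=.
  rewrite (_ : t ^+ 2 + 2 * 1 * t + 1 = (t + 1) ^+ 2); last by ring.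
  by field.
have rp : 0 < r by rewrite lt_neqAle eq_sym rn0.
have s0 := sinhR_gt0 rp.
exists (fun t => (sinhR r)^-1 * (ln (t + expR (- r)) - ln (t + expR r))); split.
  move=> t t0; have d1 := is_deriveB (lnd _ _ (expR_gt0 (- r)) t0) (lnd _ _ (expR_gt0 r) t0).
  have d2 : is_derive (t : R) 1 (fun t => (sinhR r)^-1 * (ln (t + expR (- r)) - ln (t + expR r))) _ :=
    is_deriveZ (sinhR r)^-1 d1.
  move: d2 => /is_derive_eq; apply; rewrite /GRing.scale/=.
  have E : expR r * expR (- r) = 1 by rewrite expRN mulfV// gt_eqF// expR_gt0.
  have a0 : 0 < t + expR (- r) by rewrite ltr_wpDl// expR_gt0.
  have b0 : 0 < t + expR r by rewrite ltr_wpDl// expR_gt0.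
  have DE : den (coshR r) t = (t + expR (- r)) * (t + expR r).
    have -> : (t + expR (- r)) * (t + expR r) =
        t ^+ 2 + t * (expR r + expR (- r)) + expR r * expR (- r) by ring.
    by rewrite E /den /coshR; field.
  rewrite /kernel DE expr0 expr1 mulr1 -[X in X / _](_ : (expR r - expR (- r)) / sinhR r = 2).
    by field; rewrite !gt_eqF.
  by rewrite /sinhR invf_div mulrCA mulfV ?mulr1//; move: s0; rewrite /sinhR => s0;
     apply/eqP => s00; rewrite s00 mul0r ltxx in s0.
transitivity ((sinhR r)^-1 * r); last first.
  by rewrite -sinhc_mul; field; rewrite rn0 gt_eqF// sinhc_gt0.
rewrite -mulrBr; congr *%R.
rewrite !add0r !expRK.
have -> : 1 + expR r = (1 + expR (- r)) * expR r.
  by rewrite mulrDl mul1r -expRD addNr expR0 addrC.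
have p0 : 0 < 1 + expR (- r) by rewrite ltr_pwDl// expR_ge0.
by rewrite lnM ?posrE ?expR_gt0// expRK; ring.
Qed.

End LogRatio.

(** The sign s = 1 serves the covariance and s = -1 its inverse, which is again an exponential; both
    are thus instances of [jet_mexp]. *)
Definition mat_rsubmx (R : realType) d (s : R) (u : 'rV[R]_(d + vdim d)) : 'M[R]_d :=
  s *: mat (rsubmx u).

Lemma mat_rsubmx_linear (R : realType) d (s : R) : linear (@mat_rsubmx R d s).
Proof.
move=> a u v; rewrite /mat_rsubmx linearP/= mat_linear scalerDr !scalerA.
by rewrite (mulrC s a).
Qed.

HB.instance Definition _ (R : realType) d (s : R) :=
  GRing.isLinear.Build R 'rV[R]_(d + vdim d) 'M[R]_d _ (@mat_rsubmx R d s)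
    (@mat_rsubmx_linear R d s).

Section ModelExpansion.
Variables (R : realType) (d : nat).
Variables (mu0 : 'rV[R]_d.+1) (Hm0 : hyperboloid mu0).
Variables (iota : {linear 'rV[R]_d -> 'rV[R]_d.+1}) (Hiota : tangent_isometry mu0 iota).
Variables (A : 'M[R]_d) (sA : Defs.symmetric A).
Notation X := 'rV[R]_d.+1.
Notation p := (d + vdim d)%N.
Implicit Types (x : X) (u : 'rV[R]_p).

Definition on_hyperboloid x : bool := (lorentz x x == -1) && (0 < x 0 0).

Lemma on_hyperboloidP x : reflect (hyperboloid x) (on_hyperboloid x).
Proof.
by apply: (iffP andP) => [[/eqP]|[->]] //; split => //; apply/eqP.
Qed.

(* Retraction used to define the coefficients at every point of the ambient space. *)
Definition retract x : X := if on_hyperboloid x then x else mu0.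

Lemma retract_hyperboloid x : hyperboloid (retract x).
Proof. by rewrite /retract; case: ifPn => // /on_hyperboloidP. Qed.

Lemma measurable_on_hyperboloid : measurable_fun setT on_hyperboloid.
Proof.
apply: measurable_and.
  by apply: measurable_fun_eqr; last exact: measurable_cst; apply: measurable_lorentz; meas.
by apply: measurable_fun_ltr; meas.
Qed.

Lemma measurable_retract : measurable_fun setT retract.
Proof.
apply: measurable_fun_ifT; [exact: measurable_on_hyperboloid|exact: measurable_id|].
exact: measurable_cst.
Qed.

Definition hradius x : R := enorm (Tcoord mu0 (retract x)).
Definition weight x : R := 1 + hradius x.
Definition lheight x : R := - lorentz mu0 (retract x).

Lemma radius_ge0 x : 0 <= hradius x. Proof. exact: enorm_ge0. Qed.

Lemma weight_ge1 x : 1 <= weight x.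
Proof. by rewrite lerDl radius_ge0. Qed.

Let w1 := weight_ge1.

Lemma measurable_radius : measurable_fun setT hradius.
Proof.
apply: measurable_enorm.
exact: (measurableT_comp (measurable_Tcoord Hm0) measurable_retract).
Qed.

Lemma measurable_lheight : measurable_fun setT lheight.
Proof.
by apply: measurable_funN; apply: measurable_lorentz; [meas|exact: measurable_retract].
Qed.

Lemma retract_chart x : retract x = chart mu0 (Tcoord mu0 (retract x)).
Proof.
have [z E] := chart_surj Hm0 (retract_hyperboloid x).
by rewrite {2}E Tcoord_chart.
Qed.

Lemma lheightE x : lheight x = coshR (hradius x).
Proof. by rewrite /lheight retract_chart chart_lorentz// opprK. Qed.

Lemma lheight_ge1 x : 1 <= lheight x.
Proof. by rewrite lheightE coshR_ge1. Qed.

Lemma lheight_gt0 x : 0 < lheight x.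
Proof. exact: lt_le_trans ltr01 (lheight_ge1 x). Qed.

(** The coordinates of x are not tempered, since they grow like the cosh of the distance. This
    linear bound is meant to be multiplied by [ratio], as [ratio] times [lheight] is at most twice
    the weight. *)
Lemma coord_lheight : exists2 C, 0 <= C & forall x j, `|retract x 0 j| <= C * lheight x.
Proof.
pose B := boost mu0; pose M := \sum_j `|mu0 0 j|.
have M0 : 0 <= M by exact: sumr_ge0.
exists (M + mnorm B); first by rewrite addr_ge0 ?mnorm_ge0.
move=> x j; rewrite retract_chart chart_expand// lheightE; set z := Tcoord mu0 _.
rewrite (_ : hradius x = enorm z)//; set r := enorm z.
have r0 : 0 <= r := enorm_ge0 z.
rewrite !mxE; apply: (le_trans (ler_normD _ _)); rewrite mulrDl; apply: lerD.
  rewrite normrM (gtr0_norm (coshR_gt0 _)) mulrC ler_wpM2r ?(ltW (coshR_gt0 _))//.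
  by rewrite /M (bigD1 j)//= lerDl sumr_ge0.
rewrite normrM (gtr0_norm (sinhc_gt0 _)).
have H : `|\sum_k of_coord z 0 k * B k j| <= r * mnorm B.
  apply: (le_trans (ler_norm_sum _ _ _)).
  apply: (@le_trans _ _ (\sum_k r * `|B k j|)).
    apply: ler_sum => k _; rewrite normrM ler_wpM2r//.
    rewrite of_coordE; case: (unliftP ord0 k) => [l|] ->; last by rewrite row_cons0 normr0.
    by rewrite row_consS /r le_enorm_coord.
  rewrite -mulr_sumr ler_wpM2l// /mnorm exchange_big/= [leRHS](bigD1 j)//= lerDl.
  by apply: sumr_ge0 => l _; exact: sumr_ge0.
apply: (le_trans (ler_wpM2l (ltW (sinhc_gt0 _)) H)).
rewrite mulrA sinhc_mul mulrC ler_wpM2l ?mnorm_ge0//.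
by rewrite -subr_ge0 (_ : _ - _ = expR (- r)) ?expR_ge0// /coshR /sinhR; field.
Qed.

Definition ratio x : R := moment 0 (lheight x).

Lemma ratioE x : ratio x = (sinhc (hradius x))^-1.
Proof. by rewrite /ratio lheightE moment0_coshR// radius_ge0. Qed.

Lemma ratio_gt0 x : 0 < ratio x.
Proof. by rewrite ratioE invr_gt0 sinhc_gt0. Qed.

Lemma ratio_le2 x : ratio x <= 2.
Proof.
rewrite ratioE -[2]invrK lef_pV2 ?posrE ?invr_gt0 ?sinhc_gt0//.
have r0 := radius_ge0 x; have [->|rn0] := eqVneq (hradius x) 0.
  by rewrite /sinhc eqxx; lra.
have rp : 0 < hradius x by rewrite lt_neqAle eq_sym rn0.
by rewrite -(ler_pM2r rp) sinhc_mul mulrC; exact: sinhR_ge_half.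
Qed.

Lemma ratio_lheight x : ratio x * lheight x <= 2 * weight x.
Proof.
have r0 := radius_ge0 x.
have c : lheight x <= sinhR (hradius x) + 1.
  rewrite lheightE -subr_ge0 (_ : _ - _ = 1 - expR (- hradius x)).
    by rewrite subr_ge0 -expR0 ler_expR oppr_le0.
  by rewrite /coshR /sinhR; field.
have g0 := ratio_gt0 x; have g2 := ratio_le2 x.
apply: (le_trans (ler_wpM2l (ltW g0) c)).
have E : ratio x * sinhR (hradius x) = hradius x.
  by rewrite ratioE -sinhc_mul mulKf// gt_eqF// sinhc_gt0.
rewrite mulrDr E mulr1 /weight; lra.
Qed.

Lemma measurable_ratio : measurable_fun setT ratio.
Proof.
by apply: measurable_moment; [exact: measurable_lheight | move=> x; exact: ltW (lheight_gt0 x)].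
Qed.

Lemma tempered_ratio_lheight : tempered weight (fun x => ratio x * lheight x).
Proof.
split; first by apply: measurable_funM; [exact: measurable_ratio|exact: measurable_lheight].
exists 2, 1%N => x; rewrite expr1 gtr0_norm ?mulr_gt0 ?ratio_gt0 ?lheight_gt0//.
exact: ratio_lheight.
Qed.

Lemma tempered_ratio_coord j : tempered weight (fun x => ratio x * retract x 0 j).
Proof.
split.
  apply: measurable_funM; first exact: measurable_ratio.
  by apply: measurable_rowE; exact: measurable_retract.
have [C C0 H] := coord_lheight.
exists (2 * C), 1%N => x; rewrite expr1 normrM gtr0_norm ?ratio_gt0//.
apply: (le_trans (ler_wpM2l (ltW (ratio_gt0 x)) (H x j))).
by rewrite mulrCA mulrC [leRHS]mulrAC ler_wpM2r// ratio_lheight.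
Qed.

Lemma tempered_ln_ratio : tempered weight (fun x => ln (ratio x)).
Proof.
split; first by apply: measurable_ln_comp; exact: measurable_ratio.
exists (1 + expR 1), 1%N => x; rewrite expr1 ratioE.
have r0 := radius_ge0 x; have s0 := sinhc_gt0 (hradius x).
have e0 : 0 < 1 + expR 1 :> R by rewrite addr_gt0 ?expR_gt0.
rewrite lnV ?posrE// normrN /weight; move: (hradius x) r0 s0 => r r0 s0.
have up : sinhc r <= (1 + expR 1) * expR r.
  have er : 1 <= expR r by rewrite -expR0 ler_expR.
  have [r1|r1] := lerP r 1.
    have := @sinhc_expand R r; rewrite (ger0_norm r0) => /(_ r1); rewrite ler_norml => /andP[_ H].
    apply: (@le_trans _ _ (1 + expR 1)); last by rewrite ler_peMr// ltW.
    have : expR 1 * r ^+ 2 <= expR 1 by rewrite ler_piMr ?expR_ge0// exprn_ile1.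
    lra.
  have sh : sinhc r <= sinhR r by rewrite -sinhc_mul ler_peMr ?ltW.
  have s2 : sinhR r <= expR r.
    by rewrite /sinhR; have := expR_ge0 (- r); have := expR_ge0 r; lra.
  apply: (le_trans sh); apply: (le_trans s2); rewrite ler_peMl ?expR_ge0// lerDl expR_ge0//.
have low : expR (- 1) <= sinhc r.
  have h : 2^-1 <= sinhc r.
    have [->|rn0] := eqVneq r 0; first by rewrite /sinhc eqxx; lra.
    have rp : 0 < r by rewrite lt_neqAle eq_sym rn0.
    by rewrite -(ler_pM2r rp) sinhc_mul mulrC; exact: sinhR_ge_half.
  apply: le_trans h; rewrite expRN lef_pV2 ?posrE ?expR_gt0//.
  by have := expR_ge1Dx (1 : R); lra.
rewrite ler_norml; apply/andP; split.
  apply: (@le_trans _ _ (- 1)); last first.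
    by rewrite -[- 1]expRK ler_ln ?posrE ?expR_gt0.
  rewrite lerN2 mulrDr mulr1; have := expR_ge0 (1 : R).
  have : 0 <= (1 + expR 1) * r by rewrite mulr_ge0 ?(ltW e0).
  lra.
have : ln (sinhc r) <= ln ((1 + expR 1) * expR r).
  by rewrite ler_ln ?posrE ?mulr_gt0 ?expR_gt0.
rewrite lnM ?posrE ?expR_gt0// expRK => H; apply: (le_trans H).
have : ln (1 + expR 1) <= expR 1 :> R by rewrite le_ln1Dx// (lt_le_trans _ (expR_ge0 _)) ?ltrN10.
have : 0 <= expR 1 * r by rewrite mulr_ge0 ?expR_ge0.
by rewrite mulrDr mulr1 mulrDl mul1r; lra.
Qed.

Definition theta0 : 'rV[R]_p := row_mx 0 (vech A).

Lemma tangent_iota a : tangent mu0 (iota a).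
Proof. by have [<- _] := Hiota; exists a. Qed.

Lemma tnorm_iota a : tnorm (iota a) = enorm a.
Proof. by have [_ H] := Hiota; rewrite /tnorm H. Qed.

Lemma mu_ofE theta : mu_of iota mu0 theta =
  coshR (enorm (lsubmx theta)) *: mu0 + sinhc (enorm (lsubmx theta)) *: iota (lsubmx theta).
Proof. by rewrite /mu_of ExpE// ?tnorm_iota//; exact: tangent_iota. Qed.

Lemma mu_of_hyperboloid theta : hyperboloid (mu_of iota mu0 theta).
Proof.
rewrite /mu_of; set v := iota _; have Tv : tangent mu0 v by exact: tangent_iota.
pose z := v *m invmx (boost mu0).
have vz : v = z *m boost mu0 by rewrite mulmxKV// boost_unit.
have z0 : z 0 0 = 0.
  have := Tv; rewrite /tangent/= vz -{1}(boost_origin mu0) boost_lorentz// lorentz_origin.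
  by move=> /eqP; rewrite oppr_eq0 => /eqP.
have zc : z = of_coord (row_behead z) by rewrite of_coordE -z0 row_consK.
by rewrite vz zc boost_coord// chartE//; exact: chart_hyperboloid.
Qed.

Lemma lsubmx_theta0D u : lsubmx (theta0 + u) = lsubmx u.
Proof. by rewrite /theta0 linearD/= row_mxKl add0r. Qed.

Lemma Sigma_ofE u : Sigma_of (theta0 + u) = mexp (A + mat (rsubmx u)).
Proof.
rewrite /Sigma_of /theta0 linearD/= row_mxKr -[vech A]scale1r mat_linear scale1r.
by rewrite mat_vech.
Qed.

Let mut u : X := mu_of iota mu0 (theta0 + u).

Lemma jet_mu j : jet weight (fun=> mu0 0 j) (fun _ u => mut u 0 j).
Proof.
have lL : linear_form weight (fun (_ : X) u => iota (lsubmx u) 0 j).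
  exists (fun i _ => iota (lsubmx (delta_mx 0 i : 'rV[R]_p)) 0 j).
    by move=> i; exact: tempered_cst.
  move=> x u; rewrite -[iota _]/((iota \o lsubmx) u) linear_delta summxE.
  by apply: eq_bigr => i _; rewrite mxE.
have J := jetD w1 (jetZ w1 (mu0 0 j) (jet_cosh d (vdim d) w1)) (jet_sinhc w1 lL).
apply: (jet_ext _ _ J) => x; first by rewrite mulr1 addr0.
by move=> u; rewrite /mut mu_ofE lsubmx_theta0D !mxE mulrC.
Qed.

(** The first-order relative variation of the cosh of the distance in the direction i. Numerator and
    denominator both grow like cosh, so it is bounded uniformly in x. *)
Let slope i x : R := - lorentz (iota (lsubmx (delta_mx 0 i : 'rV[R]_p))) (retract x) / lheight x.

Lemma slope_bound : exists C, forall i x, `|slope i x| <= C.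
Proof.
have [C C0 H] := coord_lheight.
exists (\sum_i \sum_j `|iota (lsubmx (delta_mx 0 i : 'rV[R]_p)) 0 j| * C) => i x.
rewrite (bigD1 i)//= ler_wpDr//.
  by apply: sumr_ge0 => l _; apply: sumr_ge0 => j _; rewrite mulr_ge0.
rewrite /slope; set v := iota _; have c0 := lheight_gt0 x.
rewrite normrM normrN normfV (gtr0_norm c0) ler_pdivrMr// mulr_suml /lorentz big_ord_recl.
apply: (le_trans (ler_normD _ _)); rewrite normrN; apply: lerD.
  by rewrite normrM -mulrA ler_wpM2l.
apply: (le_trans (ler_norm_sum _ _ _)); apply: ler_sum => j _.
by rewrite normrM -mulrA ler_wpM2l.
Qed.

(** The exact relative increment of the cosh of the distance when mu0 moves to the mean at u.
    Bounded slopes make it [small], so that the expansions of [moment] and [ln] apply simultaneously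
    at all x. *)
Let eta x u : R := (coshR (enorm (lsubmx u)) - 1) +
  sinhc (enorm (lsubmx u)) * (\sum_i u 0 i * slope i x).

Lemma lheight_eta x u : - lorentz (mut u) (retract x) = lheight x * (1 + eta x u).
Proof.
have c0 : lheight x != 0 by rewrite gt_eqF ?lheight_gt0.
rewrite /eta /mut mu_ofE lsubmx_theta0D lorentzDl !lorentzZl.
have -> : \sum_i u 0 i * slope i x = - lorentz (iota (lsubmx u)) (retract x) / lheight x.
  rewrite -[iota (lsubmx u)]/((iota \o lsubmx) u) linear_delta /slope.
  under eq_bigr do rewrite mulrA.
  rewrite -mulr_suml; congr (_ / _); under eq_bigr do rewrite mulrN.
  rewrite sumrN; congr (- _).
  have E (r : seq 'I_p) : \sum_(i <- r) u 0 i * lorentz (iota (lsubmx (delta_mx 0 i : 'rV[R]_p))) (retract x) =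
      lorentz (\sum_(i <- r) u 0 i *: (iota \o lsubmx) (delta_mx 0 i : 'rV[R]_p)) (retract x).
    elim: r => [|i r IH]; last by rewrite !big_cons IH lorentzDl lorentzZl.
    by rewrite !big_nil -[0 in RHS](scale0r (retract x)) lorentzZl mul0r.
  exact: E.
rewrite (_ : lorentz mu0 (retract x) = - lheight x); last by rewrite opprK.
by field.
Qed.

Let tempered_slope i : tempered weight (slope i).
Proof.
have [C H] := slope_bound; split; last by exists C, 0%N => x; rewrite mulr1.
apply: measurable_funM; last by apply: measurable_inv; exact: measurable_lheight.
by apply: measurable_funN; apply: measurable_lorentz; [meas|exact: measurable_retract].
Qed.

Let lform_slope : linear_form weight (fun x u => \sum_i u 0 i * slope i x).
Proof. by exists slope. Qed.

Let jet_eta : jet weight (fun=> 0) eta.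
Proof.
have J := jetD w1 (jetD w1 (jet_cosh d (vdim d) w1) (jet_tempered p (tempered_cst weight (- 1))))
  (jet_sinhc w1 lform_slope).
by apply: (jet_ext _ _ J) => x; rewrite ?subrr ?addr0.
Qed.

Let small_eta : small eta.
Proof.
have Jc : jet weight (fun=> 0) (fun (_ : X) (u : 'rV[R]_p) => coshR (enorm (lsubmx u)) - 1).
  have J := jetD w1 (jet_cosh d (vdim d) w1) (jet_tempered p (tempered_cst weight (- 1))).
  by apply: (jet_ext _ _ J) => x; rewrite ?subrr.
have s1 : small (fun (_ : X) (u : 'rV[R]_p) => coshR (enorm (lsubmx u)) - 1).
  by apply: (small_const w1 _ Jc).
have [C HC] := slope_bound.
have s2 : small (fun x (u : 'rV[R]_p) => \sum_i u 0 i * slope i x) by exact: small_linear HC.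
have s3 : small (fun (_ : X) (u : 'rV[R]_p) => sinhc (enorm (lsubmx u)) - 1).
  apply: (@small_vanish _ _ _ _ weight w1) => //.
  exists (expR 1), 0%N, 1; split; rewrite ?expR_ge0// => x u u1.
  have l1 := le_trans (enorm_lsubmx u) u1.
  have := @sinhc_expand R (enorm (lsubmx u)); rewrite [`|enorm _|]ger0_norm ?enorm_ge0// => /(_ l1).
  rewrite expr0 mulr1 => /le_trans; apply; rewrite ler_wpM2l ?expR_ge0// expr1.
  apply: le_trans (enorm_lsubmx u); rewrite expr2 ler_piMr ?enorm_ge0//.
have S := smallD s1 (smallD s2 (smallM s3 s2)).
move=> eps /S[dl dl0 H]; exists dl => // x u /(H x).
by rewrite /eta (_ : _ + (_ + _) = coshR (enorm (lsubmx u)) - 1 +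
  sinhc (enorm (lsubmx u)) * \sum_i u 0 i * slope i x)//; ring.
Qed.

Let factor x z : R := moment 0 (lheight x * (1 + z)) / ratio x.

Let factor_expand x z : `|z| <= 2^-1 ->
  `|factor x z - (1 + - (moment 1 (lheight x) / ratio x) * z +
     moment 2 (lheight x) / ratio x * z ^+ 2)| <= 2 * `|z| ^+ 3.
Proof.
move=> zb; have g0 := ratio_gt0 x; have c0 := ltW (lheight_gt0 x).
have := moment_expand c0 zb; rewrite -/(ratio x) => H.
have E (a : R) : `|a| * ratio x = `|a * ratio x| by rewrite normrM (gtr0_norm g0).
rewrite -(ler_pM2r g0) E.
by rewrite (_ : _ * ratio x = moment 0 (lheight x * (1 + z)) -
  (ratio x - z * moment 1 (lheight x) + z ^+ 2 * moment 2 (lheight x)))//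
  /factor; field; rewrite gt_eqF.
Qed.

Let moment_ratio k x : `|moment k (lheight x) / ratio x| <= 1.
Proof.
have g0 := ratio_gt0 x; have c0 := ltW (lheight_gt0 x).
rewrite ger0_norm ?divr_ge0 ?moment_ge0 ?(ltW g0)//.
by rewrite ler_pdivrMr// mul1r; exact: moment_le.
Qed.

Let tempered_moment_ratio k : tempered weight (fun x => moment k (lheight x) / ratio x).
Proof.
split; last by exists 1, 0%N => x; rewrite mulr1.
apply: measurable_funM; last by apply: measurable_inv; exact: measurable_ratio.
by apply: measurable_moment; [exact: measurable_lheight|move=> x; exact: ltW (lheight_gt0 x)].
Qed.

Let jet_factor : jet weight (fun=> 1) (fun x u => factor x (eta x u)).
Proof.
have t1 : tempered weight (fun x => - (moment 1 (lheight x) / ratio x)).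
  have T := temperedM w1 (tempered_cst weight (- 1)) (tempered_moment_ratio 1).
  by rewrite (_ : (fun x => - _) = fun x => -1 * (moment 1 (lheight x) / ratio x))//;
     apply/funext => x; rewrite mulN1r.
exact: (jet_comp w1 (tempered_cst weight 1) t1 (tempered_moment_ratio 2) jet_eta small_eta factor_expand).
Qed.

Let small_factor : small (fun x u => factor x (eta x u) - 1).
Proof.
apply: (@small_comp _ _ _ _ (fun x z => factor x z - 1) 3 eta small_eta) => x z zb.
have := factor_expand x zb; have m1 := moment_ratio 1 x; have m2 := moment_ratio 2 x.
move: (moment 1 _ / _) (moment 2 _ / _) m1 m2 => a b a1 b1 H.
have -> : factor x z - 1 = (factor x z - (1 + - a * z + b * z ^+ 2)) + (- a * z + b * z ^+ 2) by ring.
apply: (le_trans (ler_normD _ _)); apply: (le_trans (lerD H (ler_normD _ _))).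
rewrite (normrM (- a)) normrN (normrM b) normrX; have z0 := normr_ge0 z.
have h1 : `|a| * `|z| <= `|z| by rewrite ler_piMl.
have h2 : `|b| * `|z| ^+ 2 <= 2^-1 * `|z|.
  apply: (@le_trans _ _ (`|z| ^+ 2)); first by rewrite ler_piMl ?exprn_ge0.
  by rewrite expr2 ler_wpM2r.
have h3 : `|z| ^+ 3 <= 4^-1 * `|z|.
  rewrite exprSr ler_wpM2r// (_ : 4^-1 = 2^-1 ^+ 2); last by field.
  by rewrite lerXn2r ?nnegrE.
lra.
Qed.

Lemma ratio_at x u : (sinhc (arcosh (- lorentz (mut u) (retract x))))^-1 =
  ratio x * factor x (eta x u).
Proof.
have c1 : 1 <= - lorentz (mut u) (retract x).
  by rewrite lerNr; apply: lorentz_le_m1; [exact: mu_of_hyperboloid|exact: retract_hyperboloid].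
rewrite -moment0_coshR ?arcosh_ge0// arcoshK// lheight_eta /factor [RHS]mulrC divfK//.
by rewrite gt_eqF// ratio_gt0.
Qed.

(** Compares the distances from x to mu0 and to a nearby mean; the moments of the weight under
    nearby laws are bounded through it. *)
Lemma lheight_le : exists2 dl, 0 < dl & forall u x, enorm u <= dl ->
  lheight x <= 2 * - lorentz (mu_of iota mu0 (theta0 + u)) (retract x).
Proof.
have h0 : (0 : R) < 2^-1 by rewrite invr_gt0.
have [dl dl0 H] := small_eta h0; exists dl => // u x /(H x).
rewrite -/(mut u) lheight_eta ler_norml => /andP[e1 _].
have c0 := lheight_gt0 x.
have : 0 <= lheight x * (1 + 2 * eta x u) by rewrite mulr_ge0 ?(ltW c0)//; lra.
by rewrite mulrDr mulr1; lra.
Qed.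

(** The prefactor r / sinh r is distributed over the linear expression in x before any product of
    jets is taken: [ratio] times a coordinate and [ratio] times [lheight] are tempered, whereas
    their second factors alone are not. *)
Lemma jet_Tcoord j : jet weight (fun x => Tcoord (mut 0) (retract x) 0 j)
  (fun x u => Tcoord (mut u) (retract x) 0 j).
Proof.
have J1 k := jetM w1 (jet_tempered p (tempered_ratio_coord k)) jet_factor.
have J2 := jetM w1 (jet_tempered p tempered_ratio_lheight)
  (jetM w1 (jetD w1 (jet_tempered p (tempered_cst weight 1)) jet_eta) jet_factor).
have m0 : 0 < 1 + mu0 0 0 by rewrite addr_gt0// hyperboloid_neq.
have J3 : jet weight (fun=> 1 + mu0 0 0) (fun _ u => 1 + mut u 0 0).
  exact: (jetD w1 (jet_tempered p (tempered_cst weight 1)) (jet_mu 0)).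
have J4 := jet_inv w1 m0 J3.
have J5 := jetM w1 (jetM w1 (jetD w1 (J1 ord0) J2) J4) (jetZ w1 (- 1) (jet_mu (lift ord0 j))).
have J6 := jetD w1 (J1 (lift ord0 j)) J5.
apply: (jet_self (jet_ext (fun _ => erefl) _ J6)) => x u.
rewrite Tcoord_spatial; [|exact: mu_of_hyperboloid|exact: retract_hyperboloid].
have EZ (v : 'rV[R]_d) c : (c *: v) 0 j = c * v 0 j by rewrite mxE.
have EB (a b : 'rV[R]_d) c : (a - c *: b) 0 j = a 0 j - c * b 0 j by rewrite !mxE.
rewrite EZ ratio_at /spatial EB !row_beheadE.
rewrite -[X in (_ - X) / _]opprK lheight_eta.
have [] : 1 + mut u 0 0 != 0.
  by rewrite gt_eqF// addr_gt0// hyperboloid_neq//; exact: mu_of_hyperboloid.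
by rewrite -/(mut u) => m1; field.
Qed.

(** Here [phi] is minus the logarithm of r / sinh r, and the latter is [ratio] times [factor]; the
    logarithm of [ratio] is tempered and [factor] is uniformly close to 1. *)
Lemma jet_phi : jet weight (fun x => phi (Tcoord (mut 0) (retract x)))
  (fun x u => phi (Tcoord (mut u) (retract x))).
Proof.
have jz : jet weight (fun=> 0) (fun x u => factor x (eta x u) - 1).
  have J := jetD w1 jet_factor (jet_tempered p (tempered_cst weight (- 1))).
  by apply: (jet_ext _ _ J) => x; rewrite ?subrr.
have J := jet_comp w1 (tempered_cst weight 0) (tempered_cst weight 1) (tempered_cst weight (- 2^-1))
  jz small_factor (fun _ z => @ln_expand R z).
have J' := jetZ w1 (- 1) (jetD w1 (jet_tempered p tempered_ln_ratio) J).
apply: (jet_self (jet_ext (fun _ => erefl) _ J')) => x u.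
rewrite (addrC 1) subrK.
have Hm := mu_of_hyperboloid (theta0 + u); have Hx := retract_hyperboloid x.
have [z E] := chart_surj Hm Hx.
have RA := ratio_at x u; move: RA; rewrite /mut E Tcoord_chart// chart_lorentz// opprK.
rewrite arcosh_coshR ?enorm_ge0// => RA.
have f0 : 0 < factor x (eta x u).
  by rewrite -(pmulr_rgt0 _ (ratio_gt0 x)) -RA invr_gt0 sinhc_gt0.
rewrite -lnM ?posrE ?ratio_gt0// -RA lnV ?posrE ?sinhc_gt0// mulN1r opprK.
exact/esym/phi_sinhc.
Qed.

Lemma invmx_Sigma_of u : invmx (Sigma_of (theta0 + u)) = mexp (- A + mat_rsubmx (- 1) u).
Proof. by rewrite Sigma_ofE invmx_mexp opprD /mat_rsubmx scaleN1r. Qed.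

Lemma det_mexp_gt0 (B : 'M[R]_d) : Defs.symmetric B -> 0 < \det (mexp B).
Proof. by move=> sB; apply: (det_factor_gt0 (mexp_sqrt sB)); exact: mexp_unit. Qed.

Lemma jet_ln_det : jet weight (fun=> ln (\det (mexp A))) (fun _ u => ln (\det (Sigma_of (theta0 + u)))).
Proof.
apply: jet_ln; first exact: weight_ge1.
  exact: det_mexp_gt0.
have J i j := jet_mexp weight A (@mat_rsubmx R d 1 : {linear _ -> _}) i j.
have JD := jet_det (c := fun=> mexp A) (f := fun _ u => mexp (A + mat_rsubmx 1 u)) w1 J.
apply: (jet_ext _ _ JD) => //.
by move=> x u; rewrite Sigma_ofE /mat_rsubmx scale1r.
Qed.

Lemma jet_quad : jet weight
  (fun x => quad (invmx (Sigma_of (theta0 + 0))) (Tcoord (mut 0) (retract x)))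
  (fun x u => quad (invmx (Sigma_of (theta0 + u))) (Tcoord (mut u) (retract x))).
Proof.
have J i j := jet_mexp weight (- A) (@mat_rsubmx R d (- 1) : {linear _ -> _}) i j.
have J1 j := jet_sum w1 (index_enum _) (fun i => jetM w1 (jet_Tcoord i) (J i j)).
have J2 := jet_sum w1 (index_enum _) (fun j => jetM w1 (J1 j) (jet_Tcoord j)).
apply: (jet_self (jet_ext (fun _ => erefl) _ J2)) => x u.
rewrite /quad /dot; apply: eq_bigr => j _; rewrite mxE; congr (_ * _).
by apply: eq_bigr => i _; rewrite invmx_Sigma_of.
Qed.

Lemma jet_mdens : jet weight (mdens iota mu0 theta0) (fun x u => mdens iota mu0 (theta0 + u) x).
Proof.
(* Off the hyperboloid [Tcoord] is 0, so that only the determinant term of the log-density remains;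
   the indicator switches the other terms off and the jet holds on the whole ambient space. *)
have th : tempered weight (fun x => (on_hyperboloid x)%:R : R).
  split; last by exists 1, 0%N => x; rewrite mulr1; case: on_hyperboloid; rewrite ?normr1 ?normr0.
  by apply: measurable_bool_natmul; exact: measurable_on_hyperboloid.
have J := jetD w1 (jetZ w1 (- 2^-1) jet_ln_det)
  (jetM w1 (jet_tempered p th) (jetD w1 (jetZ w1 (- 2^-1) jet_quad) (jetZ w1 (1 - d%:R) jet_phi))).
have [c J'] : exists c, jet weight c (fun x u => mdens iota mu0 (theta0 + u) x).
  eexists; apply: (jet_ext (fun _ => erefl) _ J) => x u.
  rewrite /mdens /logdens -/(mut u) /retract.
  case: (boolP (on_hyperboloid x)) => Hx; first by rewrite mul1r; ring.
  rewrite mul0r (_ : Tcoord (mut u) x = 0); last first.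
    by apply: Tcoord_out; [exact: mu_of_hyperboloid|exact/on_hyperboloidP].
  rewrite /quad /phi eqxx mul0mx (_ : dot 0 0 = 0); last first.
    by rewrite /dot big1// => i _; rewrite mxE mul0r.
  by ring.
apply: (jet_ext _ (fun _ _ => erefl) (jet_self J')) => x.
by rewrite addr0.
Qed.

End ModelExpansion.

(** * Score identities and sample sums *)

Lemma measure_setT (R : realType) e (X : measurableType e) (P : probability X R) :
  (P : {measure set X -> \bar R}) setT = 1%E.
Proof. exact: probability_setT. Qed.

Section TemperedIntegrals.
Variables (R : realType) (e : measure_display) (X : measurableType e) (w : X -> R).
Hypotheses (mw : measurable_fun setT w) (w1 : forall x, 1 <= w x).
Variable P : probability X R.
Hypothesis mom : forall k, (\int[P]_x (w x ^+ k)%:E < +oo)%E.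

Lemma tempered_integrable c : tempered w c -> P.-integrable setT (EFin \o c).
Proof.
move=> tc; have [mc _] := tc; have [C [k [C0 H]]] := tempered_bound w1 tc.
apply: (@le_integrable _ _ _ P setT measurableT _ (fun x => C%:E * (w x ^+ k)%:E)%E).
- exact/measurable_EFinP.
- move=> x _; rewrite -EFinM !abse_EFin lee_fin.
  by apply: (le_trans (H x)); rewrite ler_norm.
apply: integrableZl => //; apply/integrableP; split.
  by apply/measurable_EFinP; apply: measurable_funX.
under eq_integral => x _ do rewrite abse_EFin ger0_norm ?(wX_ge0 w1)//.
exact: mom.
Qed.

Lemma tempered_norm c : tempered w c -> tempered w (fun x => `|c x|).
Proof.
move=> [mc [C [k H]]]; split; last by exists C, k => x; rewrite normr_id.
by apply: (measurableT_comp (@normr_measurable _ setT)).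
Qed.

Lemma tempered_wX k : tempered w (fun x => w x ^+ k).
Proof.
split; first by apply: measurable_funX.
by exists 1, k => x; rewrite mul1r ger0_norm// (wX_ge0 w1).
Qed.

Definition mean (c : X -> R) : R := \int[P]_x c x.

Lemma mean_ge0 c : (forall x, 0 <= c x) -> 0 <= mean c.
Proof. by move=> c0; exact: Rintegral_ge0. Qed.

Lemma meanD c c' : tempered w c -> tempered w c' ->
  mean (fun x => c x + c' x) = mean c + mean c'.
Proof. by move=> tc tc'; apply: RintegralD => //; exact: tempered_integrable. Qed.

Lemma meanZ a c : tempered w c -> mean (fun x => a * c x) = a * mean c.
Proof. by move=> tc; apply: RintegralZl => //; exact: tempered_integrable. Qed.

Lemma mean_cst a : mean (fun=> a) = a.
Proof. by rewrite /mean Rintegral_cst// measure_setT mulr1. Qed.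

Lemma mean_sum (I : Type) (r : seq I) (c : I -> X -> R) :
  (forall i, tempered w (c i)) ->
  mean (fun x => \sum_(i <- r) c i x) = \sum_(i <- r) mean (c i).
Proof.
move=> tc; elim: r => [|i r IH].
  by rewrite big_nil (_ : (fun x => _) = fun=> 0) ?mean_cst//; apply/funext => x; rewrite big_nil.
rewrite big_cons -IH -meanD//; last exact: tempered_sum.
by congr mean; apply/funext => x; rewrite big_cons.
Qed.

Lemma mean_le c c' : tempered w c -> tempered w c' -> (forall x, c x <= c' x) -> mean c <= mean c'.
Proof. by move=> tc tc' cc; apply: le_Rintegral => //; exact: tempered_integrable. Qed.

Lemma mean_norm c : tempered w c -> `|mean c| <= mean (fun x => `|c x|).
Proof. by move=> tc; apply: le_normr_Rintegral => //; exact: tempered_integrable. Qed.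

Lemma mean_EFin c : tempered w c -> ((mean c)%:E = \int[P]_x (c x)%:E)%E.
Proof.
move=> tc; rewrite /mean /Rintegral fineK//.
exact: integrable_fin_num (tempered_integrable tc).
Qed.

End TemperedIntegrals.

(** The factor 1 + exp y is shaped for the change of law: |y|^3 exp y under the base law is |y|^3
    under the neighbouring one. The constant is exp 1 for |y| <= 1, plus 3 to absorb 1, |y| and y^2
    when |y| > 1. *)
Lemma expR_expand_global (R : realType) (y : R) :
  `|expR y - 1 - y - 2^-1 * y ^+ 2| <= (expR 1 + 3) * (`|y| ^+ 3 * (1 + expR y)).
Proof.
have e0 := expR_ge0 y; have e1 := expR_ge0 (1 : R).
have n0 : 0 <= `|y| ^+ 3 by rewrite exprn_ge0.
have [y1|y1] := lerP `|y| 1.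
  apply: (le_trans (expR_expand y1)).
  apply: ler_pM => //; first by rewrite lerDl.
  by rewrite ler_peMr// lerDl.
have h1 : 1 <= `|y| by exact: ltW.
have h2 : `|y| <= `|y| ^+ 3 by rewrite ler_eXnr.
have h3 : `|y| ^+ 2 <= `|y| ^+ 3 by rewrite ler_weXn2l.
have h4 : 1 <= `|y| ^+ 3 by apply: (le_trans h1).
have h5 : expR y <= `|y| ^+ 3 * expR y by rewrite ler_peMl.
have b : `|expR y - 1 - y - 2^-1 * y ^+ 2| <= expR y + 1 + `|y| + `|y| ^+ 2.
  apply: (le_trans (ler_normB _ _)); apply: lerD; last first.
    rewrite normrM normrX ger0_norm ?invr_ge0//.
    by rewrite ler_piMl ?exprn_ge0// invf_le1// ler1n.
  apply: (le_trans (ler_normB _ _)); rewrite lerD2r.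
  by apply: (le_trans (ler_normB _ _)); rewrite normr1 ger0_norm.
apply: (le_trans b); rewrite mulrDl.
have : 0 <= expR 1 * (`|y| ^+ 3 * (1 + expR y)) by rewrite !mulr_ge0// addr_ge0.
have : 0 <= `|y| ^+ 3 * expR y by rewrite mulr_ge0.
by rewrite [`|y| ^+ 3 * (1 + _)]mulrDr mulr1; lra.
Qed.

(** * First and second order identities of the score *)

Section ScoreIdentities.
Variables (R : realType) (e : measure_display) (X : measurableType e) (w : X -> R) (p : nat).
Hypotheses (mw : measurable_fun setT w) (w1 : forall x, 1 <= w x).
Variables (P : 'rV[R]_p -> probability X R) (ell : X -> 'rV[R]_p -> R).
Variables (a : 'I_p -> X -> R) (b : 'I_p -> 'I_p -> X -> R).
Hypotheses (ta : forall i, tempered w (a i)) (tb : forall i j, tempered w (b i j)).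
Hypothesis mell : forall u, measurable_fun setT (ell ^~ u).
Hypothesis density : forall u (F : X -> \bar R), measurable_fun setT F ->
  (forall x, 0 <= F x)%E -> (\int[P u]_x F x = \int[P 0%R]_x (F x * (expR (ell x u))%:E))%E.
Let L x (u : 'rV[R]_p) := \sum_i u 0 i * a i x.
Let Q x (u : 'rV[R]_p) := \sum_i \sum_j u 0 i * u 0 j * b i j x.
Hypothesis expansion : vanish w 3 (fun x u => ell x u - (L x u + Q x u)).
Hypothesis moments : exists2 d : R, 0 < d & forall k, exists C : R, forall u, enorm u <= d ->
  (\int[P u]_x (w x ^+ k)%:E <= C%:E)%E.

Let mom0 k : (\int[P 0%R]_x (w x ^+ k)%:E < +oo)%E.
Proof.
have [d d0 H] := moments; have [C HC] := H k.
by apply: (le_lt_trans (HC 0 _)); rewrite ?ltry// enorm0 ltW.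
Qed.

Let E0 := mean (P 0).

Let tL u : tempered w (fun x => L x u).
Proof.
apply: tempered_sum => // i; apply: temperedM => //; exact: tempered_cst.
Qed.

Let tQ u : tempered w (fun x => Q x u).
Proof.
apply: tempered_sum => // i; apply: tempered_sum => // j; apply: temperedM => //.
exact: tempered_cst.
Qed.

Let lL : linear_form w L. Proof. by exists a. Qed.
Let qQ : quadratic_form w Q. Proof. by exists b. Qed.

Let ell_vanish : vanish w 1 ell.
Proof.
have O1 := vanishD w1 (linear_form_vanish w1 lL)
  (vanish_le w1 (isT : (1 <= 2)%N) (quadratic_form_vanish w1 qQ)).
by apply: vanish_ext (vanishD w1 O1 (vanish_le w1 (isT : (1 <= 3)%N) expansion)) => x u; ring.
Qed.

Lemma ell_tempered : exists2 d : R, 0 < d & forall u, enorm u <= d -> tempered w (ell ^~ u).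
Proof.
have [C [k [d [d0 C0 H]]]] := ell_vanish; exists d => // u ud; split; first exact: mell.
exists (C * enorm u), k => x; apply: (le_trans (H x u ud)).
by rewrite expr1 mulrAC.
Qed.

(** Since the likelihood ratio has mean 1, the mean of l + l^2/2 is minus that of the Taylor
    remainder of exp l. The two halves of the bound on this remainder are integrated under P 0 and P
    u, where polynomial moments of w suffice. *)
Lemma ell_mean : exists C d : R, 0 < d /\ forall u, enorm u <= d ->
  `|E0 (fun x => ell x u + 2^-1 * ell x u ^+ 2)| <= C * enorm u ^+ 3.
Proof.
have [d1 d10 M] := moments; have [d2 d20 T] := ell_tempered.
have [C [k [d3 [d30 C0 H]]]] := ell_vanish.
have [K HK] := M (3 * k)%N.
exists ((expR 1 + 3) * (C ^+ 3 * K *+ 2)), (Num.min d1 (Num.min d2 d3)).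
rewrite !lt_min d10 d20 d30; split => // u; rewrite !le_min => /and3P[u1 u2 u3].
have tl := T u u2.
have tl2 : tempered w (fun x => ell x u + 2^-1 * ell x u ^+ 2).
  apply: temperedD => //; apply: temperedM => //; first exact: tempered_cst.
  under eq_fun do rewrite expr2; exact: temperedM.
have ml := mell u.
have mE : measurable_fun setT (fun x => expR (ell x u)) by exact: measurable_expR_comp.
have iE1 : (\int[P 0%R]_x (expR (ell x u))%:E = 1)%E.
  transitivity (\int[P u]_x cst 1%E x)%E.
    by rewrite (density u)//; apply: eq_integral => x _; rewrite mul1e.
  by rewrite integral_cst// mul1e measure_setT.
have iE : (P 0).-integrable setT (EFin \o (fun x => expR (ell x u))).
  apply/integrableP; split; first exact/measurable_EFinP.
  rewrite (_ : (\int[P 0%R]_x _)%E = 1%E) ?ltry// -iE1.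
  by apply: eq_integral => x _; rewrite /= ger0_norm// expR_ge0.
have iM (f : X -> R) : tempered w f -> (P 0).-integrable setT (EFin \o f).
  exact: tempered_integrable.
have bound3 v (vd : enorm v <= d1) :
    (\int[P v]_x (`|ell x u| ^+ 3)%:E <= (C ^+ 3 * K * enorm u ^+ 3)%:E)%E.
  apply: (@le_trans _ _ (\int[P v]_x ((C ^+ 3 * enorm u ^+ 3)%:E * (w x ^+ (3 * k))%:E))%E).
    apply: ge0_le_integral => //.
    - apply/measurable_EFinP; apply: measurable_funX.
      by apply: (measurableT_comp (@normr_measurable _ setT)).
    - by apply: emeasurable_funM => //; apply/measurable_EFinP; exact: measurable_funX.
    move=> x _; rewrite -EFinM lee_fin.
    apply: (@le_trans _ _ ((C * w x ^+ k * enorm u) ^+ 3)).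
      rewrite lerXn2r ?nnegrE// ?mulr_ge0 ?(wX_ge0 w1) ?enorm_ge0//.
      by have := H x u u3; rewrite expr1.
    by rewrite !exprMn -exprM (mulnC k) mulrAC.
  rewrite ge0_integralZl//.
  - rewrite (_ : C ^+ 3 * K * enorm u ^+ 3 = (C ^+ 3 * enorm u ^+ 3) * K); last by ring.
    by rewrite [leRHS]EFinM lee_wpmul2l ?HK// lee_fin mulr_ge0 ?exprn_ge0 ?enorm_ge0.
  - by apply/measurable_EFinP; exact: measurable_funX.
  - by move=> x _; rewrite lee_fin (wX_ge0 w1).
  - by rewrite lee_fin mulr_ge0 ?exprn_ge0 ?enorm_ge0.
have d00 : enorm (0 : 'rV[R]_p) <= d1 by rewrite enorm0 ltW.
pose rem x := expR (ell x u) - 1 - ell x u - 2^-1 * ell x u ^+ 2.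
pose q x := 1 + (ell x u + 2^-1 * ell x u ^+ 2).
have tq : tempered w q by apply: temperedD => //; exact: tempered_cst.
have remE : rem = fun x => expR (ell x u) - q x.
  by apply/funext => x; rewrite /rem /q; ring.
have irem : (P 0).-integrable setT (EFin \o rem).
  rewrite remE (_ : EFin \o _ = ((EFin \o (fun x => expR (ell x u))) \- (EFin \o q))%E)//.
  by apply: integrableB => //; exact: iM.
have Erem : E0 (fun x => ell x u + 2^-1 * ell x u ^+ 2) = - (\int[P 0]_x rem x).
  rewrite remE RintegralB//; last exact: iM.
  rewrite {1}/Rintegral iE1 /= -/(mean (P 0) _) (meanD mw w1 mom0)//; last exact: tempered_cst.
  by rewrite mean_cst /E0; ring.
rewrite Erem normrN -lee_fin.
apply: (le_trans (y := (\int[P 0%R]_x (`|rem x|)%:E)%E)).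
  have := @le_normr_Rintegral _ _ _ (P 0) setT rem measurableT irem; rewrite -lee_fin => /le_trans; apply.
  rewrite /Rintegral fineK//; apply: integrable_fin_num => //.
  exact: integrable_abse irem.
have mnr : measurable_fun setT (fun x => (`|rem x|)%:E).
  apply/measurable_EFinP; apply: (measurableT_comp (@normr_measurable _ setT)).
  by rewrite /rem; apply: measurable_funB; [apply: measurable_funB;
    [exact: measurable_funB|]|apply: measurable_funM => //; exact: measurable_funX].
have m3 : measurable_fun setT (fun x => `|ell x u| ^+ 3).
  by apply: measurable_funX; apply: (measurableT_comp (@normr_measurable _ setT)).
have m3E : measurable_fun setT (fun x => (`|ell x u| ^+ 3)%:E) by exact/measurable_EFinP.
apply: (@le_trans _ _ (\int[P 0%R]_x ((expR 1 + 3)%:E *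
    ((`|ell x u| ^+ 3)%:E + (`|ell x u| ^+ 3)%:E * (expR (ell x u))%:E)))%E).
  apply: ge0_le_integral => //.
  - apply: emeasurable_funM => //; apply: emeasurable_funD; first exact: m3E.
    by apply: emeasurable_funM; [exact: m3E|exact/measurable_EFinP].
  - move=> x _; have := expR_expand_global (ell x u).
    by rewrite [`|ell x u| ^+ 3 * _]mulrDr mulr1 -lee_fin EFinM EFinD EFinM.
have n0 x : (0 <= (`|ell x u| ^+ 3)%:E :> \bar R)%E by rewrite lee_fin exprn_ge0.
have mp : measurable_fun setT (fun x => (`|ell x u| ^+ 3)%:E * (expR (ell x u))%:E)%E.
  by apply: emeasurable_funM; [exact: m3E|exact/measurable_EFinP].
have p0 x : (0 <= (`|ell x u| ^+ 3)%:E * (expR (ell x u))%:E :> \bar R)%E.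
  by rewrite mule_ge0// lee_fin expR_ge0.
have H2 := leeD (bound3 0 d00) (bound3 u u1).
have K0 : (0%:E <= (expR 1 + 3)%:E :> \bar R)%E by rewrite lee_fin addr_ge0 ?expR_ge0.
rewrite (ge0_integralZl _ _ _ _ K0)//; last 2 first.
- exact: emeasurable_funD.
- by move=> x _; exact: adde_ge0.
rewrite ge0_integralD// -density//; apply: (le_trans (lee_wpmul2l K0 H2)).
by rewrite -EFinD -EFinM lee_fin le_eqVlt; apply/orP; left; apply/eqP; ring.
Qed.

(** Reads off the coefficients of degrees 1 and 2 along a ray. It serves the score identities and,
    later, the first two Gaussian moments. *)
Lemma cubic_small_coef (A B C d : R) : 0 < d ->
  (forall t, 0 < t <= d -> `|t * A + t ^+ 2 * B| <= C * t ^+ 3) -> A = 0 /\ B = 0.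
Proof.
move=> d0 H.
have small0 (x K : R) : (forall t, 0 < t <= d -> `|x| <= K * t) -> x = 0.
  move=> Hx; apply/eqP; rewrite -normr_le0; apply/ler_addgt0Pl => eps e0; rewrite addr0.
  pose t := Num.min d (eps / (`|K| + 1)).
  have K0 : 0 < `|K| + 1 by rewrite ltr_wpDl.
  have t0 : 0 < t by rewrite lt_min d0 divr_gt0.
  have td : 0 < t <= d by rewrite t0 ge_min lexx.
  apply: (le_trans (Hx t td)).
  apply: (@le_trans _ _ ((`|K| + 1) * t)).
    by rewrite ler_wpM2r ?(ltW t0)// (le_trans (ler_norm K))// lerDl.
  by rewrite mulrC -ler_pdivlMr// /t ge_min lexx orbT.
have A0 : A = 0.
  apply: (@small0 A (`|C| * d + `|B|)) => t /andP[t0 td].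
  have := H t _; rewrite t0 td => /(_ isT) Ht.
  have {}Ht : `|A + t * B| <= C * t ^+ 2.
    by rewrite -(ler_pM2l t0) -[X in X * _ <= _](gtr0_norm t0) -normrM mulrDr mulrA -expr2
      (le_trans Ht)// exprSr mulrA mulrC.
  have -> : A = (A + t * B) - t * B by ring.
  apply: (le_trans (ler_normB _ _)); rewrite mulrDl; apply: lerD; last first.
    by rewrite normrM (gtr0_norm t0) mulrC.
  apply: (le_trans Ht); rewrite expr2 mulrA ler_wpM2r ?(ltW t0)//.
  apply: (@le_trans _ _ (`|C| * t)); first by rewrite ler_wpM2r ?(ltW t0)// ler_norm.
  by rewrite ler_wpM2l.
split => //; apply: (@small0 B C) => t /andP[t0 td].
have := H t _; rewrite t0 td A0 mulr0 add0r => /(_ isT).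
rewrite normrM normrX (gtr0_norm t0) => Ht.
have t2 : 0 < t ^+ 2 by rewrite exprn_gt0.
by rewrite -(ler_pM2l t2) (le_trans Ht)// exprSr mulrCA.
Qed.

Lemma score_identities_at u :
  E0 (fun x => L x u) = 0 /\ E0 (fun x => Q x u + 2^-1 * L x u ^+ 2) = 0.
Proof.
have OL := linear_form_vanish w1 lL; have OQ := quadratic_form_vanish w1 qQ.
have Or : vanish w 3 (fun x u => (ell x u + 2^-1 * ell x u ^+ 2) - (L x u + (Q x u + 2^-1 * L x u ^+ 2))).
  have O2 := vanishD w1 OQ (vanish_le w1 (isT : (2 <= 3)%N) expansion).
  (* The difference l^2 - L^2 is factored as (l - L)(l + L), of orders 2 and 1, with l - L written
     as Q plus the cubic error. *)
  have O3 : vanish w 3 (fun x u => (Q x u + (ell x u - (L x u + Q x u))) * (ell x u + L x u)).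
    exact: (vanishM O2 (vanishD w1 ell_vanish OL)).
  have O4 : vanish w 3 (fun x u => 2^-1 * ((Q x u + (ell x u - (L x u + Q x u))) * (ell x u + L x u))).
    have Oc : vanish w 0 (fun (_ : X) (_ : 'rV[R]_p) => 2^-1).
      by apply: vanish_tempered => //; exact: tempered_cst.
    exact: (vanishM Oc O3).
  by apply: vanish_ext (vanishD w1 expansion O4) => x v; field.
have [C1 [d1 [d10 H1]]] := ell_mean; have [d2 d20 T] := ell_tempered.
have [C [k [d3 [d30 C0 H]]]] := Or.
pose K := mean (P 0) (fun x => w x ^+ k).
pose N := enorm u + 1; have N0 : 0 < N by rewrite ltr_wpDl ?enorm_ge0.
pose dm := Num.min d1 (Num.min d2 d3) / N.
have dm0 : 0 < dm by rewrite divr_gt0// !lt_min d10 d20 d30.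
apply: (@cubic_small_coef _ _ ((C1 + C * K) * enorm u ^+ 3) dm) => // t /andP[t0 td].
have tu : enorm (t *: u) <= Num.min d1 (Num.min d2 d3).
  rewrite enormZ (gtr0_norm t0); apply: (@le_trans _ _ (dm * N)).
    by rewrite ler_pM ?enorm_ge0 ?(ltW t0)// lerDl.
  by rewrite divfK// gt_eqF.
move: tu; rewrite !le_min => /and3P[tu1 tu2 tu3].
have LE x : L x (t *: u) = t * L x u.
  by rewrite /L mulr_sumr; apply: eq_bigr => i _; rewrite mxE mulrA.
have QE x : Q x (t *: u) = t ^+ 2 * Q x u.
  rewrite /Q mulr_sumr; apply: eq_bigr => i _; rewrite mulr_sumr; apply: eq_bigr => j _.
  by rewrite !mxE; ring.
have tQL : tempered w (fun x => Q x u + 2^-1 * L x u ^+ 2).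
  apply: temperedD => //; apply: temperedM => //; first exact: tempered_cst.
  by under eq_fun do rewrite expr2; exact: temperedM.
have tl := T _ tu2.
have tl2 : tempered w (fun x => ell x (t *: u) + 2^-1 * ell x (t *: u) ^+ 2).
  apply: temperedD => //; apply: temperedM => //; first exact: tempered_cst.
  by under eq_fun do rewrite expr2; exact: temperedM.
have tLQ : tempered w (fun x => L x (t *: u) + (Q x (t *: u) + 2^-1 * L x (t *: u) ^+ 2)).
  apply: temperedD => //; apply: temperedD => //; apply: temperedM => //; first exact: tempered_cst.
  by under eq_fun do rewrite expr2; exact: temperedM.
have E : t * E0 (fun x => L x u) + t ^+ 2 * E0 (fun x => Q x u + 2^-1 * L x u ^+ 2) =
    E0 (fun x => L x (t *: u) + (Q x (t *: u) + 2^-1 * L x (t *: u) ^+ 2)).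
  rewrite /E0 -!(meanZ mw w1 mom0)// -(meanD mw w1 mom0); last 2 first.
  - by apply: temperedM => //; exact: tempered_cst.
  - by apply: temperedM => //; exact: tempered_cst.
  by congr mean; apply/funext => x; rewrite LE QE; ring.
rewrite E.
have := H1 _ tu1; rewrite enormZ (gtr0_norm t0) => {}H1.
pose r x := (ell x (t *: u) + 2^-1 * ell x (t *: u) ^+ 2) -
   (L x (t *: u) + (Q x (t *: u) + 2^-1 * L x (t *: u) ^+ 2)).
have tr : tempered w r.
  rewrite (_ : r = fun x => (ell x (t *: u) + 2^-1 * ell x (t *: u) ^+ 2) +
   -1 * (L x (t *: u) + (Q x (t *: u) + 2^-1 * L x (t *: u) ^+ 2))); last first.
    by apply/funext => x; rewrite mulN1r.
  by apply: temperedD => //; apply: temperedM => //; exact: tempered_cst.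
have -> : E0 (fun x => L x (t *: u) + (Q x (t *: u) + 2^-1 * L x (t *: u) ^+ 2)) =
    E0 (fun x => ell x (t *: u) + 2^-1 * ell x (t *: u) ^+ 2) + -1 * E0 r.
  rewrite /E0 -(meanZ mw w1 mom0)// -(meanD mw w1 mom0)//; last by apply: temperedM => //; exact: tempered_cst.
  by congr mean; apply/funext => x; rewrite /r; ring.
apply: (le_trans (ler_normD _ _)); rewrite normrM normrN1 mul1r.
have Hr : `|E0 r| <= C * K * (t * enorm u) ^+ 3.
  apply: (le_trans (mean_norm mw w1 mom0 tr)).
  apply: (@le_trans _ _ (mean (P 0) (fun x => C * (t * enorm u) ^+ 3 * w x ^+ k))).
    apply: (mean_le mw w1 mom0); [exact: tempered_norm| |].
      by apply: temperedM => //; [exact: tempered_cst|exact: tempered_wX].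
    move=> x; have := H x _ tu3; rewrite enormZ (gtr0_norm t0) => /le_trans; apply.
    by rewrite mulrAC.
  by rewrite (meanZ mw w1 mom0)// /K; [rewrite mulrAC|exact: tempered_wX].
apply: (le_trans (lerD H1 Hr)).
by rewrite (_ : C1 * (t * enorm u) ^+ 3 + _ = (C1 + C * K) * enorm u ^+ 3 * t ^+ 3)//; ring.
Qed.

Lemma mean_score i : E0 (a i) = 0.
Proof.
have [H _] := score_identities_at (delta_mx 0 i); rewrite -H; congr mean.
apply/funext => x; rewrite /L (bigD1 i)//= big1 ?addr0.
  by rewrite mxE !eqxx mul1r.
by move=> j ji; rewrite mxE eqxx (negbTE ji) mul0r.
Qed.

Lemma mean_second u : E0 (fun x => Q x u) = - (2^-1 * E0 (fun x => L x u ^+ 2)).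
Proof.
have [_] := score_identities_at u; rewrite /E0.
have tL2 : tempered w (fun x => L x u ^+ 2) by under eq_fun do rewrite expr2; exact: temperedM.
rewrite (meanD mw w1 mom0)//; last by apply: temperedM => //; exact: tempered_cst.
by rewrite (meanZ mw w1 mom0)// => /eqP; rewrite addr_eq0 => /eqP.
Qed.

End ScoreIdentities.

(** * Sums over an independent sample *)

Section SampleSums.
Variables (R : realType) (e : measure_display) (X : measurableType e) (P : probability X R).
Local Open Scope ereal_scope.

Lemma measurable_sample_sum n (f : X -> R) : measurable_fun setT f ->
  measurable_fun setT (fun t : n.-tuple X => \sum_(i < n) f (tnth t i))%R.
Proof.
move=> mf; apply: measurable_rsum => i.
by apply: (measurableT_comp mf); exact: measurable_tnth.
Qed.

Lemma sample_sum_cons n (f : X -> R) x (t : n.-tuple X) :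
  (\sum_(i < n.+1) f (tnth [tuple of x :: t] i) = f x + \sum_(i < n) f (tnth t i))%R.
Proof.
by rewrite big_ord_recl tnth0; congr (_ + _)%R; apply: eq_bigr => i _; rewrite tnthS.
Qed.

(** The shift c makes the induction work: the observation that is peeled off joins it, and its cross
    term integrates to 0 by centring. *)
Lemma integral_sample_sqr n (f : X -> R) (c : R) : measurable_fun setT f ->
  P.-integrable setT (EFin \o f) -> P.-integrable setT (EFin \o (fun x => f x ^+ 2)%R) ->
  (\int[P]_x f x = 0)%R ->
  \int[prodprob P n]_t ((c + \sum_(i < n) f (tnth t i)) ^+ 2)%:E =
  (c ^+ 2 + n%:R * \int[P]_x (f x ^+ 2))%:E.
Proof.
move=> mf If If2 f0; elim: n c => [|n IH] c.
  rewrite integral_prodprob0; first by rewrite big_ord0 addr0 mul0r addr0.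
  apply/measurable_EFinP; apply: measurable_funX; apply: measurable_funD => //.
  exact: measurable_sample_sum.
rewrite integral_prodprobS; last 2 first.
- apply/measurable_EFinP; apply: measurable_funX; apply: measurable_funD => //.
  exact: measurable_sample_sum.
- by move=> t; rewrite lee_fin sqr_ge0.
pose s2 := (\int[P]_x (f x ^+ 2))%R.
transitivity (\int[P]_x ((c ^+ 2 + n%:R * s2)%:E + ((2 * c)%:E * (f x)%:E + (f x ^+ 2)%:E))).
  apply: eq_integral => x _; under eq_integral => t _ do rewrite sample_sum_cons addrA.
  by rewrite IH -/s2 -!EFinM -!EFinD; congr EFin; ring.
have Ic : P.-integrable setT (fun x => (2 * c)%:E * (EFin \o f) x) by exact: integrableZl.
have fin : \int[P]_x (f x ^+ 2)%:E = s2%:E.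
  by rewrite /s2 /Rintegral fineK//; exact: integrable_fin_num If2.
have fin0 : \int[P]_x (f x)%:E = 0.
  by rewrite -[RHS]/(0%:E) -f0 /Rintegral fineK//; exact: integrable_fin_num If.
rewrite integralD//; last 2 first.
- by apply/integrableP; split => //; rewrite integral_cst// measure_setT mule1 ltry.
- exact: integrableD.
rewrite integral_cst// measure_setT mule1 integralD// integralZl// fin fin0 mule0 add0e.
by rewrite -EFinD -natr1 mulrDl mul1r addrA.
Qed.

Lemma integral_sample_sum n (g : X -> R) (c : R) : measurable_fun setT g ->
  (forall x, 0 <= g x)%R -> (0 <= c)%R ->
  \int[prodprob P n]_t (c + \sum_(i < n) g (tnth t i))%:E =
  c%:E + n%:R%:E * \int[P]_x (g x)%:E.
Proof.
move=> mg g0; elim: n c => [|n IH] c c0.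
  rewrite integral_prodprob0; first by rewrite big_ord0 addr0 mul0e adde0.
  apply/measurable_EFinP; apply: measurable_funD => //; exact: measurable_sample_sum.
rewrite integral_prodprobS; last 2 first.
- apply/measurable_EFinP; apply: measurable_funD => //; exact: measurable_sample_sum.
- by move=> t; rewrite lee_fin addr_ge0// sumr_ge0.
have I0 : 0 <= \int[P]_x (g x)%:E by apply: integral_ge0 => x _; rewrite lee_fin.
transitivity (\int[P]_x ((c%:E + n%:R%:E * \int[P]_x (g x)%:E) + (g x)%:E)).
  apply: eq_integral => x _; under eq_integral => t _ do rewrite sample_sum_cons addrA.
  by rewrite IH ?addr_ge0// EFinD addeAC.
rewrite ge0_integralD//; last 3 first.
- by move=> x _; rewrite adde_ge0 ?mule_ge0 ?lee_fin.
- by move=> x _; rewrite lee_fin.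
- exact/measurable_EFinP.
rewrite integral_cst// measure_setT mule1 -addeA; congr (_ + _).
by rewrite -natr1 EFinD ge0_muleDl ?lee_fin// mul1e.
Qed.

Lemma measurable_integral_cons n (F : n.+1.-tuple X -> \bar R) :
  measurable_fun setT F -> (forall t, 0 <= F t) ->
  measurable_fun setT (fun x => \int[prodprob P n]_t F [tuple of x :: t]).
Proof.
move=> mF F0.
apply: (@measurable_fun_fubini_tonelli_F _ _ X (n.-tuple X) R (prodprob P n)
  (fun z => F [tuple of z.1 :: z.2])) => //.
by apply: (measurableT_comp mF); exact: measurable_cons measurable_fst measurable_snd.
Qed.

End SampleSums.

Section SampleDensity.
Variables (R : realType) (e : measure_display) (X : measurableType e) (P Q : probability X R).
Variables (ell : X -> R).
Hypothesis mell : measurable_fun setT ell.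
Hypothesis density : forall (F : X -> \bar R), measurable_fun setT F ->
  (forall x, 0 <= F x)%E -> (\int[Q]_x F x = \int[P]_x (F x * (expR (ell x))%:E))%E.
Local Open Scope ereal_scope.

Lemma sample_density n (F : n.-tuple X -> \bar R) : measurable_fun setT F ->
  (forall t, 0 <= F t) ->
  \int[prodprob Q n]_t F t =
  \int[prodprob P n]_t (F t * (expR (\sum_(i < n) ell (tnth t i)))%:E).
Proof.
have mE m : measurable_fun setT (fun t : m.-tuple X => (expR (\sum_(i < m) ell (tnth t i)))%:E).
  by apply/measurable_EFinP; apply: measurable_expR_comp; exact: measurable_sample_sum.
elim: n F => [|n IH] F mF F0.
  rewrite !integral_prodprob0//; first by rewrite big_ord0 expR0 mule1.
  by apply: emeasurable_funM => //; exact: (mE 0%N).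
rewrite !integral_prodprobS//; last 2 first.
- by apply: emeasurable_funM => //; exact: (mE n.+1).
- by move=> t; rewrite mule_ge0// lee_fin expR_ge0.
have mFx x : measurable_fun setT (fun t : n.-tuple X => F [tuple of x :: t]).
  by apply: (measurableT_comp mF); exact: measurable_cons_tuple.
rewrite density; last 2 first.
- exact: measurable_integral_cons.
- by move=> x; exact: integral_ge0.
apply: eq_integral => x _; rewrite IH//.
have mm : measurable_fun setT (fun t : n.-tuple X =>
    F [tuple of x :: t] * (expR (\sum_(i < n) ell (tnth t i)))%:E).
  by apply: emeasurable_funM => //; exact: (mE n).
have pp (t : n.-tuple X) : setT t -> 0 <= F [tuple of x :: t] * (expR (\sum_(i < n) ell (tnth t i)))%:E.
  by move=> _; rewrite mule_ge0// lee_fin expR_ge0.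
have ee : 0 <= (expR (ell x))%:E :> \bar R by rewrite lee_fin expR_ge0.
rewrite -(ge0_integralZr _ measurableT mm pp ee).
apply: eq_integral => t _; rewrite sample_sum_cons -muleA -EFinM; congr (_ * _%:E).
by rewrite expRD mulrC.
Qed.

(** Tested on indicators, the density identity identifies the Radon-Nikodym derivative almost
    everywhere with a positive exponential, whose extended logarithm is the finite sum. *)
Lemma sample_RN n : prodprob Q n `<< prodprob P n /\
  {ae prodprob P n, forall t, lne (('d (charge_of_finite_measure (prodprob Q n)) '/d (prodprob P n)) t)
     = (\sum_(i < n) ell (tnth t i))%:E}.
Proof.
pose g (t : n.-tuple X) := (expR (\sum_(i < n) ell (tnth t i)))%:E.
have mg : measurable_fun setT g.
  by apply/measurable_EFinP; apply: measurable_expR_comp; exact: measurable_sample_sum.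
have g0 t : 0 <= g t by rewrite lee_fin expR_ge0.
have QE A : measurable A -> prodprob Q n A = \int[prodprob P n]_(t in A) g t.
  move=> mA.
  have mI : measurable_fun setT (EFin \o (\1_A : n.-tuple X -> R)).
    by apply/measurable_EFinP; exact: measurable_indic.
  transitivity (\int[prodprob Q n]_t (EFin \o (\1_A : n.-tuple X -> R)) t).
    by rewrite integral_indic// setIT.
  rewrite sample_density//; last by move=> t; rewrite lee_fin.
  rewrite [RHS]integral_mkcond epatch_indic; apply: eq_integral => t _.
  by rewrite /= muleC.
have dom : prodprob Q n `<< prodprob P n.
  apply/null_content_dominatesP => A mA PA0.
  rewrite QE//; apply: null_set_integral => //; exact: measurable_funTS.
split => //.
have dom' : charge_of_finite_measure (prodprob Q n) `<< prodprob P n by exact: dom.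
have : ae_eq (prodprob P n) setT ('d (charge_of_finite_measure (prodprob Q n)) '/d (prodprob P n)) g.
  apply: integral_ae_eq => //; first exact: Radon_Nikodym_integrable.
  move=> E _ mE; rewrite -Radon_Nikodym_integral//; exact: QE.
apply: filterS => t /(_ I) ->.
by rewrite /g lne_EFin ?expR_gt0// expRK.
Qed.

End SampleDensity.

Section Monotone.
Variables (R : realType).
Local Open Scope ereal_scope.

(** No measurability is assumed: the integral of a nonnegative function is a supremum over the
    simple functions below it. *)
Lemma ge0_integral_mono e (X : measurableType e) (m : {measure set X -> \bar R}) (f g : X -> \bar R) :
  (forall x, 0 <= f x) -> (forall x, f x <= g x) -> \int[m]_x f x <= \int[m]_x g x.
Proof.
move=> f0 fg; have g0 x : 0 <= g x := le_trans (f0 x) (fg x).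
rewrite !ge0_integralTE//; apply: ereal_sup_le => _ [h hf <-]; exists h => //.
by move=> x; exact: le_trans (hf x) (fg x).
Qed.

(** Valid for arbitrary sets, because the product is computed as an iterated integral of sections.
    It is applied to the event that some h makes the remainder large. *)
Lemma prodprob_mono e (X : measurableType e) (P : probability X R) n (A B : set (n.-tuple X)) :
  A `<=` B -> prodprob P n A <= prodprob P n B.
Proof.
elim: n A B => [|n IH] A B AB /=.
  rewrite /dirac/= !indicE lee_fin ler_nat.
  by case: (boolP (_ \in A)) => // /set_mem /AB /mem_set ->.
rewrite /pushforward /product_measure1/=.
apply: ge0_integral_mono => // x; apply: IH => t.
by rewrite /xsection/= !inE => /AB.
Qed.

Lemma prodprob_markov e (X : measurableType e) (P : probability X R) n (A : set (n.-tuple X))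
    (Z : n.-tuple X -> R) (eps K : R) : measurable_fun setT Z -> (forall t, 0 <= Z t)%R ->
  (0 < eps)%R -> (forall t, A t -> eps < Z t)%R -> \int[prodprob P n]_t (Z t)%:E <= K%:E ->
  prodprob P n A <= (K / eps)%:E.
Proof.
move=> mZ Z0 e0 AZ ZK.
pose B := [set t | (eps < Z t)%R].
have mB : measurable B.
  rewrite (_ : B = setT `&` Z @^-1` `]eps, +oo[%classic); last first.
    by apply/seteqP; split => t /=; rewrite in_itv/= andbT => // -[].
  by apply: mZ => //; exact: measurable_itv.
apply: (le_trans (prodprob_mono _ (AZ : A `<=` B))).
have -> : prodprob P n B = \int[prodprob P n]_t (\1_B t)%:E by rewrite integral_indic// setIT.
apply: (@le_trans _ _ (\int[prodprob P n]_t ((eps^-1)%:E * (Z t)%:E))).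
  apply: ge0_le_integral => //.
  - by apply/measurable_EFinP; exact: measurable_indic.
  - by apply: emeasurable_funM => //; exact/measurable_EFinP.
  move=> t _; rewrite -EFinM lee_fin indicE; case: (boolP (t \in B)) => [/set_mem Bt|_] /=.
    by rewrite mulrC ler_pdivlMr// mul1r ltW.
  by rewrite mulr_ge0// invr_ge0 ltW.
rewrite ge0_integralZl//; last 3 first.
- exact/measurable_EFinP.
- by move=> t _; rewrite lee_fin.
- by rewrite lee_fin invr_ge0 ltW.
by rewrite mulrC EFinM lee_wpmul2l// lee_fin invr_ge0 ltW.
Qed.

End Monotone.

(** * The LAN remainder *)

Section LANBound.
Variables (R : realType) (e : measure_display) (X : measurableType e) (w : X -> R) (p : nat).
Hypotheses (mw : measurable_fun setT w) (w1 : forall x, 1 <= w x).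
Variables (P : probability X R) (ell : X -> 'rV[R]_p -> R).
Variables (a : 'I_p -> X -> R) (b : 'I_p -> 'I_p -> X -> R).
Hypotheses (ta : forall i, tempered w (a i)) (tb : forall i j, tempered w (b i j)).
Let L x (u : 'rV[R]_p) := \sum_i u 0 i * a i x.
Let Q x (u : 'rV[R]_p) := \sum_i \sum_j u 0 i * u 0 j * b i j x.
Hypothesis expansion : vanish w 3 (fun x u => ell x u - (L x u + Q x u)).
Hypothesis mom : forall k, (\int[P]_x (w x ^+ k)%:E < +oo)%E.
Hypothesis second : forall u, mean P (fun x => Q x u) = - (2^-1 * mean P (fun x => L x u ^+ 2)).

Let bc j k x := b j k x - mean P (b j k).

Let tbc j k : tempered w (bc j k).
Proof.
rewrite (_ : bc j k = fun x => b j k x + - mean P (b j k))//.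
by apply: temperedD => //; exact: tempered_cst.
Qed.

Let bc0 j k : \int[P]_x bc j k x = 0.
Proof.
rewrite -[LHS]/(mean P (bc j k)) /bc (meanD mw w1 mom) ?mean_cst ?subrr//.
exact: tempered_cst.
Qed.

Let meanQ u : mean P (fun x => Q x u) = \sum_i \sum_j u 0 i * u 0 j * mean P (b i j).
Proof.
have t1 i j : tempered w (fun x => u 0 i * u 0 j * b i j x).
  by apply: temperedM => //; exact: tempered_cst.
rewrite /Q (mean_sum mw w1 mom); last by move=> i; exact: tempered_sum.
apply: eq_bigr => i _; rewrite (mean_sum mw w1 mom)//; apply: eq_bigr => j _.
by rewrite (meanZ mw w1 mom).
Qed.

(** The remainder is a sum of cubic errors plus a quadratic form in u whose coefficients are centred
    sums. Both are bounded over all h of norm at most M by one measurable function, of mean K / sqrt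
    n, and Markov's inequality concludes. *)
Lemma LAN_remainder_bound (M : R) : 0 <= M -> exists (K : R) (N0 : nat), forall n (eps : R),
  (N0 <= n)%N -> 0 < eps ->
  (prodprob P n [set t | exists2 h : 'rV[R]_p, (enorm h <= M)%R &
     (eps < `|\sum_(i < n) ell (tnth t i) ((Num.sqrt n%:R)^-1 *: h)
      - (\sum_(i < n) L (tnth t i) ((Num.sqrt n%:R)^-1 *: h)
         - 2^-1 * mean P (fun x => L x h ^+ 2))|)%R]
   <= (K * (Num.sqrt n%:R)^-1 / eps)%:E)%E.
Proof.
move=> M0; have [C [k [d [d0 C0 H]]]] := expansion.
pose W := mean P (fun x => w x ^+ k).
pose sg j l := mean P (fun x => bc j l x ^+ 2).
pose K := C * M ^+ 3 * W + M ^+ 2 * \sum_j \sum_l 2^-1 * (sg j l + 1).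
(* Beyond this rank M / sqrt n is at most d, so every rescaled h lies in the ball where the
   expansion holds. *)
have [N1 HN1] : exists N1 : nat, (M / d) ^+ 2 < N1%:R.
  by exists (Num.truncn ((M / d) ^+ 2)).+1; exact: truncnS_gt.
exists K, N1.+1 => n eps nN e0.
have n0 : 0 < n%:R :> R by rewrite ltr0n (leq_trans _ nN).
set s := Num.sqrt n%:R; have s0 : 0 < s by rewrite sqrtr_gt0.
have ss : s ^+ 2 = n%:R by rewrite sqr_sqrtr// ltW.
pose r := s^-1; have r0 : 0 < r by rewrite invr_gt0.
have rr : r ^+ 2 * n%:R = 1 by rewrite -ss -exprMn mulVf ?expr1n// gt_eqF.
have rM : r * M <= d.
  rewrite mulrC ler_pdivrMr// mulrC -ler_pdivrMr//.
  rewrite -(@ler_pXn2r _ 2) ?nnegrE ?divr_ge0 ?(ltW d0) ?(ltW s0)// ss ltW//.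
  by apply: (lt_le_trans HN1); rewrite ler_nat ltnW.
pose S j l (t : n.-tuple X) := \sum_(i < n) bc j l (tnth t i).
(* The majorant: the first term bounds the cubic errors, the second the coefficients |S| through |S|
   <= (r S^2 + s) / 2, which holds because r s = 1 and involves second moments only. *)
pose Z (t : n.-tuple X) : R := C * (r * M) ^+ 3 * (\sum_(i < n) w (tnth t i) ^+ k) +
  \sum_j \sum_l M ^+ 2 * r ^+ 2 * 2^-1 * (r * S j l t ^+ 2 + s).
have mbc j l : measurable_fun setT (bc j l) by have [] := tbc j l.
have mS j l : measurable_fun setT (S j l) by exact: measurable_sample_sum.
have mwk : measurable_fun setT (fun t : n.-tuple X => \sum_(i < n) w (tnth t i) ^+ k).
  by apply: (measurable_sample_sum (f := fun x => w x ^+ k)); exact: measurable_funX.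
have mT j l : measurable_fun setT (fun t => M ^+ 2 * r ^+ 2 * 2^-1 * (r * S j l t ^+ 2 + s)).
  apply: measurable_funM => //; apply: measurable_funD => //; apply: measurable_funM => //.
  exact: measurable_funX.
have T0 j l t : 0 <= M ^+ 2 * r ^+ 2 * 2^-1 * (r * S j l t ^+ 2 + s).
  have r0' := ltW r0; have s0' := ltW s0.
  apply: mulr_ge0; first by rewrite mulr_ge0 ?invr_ge0// mulr_ge0 ?exprn_ge0.
  by rewrite addr_ge0// mulr_ge0// sqr_ge0.
have A0 : 0 <= C * (r * M) ^+ 3 by rewrite mulr_ge0// exprn_ge0// mulr_ge0// ltW.
have W0 t : 0 <= \sum_(i < n) w (tnth t i) ^+ k by apply: sumr_ge0 => i _; rewrite (wX_ge0 w1).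
apply: (@prodprob_markov _ _ _ _ _ _ Z) => //.
- apply: measurable_funD; first exact: measurable_funM.
  by do 2!(apply: measurable_rsum => ?).
- move=> t; apply: addr_ge0; first exact: mulr_ge0.
  by apply: sumr_ge0 => j _; apply: sumr_ge0 => l _; exact: T0.
- move=> t [h hM lt]; apply: (lt_le_trans lt).
  set u := r *: h; have uM : enorm u <= r * M.
    by rewrite enormZ gtr0_norm// ler_wpM2l// ltW.
  have ud : enorm u <= d by exact: le_trans uM rM.
  (* The centring constant of the LAN expansion is minus the total mean of the quadratic parts, by
     the second score identity and r^2 n = 1. *)
  have sec : 2^-1 * mean P (fun x => L x h ^+ 2) = - \sum_(i < n) mean P (fun x => Q x u).
    have -> : 2^-1 * mean P (fun x => L x h ^+ 2) = - mean P (fun x => Q x h).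
      by rewrite second opprK.
    congr (- _); rewrite sumr_const card_ord !meanQ -[RHS]mulr_natl.
    rewrite mulr_sumr; apply: eq_bigr => i _; rewrite mulr_sumr; apply: eq_bigr => j _.
    rewrite !mxE; have -> : r * h 0 i * (r * h 0 j) = r ^+ 2 * (h 0 i * h 0 j) by ring.
    transitivity (r ^+ 2 * n%:R * (h 0 i * h 0 j * mean P (b i j))); last by ring.
    by rewrite rr mul1r.
  rewrite sec opprK.
  have -> : \sum_(i < n) ell (tnth t i) u - (\sum_(i < n) L (tnth t i) u + \sum_(i < n) mean P (Q^~ u)) =
    \sum_(i < n) (ell (tnth t i) u - (L (tnth t i) u + Q (tnth t i) u)) +
    \sum_j \sum_l u 0 j * u 0 l * S j l t.
    have -> : \sum_j \sum_l u 0 j * u 0 l * S j l t = \sum_(i < n) (Q (tnth t i) u - mean P (Q^~ u)).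
      rewrite (eq_bigr (fun j => \sum_(i < n) \sum_l u 0 j * u 0 l * bc j l (tnth t i))); last first.
        move=> j _; rewrite exchange_big/=; apply: eq_bigr => l _; by rewrite mulr_sumr.
      rewrite exchange_big/=; apply: eq_bigr => i _; rewrite meanQ /Q -sumrB.
      by apply: eq_bigr => j _; rewrite -sumrB; apply: eq_bigr => l _; rewrite /bc mulrBr.
    by rewrite !sumrB big_split/=; ring.
  apply: (le_trans (ler_normD _ _)); apply: lerD.
    apply: (le_trans (ler_norm_sum _ _ _)); rewrite mulr_sumr; apply: ler_sum => i _.
    apply: (le_trans (H _ _ ud)); rewrite mulrAC ler_wpM2r ?(wX_ge0 w1)// ler_wpM2l//.
    by rewrite lerXn2r ?nnegrE ?enorm_ge0// (le_trans (enorm_ge0 u)).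
  apply: (le_trans (ler_norm_sum _ _ _)); apply: ler_sum => j _.
  apply: (le_trans (ler_norm_sum _ _ _)); apply: ler_sum => l _.
  rewrite normrM normrM.
  apply: (@le_trans _ _ (r ^+ 2 * M ^+ 2 * `|S j l t|)).
    rewrite ler_wpM2r// -exprMn expr2 ler_pM//; apply: le_trans uM; exact: le_enorm_coord.
  rewrite [r ^+ 2 * _]mulrC -mulrA ler_wpM2l ?mulr_ge0 ?exprn_ge0 ?(ltW r0)//.
  have : 0 <= r * (`|S j l t| - s) ^+ 2 by rewrite mulr_ge0 ?sqr_ge0// ltW.
  rewrite sqrrB real_normK ?num_real// ss.
  have -> : r * (S j l t ^+ 2 - `|S j l t| * s *+ 2 + n%:R) =
    r * S j l t ^+ 2 - 2 * `|S j l t| * (r * s) + r * n%:R by ring.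
  have rs1 : r * s = 1 by rewrite mulVf// gt_eqF.
  have rn : r * n%:R = s by rewrite -ss expr2 mulrA rs1 mul1r.
  by rewrite rs1 rn mulr1; move: (r * _ ^+ 2) `|_| => q v; lra.
have Ew : (\int[prodprob P n]_t (\sum_(i < n) w (tnth t i) ^+ k)%:E = (n%:R * W)%:E)%E.
  have := @integral_sample_sum _ _ _ P n (fun x => w x ^+ k) 0 _ _ (lexx 0).
  under eq_integral do rewrite add0r.
  move=> ->; last 2 first.
  - exact: measurable_funX.
  - by move=> x; rewrite (wX_ge0 w1).
  by rewrite add0e EFinM; congr (_ * _)%E; rewrite (mean_EFin mw w1 mom)//; exact: tempered_wX.
have ES j l : (\int[prodprob P n]_t (S j l t ^+ 2)%:E = (n%:R * sg j l)%:E)%E.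
  have t2 : tempered w (fun x => bc j l x ^+ 2).
    by under eq_fun do rewrite expr2; exact: temperedM.
  have := @integral_sample_sqr _ _ _ P n (bc j l) 0 (mbc j l)
    (tempered_integrable mw w1 mom (tbc j l)) (tempered_integrable mw w1 mom t2) (bc0 j l).
  by under eq_integral do rewrite add0r; rewrite expr0n/= add0r.
have ET j l : (\int[prodprob P n]_t (M ^+ 2 * r ^+ 2 * 2^-1 * (r * S j l t ^+ 2 + s))%:E =
   (M ^+ 2 * (2^-1 * (sg j l + 1)) * r)%:E)%E.
  have mS2 : measurable_fun setT (fun t => (S j l t ^+ 2)%:E).
    by apply/measurable_EFinP; exact: measurable_funX.
  have S20 t : setT t -> (0 <= (S j l t ^+ 2)%:E :> \bar R)%E by move=> _; rewrite lee_fin sqr_ge0.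
  have r0E : (0 <= r%:E :> \bar R)%E by rewrite lee_fin ltW.
  have mrS : measurable_fun setT (fun t => r%:E * (S j l t ^+ 2)%:E)%E.
    exact: emeasurable_funM.
  have rS0 t : setT t -> (0 <= r%:E * (S j l t ^+ 2)%:E :> \bar R)%E.
    by move=> _; rewrite mule_ge0// S20.
  have s0E (t : n.-tuple X) : setT t -> (0 <= s%:E :> \bar R)%E by rewrite lee_fin ltW.
  have msum : measurable_fun setT (fun t => r%:E * (S j l t ^+ 2)%:E + s%:E)%E.
    exact: emeasurable_funD.
  have sum0 t : setT t -> (0 <= r%:E * (S j l t ^+ 2)%:E + s%:E :> \bar R)%E.
    by move=> _; rewrite adde_ge0 ?rS0 ?(s0E t).
  have c0E : (0 <= (M ^+ 2 * r ^+ 2 * 2^-1)%:E :> \bar R)%E.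
    by rewrite lee_fin mulr_ge0 ?invr_ge0// mulr_ge0 ?exprn_ge0// ltW.
  transitivity (\int[prodprob P n]_t ((M ^+ 2 * r ^+ 2 * 2^-1)%:E * (r%:E * (S j l t ^+ 2)%:E + s%:E)))%E.
    by apply: eq_integral => t _.
  rewrite (ge0_integralZl _ measurableT msum sum0 c0E).
  rewrite (ge0_integralD _ measurableT rS0 mrS s0E (measurable_cst _)).
  rewrite (ge0_integralZl _ measurableT mS2 S20 r0E).
  rewrite ES integral_cst// measure_setT mule1.
  transitivity (M ^+ 2 * r ^+ 2 * 2^-1 * (r * (n%:R * sg j l) + s))%:E; first by [].
  congr EFin.
  have -> : s = r * n%:R by rewrite -ss expr2 mulrA mulVf ?mul1r// gt_eqF.
  have -> : M ^+ 2 * r ^+ 2 * 2^-1 * (r * (n%:R * sg j l) + r * n%:R) =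
    (r ^+ 2 * n%:R) * (M ^+ 2 * (2^-1 * (sg j l + 1)) * r) by ring.
  by rewrite rr mul1r.
have mwkE : measurable_fun setT (fun t : n.-tuple X => (\sum_(i < n) w (tnth t i) ^+ k)%:E).
  exact/measurable_EFinP.
have wk0 t : setT t -> (0 <= (\sum_(i < n) w (tnth t i) ^+ k)%:E :> \bar R)%E.
  by move=> _; rewrite lee_fin.
have A0E : (0 <= (C * (r * M) ^+ 3)%:E :> \bar R)%E by rewrite lee_fin.
have mcwk := emeasurable_funM (measurable_cst (C * (r * M) ^+ 3)%:E) mwkE.
have cwk0 (t : n.-tuple X) : setT t ->
    (0 <= (C * (r * M) ^+ 3)%:E * (\sum_(i < n) w (tnth t i) ^+ k)%:E :> \bar R)%E.
  by move=> _; rewrite mule_ge0// wk0.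
have mTT : measurable_fun setT (fun t : n.-tuple X =>
    (\sum_j \sum_l M ^+ 2 * r ^+ 2 * 2^-1 * (r * S j l t ^+ 2 + s))%:E).
  by apply/measurable_EFinP; apply: measurable_rsum => j; apply: measurable_rsum => l.
have TT0 (t : n.-tuple X) : setT t ->
    (0 <= (\sum_j \sum_l M ^+ 2 * r ^+ 2 * 2^-1 * (r * S j l t ^+ 2 + s))%:E :> \bar R)%E.
  by move=> _; rewrite lee_fin; apply: sumr_ge0 => j _; apply: sumr_ge0 => l _; exact: T0.
have -> : (\int[prodprob P n]_t (Z t)%:E =
  \int[prodprob P n]_t ((C * (r * M) ^+ 3)%:E * (\sum_(i < n) w (tnth t i) ^+ k)%:E +
    (\sum_j \sum_l M ^+ 2 * r ^+ 2 * 2^-1 * (r * S j l t ^+ 2 + s))%:E))%E.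
  by apply: eq_integral => t _.
rewrite (ge0_integralD _ measurableT cwk0 mcwk TT0 mTT).
rewrite (ge0_integralZl _ measurableT mwkE wk0 A0E).
rewrite Ew -EFinM.
have -> : (\int[prodprob P n]_t (\sum_j \sum_l M ^+ 2 * r ^+ 2 * 2^-1 * (r * S j l t ^+ 2 + s))%:E =
   (\sum_j \sum_l M ^+ 2 * (2^-1 * (sg j l + 1)) * r)%:E)%E.
  under eq_integral do rewrite -sumEFin.
  rewrite ge0_integral_sum//; last 2 first.
  - by move=> j; apply/measurable_EFinP; apply: measurable_rsum.
  - by move=> j t _; rewrite lee_fin; apply: sumr_ge0 => ? _.
  rewrite -sumEFin; apply: eq_bigr => j _; under eq_integral do rewrite -sumEFin.
  rewrite ge0_integral_sum//; last 2 first.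
  - by move=> l; exact/measurable_EFinP.
  - by move=> l t _; rewrite lee_fin.
  by rewrite -sumEFin; apply: eq_bigr => l _; rewrite ET.
rewrite -EFinD lee_fin le_eqVlt; apply/orP; left; apply/eqP.
rewrite /K mulrDl; congr (_ + _).
  have -> : C * (r * M) ^+ 3 * (n%:R * W) = r ^+ 2 * n%:R * (C * M ^+ 3 * W * r) by ring.
  by rewrite rr mul1r.
rewrite -mulrA mulr_suml mulr_sumr; apply: eq_bigr => j _.
rewrite mulr_suml mulr_sumr; apply: eq_bigr => l _; by rewrite -/r; ring.
Qed.

End LANBound.

(** * The central limit theorem *)

Section GaussianVector.
Variables (R : realType) (k : nat).
Implicit Types (z a : 'rV[R]_k).

Definition gauss : probability 'rV[R]_k R :=
  law (prodprob (normal_prob 0 1) k) (0 : 'rV[R]_k) (@tuple_row R k).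

Local Open Scope ereal_scope.

Lemma ge0_integral_gauss (F : 'rV[R]_k -> \bar R) :
  measurable_fun setT F -> (forall v, 0 <= F v) ->
  \int[gauss]_z F z = \int[leb R k]_z (F z * (gauss_pdf z)%:E).
Proof.
move=> mF F0; rewrite /gauss ge0_integral_law//; last exact: measurable_tuple_row.
exact: integral_gauss.
Qed.

(** The Cameron-Martin formula, from translation invariance of Lebesgue measure. It moves a shift
    from the test function to an explicit smooth density. *)
Lemma gauss_shift (F : 'rV[R]_k -> \bar R) a :
  measurable_fun setT F -> (forall v, 0 <= F v) ->
  \int[gauss]_z F (z + a)%R = \int[gauss]_z (F z * (expR (dot z a - 2^-1 * dot a a))%:E).
Proof.
move=> mF F0.
have mFa : measurable_fun setT (fun z : 'rV[R]_k => F (z + a)%R).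
  by apply: (measurableT_comp mF); apply: measurable_rowD.
have mw : measurable_fun setT (fun z : 'rV[R]_k => (expR (dot z a - 2^-1 * dot a a))%:E).
  by apply/measurable_EFinP; apply: measurable_expR_comp; apply: measurable_funB => //; meas.
rewrite !ge0_integral_gauss//; last 2 first.
- exact: emeasurable_funM.
- by move=> z; rewrite mule_ge0// lee_fin expR_ge0.
pose H z := F z * (gauss_pdf (z - a)%R)%:E.
transitivity (\int[leb R k]_z H (z + a)%R).
  by apply: eq_integral => z _; rewrite /H addrK.
rewrite leb_translate//; last 2 first.
- apply: emeasurable_funM => //; apply/measurable_EFinP; apply: measurable_gauss_pdf.
  by apply: measurable_rowD.
- by move=> z; rewrite mule_ge0// lee_fin gauss_pdf_ge0.
apply: eq_integral => z _; rewrite /H -muleA -EFinM; congr (_ * _%:E).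
rewrite /gauss_pdf mulrCA -expRD; congr (_ * expR _)%R.
rewrite -(scaleN1r a) dotDl !dotDr !dotZl !dotZr (dotC a z); lra.
Qed.

Definition gweight z : R := (1 + enorm z)%R.

Lemma gweight_ge1 z : (1 <= gweight z)%R. Proof. by rewrite lerDl enorm_ge0. Qed.

Lemma measurable_gweight : measurable_fun setT gweight.
Proof. by rewrite /gweight; meas. Qed.

Lemma expR_ge_pow (y : R) n : (0 <= y)%R -> (y ^+ n <= n`!%:R * expR y)%R.
Proof.
move=> y0; have f0 : (0 < n`!%:R :> R)%R by rewrite ltr0n fact_gt0.
rewrite mulrC -ler_pdivrMr//.
have C := is_cvg_series_exp_coeff y.
have ND : nondecreasing_seq (series (exp_coeff y)).
  by apply: nondecreasing_series => i _ _; exact: exp_coeff_ge0.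
apply: le_trans (nondecreasing_cvgn_le ND C n.+1).
rewrite /series/= big_nat_recr//= lerDr; apply: sumr_ge0 => i _; exact: exp_coeff_ge0.
Qed.

(** The power is dominated by a multiple of exp(|z|^2 / 4), and this exponential times the Gaussian
    density is that density at c z with c^2 = 1/2, whose integral a scaling shows to be finite. *)
Lemma gauss_moments n : \int[gauss]_z (gweight z ^+ n)%:E < +oo.
Proof.
(* The factor exp 2 comes from 1 + t <= 2 + t^2/4, that is (t/2 - 1)^2 >= 0. *)
pose C : R := (n`!%:R * expR 2)%R.
have C0 : (0 <= C)%R by rewrite mulr_ge0// expR_ge0.
pose c := (Num.sqrt (2^-1 : R))%R.
have c0 : (0 < c)%R by rewrite sqrtr_gt0 invr_gt0.
have c2 : (c ^+ 2 = 2^-1)%R by rewrite sqr_sqrtr// invr_ge0.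
have b z : (gweight z ^+ n <= C * expR (4^-1 * dot z z))%R.
  apply: (le_trans (expR_ge_pow n (le_trans ler01 (gweight_ge1 z)))).
  rewrite /C -mulrA ler_wpM2l// -expRD ler_expR /gweight -sqr_enorm.
  have := sqr_ge0 (2^-1 * enorm z - 1)%R.
  have -> : (4^-1 * enorm z ^+ 2 = (2^-1 * enorm z - 1) ^+ 2 + enorm z - 1)%R by field.
  by lra.
have mg := measurable_gweight.
apply: (@le_lt_trans _ _ (\int[gauss]_z (C * expR (4^-1 * dot z z))%:E)).
  apply: ge0_le_integral => //.
  - by move=> z _; rewrite lee_fin exprn_ge0// (le_trans ler01 (gweight_ge1 z)).
  - by apply/measurable_EFinP; exact: measurable_funX.
  - by apply/measurable_EFinP; meas.
  - by move=> z _; rewrite lee_fin.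
rewrite ge0_integral_gauss; last 2 first.
- by apply/measurable_EFinP; meas.
- by move=> z; rewrite lee_fin mulr_ge0// expR_ge0.
have mpdf : measurable_fun setT (fun z : 'rV[R]_k => (gauss_pdf z)%:E).
  by apply/measurable_EFinP; apply: measurable_gauss_pdf; meas.
have p0 (z : 'rV[R]_k) : 0 <= (gauss_pdf z)%:E :> \bar R by rewrite lee_fin gauss_pdf_ge0.
have mpc : measurable_fun setT (fun z : 'rV[R]_k => (gauss_pdf (c *: z)%R)%:E).
  by apply/measurable_EFinP; apply: measurable_gauss_pdf; meas.
have pc0 (z : 'rV[R]_k) : 0 <= (gauss_pdf (c *: z)%R)%:E :> \bar R by rewrite lee_fin gauss_pdf_ge0.
have tot : \int[leb R k]_z (gauss_pdf z)%:E = 1.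
  transitivity (\int[gauss]_z cst 1 z).
    by rewrite ge0_integral_gauss//; apply: eq_integral => z _; rewrite mul1e.
  by rewrite integral_cst// mul1e measure_setT.
have := leb_scale c0 mpdf p0; rewrite tot => E.
have -> : \int[leb R k]_z ((C * expR (4^-1 * dot z z))%:E * (gauss_pdf z)%:E) =
    C%:E * \int[leb R k]_z (gauss_pdf (c *: z)%R)%:E.
  have H (z : 'rV[R]_k) : (C * expR (4^-1 * dot z z) * gauss_pdf z = C * gauss_pdf (c *: z))%R.
    rewrite -mulrA; congr (C * _)%R.
    rewrite /gauss_pdf dotZl dotZr mulrCA -expRD; congr (_ * expR _)%R.
    by rewrite [(c * (c * _))%R]mulrA -expr2 c2; field.
  have C0E : 0 <= C%:E :> \bar R by rewrite lee_fin.
  rewrite -(ge0_integralZl _ measurableT mpc (fun z _ => pc0 z) C0E).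
  by apply: eq_integral => z _; rewrite -EFinM H EFinM.
have ck : (0 < c ^+ k)%R by rewrite exprn_gt0.
have fin : \int[leb R k]_z (gauss_pdf (c *: z)%R)%:E < +oo.
  rewrite ltNge; apply/negP; rewrite leye_eq => /eqP I; move: E; rewrite I.
  by rewrite gt0_muley// lte_fin.
rewrite lte_mul_pinfty//.
Qed.

Definition gdev a z : R := (dot z a - 2^-1 * dot a a)%R.

(* Second-order Taylor remainder, in a, of exp(z.a - |a|^2/2). *)
Definition grem a z : R :=
  (expR (gdev a z) - 1 - dot z a - 2^-1 * (dot z a ^+ 2 - dot a a))%R.

Lemma gdev_le a z : (`|gdev a z| <= gweight z * (enorm a + enorm a ^+ 2))%R.
Proof.
rewrite /gdev /gweight; apply: (le_trans (ler_normB _ _)).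
have h1 := dot_le_enorm z a; have z0 := enorm_ge0 z; have a0 := enorm_ge0 a.
rewrite -sqr_enorm [`|2^-1 * _|%R]ger0_norm ?mulr_ge0 ?exprn_ge0 ?invr_ge0//.
have a2 : (0 <= enorm a ^+ 2)%R by rewrite exprn_ge0.
have : (0 <= enorm z * enorm a ^+ 2)%R by rewrite mulr_ge0.
by move: h1 a2; rewrite mulrDl mul1r !mulrDr; lra.
Qed.

Lemma gdev_shift_le a z : (`|gdev a (z + a)| <= gweight z * (enorm a + enorm a ^+ 2))%R.
Proof.
have -> : gdev a (z + a) = (dot z a + 2^-1 * dot a a)%R by rewrite /gdev dotDl; lra.
rewrite /gweight; apply: (le_trans (ler_normD _ _)).
have h1 := dot_le_enorm z a; have z0 := enorm_ge0 z; have a0 := enorm_ge0 a.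
rewrite -sqr_enorm [`|2^-1 * _|%R]ger0_norm ?mulr_ge0 ?exprn_ge0 ?invr_ge0//.
have a2 : (0 <= enorm a ^+ 2)%R by rewrite exprn_ge0.
have : (0 <= enorm z * enorm a ^+ 2)%R by rewrite mulr_ge0.
by move: h1 a2; rewrite mulrDl mul1r !mulrDr; lra.
Qed.

Lemma measurable_gdev a : measurable_fun setT (gdev a).
Proof. by rewrite /gdev; apply: measurable_funB => //; meas. Qed.

Lemma measurable_grem a : measurable_fun setT (grem a).
Proof.
rewrite /grem; have mD := measurable_gdev a.
apply: measurable_funB.
  apply: measurable_funB; last by meas.
  by apply: measurable_funB => //; exact: measurable_expR_comp.
by apply: measurable_funM => //; apply: measurable_funB => //; meas.
Qed.

(** [grem] is sorted by degree in a, the exponential by powers of y = [gdev a z]. They differ by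
    |a|^4/8 - (z.a)|a|^2/2, of degrees 4 and 3, which the last summand absorbs. *)
Lemma grem_le a z : (`|grem a z| <= (expR 1 + 3) * (`|gdev a z| ^+ 3 * (1 + expR (gdev a z))) +
  (gweight z * (enorm a + enorm a ^+ 2)) ^+ 3)%R.
Proof.
pose y := gdev a z; have H := expR_expand_global y.
have -> : (grem a z = (expR y - 1 - y - 2^-1 * y ^+ 2) +
    (8^-1 * dot a a ^+ 2 - 2^-1 * dot z a * dot a a))%R.
  by rewrite /grem -/y /y /gdev; field.
apply: (le_trans (ler_normD _ _)); apply: lerD => //.
have h1 := dot_le_enorm z a; have z0 := enorm_ge0 z; have a0 := enorm_ge0 a.
rewrite -sqr_enorm; set s := enorm a in h1 a0 *; set t := enorm z in h1 z0 *.
apply: (@le_trans _ _ (8^-1 * s ^+ 4 + 2^-1 * (t * s) * s ^+ 2)%R).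
  apply: (le_trans (ler_normB _ _)); apply: lerD.
    by rewrite -exprM ger0_norm// mulr_ge0// exprn_ge0.
  rewrite normrM (ger0_norm (exprn_ge0 2 a0)) ler_wpM2r ?exprn_ge0//.
  by rewrite normrM ger0_norm ?invr_ge0// ler_wpM2l.
rewrite /gweight -/t exprMn.
have t1 : (1 <= (1 + t) ^+ 3)%R by rewrite exprn_ege1// lerDl.
have t2 : (t <= (1 + t) ^+ 3)%R.
  apply: (@le_trans _ _ (1 + t)%R); first by rewrite lerDr.
  by rewrite ler_eXnr// lerDl.
have s3 : (s ^+ 3 <= (s + s ^+ 2) ^+ 3)%R.
  by rewrite lerXn2r ?nnegrE ?addr_ge0 ?exprn_ge0// lerDl exprn_ge0.
have s4 : (s ^+ 4 <= (s + s ^+ 2) ^+ 3)%R.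
  have -> : ((s + s ^+ 2) ^+ 3 = s ^+ 4 + (s ^+ 3 + s ^+ 4 * 2 + s ^+ 5 * 3 + s ^+ 6))%R by ring.
  by rewrite lerDl !addr_ge0 ?mulr_ge0 ?exprn_ge0.
have q0 : (0 <= (s + s ^+ 2) ^+ 3)%R by rewrite exprn_ge0// addr_ge0// exprn_ge0.
have e1 : (s ^+ 4 <= (1 + t) ^+ 3 * (s + s ^+ 2) ^+ 3)%R.
  by apply: (le_trans s4); rewrite ler_peMl.
have e2 : (t * s ^+ 3 <= (1 + t) ^+ 3 * (s + s ^+ 2) ^+ 3)%R.
  by rewrite ler_pM// exprn_ge0.
have -> : (2^-1 * (t * s) * s ^+ 2 = 2^-1 * (t * s ^+ 3))%R by ring.
have q1 : (0 <= (1 + t) ^+ 3 * (s + s ^+ 2) ^+ 3)%R by rewrite mulr_ge0// (le_trans ler01 t1).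
by move: e1 e2 q1; move: ((1 + t) ^+ 3 * _)%R (t * s ^+ 3)%R (s ^+ 4)%R => q u v; lra.
Qed.

(** The exponential in the bound of [grem_le] is removed by [gauss_shift], which evaluates [gdev a]
    at z + a instead; [gdev_shift_le] bounds it there. The vector a is not restricted to be
    small. *)
Lemma grem_integral : exists2 C : R, (0 <= C)%R & forall a,
  \int[gauss]_z (`|grem a z|)%:E <= (C * (enorm a + enorm a ^+ 2) ^+ 3)%:E.
Proof.
have [M HM] : exists M : R, \int[gauss]_z (gweight z ^+ 3)%:E = M%:E.
  have g3 := gauss_moments 3.
  have p3 : 0 <= \int[gauss]_z (gweight z ^+ 3)%:E.
    by apply: integral_ge0 => z _; rewrite lee_fin exprn_ge0// (le_trans ler01 (gweight_ge1 z)).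
  by exists (fine (\int[gauss]_z (gweight z ^+ 3)%:E)); rewrite fineK// ge0_fin_numE.
have M0 : (0 <= M)%R.
  by rewrite -lee_fin -HM; apply: integral_ge0 => z _; rewrite lee_fin exprn_ge0// (le_trans ler01 (gweight_ge1 z)).
exists (((expR 1 + 3) * 2 + 1) * M)%R.
  by rewrite mulr_ge0// addr_ge0// mulr_ge0// addr_ge0// expR_ge0.
move=> a; set s := (enorm a + enorm a ^+ 2)%R.
have s0 : (0 <= s)%R by rewrite addr_ge0 ?exprn_ge0 ?enorm_ge0.
have mD := measurable_gdev a.
have mD3 : measurable_fun setT (fun z => (`|gdev a z| ^+ 3)%:E).
  by apply/measurable_EFinP; apply: measurable_funX; apply: (measurableT_comp (@normr_measurable _ setT)).
have D30 z : 0 <= (`|gdev a z| ^+ 3)%:E :> \bar R by rewrite lee_fin exprn_ge0.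
have mE : measurable_fun setT (fun z => (expR (gdev a z))%:E).
  by apply/measurable_EFinP; exact: measurable_expR_comp.
have mW : measurable_fun setT (fun z => (gweight z ^+ 3)%:E).
  by apply/measurable_EFinP; apply: measurable_funX; exact: measurable_gweight.
have W0 z : 0 <= (gweight z ^+ 3)%:E :> \bar R.
  by rewrite lee_fin exprn_ge0// (le_trans ler01 (gweight_ge1 z)).
have s3 : 0 <= (s ^+ 3)%:E :> \bar R by rewrite lee_fin exprn_ge0.
have b1 : \int[gauss]_z (`|gdev a z| ^+ 3)%:E <= (s ^+ 3 * M)%:E.
  rewrite EFinM -HM -ge0_integralZl//.
  apply: ge0_le_integral => //; first exact: emeasurable_funM.
  move=> z _; rewrite -EFinM lee_fin mulrC -exprMn lerXn2r ?nnegrE//.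
    by rewrite mulr_ge0// (le_trans ler01 (gweight_ge1 z)).
  exact: gdev_le.
have b2 : \int[gauss]_z ((`|gdev a z| ^+ 3)%:E * (expR (gdev a z))%:E) <= (s ^+ 3 * M)%:E.
  rewrite -(gauss_shift a mD3 D30) EFinM -HM -ge0_integralZl//.
  apply: ge0_le_integral => //.
  - by apply: (measurableT_comp mD3); apply: measurable_rowD.
  - exact: emeasurable_funM.
  move=> z _; rewrite -EFinM lee_fin mulrC -exprMn lerXn2r ?nnegrE//.
    by rewrite mulr_ge0// (le_trans ler01 (gweight_ge1 z)).
  exact: gdev_shift_le.
pose K : R := (expR 1 + 3)%R; have K0 : 0 <= K%:E :> \bar R by rewrite lee_fin addr_ge0// expR_ge0.
pose F1 z := (`|gdev a z| ^+ 3)%:E + (`|gdev a z| ^+ 3)%:E * (expR (gdev a z))%:E.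
have mDE : measurable_fun setT (fun z => (`|gdev a z| ^+ 3)%:E * (expR (gdev a z))%:E).
  exact: emeasurable_funM.
have DE0 z : setT z -> 0 <= (`|gdev a z| ^+ 3)%:E * (expR (gdev a z))%:E :> \bar R.
  by move=> _; rewrite mule_ge0// lee_fin expR_ge0.
have mF1 : measurable_fun setT F1 by exact: emeasurable_funD.
have F10 z : setT z -> 0 <= F1 z by move=> _; rewrite adde_ge0// DE0.
have mKF := emeasurable_funM (measurable_cst K%:E) mF1.
have KF0 z : setT z -> 0 <= K%:E * F1 z by move=> _; rewrite mule_ge0// F10.
have msW := emeasurable_funM (measurable_cst (s ^+ 3)%:E) mW.
have sW0 z : setT z -> 0 <= (s ^+ 3)%:E * (gweight z ^+ 3)%:E :> \bar R by move=> _; rewrite mule_ge0.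
apply: (@le_trans _ _ (\int[gauss]_z (K%:E * F1 z + (s ^+ 3)%:E * (gweight z ^+ 3)%:E))).
  apply: ge0_le_integral => //.
  - apply/measurable_EFinP; apply: (measurableT_comp (@normr_measurable _ setT)).
    exact: measurable_grem.
  - exact: emeasurable_funD.
  move=> z _; have := grem_le a z; rewrite -lee_fin => /le_trans; apply.
  rewrite -/s -/K (_ : (K * (`|gdev a z| ^+ 3 * (1 + expR (gdev a z))) + (gweight z * s) ^+ 3 =
    K * (`|gdev a z| ^+ 3 + `|gdev a z| ^+ 3 * expR (gdev a z)) + s ^+ 3 * gweight z ^+ 3)%R)//.
  by ring.
rewrite (ge0_integralD _ measurableT KF0 mKF sW0 msW) (ge0_integralZl _ measurableT mF1 F10 K0).
rewrite (ge0_integralD _ measurableT (fun z _ => D30 z) mD3 DE0 mDE).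
rewrite (ge0_integralZl _ measurableT mW (fun z _ => W0 z) s3) HM.
apply: (le_trans (leeD2r _ (lee_wpmul2l K0 (leeD b1 b2)))).
rewrite (_ : _ + _ = (K * (s ^+ 3 * M + s ^+ 3 * M) + s ^+ 3 * M)%:E)//.
by rewrite lee_fin le_eqVlt; apply/orP; left; apply/eqP; rewrite /K; ring.
Qed.

End GaussianVector.

(** * Averaging operators and the replacement of summands *)

Section Averages.
Variables (R : realType) (k : nat).
Implicit Types (f g h : 'rV[R]_k -> R) (y : 'rV[R]_k).

(** A class of bounded test functions stable under every averaging operator. Continuity is not part
    of it, and bounded functions reach it by an affine rescaling. *)
Definition unit_valued f : Prop := measurable_fun setT f /\ forall y, 0 <= f y <= 1.

Section Average.
Variables (e : measure_display) (X : measurableType e) (P : probability X R).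
Variable phi : X -> 'rV[R]_k.
Hypothesis mphi : measurable_fun setT phi.

(** A translation-invariant smoothing operator. Such operators commute by Fubini and contract the
    sup distance; an independent sum gives their composition. *)
Definition average f y : R := mean P (fun x => f (y + phi x)).

Let measurable_shift f y : measurable_fun setT f -> measurable_fun setT (fun x => f (y + phi x)).
Proof. by move=> mf; apply: (measurableT_comp mf); apply: measurable_rowD. Qed.

Let mw : measurable_fun setT (fun _ : X => 1 : R). Proof. exact: measurable_cst. Qed.

Let w1 (x : X) : (1 : R) <= (fun _ : X => 1) x. Proof. by []. Qed.

Let mom n : (\int[P]_x (((fun _ : X => 1 : R) x) ^+ n)%:E < +oo)%E.
Proof. by rewrite integral_cst// measure_setT mule1 ltry. Qed.

Let tempered_shift f y : unit_valued f -> tempered (fun _ : X => 1) (fun x => f (y + phi x)).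
Proof.
move=> [mf f01]; split; first exact: measurable_shift.
exists 1, 0%N => x; rewrite expr0 mulr1; have /andP[f0 f1] := f01 (y + phi x).
by rewrite ger0_norm.
Qed.

Lemma average_EFin f y : unit_valued f ->
  ((average f y)%:E = \int[P]_x (f (y + phi x))%:E)%E.
Proof. by move=> uf; exact: (mean_EFin mw w1 mom (tempered_shift _ uf)). Qed.

Lemma unit_valued_average f : unit_valued f -> unit_valued (average f).
Proof.
move=> uf; have [mf f01] := uf; split.
  have mF : measurable_fun setT (fun z : 'rV[R]_k * X => (f (z.1 + phi z.2))%:E).
    apply/measurable_EFinP; apply: (measurableT_comp mf); apply: measurable_rowD.
      exact: measurable_fst.
    by apply: (measurableT_comp mphi); exact: measurable_snd.
  have F0 (z : 'rV[R]_k * X) : (0 <= (f (z.1 + phi z.2))%:E)%E.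
    by rewrite lee_fin; have /andP[] := f01 (z.1 + phi z.2).
  apply/measurable_EFinP.
  have := measurable_fun_fubini_tonelli_F (m2 := P) _ mF F0; apply: eq_measurable_fun => y _.
  by rewrite /fubini_F/= (average_EFin y uf).
move=> y; apply/andP; split.
  by apply: mean_ge0 => x; have /andP[] := f01 (y + phi x).
rewrite -[X in _ <= X](mean_cst P); apply: (mean_le mw w1 mom).
- exact: tempered_shift.
- exact: tempered_cst.
- by move=> x; have /andP[] := f01 (y + phi x).
Qed.

Lemma average_dist f g (delta : R) y : unit_valued f -> unit_valued g ->
  (forall z, `|f z - g z| <= delta) -> `|average f y - average g y| <= delta.
Proof.
move=> uf ug fg.
have tf := tempered_shift y uf; have tg := tempered_shift y ug.
have tc a : tempered (fun _ : X => 1 : R) (fun=> a) by exact: tempered_cst.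
rewrite ler_distlC; apply/andP; split.
- rewrite /average -[delta](mean_cst P) lerBlDr -(meanD mw w1 mom tg (tc _)).
  apply: (mean_le mw w1 mom tf); first exact: temperedD.
  by move=> x; have := fg (y + phi x); rewrite ler_distl => /andP[_]; rewrite addrC.
- rewrite /average -[delta](mean_cst P) -(meanD mw w1 mom tf (tc _)).
  apply: (mean_le mw w1 mom tg); first exact: temperedD.
  by move=> x; have := fg (y + phi x); rewrite ler_distlC => /andP[_].
Qed.

End Average.

Lemma averageC e1 e2 (X1 : measurableType e1) (X2 : measurableType e2)
    (P1 : probability X1 R) (P2 : probability X2 R)
    (phi1 : X1 -> 'rV[R]_k) (phi2 : X2 -> 'rV[R]_k) f y :
  measurable_fun setT phi1 -> measurable_fun setT phi2 -> unit_valued f ->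
  average P1 phi1 (average P2 phi2 f) y = average P2 phi2 (average P1 phi1 f) y.
Proof.
move=> m1 m2 uf; have [mf f01] := uf; apply: EFin_inj.
rewrite !average_EFin//; last 2 first.
- exact: unit_valued_average.
- exact: unit_valued_average.
have mF : measurable_fun setT (fun z : X1 * X2 => (f (y + phi1 z.1 + phi2 z.2))%:E).
  apply/measurable_EFinP; apply: (measurableT_comp mf); apply: measurable_rowD.
    by apply: measurable_rowD => //; apply: (measurableT_comp m1); exact: measurable_fst.
  by apply: (measurableT_comp m2); exact: measurable_snd.
have F0 (z : X1 * X2) : (0 <= (f (y + phi1 z.1 + phi2 z.2))%:E)%E.
  by rewrite lee_fin; have /andP[] := f01 (y + phi1 z.1 + phi2 z.2).
transitivity (\int[P1]_x \int[P2]_x' (f (y + phi1 x + phi2 x'))%:E)%E.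
  by apply: eq_integral => x _; rewrite average_EFin.
rewrite (fubini_tonelli (m1 := P1) (m2 := P2) _ mF F0)/=; apply: eq_integral => x' _; rewrite average_EFin//.
by apply: eq_integral => x _; rewrite addrAC.
Qed.

Section Samples.
Variables (e : measure_display) (X : measurableType e) (P : probability X R).
Variable phi : X -> 'rV[R]_k.
Hypothesis mphi : measurable_fun setT phi.

Definition row_sum n (t : n.-tuple X) : 'rV[R]_k := \sum_(i < n) phi (tnth t i).

Lemma row_sumE n (t : n.-tuple X) j : row_sum t 0 j = \sum_(i < n) phi (tnth t i) 0 j.
Proof. by rewrite /row_sum summxE. Qed.

Lemma measurable_row_sum n : measurable_fun setT (@row_sum n).
Proof.
apply: measurable_row => j.
apply: (eq_measurable_fun (fun t : n.-tuple X => \sum_(i < n) phi (tnth t i) 0 j)).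
  by move=> t _; rewrite row_sumE.
by apply: (measurable_sample_sum (f := fun x => phi x 0 j)); exact: measurable_rowE.
Qed.

Lemma row_sum_cons n x (t : n.-tuple X) : row_sum [tuple of x :: t] = phi x + row_sum t.
Proof.
by apply/rowP => j; rewrite mxE !row_sumE (sample_sum_cons (fun x => phi x 0 j)).
Qed.

Lemma average_sample0 f y : unit_valued f ->
  average (prodprob P 0) (@row_sum 0) f y = f y.
Proof.
move=> uf; have [mf f01] := uf; apply: EFin_inj; rewrite average_EFin//; last exact: measurable_row_sum.
rewrite integral_prodprob0; first by rewrite /row_sum big_ord0 addr0.
apply/measurable_EFinP; apply: (measurableT_comp mf); apply: measurable_rowD => //.
exact: measurable_row_sum.
Qed.

Lemma average_sampleS n f y : unit_valued f ->
  average (prodprob P n.+1) (@row_sum n.+1) f y =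
  average P phi (average (prodprob P n) (@row_sum n) f) y.
Proof.
move=> uf; have [mf f01] := uf; have ms := @measurable_row_sum.
apply: EFin_inj; 
have uA := unit_valued_average (prodprob P n) (ms n) uf.
rewrite (average_EFin _ (ms _) _ uf) (average_EFin P mphi y uA).
rewrite integral_prodprobS.
- apply: eq_integral => x _; rewrite (average_EFin _ (ms n) _ uf).
  by apply: eq_integral => t _; rewrite row_sum_cons addrA.
- apply/measurable_EFinP; apply: (measurableT_comp mf); apply: measurable_rowD => //.
  exact: (ms n.+1).
- by move=> t; rewrite lee_fin; have /andP[] := f01 (y + row_sum t).
Qed.

End Samples.

(* Telescoping: replacing the n summands one at a time costs delta each,
   because the smoothing average commutes with the other averages. *)
Lemma average_sample_dist e1 e2 e3 (X1 : measurableType e1) (X2 : measurableType e2)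
    (X3 : measurableType e3) (P1 : probability X1 R) (P2 : probability X2 R)
    (P3 : probability X3 R) (phi1 : X1 -> 'rV[R]_k) (phi2 : X2 -> 'rV[R]_k)
    (phi3 : X3 -> 'rV[R]_k) (delta : R) :
  measurable_fun setT phi1 -> measurable_fun setT phi2 -> measurable_fun setT phi3 ->
  (forall h y, unit_valued h ->
     `|average P1 phi1 (average P3 phi3 h) y - average P2 phi2 (average P3 phi3 h) y| <= delta) ->
  forall n h y, unit_valued h ->
  `|average (prodprob P1 n) (@row_sum _ _ phi1 n) (average P3 phi3 h) y -
    average (prodprob P2 n) (@row_sum _ _ phi2 n) (average P3 phi3 h) y| <= n%:R * delta.
Proof.
move=> m1 m2 m3 H; elim=> [|n IH] h y uh.
  have u3 := unit_valued_average P3 m3 uh.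
  by rewrite !average_sample0// subrr normr0 mul0r.
have u3 := unit_valued_average P3 m3 uh.
have s1 := @measurable_row_sum _ _ _ m1 n; have s2 := @measurable_row_sum _ _ _ m2 n.
have v1 := unit_valued_average (prodprob P1 n) s1 u3.
have v2 := unit_valued_average (prodprob P2 n) s2 u3.
rewrite !average_sampleS// -natr1 mulrDl mul1r.
apply: (le_trans (ler_distD (average P1 phi1 (average (prodprob P2 n) (@row_sum _ _ phi2 n) (average P3 phi3 h)) y) _ _)).
apply: lerD; first by apply: average_dist => // z; exact: IH.
have -> : average (prodprob P2 n) (@row_sum _ _ phi2 n) (average P3 phi3 h) =
    average P3 phi3 (average (prodprob P2 n) (@row_sum _ _ phi2 n) h).
  by apply/funext => z; rewrite averageC.
by apply: H; exact: unit_valued_average.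
Qed.

End Averages.

Section GaussianTaylor.
Variables (R : realType) (k : nat).
Implicit Types (z a v y : 'rV[R]_k) (F h : 'rV[R]_k -> R).
Notation gm := (mean (gauss R k)).
Let mw := @measurable_gweight R k.
Let w1 := @gweight_ge1 R k.
Let mom := @gauss_moments R k.

Let tempered_coord i : tempered (@gweight R k) (fun z => z 0 i).
Proof.
split; first exact: measurable_coord.
exists 1, 1%N => z; rewrite mul1r expr1 /gweight (le_trans (le_enorm_coord z i))//.
by rewrite lerDr.
Qed.

Let tempered_unit F : unit_valued F -> tempered (@gweight R k) F.
Proof.
move=> [mF F01]; split=> //; exists 1, 0%N => z; rewrite expr0 mulr1.
by have /andP[F0 F1] := F01 z; rewrite ger0_norm.
Qed.

Lemma dot_sqr z a : dot z a ^+ 2 = \sum_i \sum_j a 0 i * a 0 j * (z 0 i * z 0 j).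
Proof.
rewrite expr2 /dot mulr_suml; apply: eq_bigr => i _; rewrite mulr_sumr.
by apply: eq_bigr => j _; ring.
Qed.

Lemma dot_self_delta a : dot a a = \sum_i \sum_j a 0 i * a 0 j * (i == j)%:R.
Proof.
rewrite /dot; apply: eq_bigr => i _; rewrite (bigD1 i)//= eqxx mulr1 big1 ?addr0// => j.
by rewrite eq_sym => /negbTE ->; rewrite mulr0.
Qed.

(** By [gauss_shift] the dependence on a is carried by exp(z.a - |a|^2/2) alone, whose Taylor
    coefficients are Hermite polynomials in z. F enters through |F| <= 1 only, so C does not depend
    on it. *)
Lemma gauss_taylor : exists2 C : R, 0 <= C & forall F a, unit_valued F ->
  `|gm (fun z => F (z + a)) - (gm F + \sum_i a 0 i * gm (fun z => F z * z 0 i) +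
     \sum_i \sum_j a 0 i * a 0 j * (2^-1 * gm (fun z => F z * (z 0 i * z 0 j - (i == j)%:R))))|
   <= C * (enorm a + enorm a ^+ 2) ^+ 3.
Proof.
have [C C0 HC] := @grem_integral R k; exists C => // F a uF; have [mF F01] := uF.
have F0 z : 0 <= F z by have /andP[] := F01 z.
have tF := tempered_unit uF.
have tc b : tempered (@gweight R k) (fun=> b) by exact: tempered_cst.
have t1 i : tempered (@gweight R k) (fun z => F z * z 0 i) by exact: temperedM.
have t2 i j : tempered (@gweight R k) (fun z => F z * (z 0 i * z 0 j - (i == j)%:R)).
  by apply: temperedM => //; apply: temperedD => //; exact: temperedM.
have ts1 : tempered (@gweight R k) (fun z => \sum_i a 0 i * (F z * z 0 i)).
  by apply: tempered_sum => // i; exact: temperedM.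
have ts2' i : tempered (@gweight R k) (fun z => \sum_j a 0 i * a 0 j * (2^-1 * (F z * (z 0 i * z 0 j - (i == j)%:R)))).
  by apply: tempered_sum => // j; apply: temperedM => //; exact: temperedM.
have ts2 : tempered (@gweight R k) (fun z => \sum_i \sum_j a 0 i * a 0 j * (2^-1 * (F z * (z 0 i * z 0 j - (i == j)%:R)))).
  by apply: tempered_sum.
pose q z := F z + \sum_i a 0 i * (F z * z 0 i) +
  \sum_i \sum_j a 0 i * a 0 j * (2^-1 * (F z * (z 0 i * z 0 j - (i == j)%:R))).
have tq : tempered (@gweight R k) q by apply: temperedD => //; exact: temperedD.
have mq : gm q = gm F + \sum_i a 0 i * gm (fun z => F z * z 0 i) +
     \sum_i \sum_j a 0 i * a 0 j * (2^-1 * gm (fun z => F z * (z 0 i * z 0 j - (i == j)%:R))).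
  rewrite /q (meanD mw w1 mom) ?(meanD mw w1 mom)//; last exact: temperedD.
  rewrite !(mean_sum mw w1 mom)//; last first.
    by move=> i; exact: temperedM.
  congr (_ + _ + _); apply: eq_bigr => i _; first by rewrite (meanZ mw w1 mom).
  rewrite (mean_sum mw w1 mom); last by move=> j; apply: temperedM => //; exact: temperedM.
  apply: eq_bigr => j _; rewrite (meanZ mw w1 mom); last exact: temperedM.
  by rewrite (meanZ mw w1 mom).
rewrite -mq.
have Fq z : F z * expR (gdev a z) = q z + F z * grem a z.
  rewrite /q /grem dot_sqr dot_self_delta.
  have -> : \sum_i a 0 i * (F z * z 0 i) = F z * dot z a.
    by rewrite /dot mulr_sumr; apply: eq_bigr => i _; ring.
  have -> : \sum_i \sum_j a 0 i * a 0 j * (2^-1 * (F z * (z 0 i * z 0 j - (i == j)%:R))) =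
      F z * (2^-1 * (\sum_i \sum_j a 0 i * a 0 j * (z 0 i * z 0 j) - \sum_i \sum_j a 0 i * a 0 j * (i == j)%:R)).
    rewrite -sumrB !mulr_sumr; apply: eq_bigr => i _.
    rewrite -sumrB !mulr_sumr; apply: eq_bigr => j _; ring.
  by ring.
have mg := measurable_grem a.
have mFg : measurable_fun setT (fun z => F z * grem a z) by exact: measurable_funM.
have bound : (\int[gauss R k]_z `|(F z * grem a z)%:E| <= (C * (enorm a + enorm a ^+ 2) ^+ 3)%:E)%E.
  apply: (le_trans _ (HC a)); apply: ge0_le_integral => //.
  - by apply/measurable_EFinP; apply: (measurableT_comp (@normr_measurable _ setT)).
  - by apply/measurable_EFinP; apply: (measurableT_comp (@normr_measurable _ setT)).
  move=> z _; rewrite lee_fin normrM ger0_norm// ler_piMl//.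
  by have /andP[] := F01 z.
have iFg : (gauss R k).-integrable setT (EFin \o (fun z => F z * grem a z)).
  apply/integrableP; split; first exact/measurable_EFinP.
  exact: (le_lt_trans bound (ltry _)).
have -> : gm (fun z => F (z + a)) = gm q + \int[gauss R k]_z (F z * grem a z).
  have iq := tempered_integrable mw w1 mom tq.
  rewrite /mean -(RintegralD _ iq iFg)//.
  rewrite /Rintegral; congr fine.
  have := gauss_shift a (F := fun z => (F z)%:E).
  move=> ->; last 2 first.
  - exact/measurable_EFinP.
  - by move=> z; rewrite lee_fin.
  by apply: eq_integral => z _; rewrite -Fq EFinM.
rewrite addrC addKr.
apply: (le_trans (le_normr_Rintegral _ iFg)) => //.
rewrite -lee_fin /Rintegral fineK//.
rewrite ge0_fin_numE; last by apply: integral_ge0.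
exact: (le_lt_trans bound (ltry _)).
Qed.

(** For the constant test function 1 the shifted mean is unchanged, so the terms of degrees 1 and 2
    of [gauss_taylor] sum to a cubic quantity along a ray and vanish. No Gaussian integral is
    computed. *)
Lemma gauss_first_second a : gm (fun z => dot z a) = 0 /\ gm (fun z => dot z a ^+ 2) = dot a a.
Proof.
have [C C0 HC] := gauss_taylor.
have tc b : tempered (@gweight R k) (fun=> b) by exact: tempered_cst.
have td : tempered (@gweight R k) (fun z => dot z a).
  by apply: tempered_sum => // i; exact: temperedM.
have td2 : tempered (@gweight R k) (fun z => dot z a ^+ 2) by exact: temperedM.
have u1 : unit_valued (fun _ : 'rV[R]_k => 1 : R).
  by split; [exact: measurable_cst|move=> y; rewrite ler01 lexx].
have E1 (b : 'rV[R]_k) : \sum_i b 0 i * gm (fun z => 1 * z 0 i) = gm (fun z => dot z b).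
  rewrite [RHS](mean_sum mw w1 mom); last by move=> i; exact: temperedM.
  apply: eq_bigr => i _; rewrite -(meanZ mw w1 mom); last exact: temperedM.
  by congr gm; apply/funext => z; ring.
have E2 (b : 'rV[R]_k) : \sum_i \sum_j b 0 i * b 0 j * (2^-1 * gm (fun z => 1 * (z 0 i * z 0 j - (i == j)%:R))) =
   2^-1 * (gm (fun z => dot z b ^+ 2) - dot b b).
  have tz i j : tempered (@gweight R k) (fun z => z 0 i * z 0 j) by exact: temperedM.
  have -> : gm (fun z => dot z b ^+ 2) = \sum_i \sum_j b 0 i * b 0 j * gm (fun z => z 0 i * z 0 j).
    rewrite (_ : (fun z => _) = fun z => \sum_i \sum_j b 0 i * b 0 j * (z 0 i * z 0 j)); last first.
      by apply/funext => z; exact: dot_sqr.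
    rewrite (mean_sum mw w1 mom); last by move=> i; apply: tempered_sum => // j; exact: temperedM.
    apply: eq_bigr => i _; rewrite (mean_sum mw w1 mom); last by move=> j; exact: temperedM.
    by apply: eq_bigr => j _; rewrite (meanZ mw w1 mom).
  rewrite dot_self_delta -sumrB mulr_sumr; apply: eq_bigr => i _.
  rewrite -sumrB mulr_sumr; apply: eq_bigr => j _.
  have -> : gm (fun z => 1 * (z 0 i * z 0 j - (i == j)%:R)) = gm (fun z => z 0 i * z 0 j) - (i == j)%:R.
    have := meanD mw w1 mom (tz i j) (tc (- (i == j)%:R)); rewrite mean_cst => <-.
    by congr gm; apply/funext => z; ring.
  by ring.
suff [A0 B0] : gm (fun z => dot z a) = 0 /\ 2^-1 * (gm (fun z => dot z a ^+ 2) - dot a a) = 0.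
  split=> //; move: B0; lra.
apply: (@cubic_small_coef R _ _ (C * (enorm a + enorm a ^+ 2) ^+ 3) 1) => // t /andP[t0 t1].
have := HC (fun=> 1) (t *: a) u1; rewrite E1 E2.
have -> : gm (fun z => dot z (t *: a)) = t * gm (fun z => dot z a).
  by rewrite -(meanZ mw w1 mom)//; congr gm; apply/funext => z; rewrite dotZr.
have -> : gm (fun z => dot z (t *: a) ^+ 2) = t ^+ 2 * gm (fun z => dot z a ^+ 2).
  by rewrite -(meanZ mw w1 mom)//; congr gm; apply/funext => z; rewrite dotZr exprMn.
rewrite dotZl dotZr !(mean_cst (gauss R k)).
have -> : 1 - (1 + t * gm (fun z => dot z a) +
    2^-1 * (t ^+ 2 * gm (fun z => dot z a ^+ 2) - t * (t * dot a a))) =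
   - (t * gm (fun z => dot z a) + t ^+ 2 * (2^-1 * (gm (fun z => dot z a ^+ 2) - dot a a))) by ring.
rewrite normrN => /le_trans; apply; rewrite -mulrA ler_wpM2l// -exprMn.
rewrite lerXn2r ?nnegrE//.
- by rewrite addr_ge0 ?exprn_ge0 ?enorm_ge0.
- by rewrite mulr_ge0 ?addr_ge0 ?exprn_ge0 ?enorm_ge0// ltW.
rewrite enormZ (ger0_norm (ltW t0)).
have -> : (enorm a + enorm a ^+ 2) * t = t * enorm a + (t * enorm a) ^+ 2 + t * (1 - t) * enorm a ^+ 2.
  by ring.
by rewrite lerDl mulr_ge0 ?exprn_ge0 ?enorm_ge0// mulr_ge0 ?subr_ge0//; exact: ltW.
Qed.

Lemma gauss_cov a b : gm (fun z => dot z a * dot z b) = dot a b.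
Proof.
have tc c : tempered (@gweight R k) (fun=> c) by exact: tempered_cst.
have td c : tempered (@gweight R k) (fun z => dot z c).
  by apply: tempered_sum => // i; exact: temperedM.
have td2 c : tempered (@gweight R k) (fun z => dot z c ^+ 2) by exact: temperedM.
have -> : (fun z => dot z a * dot z b) = (fun z => 2^-1 * dot z (a + b) ^+ 2 +
    (- 2^-1 * dot z a ^+ 2 + - 2^-1 * dot z b ^+ 2)).
  by apply/funext => z; rewrite dotDr; field.
rewrite !(meanD mw w1 mom) ?(meanZ mw w1 mom)//; first last.
- by apply: temperedD => //; exact: temperedM.
- exact: temperedM.
- exact: temperedM.
- exact: temperedM.
rewrite (gauss_first_second _).2 (gauss_first_second a).2 (gauss_first_second b).2.
by rewrite dotDl !dotDr (dotC b a); field.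
Qed.

End GaussianTaylor.

(** * Stability of the Gaussian law *)

Section GaussianStability.
Variables (R : realType) (k : nat).
Implicit Types (z a v y : 'rV[R]_k).
Local Open Scope ereal_scope.
Notation gk := (gauss R k).

Lemma gauss_scale (c : R) (F : 'rV[R]_k -> \bar R) : (0 < c)%R ->
  measurable_fun setT F -> (forall v, 0 <= F v) ->
  \int[gk]_z F z =
  (c ^+ k)%:E * \int[gk]_z (F (c *: z)%R * (expR (2^-1 * (1 - c ^+ 2) * dot z z))%:E).
Proof.
move=> c0 mF F0.
have mpdf : measurable_fun setT (fun z : 'rV[R]_k => (gauss_pdf z)%:E).
  by apply/measurable_EFinP; apply: measurable_gauss_pdf; meas.
have mc : measurable_fun setT (fun z : 'rV[R]_k => F (c *: z)%R).
  by apply: (measurableT_comp mF); meas.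
have me : measurable_fun setT (fun z : 'rV[R]_k => (expR (2^-1 * (1 - c ^+ 2) * dot z z))%:E).
  by apply/measurable_EFinP; meas.
rewrite !ge0_integral_gauss//; last 2 first.
- exact: emeasurable_funM.
- by move=> z; rewrite mule_ge0// lee_fin expR_ge0.
have p0 (z : 'rV[R]_k) : 0 <= (gauss_pdf z)%:E :> \bar R by rewrite lee_fin gauss_pdf_ge0.
rewrite (leb_scale c0); last 2 first.
- exact: emeasurable_funM.
- by move=> z; exact: mule_ge0.
congr (_ * _); apply: eq_integral => z _; rewrite -muleA -EFinM; congr (_ * _%:E).
rewrite /gauss_pdf mulrCA -expRD; congr (_ * expR _)%R.
by rewrite dotZl dotZr; field.
Qed.

Lemma gauss_exp a : \int[gk]_z (expR (dot z a))%:E = (expR (2^-1 * dot a a))%:E.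
Proof.
have := gauss_shift a (measurable_cst (1 : \bar R)) (fun=> lee01).
rewrite integral_cst// measure_setT mule1.
have me : measurable_fun setT (fun z : 'rV[R]_k => (expR (dot z a))%:E).
  by apply/measurable_EFinP; meas.
have e0 z : setT z -> 0 <= (expR (dot z a))%:E :> \bar R by rewrite lee_fin expR_ge0.
have c0 : 0 <= (expR (- (2^-1 * dot a a)))%:E :> \bar R by rewrite lee_fin expR_ge0.
have -> : \int[gk]_z (1 * (expR (dot z a - 2^-1 * dot a a))%:E) =
   (expR (- (2^-1 * dot a a)))%:E * \int[gk]_z (expR (dot z a))%:E.
  rewrite -(ge0_integralZl _ measurableT me e0 c0); apply: eq_integral => z _.
  by rewrite mul1e -EFinM -expRD addrC.
move=> H; transitivity ((expR (2^-1 * dot a a))%:E *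
    ((expR (- (2^-1 * dot a a)))%:E * \int[gk]_z (expR (dot z a))%:E)).
  by rewrite muleA -EFinM -expRD subrr expR0 mul1e.
by rewrite -H mule1.
Qed.

(* Shifting z by (b/a) z' turns the sum into a z alone, at the price of an
   exponential weight whose z'-integral is explicit. *)
Lemma gauss_add (a b : R) (F : 'rV[R]_k -> \bar R) : (0 < a)%R ->
  measurable_fun setT F -> (forall v, 0 <= F v) ->
  \int[gk]_z' \int[gk]_z F (a *: z + b *: z')%R =
  \int[gk]_z F (Num.sqrt (a ^+ 2 + b ^+ 2) *: z)%R.
Proof.
move=> a0 mF F0; pose r := (b / a)%R; pose c := Num.sqrt (1 + r ^+ 2)%R.
have r2 : (0 < 1 + r ^+ 2)%R by rewrite ltr_pwDl// sqr_ge0.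
have c0 : (0 < c)%R by rewrite sqrtr_gt0.
have c2 : (c ^+ 2 = 1 + r ^+ 2)%R by rewrite sqr_sqrtr// ltW.
have cN : c != 0%R by rewrite gt_eqF.
have mFa : measurable_fun setT (fun z : 'rV[R]_k => F (a *: z)%R).
  by apply: (measurableT_comp mF); meas.
pose W (z' z : 'rV[R]_k) : R := expR (dot z (r *: z') - 2^-1 * dot (r *: z') (r *: z')).
have mFW : measurable_fun setT (fun zz : 'rV[R]_k * 'rV[R]_k => F (a *: zz.2)%R * (W zz.1 zz.2)%:E).
  apply: emeasurable_funM.
    by apply: (measurableT_comp mFa); exact: measurable_snd.
  by rewrite /W; apply/measurable_EFinP; apply: measurable_expR_comp; apply: measurable_funB; meas.
have FW0 (zz : 'rV[R]_k * 'rV[R]_k) : 0 <= F (a *: zz.2)%R * (W zz.1 zz.2)%:E.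
  by rewrite mule_ge0// lee_fin expR_ge0.
transitivity (\int[gk]_z' \int[gk]_z (F (a *: z)%R * (W z' z)%:E)).
  apply: eq_integral => z' _; rewrite -(gauss_shift (r *: z')%R mFa)//.
  apply: eq_integral => z _; congr F.
  by rewrite scalerDr scalerA /r mulrCA divff ?mulr1// gt_eqF.
rewrite (fubini_tonelli (m1 := gk) (m2 := gk) _ mFW FW0)/=.
have inner z : \int[gk]_z' (W z' z)%:E =
    ((c ^- k) * expR (2^-1 * (1 - c ^- 2) * dot z z))%:E.
  have ci0 : (0 < c^-1)%R by rewrite invr_gt0.
  rewrite (@gauss_scale c^-1 (fun z' => (W z' z)%:E))//; last 2 first.
  - by rewrite /W; apply/measurable_EFinP; apply: measurable_expR_comp; apply: measurable_funB; meas.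
  - by move=> z'; rewrite lee_fin expR_ge0.
  rewrite exprVn EFinM; congr (_ * _).
  transitivity (\int[gk]_z' (expR (dot z' ((r / c) *: z)))%:E).
    apply: eq_integral => z' _; rewrite -EFinM /W -expRD; congr (expR _)%:E.
    rewrite !dotZl !dotZr (dotC z z') exprVn c2.
    have n2 : (1 + r ^+ 2 != 0)%R by rewrite gt_eqF.
    have -> : (r * (c^-1 * (r * (c^-1 * dot z' z'))) = r ^+ 2 * dot z' z' / (1 + r ^+ 2))%R.
      by rewrite -c2; field.
    by field; rewrite n2 cN.
  rewrite gauss_exp dotZl dotZr; congr (expR _)%:E.
  have n2 : (1 + r ^+ 2 != 0)%R by rewrite gt_eqF.
  have -> : (r / c * (r / c * dot z z) = r ^+ 2 * dot z z / (1 + r ^+ 2))%R.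
    by rewrite -c2; field.
  by rewrite c2; field.
have mW z : measurable_fun setT (fun z' => (W z' z)%:E).
  by rewrite /W; apply/measurable_EFinP; apply: measurable_expR_comp; apply: measurable_funB; meas.
have W0 z : forall z', setT z' -> 0 <= (W z' z)%:E by move=> z' _; rewrite lee_fin expR_ge0.
transitivity (\int[gk]_z (F (a *: z)%R * \int[gk]_z' (W z' z)%:E)).
  apply: eq_integral => z _.
  by rewrite -(ge0_integralZl _ measurableT (mW z) (W0 z) (F0 (a *: z)%R)).
have ci0 : (0 < c^-1)%R by rewrite invr_gt0.
have mS : measurable_fun setT (fun z : 'rV[R]_k => F (Num.sqrt (a ^+ 2 + b ^+ 2) *: z)%R).
  by apply: (measurableT_comp mF); meas.
rewrite (gauss_scale ci0 mS)//.
have mE : measurable_fun setT (fun z : 'rV[R]_k => (expR (2^-1 * (1 - c^-1 ^+ 2) * dot z z))%:E).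
  by apply/measurable_EFinP; meas.
have ck0 : 0 <= (c^-1 ^+ k)%:E :> \bar R by rewrite lee_fin exprn_ge0// ltW.
have sE : (Num.sqrt (a ^+ 2 + b ^+ 2) = c * a)%R.
  rewrite /c -[X in (_ * X)%R](gtr0_norm a0) -sqrtr_sqr -sqrtrM ?ltW//; congr Num.sqrt.
  by rewrite /r; field; rewrite gt_eqF.
rewrite -ge0_integralZl//; last 2 first.
- by apply: emeasurable_funM => //; apply: (measurableT_comp mS); meas.
- by move=> z _; rewrite mule_ge0// lee_fin expR_ge0.
apply: eq_integral => z _; rewrite inner EFinM scalerA sE.
have -> : (c * a * c^-1 = a)%R by field.
rewrite !exprVn.
by rewrite muleCA.
Qed.

Lemma gauss_row_sum n (r : R) (F : 'rV[R]_k -> \bar R) : (0 < r)%R ->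
  measurable_fun setT F -> (forall v, 0 <= F v) ->
  \int[prodprob gk n.+1]_t F (row_sum (fun z : 'rV[R]_k => r *: z) t)%R =
  \int[gk]_z F ((r * Num.sqrt n.+1%:R) *: z)%R.
Proof.
move=> r0 mF F0.
have mr : measurable_fun setT (fun z : 'rV[R]_k => (r *: z)%R) by meas.
have ms m : measurable_fun setT (@row_sum R k _ 'rV[R]_k (fun z => (r *: z)%R) m).
  exact: measurable_row_sum.
elim: n F mF F0 => [|n IH] F mF F0.
  rewrite integral_prodprobS; last 2 first.
  - exact: (measurableT_comp mF (ms 1%N)).
  - by [].
  apply: eq_integral => z _; rewrite integral_prodprob0; last first.
    apply: (measurableT_comp mF); apply: (measurableT_comp (ms 1%N)).
    exact: measurable_cons_tuple.
  by rewrite row_sum_cons /row_sum big_ord0 addr0 sqrtr1 mulr1.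
rewrite integral_prodprobS; last 2 first.
- exact: (measurableT_comp mF (ms n.+2)).
- by [].
transitivity (\int[gk]_x \int[gk]_z F ((r * Num.sqrt n.+1%:R) *: z + r *: x)%R).
  apply: eq_integral => x _; rewrite -(IH (fun v => F (v + r *: x)%R))//.
  - by apply: eq_integral => t _; rewrite row_sum_cons addrC.
  - by apply: (measurableT_comp mF); apply: measurable_rowD.
rewrite gauss_add//; last by rewrite mulr_gt0// sqrtr_gt0 ltr0n.
apply: eq_integral => z _; congr (F (_ *: _)).
rewrite exprMn sqr_sqrtr// -[in RHS](gtr0_norm r0) -sqrtr_sqr -sqrtrM ?sqr_ge0//.
by congr Num.sqrt; rewrite -[in RHS]natr1; ring.
Qed.

End GaussianStability.

(** * A quadratic modulus of continuity *)

Section Modulus.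
Variables (R : realType) (k : nat).
Implicit Types (f : 'rV[R]_k -> R) (y v : 'rV[R]_k).

Lemma sqr_coord_le_dot v i : v 0 i ^+ 2 <= dot v v.
Proof.
rewrite /dot (bigD1 i)//= -expr2 lerDl; apply: sumr_ge0 => j _.
by rewrite -expr2 sqr_ge0.
Qed.

(** Uniform continuity holds on a compact cube only; outside it, or for a large shift v, a quadratic
    term already exceeds the trivial bound 1. Tightness is thereby reduced to second moments. *)
Lemma continuous_modulus f (eta kappa : R) : continuous f -> (forall y, 0 <= f y <= 1) ->
  0 < eta -> 0 < kappa -> exists2 lambda : R, 0 <= lambda & forall y v,
  `|f (y + v) - f y| <= eta + kappa * dot y y + lambda * dot v v.
Proof.
(* With this half-width, kappa c^2 is at least 1, as c^2 contains the term 2 / kappa. *)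
move=> cf f01 eta0 kappa0; pose c := kappa^-1 + 1.
have c0 : 0 < c by rewrite addr_gt0// invr_gt0.
have cK : compact [set y : 'rV[R]_k | forall i, `[- c, c]%classic (y ord0 i)].
  by apply: (@rV_compact _ _ (fun=> `[- c, c]%classic)) => i; exact: segment_compact.
have dot0 (u : 'rV[R]_k) : 0 <= dot u u by apply: sumr_ge0 => i _; rewrite -expr2 sqr_ge0.
have [delta delta0 Hd] : exists2 delta : R, 0 < delta & forall y v,
    (forall i, `[- c, c]%classic (y ord0 i)) -> (forall i, `|v 0 i| <= delta) -> `|f (y + v) - f y| <= eta.
  have /compact_near_coveringP nc := cK.
  have := nc R (0^'+) (fun delta y => forall v, (forall i, `|v 0 i| <= delta) ->
    `|f (y + v) - f y| <= eta) _.
  case.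
    move=> y _.
    have /cvgrPdist_le/(_ (eta / 2) (divr_gt0 eta0 (ltr0n _ 2)))/nbhs_ballP[rho /= rho0 H] := cf y.
    exists (ball y (rho / 2), [set d : R | d < rho / 2]); first split => /=.
    - by apply: nbhsx_ballx; rewrite divr_gt0.
    - by apply: nbhs_right_lt; rewrite divr_gt0.
    move=> [y' d] [/= By' dr] v vd.
    have r2 : rho / 2 <= rho by move: rho0 => /=; lra.
    have h1 := H _ (le_ball r2 By').
    have h2 : `|f y - f (y' + v)| <= eta / 2.
      apply: H; split=> // i j; rewrite ord1; have := By'.2 0 j; rewrite /ball/= => B1.
      rewrite mxE opprD addrA (le_lt_trans (ler_normB _ _))// [ltRHS](splitr rho).
      by apply: ltrD => //; exact: le_lt_trans (vd j) dr.
    rewrite (_ : f (y' + v) - f y' = (f y - f y') - (f y - f (y' + v))); last by ring.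
    by rewrite (le_trans (ler_normB _ _))// [leRHS](splitr eta) lerD.
  move=> d /= d0 H; exists (d / 2); first by rewrite divr_gt0.
  move=> y v yc vd; apply: (H (d / 2)) => //=; last by rewrite divr_gt0.
  by rewrite sub0r normrN gtr0_norm ?divr_gt0// ltr_pdivrMr// ltr_pMr// ltr1n.
exists (delta ^- 2); first by rewrite invr_ge0 exprn_ge0// ltW.
move=> y v.
have k0 : 0 <= kappa * dot y y by rewrite mulr_ge0// ltW.
have l0 : 0 <= delta ^- 2 * dot v v by rewrite mulr_ge0// invr_ge0 exprn_ge0// ltW.
have d1 : `|f (y + v) - f y| <= 1.
  have /andP[a0 a1] := f01 (y + v); have /andP[b0 b1] := f01 y.
  by rewrite ler_norml; apply/andP; split; lra.
have [yc|/existsNP[i yi]] := pselect (forall i, `[- c, c]%classic (y ord0 i)).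
  have [vd|/existsNP[i /negP]] := pselect (forall i, `|v 0 i| <= delta).
    by have := Hd _ _ yc vd; lra.
  rewrite -ltNge => vi; have : 1 <= delta ^- 2 * dot v v.
    rewrite mulrC ler_pdivlMr ?exprn_gt0// mul1r (le_trans _ (sqr_coord_le_dot v i))//.
    by rewrite -[X in _ <= X]real_normK ?num_real// lerXn2r ?nnegrE// ltW.
  by lra.
have : 1 <= kappa * dot y y.
  rewrite mulrC -ler_pdivrMr// mul1r (le_trans _ (sqr_coord_le_dot y i))//.
  apply: (@le_trans _ _ (c ^+ 2)).
    have : 0 <= kappa^-1 ^+ 2 by exact: sqr_ge0.
    by move: c0; rewrite /c sqrrD expr1n mulr1; lra.
  rewrite -[X in _ <= X]real_normK ?num_real// lerXn2r ?nnegrE//; first exact: ltW.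
  apply: ltW; rewrite ltNge; apply/negP; rewrite ler_norml => h; apply: yi.
  by rewrite /= in_itv.
by lra.
Qed.

End Modulus.

Section QuadraticError.
Variables (R : realType) (k : nat) (e : measure_display) (X : measurableType e).
Variables (P : probability X R) (phi : X -> 'rV[R]_k).
Hypothesis mphi : measurable_fun setT phi.
Variable tau : R.
Hypothesis Htau : (\int[P]_x (dot (phi x) (phi x))%:E <= tau%:E)%E.
Variables (eta kappa : R).
Hypotheses (eta0 : 0 <= eta) (kappa0 : 0 <= kappa).

Lemma average_quadratic_le (f g : 'rV[R]_k -> R) : unit_valued f -> unit_valued g ->
  (forall y, `|f y - g y| <= eta + kappa * dot y y) ->
  `|average P phi f 0 - average P phi g 0| <= eta + kappa * tau.
Proof.
suff H (f1 g1 : 'rV[R]_k -> R) : unit_valued f1 -> unit_valued g1 ->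
    (forall y, `|f1 y - g1 y| <= eta + kappa * dot y y) ->
    average P phi f1 0 - average P phi g1 0 <= eta + kappa * tau.
  move=> uf ug fg; rewrite ler_norml lerNl opprB; apply/andP; split; apply: H => //.
  by move=> y; rewrite distrC.
move=> uf ug fg; rewrite lerBlDl -lee_fin EFinD !average_EFin//.
have [mf f01] := uf; have [mg g01] := ug.
have mF h : measurable_fun setT h -> measurable_fun setT (fun x : X => (h (0 + phi x))%:E).
  move=> mh; apply/measurable_EFinP; apply: (measurableT_comp mh).
  by apply: measurable_rowD.
have md : measurable_fun setT (fun x : X => (dot (phi x) (phi x))%:E) by meas.
have d0 x : setT x -> (0 <= (dot (phi x) (phi x))%:E :> \bar R)%E.
  by move=> _; rewrite lee_fin -sqr_enorm sqr_ge0.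
have k0 : (0 <= kappa%:E)%E by rewrite lee_fin.
have mkd : measurable_fun setT (fun x : X => (kappa%:E * (dot (phi x) (phi x))%:E)%E).
  exact: emeasurable_funM.
have kd0 x : setT x -> (0 <= kappa%:E * (dot (phi x) (phi x))%:E :> \bar R)%E.
  by move=> xT; rewrite mule_ge0// d0.
have ekd0 x : setT x -> (0 <= eta%:E + kappa%:E * (dot (phi x) (phi x))%:E :> \bar R)%E.
  by move=> xT; rewrite adde_ge0// kd0.
have mekd : measurable_fun setT (fun x : X => (eta%:E + kappa%:E * (dot (phi x) (phi x))%:E)%E).
  exact: emeasurable_funD.
have g0 x : setT x -> (0 <= (g1 (0 + phi x))%:E)%E.
  by move=> _; rewrite lee_fin; have /andP[] := g01 (0 + phi x).
apply: (@le_trans _ _ (\int[P]_x ((g1 (0 + phi x))%:E +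
    (eta%:E + kappa%:E * (dot (phi x) (phi x))%:E)))%E).
  apply: ge0_le_integral => //.
  - by move=> x _; rewrite lee_fin; have /andP[] := f01 (0 + phi x).
  - exact: mF.
  - by apply: emeasurable_funD => //; exact: mF.
  move=> x _; rewrite lee_fin -lerBlDl add0r.
  exact: le_trans (ler_norm _) (fg _).
rewrite (ge0_integralD _ measurableT g0 (mF _ _ mg) ekd0 mekd).
have c0 (x : X) : setT x -> (0 <= cst eta%:E x)%E by rewrite lee_fin.
rewrite (ge0_integralD _ measurableT c0 (measurable_cst _) kd0 mkd).
rewrite (ge0_integralZl _ measurableT md d0 k0) integral_cst// measure_setT mule1.
rewrite -[X in (X <= _)%E]/(_ + (_ + _))%E; apply: leeD => //.
by rewrite EFinD; apply: leeD => //; rewrite EFinM; apply: lee_wpmul2l.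
Qed.

End QuadraticError.

Section AverageStep.
Variables (R : realType) (k : nat) (e : measure_display) (X : measurableType e) (w : X -> R).
Hypotheses (mw : measurable_fun setT w) (w1 : forall x, 1 <= w x).
Variable P : probability X R.
Hypothesis mom : forall n, (\int[P]_x (w x ^+ n)%:E < +oo)%E.
Variable s : X -> 'rV[R]_k.
Hypothesis ts : forall i, tempered w (fun x => s x 0 i).
Hypothesis s0 : forall i, mean P (fun x => s x 0 i) = 0.

Lemma tempered_row_measurable : measurable_fun setT s.
Proof. by apply: measurable_row => i; have [] := ts i. Qed.

Lemma tempered_dot : tempered w (fun x => dot (s x) (s x)).
Proof. by apply: tempered_sum => // i; exact: temperedM. Qed.

Lemma tempered_enorm : tempered w (fun x => enorm (s x)).
Proof.
have [_ [C [n H]]] := tempered_dot; split.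
  by apply: measurable_enorm; exact: tempered_row_measurable.
exists (1 + C), n => x; rewrite ger0_norm ?enorm_ge0//.
have := H x; rewrite -sqr_enorm ger0_norm ?exprn_ge0 ?enorm_ge0//.
rewrite mulrDl mul1r; have := wX_ge1 w1 x n; have := sqr_ge0 (enorm (s x) - 2^-1).
have -> : (enorm (s x) - 2^-1) ^+ 2 = enorm (s x) ^+ 2 - enorm (s x) + 4^-1 by field.
by lra.
Qed.

(** Integrating a second-order expansion kills the linear term by centring and leaves the
    covariance. The restriction r <= 1 gives r|s| + r^2|s|^2 <= r(|s| + |s|^2), whence the factor
    r^3. *)
Lemma average_step : exists2 K : R, 0 <= K & forall (g : 'rV[R]_k -> R) y B D C r,
  unit_valued g -> 0 <= C -> 0 <= r <= 1 ->
  (forall v, `|g (y + v) - (g y + \sum_i v 0 i * B i + \sum_i \sum_j v 0 i * v 0 j * D i j)|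
     <= C * (enorm v + enorm v ^+ 2) ^+ 3) ->
  `|average P (fun x => r *: s x) g y -
    (g y + r ^+ 2 * \sum_i \sum_j D i j * mean P (fun x => s x 0 i * s x 0 j))| <= C * K * r ^+ 3.
Proof.
pose kp x := (enorm (s x) + enorm (s x) ^+ 2) ^+ 3.
have te := tempered_enorm.
have tk : tempered w kp.
  have t2 : tempered w (fun x => enorm (s x) + enorm (s x) ^+ 2).
    by apply: temperedD => //; exact: temperedM.
  by apply: (temperedM w1 t2); exact: temperedM.
have kp0 x : 0 <= kp x by rewrite exprn_ge0// addr_ge0 ?exprn_ge0 ?enorm_ge0.
exists (mean P kp); first by apply: mean_ge0.
move=> g y B D C r ug C0 /andP[r0 r1] H; have [mg g01] := ug.
have tc a : tempered w (fun=> a) by exact: tempered_cst.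
have ms := tempered_row_measurable.
have tg : tempered w (fun x => g (y + r *: s x)).
  split; first by apply: (measurableT_comp mg); apply: measurable_rowD => //; meas.
  exists 1, 0%N => x; rewrite expr0 mulr1; have /andP[g0 g1] := g01 (y + r *: s x).
  by rewrite ger0_norm.
pose q x := g y + \sum_i r * B i * s x 0 i + \sum_i \sum_j r ^+ 2 * D i j * (s x 0 i * s x 0 j).
have tss i j : tempered w (fun x => s x 0 i * s x 0 j) by exact: temperedM.
have t1 : tempered w (fun x => \sum_i r * B i * s x 0 i).
  by apply: tempered_sum => // i; exact: temperedM.
have t2' i : tempered w (fun x => \sum_j r ^+ 2 * D i j * (s x 0 i * s x 0 j)).
  by apply: tempered_sum => // j; exact: temperedM.
have t2 : tempered w (fun x => \sum_i \sum_j r ^+ 2 * D i j * (s x 0 i * s x 0 j)).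
  exact: tempered_sum.
have tq : tempered w q by apply: temperedD => //; exact: temperedD.
have mq : mean P q = g y + r ^+ 2 * \sum_i \sum_j D i j * mean P (fun x => s x 0 i * s x 0 j).
  rewrite /q (meanD mw w1 mom) ?(meanD mw w1 mom)//; last exact: temperedD.
  rewrite (mean_cst P) !(mean_sum mw w1 mom)//; last by move=> i; exact: temperedM.
  rewrite [X in g y + X + _]big1 ?addr0; last by move=> i _; rewrite (meanZ mw w1 mom)// s0 mulr0.
  congr (_ + _); rewrite mulr_sumr; apply: eq_bigr => i _.
  rewrite (mean_sum mw w1 mom); last by move=> j; exact: temperedM.
  by rewrite mulr_sumr; apply: eq_bigr => j _; rewrite (meanZ mw w1 mom)// mulrA.
rewrite -mq /average -mulN1r -(meanZ mw w1 mom _ tq) -(meanD mw w1 mom)//; last exact: temperedM.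
have td : tempered w (fun x => g (y + r *: s x) + -1 * q x).
  by apply: temperedD => //; exact: temperedM.
apply: (le_trans (mean_norm mw w1 mom td)).
have -> : C * mean P kp * r ^+ 3 = mean P (fun x => C * r ^+ 3 * kp x).
  by rewrite (meanZ mw w1 mom _ tk); ring.
apply: (mean_le mw w1 mom).
- exact: tempered_norm.
- exact: temperedM.
move=> x; have := H (r *: s x); rewrite mulN1r.
have -> : g y + \sum_i (r *: s x) 0 i * B i + \sum_i \sum_j (r *: s x) 0 i * (r *: s x) 0 j * D i j = q x.
  rewrite /q; congr (_ + _ + _); apply: eq_bigr => i _; first by rewrite mxE; ring.
  by apply: eq_bigr => j _; rewrite !mxE; ring.
move=> /le_trans; apply; rewrite -mulrA ler_wpM2l// -exprMn lerXn2r ?nnegrE//.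
- by rewrite addr_ge0 ?exprn_ge0 ?enorm_ge0.
- by rewrite mulr_ge0// addr_ge0 ?exprn_ge0 ?enorm_ge0.
rewrite enormZ (ger0_norm r0).
have -> : r * (enorm (s x) + enorm (s x) ^+ 2) =
    r * enorm (s x) + (r * enorm (s x)) ^+ 2 + r * (1 - r) * enorm (s x) ^+ 2 by ring.
by rewrite lerDl mulr_ge0 ?exprn_ge0 ?enorm_ge0// mulr_ge0// subr_ge0.
Qed.

End AverageStep.

Section SmoothedTaylor.
Variables (R : realType) (k : nat).
Notation gk := (gauss R k).
Implicit Types (h : 'rV[R]_k -> R) (y v : 'rV[R]_k).

Definition smooth (eps : R) h := average gk (fun z => eps *: z) h.

Let measurable_eps (eps : R) : measurable_fun setT (fun z : 'rV[R]_k => eps *: z).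
Proof. by meas. Qed.

Lemma unit_valued_smooth eps h : unit_valued h -> unit_valued (smooth eps h).
Proof. by move=> uh; apply: unit_valued_average. Qed.

(** [gauss_taylor] with the shift v / eps. The constant depends on eps alone; the coefficients B and
    D may depend on h and y, which is harmless because they are common to the two laws being
    compared. *)
Lemma smooth_taylor (eps : R) : 0 < eps -> exists2 C : R, 0 <= C & forall h y, unit_valued h ->
  exists B D, forall v,
  `|smooth eps h (y + v) -
    (smooth eps h y + \sum_i v 0 i * B i + \sum_i \sum_j v 0 i * v 0 j * D i j)|
     <= C * (enorm v + enorm v ^+ 2) ^+ 3.
Proof.
move=> eps0; have [C C0 HC] := gauss_taylor R k.
pose c := eps^-1 + eps^-1 ^+ 2; have ei : 0 < eps^-1 by rewrite invr_gt0.
have c0 : 0 <= c by rewrite addr_ge0 ?exprn_ge0// ltW.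
exists (C * c ^+ 3); first by rewrite mulr_ge0// exprn_ge0.
move=> h y uh; have [mh h01] := uh.
pose F z := h (y + eps *: z).
have uF : unit_valued F.
  split; last by move=> z; exact: h01.
  by apply: (measurableT_comp mh); apply: measurable_rowD.
exists (fun i => eps^-1 * mean gk (fun z => F z * z 0 i)),
  (fun i j => eps^-1 ^+ 2 * (2^-1 * mean gk (fun z => F z * (z 0 i * z 0 j - (i == j)%:R)))) => v.
have := HC F (eps^-1 *: v) uF.
have -> : mean gk (fun z => F (z + eps^-1 *: v)) = smooth eps h (y + v).
  rewrite /smooth /average; congr (mean gk _); apply/funext => z; rewrite /F.
  by congr h; rewrite scalerDr scalerA divff ?gt_eqF// scale1r addrA addrAC.
rewrite -[mean gk F]/(smooth eps h y).
have -> : \sum_i (eps^-1 *: v) 0 i * mean gk (fun z => F z * z 0 i) =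
   \sum_i v 0 i * (eps^-1 * mean gk (fun z => F z * z 0 i)).
  by apply: eq_bigr => i _; rewrite mxE; ring.
have -> : \sum_i \sum_j (eps^-1 *: v) 0 i * (eps^-1 *: v) 0 j *
     (2^-1 * mean gk (fun z => F z * (z 0 i * z 0 j - (i == j)%:R))) =
  \sum_i \sum_j v 0 i * v 0 j * (eps^-1 ^+ 2 *
     (2^-1 * mean gk (fun z => F z * (z 0 i * z 0 j - (i == j)%:R)))).
  by apply: eq_bigr => i _; apply: eq_bigr => j _; rewrite !mxE; ring.
move=> /le_trans; apply; rewrite -mulrA -exprMn ler_wpM2l//.
have e0 := enorm_ge0 v.
rewrite lerXn2r ?nnegrE//.
- by rewrite addr_ge0 ?exprn_ge0 ?enorm_ge0.
- by rewrite mulr_ge0// addr_ge0 ?exprn_ge0.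
rewrite enormZ (ger0_norm (ltW ei)) /c; set a := eps^-1 in ei *; set b := enorm v in e0 *.
have -> : (a + a ^+ 2) * (b + b ^+ 2) = a * b + (a * b) ^+ 2 + (a * b ^+ 2 + a ^+ 2 * b) by ring.
by rewrite lerDl addr_ge0// mulr_ge0 ?exprn_ge0// ltW.
Qed.

Lemma smooth_dist (f : 'rV[R]_k -> R) (eta kappa lambda eps : R) y : unit_valued f ->
  0 <= lambda -> (forall y v, `|f (y + v) - f y| <= eta + kappa * dot y y + lambda * dot v v) ->
  `|f y - smooth eps f y| <=
    eta + kappa * dot y y + lambda * eps ^+ 2 * mean gk (fun z => dot z z).
Proof.
move=> uf l0 H; have [mf f01] := uf.
have mw := @measurable_gweight R k; have w1 := @gweight_ge1 R k; have mom := @gauss_moments R k.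
have tc b : tempered (@gweight R k) (fun=> b) by exact: tempered_cst.
have tz i : tempered (@gweight R k) (fun z => z 0 i).
  split; first exact: measurable_coord.
  exists 1, 1%N => z; rewrite mul1r expr1 /gweight (le_trans (le_enorm_coord z i))//.
  by rewrite lerDr.
have td : tempered (@gweight R k) (fun z => dot z z).
  by apply: tempered_sum => // i; exact: temperedM.
have tf : tempered (@gweight R k) (fun z => f (y + eps *: z)).
  split; first by apply: (measurableT_comp mf); apply: measurable_rowD.
  exists 1, 0%N => z; rewrite expr0 mulr1.
  by have /andP[F0 F1] := f01 (y + eps *: z); rewrite ger0_norm.
have tr : tempered (@gweight R k) (fun z => f (y + eps *: z) + - f y) by exact: temperedD.
have tR : tempered (@gweight R k) (fun z => lambda * eps ^+ 2 * dot z z) by exact: temperedM.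
have -> : smooth eps f y = mean gk (fun z => f (y + eps *: z) + - f y) + f y.
  rewrite (meanD mw w1 mom tf (tc _)) mean_cst subrK //.
rewrite opprD addrCA subrr addr0 normrN.
apply: (le_trans (mean_norm mw w1 mom tr)).
rewrite -(meanZ mw w1 mom _ td) -[X in X + _](mean_cst gk) -(meanD mw w1 mom (tc _) tR).
apply: (mean_le mw w1 mom).
- exact: tempered_norm.
- exact: temperedD.
by move=> z; have := H y (eps *: z); rewrite dotZl dotZr expr2 !mulrA.
Qed.

End SmoothedTaylor.

Lemma cvg_inv_sqrt (R : realType) : (Num.sqrt n%:R : R)^-1 @[n --> \oo] --> (0 : R).
Proof.
apply/cvgrPdist_le => eps eps0; exists (Num.bound (eps^-1 ^+ 2)) => // n /= Nn.
have H : eps^-1 ^+ 2 <= n%:R.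
  apply: (le_trans (ltW (archi_boundP (sqr_ge0 eps^-1)))).
  by rewrite ler_nat.
have ei : 0 < eps^-1 by rewrite invr_gt0.
have : eps^-1 <= Num.sqrt n%:R by rewrite -(gtr0_norm ei) -sqrtr_sqr ler_wsqrtr.
move=> h; rewrite sub0r normrN ger0_norm ?invr_ge0 ?sqrtr_ge0//.
by rewrite -[leRHS]invrK lef_pV2// posrE (lt_le_trans ei h).
Qed.

Section CentralLimit.
Variables (R : realType) (k : nat) (e : measure_display) (X : measurableType e) (w : X -> R).
Hypotheses (mw : measurable_fun setT w) (w1 : forall x, 1 <= w x).
Variable P : probability X R.
Hypothesis mom : forall n, (\int[P]_x (w x ^+ n)%:E < +oo)%E.
Variable s : X -> 'rV[R]_k.
Hypothesis ts : forall i, tempered w (fun x => s x 0 i).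
Hypothesis s0 : forall i, mean P (fun x => s x 0 i) = 0.
Variable L : 'M[R]_k.
Hypothesis cov : forall i j, mean P (fun x => s x 0 i * s x 0 j) = (L *m L^T) i j.
Notation gk := (gauss R k).
Let g (z : 'rV[R]_k) : 'rV[R]_k := z *m L^T.

Let gE z i : g z 0 i = dot z (row i L).
Proof. by rewrite /g mxE; apply: eq_bigr => j _; rewrite !mxE. Qed.

Let mgw := @measurable_gweight R k.
Let gw1 := @gweight_ge1 R k.
Let gmom := @gauss_moments R k.

Let tg i : tempered (@gweight R k) (fun z => g z 0 i).
Proof.
rewrite (_ : (fun z => _) = (fun z => dot z (row i L))); last by apply/funext => z; exact: gE.
apply: tempered_sum => // j; apply: temperedM => //; last exact: tempered_cst.
split; first exact: measurable_coord.
exists 1, 1%N => z; rewrite mul1r expr1 /gweight (le_trans (le_enorm_coord z j))//.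
by rewrite lerDr.
Qed.

Let g0 i : mean gk (fun z => g z 0 i) = 0.
Proof.
rewrite (_ : (fun z => _) = (fun z => dot z (row i L))); last by apply/funext => z; exact: gE.
exact: (gauss_first_second _).1.
Qed.

Let gcov i j : mean gk (fun z => g z 0 i * g z 0 j) = (L *m L^T) i j.
Proof.
rewrite (_ : (fun z => _) = (fun z => dot z (row i L) * dot z (row j L))); last first.
  by apply/funext => z; rewrite !gE.
by rewrite gauss_cov mxE; apply: eq_bigr => l _; rewrite !mxE.
Qed.

Let ms : measurable_fun setT s. Proof. exact: (tempered_row_measurable ts). Qed.
Let mg : measurable_fun setT g. Proof. by rewrite /g; meas. Qed.
Let mrs (r : R) : measurable_fun setT (fun x => r *: s x). Proof. by meas. Qed.
Let mrg (r : R) : measurable_fun setT (fun z => r *: g z). Proof. by meas. Qed.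

(** The summand and its Gaussian counterpart are both centred with covariance L L^T, so their
    averages share the main term [c] of the expansion and differ by order r^3. *)
Lemma average_step_dist (eps : R) : 0 < eps -> exists2 K : R, 0 <= K & forall h y r,
  unit_valued h -> 0 <= r <= 1 ->
  `|average P (fun x => r *: s x) (smooth eps h) y -
    average gk (fun z => r *: g z) (smooth eps h) y| <= K * r ^+ 3.
Proof.
move=> eps0; have [C C0 HC] := smooth_taylor k eps0.
have [K1 K10 H1] := average_step mw w1 mom ts s0.
have [K2 K20 H2] := average_step mgw gw1 gmom tg g0.
exists (C * K1 + C * K2); first by rewrite addr_ge0// mulr_ge0.
move=> h y r uh r01; have [B [D HBD]] := HC h y uh.
have us := unit_valued_smooth eps uh.
pose c := smooth eps h y + r ^+ 2 * \sum_i \sum_j D i j * (L *m L^T) i j.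
have E1 : `|average P (fun x => r *: s x) (smooth eps h) y - c| <= C * K1 * r ^+ 3.
  have := H1 _ _ _ _ _ _ us C0 r01 HBD.
  rewrite (eq_bigr (fun i => \sum_j D i j * (L *m L^T) i j))// => i _.
  by apply: eq_bigr => j _; rewrite cov.
have E2 : `|average gk (fun z => r *: g z) (smooth eps h) y - c| <= C * K2 * r ^+ 3.
  have := H2 _ _ _ _ _ _ us C0 r01 HBD.
  rewrite (eq_bigr (fun i => \sum_j D i j * (L *m L^T) i j))// => i _.
  by apply: eq_bigr => j _; rewrite gcov.
rewrite (le_trans (ler_distD c _ _))// mulrDl lerD//.
by rewrite distrC.
Qed.

Lemma average_gauss_sample n f y : unit_valued f ->
  average (prodprob gk n.+1) (@row_sum R k _ _ (fun z => (Num.sqrt n.+1%:R)^-1 *: g z) n.+1) f y =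
  average gk g f y.
Proof.
move=> uf; have [mf f01] := uf; apply: EFin_inj.
set r := (Num.sqrt _)^-1; have sq0 : 0 < Num.sqrt n.+1%:R :> R by rewrite sqrtr_gt0 ltr0n.
have r0 : 0 < r by rewrite invr_gt0.
rewrite !average_EFin//; last exact: measurable_row_sum.
have H := @gauss_row_sum R k n r (fun v => (f (y + v *m L^T))%:E) r0.
rewrite /r mulVf ?gt_eqF// -/r in H.
transitivity (\int[gk]_z (f (y + (1 *: z) *m L^T))%:E)%E; last first.
  by apply: eq_integral => z _; rewrite scale1r.
rewrite -H.
- apply: eq_integral => t _; congr (f (y + _))%:E.
  rewrite /row_sum mulmx_suml; apply: eq_bigr => i _.
  by rewrite scalemxAl.
- apply/measurable_EFinP; apply: (measurableT_comp mf); apply: measurable_rowD => //.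
- by move=> v; rewrite lee_fin; have /andP[] := f01 (y + v *m L^T).
Qed.

Let tau := \sum_i mean P (fun x => s x 0 i ^+ 2).

Let tau_ge0 : 0 <= tau.
Proof. by apply: sumr_ge0 => i _; apply: mean_ge0 => x; exact: sqr_ge0. Qed.

Lemma second_moment_sample n :
  (\int[prodprob P n.+1]_t (dot (row_sum (fun x => (Num.sqrt n.+1%:R)^-1 *: s x) t)
     (row_sum (fun x => (Num.sqrt n.+1%:R)^-1 *: s x) t))%:E <= tau%:E)%E.
Proof.
set r := (Num.sqrt _)^-1.
have mrow := @measurable_row_sum R k _ X _ (mrs r) n.+1.
have r2 : n.+1%:R * r ^+ 2 = 1 by rewrite exprVn sqr_sqrtr// divff// pnatr_eq0.
rewrite (_ : (fun t => _) = fun t => (\sum_(i < k)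
    ((0 + \sum_(j < n.+1) r * s (tnth t j) 0 i) ^+ 2)%:E)%E); last first.
  apply/funext => t; rewrite sumEFin; congr EFin; apply: eq_bigr => i _.
  rewrite -expr2 add0r row_sumE; congr (_ ^+ 2).
  by apply: eq_bigr => j _; rewrite mxE.
have mi i : measurable_fun setT (fun x => r * s x 0 i).
  by apply: measurable_funM => //; have [] := ts i.
rewrite ge0_integral_sum//; last 2 first.
- move=> i; apply/measurable_EFinP; apply: measurable_funX; apply: measurable_funD => //.
  exact: (measurable_sample_sum (mi i)).
- by move=> i t _; rewrite lee_fin sqr_ge0.
rewrite /tau -sumEFin le_eqVlt; apply/orP; left; apply/eqP; apply: eq_bigr => i _.
have tri : tempered w (fun x => r * s x 0 i) by apply: temperedM => //; exact: tempered_cst.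
have tss : tempered w (fun x => s x 0 i ^+ 2) by exact: temperedM.
rewrite (@integral_sample_sqr R _ X P n.+1 (fun x => r * s x 0 i) 0 (mi i)).
- rewrite expr0n add0r; congr EFin.
  transitivity (n.+1%:R * mean P (fun x => r ^+ 2 * s x 0 i ^+ 2)).
    by congr (_ * mean P _); apply/funext => x; rewrite exprMn.
  by rewrite (meanZ mw w1 mom _ tss) mulrA r2 mul1r.
- exact: (tempered_integrable mw w1 mom tri).
- by apply: (tempered_integrable mw w1 mom (c := fun x => (r * s x 0 i) ^+ 2)); exact: temperedM.
- by rewrite -[LHS]/(mean P _) (meanZ mw w1 mom _ (ts i)) s0 mulr0.
Qed.

(** Smoothing costs at most 3 eta / 10 on each side, through second moments bounded uniformly in n,
    and the replacement of n summands costs n K r^3 = K / sqrt n, at most eta / 10 for large n. *)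
Lemma central_limit_unit (f : 'rV[R]_k -> R) : continuous f -> (forall y, 0 <= f y <= 1) ->
  average (prodprob P n) (@row_sum R k _ _ (fun x => (Num.sqrt n%:R)^-1 *: s x) n) f 0
    @[n --> \oo] --> average gk g f 0.
Proof.
move=> cf f01; have uf : unit_valued f by split=> //; exact: continuous_measurable_mx.
have tgd : tempered (@gweight R k) (fun z => dot (g z) (g z)) by exact: (tempered_dot gw1 tg).
pose tau' := mean gk (fun z => dot (g z) (g z)).
pose tz := mean gk (fun z : 'rV[R]_k => dot z z).
have dd0 (z : 'rV[R]_k) : 0 <= dot z z by rewrite -sqr_enorm sqr_ge0.
have tau'0 : 0 <= tau' by apply: mean_ge0.
have tz0 : 0 <= tz by apply: mean_ge0.
apply/cvgrPdist_le => eta eta0.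
pose T := tau + tau' + 1.
have T0 : 0 < T by rewrite ltr_wpDl// addr_ge0.
have e10 : 0 < eta / 10 by rewrite divr_gt0.
have k0 : 0 < eta / 10 / T by rewrite divr_gt0.
have [lambda l0 Hl] := continuous_modulus cf f01 e10 k0.
(* The order of the choices matters: kappa comes from the second moments, lambda from kappa, eps
   from lambda, and K and the rank of n from eps. *)
pose D := lambda * tz + 1.
have D0 : 0 < D by rewrite ltr_wpDl// mulr_ge0.
pose eps := Num.sqrt (eta / 10 / D).
have eps0 : 0 < eps by rewrite sqrtr_gt0 divr_gt0.
have eps2 : lambda * eps ^+ 2 * tz <= eta / 10.
  rewrite sqr_sqrtr; last by rewrite ltW// divr_gt0.
  have -> : lambda * (eta / 10 / D) * tz = eta / 10 * ((D - 1) / D) by rewrite /D addrK; ring.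
  rewrite ler_piMr//; first exact: ltW.
  by rewrite ler_pdivrMr// mul1r lerBlDr lerDl.
have us := unit_valued_smooth eps uf.
have Hs y : `|f y - smooth eps f y| <= 2 * (eta / 10) + eta / 10 / T * dot y y.
  by have := smooth_dist eps y uf l0 Hl; rewrite -/tz; lra.
have kT t : 0 <= t -> t <= T -> eta / 10 / T * t <= eta / 10.
  move=> t0 tT; rewrite -mulrA ler_piMr//; first exact: ltW.
  by rewrite mulrC ler_pdivrMr// mul1r.
have [K K0 HK] := average_step_dist eps0.
have /cvgrPdist_le/(_ (eta / 10) e10)[N _ HN] :
    (K * (Num.sqrt n%:R)^-1 : R) @[n --> \oo] --> 0.
  by rewrite -[X in _ --> X](mulr0 K); apply: cvgMr; exact: cvg_inv_sqrt.
exists N.+1 => // -[//|n] /= Nn.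
set r := (Num.sqrt _)^-1.
have sq1 : 1 <= Num.sqrt n.+1%:R :> R by rewrite -[X in X <= _]sqrtr1 ler_wsqrtr// ler1n.
have r01 : 0 <= r <= 1.
  by rewrite invr_ge0 sqrtr_ge0/= invf_le1// (lt_le_trans ltr01).
pose A1 := average (prodprob P n.+1) (@row_sum R k _ _ (fun x => r *: s x) n.+1).
pose A2 := average gk g.
have e2 : 0 <= 2 * (eta / 10) by rewrite mulr_ge0// ltW.
have B1 : `|A1 f 0 - A1 (smooth eps f) 0| <= 3 * (eta / 10).
  have : `|A1 f 0 - A1 (smooth eps f) 0| <= 2 * (eta / 10) + eta / 10 / T * tau.
    apply: (average_quadratic_le _ (second_moment_sample n) e2 (ltW k0) uf us Hs).
    exact: measurable_row_sum.
  move=> /le_trans; apply.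
  by have := kT tau tau_ge0; rewrite /T; move: tau'0; lra.
have B2 : `|A2 f 0 - A2 (smooth eps f) 0| <= 3 * (eta / 10).
  have Ht : (\int[gk]_z (dot (g z) (g z))%:E <= tau'%:E)%E.
    by rewrite (mean_EFin mgw gw1 gmom tgd).
  apply: (le_trans (average_quadratic_le mg Ht e2 (ltW k0) uf us Hs)).
  by have := kT tau' tau'0; rewrite /T; move: tau_ge0; lra.
have B3 : `|A1 (smooth eps f) 0 - A2 (smooth eps f) 0| <= eta / 10.
  rewrite /A2 -(average_gauss_sample n 0 us).
  have meps : measurable_fun setT (fun z : 'rV[R]_k => eps *: z) by meas.
  have := average_sample_dist (mrs r) (mrg r) meps
    (fun h y uh => HK h y r uh r01) n.+1 0 uf.
  move=> /le_trans; apply.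
  have := HN n.+1 (ltnW Nn); rewrite sub0r normrN -/r; apply: le_trans.
  have r2 : n.+1%:R * r ^+ 2 = 1 by rewrite exprVn sqr_sqrtr// divff// pnatr_eq0.
  have -> : n.+1%:R * (K * r ^+ 3) = K * r 
    by transitivity (n.+1%:R * r ^+ 2 * (K * r)); [ring|rewrite r2 mul1r].
  exact: ler_norm.
rewrite (_ : _ - _ = (A2 f 0 - A2 (smooth eps f) 0) - (A1 (smooth eps f) 0 - A2 (smooth eps f) 0)
  - (A1 f 0 - A1 (smooth eps f) 0)); last by rewrite /A1 /A2; ring.
apply: (le_trans (ler_normB _ _)); apply: (le_trans (lerD (ler_normB _ _) (lexx _))).
by move: B1 B2 B3; lra.
Qed.

End CentralLimit.

Section ExpectationAverage.
Variables (R : realType) (k : nat) (e : measure_display) (X : measurableType e).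
Variables (P : probability X R) (phi : X -> 'rV[R]_k).
Hypothesis mphi : measurable_fun setT phi.

Lemma unit_valued_rescale (f : 'rV[R]_k -> R) (c : R) : measurable_fun setT f -> 0 < c ->
  (forall y, `|f y| <= c) -> unit_valued (fun y => (2 * c)^-1 * (f y + c)).
Proof.
move=> mf c0 fc; split.
  by apply: measurable_funM => //; exact: measurable_funD.
move=> y; have := fc y; rewrite ler_norml => /andP[a b].
have c2 : 0 < 2 * c by rewrite mulr_gt0.
by rewrite mulrC divr_ge0 ?(ltW c2)//= ?ler_pdivrMr ?mul1r//; lra.
Qed.

Lemma expectation_average (f : 'rV[R]_k -> R) (c : R) : measurable_fun setT f -> 0 < c ->
  (forall y, `|f y| <= c) ->
  ('E_P[f \o phi] =
   (2 * c * average P phi (fun y => (2 * c)^-1 * (f y + c)) 0 - c)%:E)%E.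
Proof.
move=> mf c0 fc; have c2 : 2 * c != 0 by rewrite mulf_neq0 ?gt_eqF.
have mw : measurable_fun setT (fun _ : X => 1 : R) by exact: measurable_cst.
have w1 (x : X) : (1 : R) <= (fun _ : X => 1) x by [].
have mom n : (\int[P]_x (((fun _ : X => 1 : R) x) ^+ n)%:E < +oo)%E.
  by rewrite integral_cst// measure_setT mule1 ltry.
have tf : tempered (fun _ : X => 1) (f \o phi).
  split; first exact: measurableT_comp.
  by exists c, 0%N => x; rewrite expr0 mulr1; exact: fc.
have tc a : tempered (fun _ : X => 1 : R) (fun=> a) by exact: tempered_cst.
have tfc := temperedD w1 tf (tc c).
have -> : average P phi (fun y => (2 * c)^-1 * (f y + c)) 0 = (2 * c)^-1 * (mean P (f \o phi) + c).
  rewrite -[X in _ + X](mean_cst P) -(meanD mw w1 mom tf (tc c)) -(meanZ mw w1 mom _ tfc).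
  by congr (mean P _); apply/funext => x; rewrite add0r.
rewrite mulrA divff// mul1r addrK unlock (mean_EFin mw w1 mom tf).
by [].
Qed.

End ExpectationAverage.

Section CentralLimitTheorem.
Variables (R : realType) (k : nat) (e : measure_display) (X : measurableType e) (w : X -> R).
Hypotheses (mw : measurable_fun setT w) (w1 : forall x, 1 <= w x).
Variable P : probability X R.
Hypothesis mom : forall n, (\int[P]_x (w x ^+ n)%:E < +oo)%E.
Variable s : X -> 'rV[R]_k.
Hypothesis ts : forall i, tempered w (fun x => s x 0 i).
Hypothesis s0 : forall i, mean P (fun x => s x 0 i) = 0.

Theorem central_limit (S L : 'M[R]_k) : L *m L^T = S ->
  (forall i j, mean P (fun x => s x 0 i * s x 0 j) = S i j) ->
  cvg_in_distribution (fun n => prodprob P n)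
    (fun n t => (Num.sqrt n%:R)^-1 *: \sum_(i < n) s (tnth t i)) (mnormal S).
Proof.
move=> LS cov f cf [M fM].
(* [mnormal S] is built from a factor [L0] of its own choosing; the comparison Gaussian has to be
   built from the same one. *)
have [L0 L0S HL0] := integral_mnormal_factor LS.
pose c := `|M| + 1; have c0 : 0 < c by rewrite ltr_wpDl.
have fc y : `|f y| <= c.
  by apply: (le_trans (fM y)); apply: (le_trans (ler_norm M)); rewrite lerDl.
have mf : measurable_fun setT f by exact: continuous_measurable_mx.
pose h y := (2 * c)^-1 * (f y + c).
have uh : unit_valued h by exact: unit_valued_rescale.
have ch : continuous h.
  move=> y; apply: (@continuousM R 'rV[R]_k (fun=> (2 * c)^-1) (fun y => f y + c)).
    exact: cst_continuous.
  apply: (@continuousD R _ 'rV[R]_k f (fun=> c)); first exact: cf.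
  exact: cst_continuous.
have ms : measurable_fun setT s by exact: (tempered_row_measurable ts).
have mrs (r : R) : measurable_fun setT (fun x => r *: s x) by meas.
have cov0 i j : mean P (fun x => s x 0 i * s x 0 j) = (L0 *m L0^T) i j by rewrite L0S.
have H := central_limit_unit mw w1 mom ts s0 cov0 ch uh.2.
have mz : measurable_fun setT (fun z : 'rV[R]_k => z *m L0^T) by meas.
have mid : measurable_fun setT (fun z : 'rV[R]_k => z) by exact: measurable_id.
have -> : ('E_(mnormal S)[f] = (2 * c * average (gauss R k) (fun z => z *m L0^T) h 0 - c)%:E)%E.
  have -> : f = f \o id by [].
  apply: (etrans (expectation_average (mnormal S) mid mf c0 fc)).
  apply: (congr1 (fun x : R => (2 * c * x - c)%:E)); apply: EFin_inj.
  rewrite (average_EFin (mnormal S) mid 0 uh) (average_EFin (gauss R k) mz 0 uh) HL0.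
  - rewrite /gauss ge0_integral_law//; first exact: measurable_tuple_row.
    + by apply/measurable_EFinP; apply: (measurableT_comp uh.1); apply: measurable_rowD.
    + by move=> z; rewrite lee_fin; have /andP[] := uh.2 (0 + z *m L0^T).
  - by apply/measurable_EFinP; apply: (measurableT_comp uh.1); apply: measurable_rowD.
  - by move=> z; rewrite lee_fin; have /andP[] := uh.2 (0 + z).
rewrite (_ : (fun n => _) = (fun n => (2 * c * average (prodprob P n)
    (@row_sum R k _ _ (fun x => (Num.sqrt n%:R)^-1 *: s x) n) h 0 - c)%:E)); last first.
  apply/funext => n.
  apply: (etrans _ (expectation_average (prodprob P n) (@measurable_row_sum _ _ _ _ _ (mrs _) n) mf c0 fc)).
  apply: (congr1 (expectation _)); apply/funext => t /=.
  by rewrite /row_sum scaler_sumr.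
apply: cvg_EFin; first by near=> n.
apply: cvgB; last exact: cvg_cst.
by apply: cvgMr; exact: H.
Unshelve. all: by end_near. Qed.

End CentralLimitTheorem.

(** * Cholesky factorization *)

Section Cholesky.
Variable R : realType.

Lemma quad_mx k (A : 'M[R]_k) (v : 'rV[R]_k) : quad A v = (v *m A *m v^T) 0 0.
Proof. by rewrite /quad dotE. Qed.

(* L = [[sqrt a, 0], [b^T / sqrt a, L']] with L' L'^T the Schur complement of
   the leading entry a. *)
Lemma cholesky k (S : 'M[R]_k) : posdef S -> exists L : 'M[R]_k, L *m L^T = S.
Proof.
elim: k S => [|k IH] S [symS posS].
  by exists 0; apply/matrixP => -[].
pose T : 'M[R]_(1 + k) := S; pose a := ulsubmx T 0 0.
pose b : 'rV[R]_k := ursubmx T; pose D := drsubmx T.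
have ET : T = block_mx a%:M b b^T D.
  rewrite -[LHS]submxK; congr block_mx; first exact: mx11_scalar.
  by rewrite /b trmx_ursub [T^T]symS.
have DT : D^T = D by rewrite /D trmx_drsub [T^T]symS.
have addE (A B : 'M[R]_1) : (A + B) 0 0 = A 0 0 + B 0 0 by rewrite mxE.
have scaleE (t : R) (A : 'M[R]_1) : (t *: A) 0 0 = t * A 0 0 by rewrite mxE.
have oppE (A : 'M[R]_1) : (- A) 0 0 = - A 0 0 by rewrite mxE.
have scalE (t : R) : (t%:M : 'M[R]_1) 0 0 = t by rewrite mxE eqxx mulr1n.
have qT (t : R) (v : 'rV[R]_k) : row_mx t%:M v != 0 ->
    0 < (t ^+ 2 * a + 2 * t * dot b v + quad D v).
  move=> /posS qS; have : 0 < (row_mx t%:M v *m T *m (row_mx t%:M v)^T) 0 0 by rewrite -quad_mx.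
  rewrite ET mul_row_block tr_row_mx mul_row_col tr_scalar_mx !mulmxDl !mul_mx_scalar !mul_scalar_mx.
  rewrite -!scalemxAl !addE !scaleE !scalE -!dotE -[dot (v *m D) v]/(quad D v) (dotC v b) => h.
  by rewrite (lt_le_trans h)// le_eqVlt; apply/orP; left; apply/eqP; ring.
have a0 : 0 < a.
  have := qT 1 0; rewrite /quad mul0mx dotC /dot !big1 => [|i _|i _]; rewrite ?mxE ?mulr0 ?mul0r//.
  rewrite expr1n mul1r !addr0; apply; apply/eqP => h.
  by have := congr1 (fun A => lsubmx A 0 0) h; rewrite row_mxKl scalE linear0 mxE => /eqP; rewrite oner_eq0.
pose U := D - a^-1 *: (b^T *m b).
have [|L' LL] := IH U.
  split; first by rewrite /U /Defs.symmetric raddfB/= linearZ/= trmx_mul trmxK DT.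
  move=> v v0; have := qT (- (a^-1 * dot b v)) v.
  have -> : row_mx (- (a^-1 * dot b v))%:M v != 0.
    by apply: contra v0 => /eqP h; rewrite -(row_mxKr (- (a^-1 * dot b v))%:M v) h linear0.
  move=> /(_ isT) h; apply: (lt_le_trans h); rewrite le_eqVlt; apply/orP; left; apply/eqP.
  rewrite /U !quad_mx mulmxBr mulmxBl -scalemxAr -scalemxAl addE oppE !scaleE.
  rewrite mulmxA -[v *m b^T *m b *m v^T]mulmxA [v *m b^T]mx11_scalar mul_scalar_mx scaleE -!dotE (dotC v b).
  by field; rewrite gt_eqF.
pose r := Num.sqrt a.
have rr : r * r = a by rewrite -expr2 sqr_sqrtr// ltW.
have r0 : r != 0 by rewrite gt_eqF// sqrtr_gt0.
pose B : 'M[R]_(1 + k) := block_mx r%:M 0 (r^-1 *: b^T) L'.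
suff E : B *m B^T = T by exists B.
rewrite ET /B tr_block_mx mulmx_block !trmx0 !mul0mx !mulmx0 !addr0 tr_scalar_mx.
congr block_mx.
- by rewrite -scalar_mxM rr.
- by rewrite mul_scalar_mx linearZ/= trmxK scalerA divff// scale1r.
- by rewrite -scalemxAl mul_mx_scalar scalerA mulVf// scale1r.
- rewrite LL /U linearZ/= trmxK -scalemxAl -scalemxAr scalerA -invfM rr.
  by rewrite addrC subrK.
Qed.

End Cholesky.

(** * The wrapped normal family *)

Section ModelLaw.
Variables (R : realType) (d' : nat).
Local Notation d := d'.+1.
Variables (mu0 : 'rV[R]_d.+1) (Hm0 : hyperboloid mu0).
Variables (iota : {linear 'rV[R]_d -> 'rV[R]_d.+1}) (Hiota : tangent_isometry mu0 iota).
Variables (A : 'M[R]_d) (sA : Defs.symmetric A).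
Local Notation X := 'rV[R]_d.+1.
Local Notation p := (d + vdim d)%N.
Local Notation w := (weight mu0).
Local Notation th0 := (theta0 A).
Implicit Types (u : 'rV[R]_p) (x : X).

Let law_at u := model iota mu0 (th0 + u).
Let mean_at u : X := mu_of iota mu0 (th0 + u).
Let ell x u : R := mdens iota mu0 (th0 + u) x - mdens iota mu0 th0 x.
(** The square root exp(B/2) of exp B, used as the factor that the Gaussian lemmas ask for. *)
Let half u : 'M[R]_d := mexp (2^-1 *: (A + mat (rsubmx u))).

Let hyp_at u : hyperboloid (mean_at u). Proof. exact: mu_of_hyperboloid. Qed.

Let symmetric_at u : Defs.symmetric (A + mat (rsubmx u)).
Proof. by rewrite /Defs.symmetric raddfD/= sA (mat_spec (rsubmx u)).1. Qed.

Let half_at u : half u *m (half u)^T = Sigma_of (th0 + u).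
Proof. by rewrite Sigma_ofE// /half mexp_sqrt. Qed.

Let unit_at u : Sigma_of (th0 + u) \in unitmx.
Proof. by rewrite Sigma_ofE// mexp_unit. Qed.

Lemma measurable_mdens u : measurable_fun setT (mdens iota mu0 (th0 + u)).
Proof. by apply: measurable_logdens; exact: hyp_at. Qed.

Lemma model_change_of_law u u' (F : X -> \bar R) : measurable_fun setT F ->
  (forall x, 0 <= F x)%E ->
  (\int[law_at u']_x F x = \int[law_at u]_x
     (F x * (expR (mdens iota mu0 (th0 + u') x - mdens iota mu0 (th0 + u) x))%:E))%E.
Proof.
exact: (HWN_change_of_law (hyp_at u) (half_at u) (unit_at u) (hyp_at u') (half_at u') (unit_at u')).
Qed.

(** The additive 3 comes from exp r <= 2 cosh r <= 4 cosh |z| <= 4 exp |z| and 4 <= exp 3. *)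
Lemma radius_chart_le : exists2 dl, 0 < dl & forall u z, enorm u <= dl ->
  hradius mu0 (chart (mean_at u) z) <= enorm z + 3.
Proof.
have [dl dl0 H] := lheight_le Hm0 Hiota A; exists dl => // u z ul.
have hx := chart_hyperboloid z (hyp_at u).
have rx : retract mu0 (chart (mean_at u) z) = chart (mean_at u) z.
  by rewrite /retract; case: on_hyperboloidP.
have := H u (chart (mean_at u) z) ul.
rewrite lheightE// rx chart_lorentz; last exact: hyp_at.
rewrite opprK => h.
have z0 := enorm_ge0 z.
set r := hradius _ _ in h *.
rewrite -ler_expR expRD.
have e3 : 4 <= expR 3 :> R by have := expR_ge1Dx (3 : R); lra.
have a1 : expR r <= 2 * coshR r by rewrite /coshR mulrC divfK ?lerDl ?expR_ge0.
have a2 : coshR (enorm z) <= expR (enorm z).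
  have : expR (- enorm z) <= expR (enorm z) by rewrite ler_expR; lra.
  by rewrite /coshR; lra.
have a3 : expR (enorm z) * 4 <= expR (enorm z) * expR 3 by rewrite ler_wpM2l ?expR_ge0.
by lra.
Qed.

Lemma Sigma_entries_bounded : exists2 T : R, 0 <= T & forall u, enorm u <= 1 ->
  forall i, Sigma_of (th0 + u) i i <= T.
Proof.
pose V : {linear 'rV[R]_p -> 'M[R]_d} :=
  HB.pack (@mat_rsubmx R d 1) (GRing.isLinear.Build _ _ _ _ _ (@mat_rsubmx_linear R d 1)).
pose c := \sum_i mnorm (V (delta_mx 0 i)).
have c0 : 0 <= c by apply: sumr_ge0 => i _; exact: mnorm_ge0.
exists (d.+1%:R * expR (mnorm A + c)); first by rewrite mulr_ge0// expR_ge0.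
move=> u u1 i; rewrite Sigma_ofE// mexpE.
apply: (le_trans (ler_norm _)); apply: (le_trans (expsum_le (geom_exp _ i i))).
rewrite ler_wpM2l// ler_expR (le_trans (mnormD _ _))// lerD2l.
have := mnorm_linear V u; rewrite /V/= /mat_rsubmx scale1r => /le_trans; apply.
by rewrite -/c ler_piMr.
Qed.

(** Cauchy-Schwarz on the rows of L, whose squared norms are the diagonal entries of S. The bound
    depends on S alone, hence holds for whichever factor [xget] selects. *)
Lemma enorm_mul_factor (L S : 'M[R]_d) z : L *m L^T = S ->
  enorm (z *m L^T) ^+ 2 <= enorm z ^+ 2 * \sum_i S i i.
Proof.
move=> LS; rewrite [X in X <= _]sqr_enorm /dot mulr_sumr; apply: ler_sum => i _.
have -> : (z *m L^T) 0 i = dot z (row i L).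
  by rewrite mxE; apply: eq_bigr => j _; rewrite !mxE.
have -> : S i i = enorm (row i L) ^+ 2.
  by rewrite sqr_enorm -LS mxE; apply: eq_bigr => j _; rewrite !mxE.
rewrite -expr2 -exprMn -[X in X <= _]real_normK ?num_real// lerXn2r ?nnegrE//.
  by rewrite mulr_ge0// enorm_ge0.
exact: dot_le_enorm.
Qed.

(** Each nearby law is an image of one fixed standard Gaussian, along which the weight is at most a
    constant times 1 + |z|, uniformly in u. *)
Lemma model_moments : exists2 dl : R, 0 < dl & forall n, exists C : R, forall u, enorm u <= dl ->
  (\int[law_at u]_x (w x ^+ n)%:E <= C%:E)%E.
Proof.
have [dl dl0 Hr] := radius_chart_le; have [T T0 HT] := Sigma_entries_bounded.
exists (Num.min dl 1); first by rewrite lt_min dl0 ltr01.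
move=> n; pose D := d%:R * T; have D0 : 0 <= D by rewrite mulr_ge0.
(* D bounds the trace of the covariance, so the weight is at most 4 + |z| (D + 1), which is below B
   (1 + |z|). *)
pose B := 4 * (1 + (D + 1)); have B0 : 0 <= B by rewrite mulr_ge0// addr_ge0// addr_ge0.
have g3 := @gauss_moments R d n.
have p3 : (0 <= \int[gauss R d]_z (gweight z ^+ n)%:E)%E.
  by apply: integral_ge0 => z _; rewrite lee_fin exprn_ge0// (le_trans ler01 (gweight_ge1 z)).
pose M := fine (\int[gauss R d]_z (gweight z ^+ n)%:E)%E.
have HM : (\int[gauss R d]_z (gweight z ^+ n)%:E = M%:E)%E by rewrite fineK// ge0_fin_numE.
exists (B ^+ n * M) => u; rewrite le_min => /andP[udl u1].
have mr := measurable_radius Hm0.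
have mwn : measurable_fun setT (fun x => (w x ^+ n)%:E).
  by apply/measurable_EFinP; apply: measurable_funX; apply: measurable_funD.
have w0 x : (0 <= (w x ^+ n)%:E)%E.
  by rewrite lee_fin exprn_ge0// (le_trans ler01 (weight_ge1 mu0 x)).
rewrite /law_at /model integral_HWN_chart//; last exact: hyp_at.
have [L0 L0S HL0] := integral_mnormal_factor (half_at u).
have mc : measurable_fun setT (fun z => (w (chart (mean_at u) z) ^+ n)%:E).
  by apply: (measurableT_comp mwn); exact: measurable_chart.
rewrite HL0//.
have mcL : measurable_fun setT (fun z : 'rV[R]_d => (w (chart (mean_at u) (z *m L0^T)) ^+ n)%:E).
  by apply: (measurableT_comp mc); meas.
apply: (@le_trans _ _ (\int[gauss R d]_z (w (chart (mean_at u) (z *m L0^T)) ^+ n)%:E)%E).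
  by rewrite /gauss ge0_integral_law//; exact: measurable_tuple_row.
have mg : measurable_fun setT (fun z : 'rV[R]_d => (gweight z ^+ n)%:E).
  by apply/measurable_EFinP; apply: measurable_funX; exact: measurable_gweight.
have g0 (z : 'rV[R]_d) : setT z -> (0 <= (gweight z ^+ n)%:E :> \bar R)%E.
  by move=> _; rewrite lee_fin exprn_ge0// (le_trans ler01 (gweight_ge1 z)).
have Bn0 : (0 <= (B ^+ n)%:E)%E by rewrite lee_fin exprn_ge0.
rewrite EFinM -HM -(ge0_integralZl _ measurableT mg g0 Bn0).
apply: ge0_le_integral => //; first exact: emeasurable_funM.
move=> z _; rewrite -EFinM lee_fin -exprMn lerXn2r ?nnegrE//.
- exact: (le_trans ler01 (weight_ge1 mu0 _)).
- by rewrite mulr_ge0// (le_trans ler01 (gweight_ge1 z)).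
have h1 := Hr u (z *m L0^T) udl.
have h2 := enorm_mul_factor z L0S.
have h3 : \sum_i Sigma_of (th0 + u) i i <= D.
  apply: (le_trans (ler_sum _ (fun i _ => HT u u1 i))).
  by rewrite sumr_const card_ord /D mulr_natl.
have z0 := enorm_ge0 z; have y0 := enorm_ge0 (z *m L0^T).
have h4 : enorm (z *m L0^T) <= enorm z * (D + 1).
  have : enorm (z *m L0^T) ^+ 2 <= (enorm z * (D + 1)) ^+ 2.
    apply: (le_trans h2); rewrite exprMn ler_wpM2l ?sqr_ge0// (le_trans h3)//.
    by rewrite sqrrD expr1n mulr1; have := sqr_ge0 D; lra.
  by rewrite ler_sqr ?nnegrE// mulr_ge0// addr_ge0.
rewrite /weight /gweight /B.
have -> : 4 * (1 + (D + 1)) * (1 + enorm z) =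
   4 * (D + 2) + 3 * (enorm z * (D + 1)) + (enorm z * (D + 1)) + 4 * enorm z by ring.
have : 0 <= enorm z * (D + 1) by rewrite mulr_ge0// addr_ge0.
by lra.
Qed.

End ModelLaw.

(** The bridge from expansions to the score: a cubic remainder at one point gives the partial
    derivatives there as the linear coefficients, without differentiating the closed form of the
    density. *)
Lemma derive_quadratic (R : realType) (p : nat) (f : 'rV[R]_p -> R) (th : 'rV[R]_p)
    (a : 'I_p -> R) (b : 'I_p -> 'I_p -> R) (K dl : R) i : 0 < dl -> 0 <= K ->
  (forall u, enorm u <= dl -> `|f (th + u) - f th -
     (\sum_i u 0 i * a i + \sum_i \sum_j u 0 i * u 0 j * b i j)| <= K * enorm u ^+ 3) ->
  'D_(delta_mx 0 i) f th = a i.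
Proof.
move=> dl0 K0 H; apply: cvg_lim => //; apply/cvgrPdist_le => eps eps0.
pose B := `|b i i| + K; have B0 : 0 <= B by rewrite addr_ge0.
pose dt := Num.min (Num.min dl 1) (eps / (B + 1)).
have dt0 : 0 < dt by rewrite !lt_min dl0 ltr01/= divr_gt0// ltr_wpDl.
rewrite near_withinE; apply/nbhs_ballP; exists dt => //= h; rewrite /ball/= sub0r normrN => hd hN0.
have [h1 h2 h3] : [/\ `|h| <= dl, `|h| <= 1 & `|h| <= eps / (B + 1)].
  by move: (ltW hd); rewrite !le_min => /andP[/andP[-> ->] ->].
have en : enorm (h *: delta_mx 0 i : 'rV[R]_p) = `|h|.
  rewrite enormZ /enorm /dot (bigD1 i)//= big1 => [|j ji]; last by rewrite !mxE (negbTE ji) andbF mul0r.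
  by rewrite !mxE !eqxx mulr1 addr0 sqrtr1 mulr1.
have := H (h *: delta_mx 0 i); rewrite en => /(_ h1).
have -> : \sum_j (h *: delta_mx 0 i : 'rV[R]_p) 0 j * a j = h * a i.
  rewrite (bigD1 i)//= big1 => [|j ji]; last by rewrite !mxE (negbTE ji) andbF mulr0 mul0r.
  by rewrite !mxE !eqxx mulr1 addr0.
have -> : \sum_j \sum_l (h *: delta_mx 0 i : 'rV[R]_p) 0 j * (h *: delta_mx 0 i : 'rV[R]_p) 0 l * b j l =
    h ^+ 2 * b i i.
  rewrite (bigD1 i)//= [X in _ + X]big1 => [|j ji]; last first.
    by rewrite big1// => l _; rewrite !mxE (negbTE ji) andbF mulr0 !mul0r.
  rewrite (bigD1 i)//= big1 => [|j ji]; last by rewrite !mxE (negbTE ji) andbF !mulr0 mul0r.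
  by rewrite !mxE !eqxx !mulr1 !addr0 expr2.
rewrite /= [_ + th]addrC; set D := f _ - f th => HD.
have hn0 : 0 < `|h| by rewrite normr_gt0.
rewrite -(ler_pM2l hn0) -normrM.
have -> : h * (a i - h^-1 *: D) = - (D - (h * a i + h ^+ 2 * b i i)) - h ^+ 2 * b i i.
  by rewrite -[h^-1 *: D]/(h^-1 * D); field.
apply: (le_trans (ler_normB _ _)); rewrite normrN.
have E1 : `|h ^+ 2 * b i i| = `|h| * (`|h| * `|b i i|) by rewrite normrM normrX expr2 mulrA.
rewrite E1; apply: (le_trans (lerD HD (lexx _))).
have -> : K * `|h| ^+ 3 + `|h| * (`|h| * `|b i i|) = `|h| * (`|h| * (K * `|h| + `|b i i|)) by ring.
rewrite ler_wpM2l//; apply: (@le_trans _ _ (`|h| * (B + 1))).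
  rewrite ler_wpM2l// /B addrC -addrA lerD2l; apply: (@le_trans _ _ K); last by rewrite lerDl.
  by rewrite ler_piMr.
by rewrite -ler_pdivlMr// ltr_wpDl.
Qed.

Lemma compact_enorm_bounded (R : realType) (p : nat) (C : set 'rV[R]_p) : compact C ->
  exists2 M : R, 0 <= M & forall h, C h -> enorm h <= M.
Proof.
move=> cC; have H i : exists M : R, forall h, C h -> `|h 0 i| <= M.
  have /compact_bounded[M [_ HM]] : compact ((fun h : 'rV[R]_p => h 0 i) @` C).
    by apply: continuous_compact => //; apply: continuous_subspaceT; exact: coord_continuous.
  exists (M + 1) => h Ch; apply: (HM (M + 1)); first by rewrite ltrDl.
  by exists h.
have [M HM] := choice H; exists (Num.sqrt (\sum_i M i ^+ 2)); first exact: sqrtr_ge0.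
move=> h Ch; rewrite /enorm ler_wsqrtr// /dot ler_sum// => i _.
rewrite -expr2 -[X in X <= _]real_normK ?num_real// lerXn2r ?nnegrE//; last exact: HM.
exact: (le_trans (normr_ge0 _) (HM i h Ch)).
Qed.

Section ModelLAN.
Variables (R : realType) (d' : nat).
Local Notation d := d'.+1.
Variables (mu0 : 'rV[R]_d.+1) (Hm0 : hyperboloid mu0).
Variables (iota : {linear 'rV[R]_d -> 'rV[R]_d.+1}) (Hiota : tangent_isometry mu0 iota).
Variables (A : 'M[R]_d) (sA : Defs.symmetric A).
Local Notation X := 'rV[R]_d.+1.
Local Notation p := (d + vdim d)%N.
Local Notation w := (weight mu0).
Local Notation th0 := (theta0 A).
Implicit Types (u h : 'rV[R]_p) (x : X).

Let P := model iota mu0 th0.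
Let ell x u : R := mdens iota mu0 (th0 + u) x - mdens iota mu0 th0 x.
Let a i x : R := score iota mu0 th0 x 0 i.

Let mw : measurable_fun setT w.
Proof. by apply: measurable_funD => //; exact: measurable_radius. Qed.

Let w1 := weight_ge1 mu0.

Let mdens_measurable u : measurable_fun setT (mdens iota mu0 (th0 + u)).
Proof. exact: measurable_mdens. Qed.

Let mell u : measurable_fun setT (ell ^~ u).
Proof.
apply: measurable_funB => //.
by have := mdens_measurable 0; rewrite addr0.
Qed.

Let density u (F : X -> \bar R) : measurable_fun setT F -> (forall x, 0 <= F x)%E ->
  (\int[model iota mu0 (th0 + u)]_x F x = \int[P]_x (F x * (expR (ell x u))%:E))%E.
Proof.
move=> mF F0; have := model_change_of_law Hm0 Hiota sA 0 u mF F0.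
by rewrite addr0.
Qed.

Let mom n : (\int[P]_x (w x ^+ n)%:E < +oo)%E.
Proof.
have [dl dl0 H] := model_moments Hm0 Hiota sA; have [C HC] := H n.
have := HC 0; rewrite enorm0 addr0 => /(_ (ltW dl0)) h.
exact: (le_lt_trans h (ltry C)).
Qed.

(** The jet provides some linear coefficients; [derive_quadratic], applied at each x separately,
    shows that they are the coordinates of the score, which thereby inherit measurability and
    polynomial bounds. *)
Lemma score_expansion : exists b : 'I_p -> 'I_p -> X -> R,
  [/\ forall i, tempered w (a i), forall i j, tempered w (b i j) &
   vanish w 3 (fun x u => ell x u - (\sum_i u 0 i * a i x + \sum_i \sum_j u 0 i * u 0 j * b i j x))].
Proof.
have [_ [L [Q [[a0 ta0 La0] [b tb Qb] V]]]] := jet_mdens Hm0 Hiota sA.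
have V' : vanish w 3 (fun x u => ell x u - (\sum_i u 0 i * a0 i x + \sum_i \sum_j u 0 i * u 0 j * b i j x)).
  have E (r s t v : R) : r - (s + t + v) = (r - s) - (t + v) by ring.
  apply: (vanish_ext _ V) => x u.
  by rewrite La0 Qb; exact: E.
have aE i : a i = a0 i.
  apply/funext => x; have [C [n [dl [dl0 C0 H]]]] := V'.
  rewrite /a mxE; apply: (@derive_quadratic R p _ th0 (a0 ^~ x) (fun i j => b i j x) (C * w x ^+ n) dl) => //.
    by rewrite mulr_ge0// wX_ge0.
  by move=> u ud; exact: H.
exists b; split=> //; first by move=> i; rewrite aE.
by apply: vanish_ext V' => x u; congr (_ - (_ + _)); apply: eq_bigr => i _; rewrite aE.
Qed.

Let ta i : tempered w (a i). Proof. by have [b []] := score_expansion. Qed.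

Lemma fisherE i j : fisher iota mu0 th0 i j = mean P (fun x => a i x * a j x).
Proof. by rewrite mxE unlock. Qed.

Lemma score_mean0 i : mean P (a i) = 0.
Proof.
have [b [_ tb V]] := score_expansion.
have den u (F : X -> \bar R) : measurable_fun setT F -> (forall x, 0 <= F x)%E ->
  (\int[model iota mu0 (th0 + u)]_x F x = \int[model iota mu0 (th0 + 0)]_x (F x * (expR (ell x u))%:E))%E.
  by rewrite addr0; exact: density.
have := mean_score mw w1 ta tb mell den V (model_moments Hm0 Hiota sA) i.
by rewrite addr0.
Qed.

Lemma quadratic_mean : exists b : 'I_p -> 'I_p -> X -> R,
  [/\ forall i j, tempered w (b i j),
   vanish w 3 (fun x u => ell x u - (\sum_i u 0 i * a i x + \sum_i \sum_j u 0 i * u 0 j * b i j x)) &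
   forall u, mean P (fun x => \sum_i \sum_j u 0 i * u 0 j * b i j x) =
     - (2^-1 * mean P (fun x => (\sum_i u 0 i * a i x) ^+ 2))].
Proof.
have [b [_ tb V]] := score_expansion; exists b; split=> // u.
have den u' (F : X -> \bar R) : measurable_fun setT F -> (forall x, 0 <= F x)%E ->
  (\int[model iota mu0 (th0 + u')]_x F x = \int[model iota mu0 (th0 + 0)]_x (F x * (expR (ell x u'))%:E))%E.
  by rewrite addr0; exact: density.
have := mean_second mw w1 ta tb mell den V (model_moments Hm0 Hiota sA) u.
by rewrite addr0.
Qed.

(** The Fisher form is the variance of the linear part, the shape in which the second score identity
    and the LAN bound express the centring constant. *)
Lemma quad_fisher h : quad (fisher iota mu0 th0) h = mean P (fun x => (\sum_i h 0 i * a i x) ^+ 2).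
Proof.
have tij i j : tempered w (fun x => a i x * a j x) by exact: temperedM.
rewrite (_ : (fun x => _) = fun x => \sum_i \sum_j h 0 i * h 0 j * (a i x * a j x)); last first.
  apply/funext => x; rewrite expr2 mulr_suml; apply: eq_bigr => i _; rewrite mulr_sumr.
  by apply: eq_bigr => j _; ring.
have tc c : tempered w (fun=> c) by exact: tempered_cst.
rewrite (mean_sum mw w1 mom); last by move=> i; apply: tempered_sum => // j; exact: temperedM.
rewrite /quad /dot.
rewrite (eq_bigr (fun j => \sum_i h 0 i * h 0 j * mean P (fun x => a i x * a j x))); last first.
  move=> j _; rewrite mxE mulr_suml; apply: eq_bigr => i _; rewrite fisherE; ring.
rewrite exchange_big/=; apply: eq_bigr => i _.
rewrite (mean_sum mw w1 mom); last by move=> j; exact: temperedM.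
by apply: eq_bigr => j _; rewrite (meanZ mw w1 mom _ (tij i j)).
Qed.

Lemma modeln_RN n u :
  modeln iota mu0 (th0 + u) n `<< modeln iota mu0 th0 n /\
  {ae modeln iota mu0 th0 n, forall t : n.-tuple X,
    lne (('d (charge_of_finite_measure (modeln iota mu0 (th0 + u) n)) '/d (modeln iota mu0 th0 n)) t)
      = (\sum_(i < n) ell (tnth t i) u)%:E}.
Proof. exact: sample_RN (mell u) (@density u) n. Qed.

Lemma LAN_remainderE n h (t : n.-tuple X) : LAN_remainder iota mu0 th0 h t =
  \sum_(i < n) ell (tnth t i) ((Num.sqrt n%:R)^-1 *: h) -
  (\sum_(i < n) \sum_j ((Num.sqrt n%:R)^-1 *: h) 0 j * a j (tnth t i) -
   2^-1 * mean P (fun x => (\sum_i h 0 i * a i x) ^+ 2)).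
Proof.
rewrite /LAN_remainder quad_fisher; congr (_ - (_ - _)).
rewrite /central_seq dotZr /dot exchange_big/= mulr_sumr; apply: eq_bigr => j _.
rewrite summxE !mulr_sumr; apply: eq_bigr => i _.
by rewrite [(_ *: h) 0 j]mxE mulrA.
Qed.

Lemma LAN_remainder_cvg0 (C : set 'rV[R]_p) : compact C ->
  cvg0_in_probability (modeln iota mu0 th0)
    (fun n t => ereal_sup [set `|LAN_remainder iota mu0 th0 h t|%:E | h in C]).
Proof.
move=> cC eps eps0; have [M M0 HM] := compact_enorm_bounded cC.
have [b [tb V second]] := quadratic_mean.
have [K [N0 HK]] := LAN_remainder_bound mw w1 tb V mom second M0.
apply: (@squeeze_cvge _ _ _ _ (fun=> 0%E) _ (fun n => (K * (Num.sqrt n%:R)^-1 / eps)%:E)).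
- exists N0 => // n /= Nn; rewrite measure_ge0/=.
  (* A supremum above eps is witnessed by some h in C, so the event lies in the existential one;
     neither is claimed to be measurable. *)
  apply: le_trans (HK n eps Nn eps0); apply: prodprob_mono => t /= /ereal_sup_gt[_ [h Ch <-]].
  rewrite lte_fin LAN_remainderE => h1; exists h => //; exact: HM.
- exact: cvg_cst.
- apply: cvg_EFin; first by near=> n.
  rewrite -[X in _ --> X](mul0r eps^-1); apply: cvgMl.
  by rewrite -[X in _ --> X](mulr0 K); apply: cvgMr; exact: cvg_inv_sqrt.
Unshelve. all: by end_near. Qed.

Lemma central_seq_cvg : posdef (fisher iota mu0 th0) ->
  cvg_in_distribution (modeln iota mu0 th0) (fun n t => central_seq iota mu0 th0 t)
    (mnormal (fisher iota mu0 th0)).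
Proof.
move=> /cholesky[L HL].
apply: (central_limit mw w1 mom ta score_mean0 HL) => i j.
by rewrite fisherE.
Qed.

End ModelLAN.

Theorem theorem6p1 (R : realType) (d : nat) (d_ge2 : (2 <= d)%N)
    (lm lp : R) (lm_gt0 : 0 < lm) (lm_lt_lp : lm < lp)
    (mu0 : 'rV[R]_d.+1) (Hmu0 : hyperboloid mu0)
    (Sigma0 : 'M[R]_d)
    (HSigma0 : relative_interior [set S | posdef S] (calK lm lp) Sigma0)
    (iota : {linear 'rV[R]_d -> 'rV[R]_d.+1})
    (Hiota : tangent_isometry mu0 iota) :
  let theta0 : 'rV[R]_(d + vdim d) := row_mx 0 (vech (mlog Sigma0)) in
  posdef (fisher iota mu0 theta0) ->
  [/\ forall (n : nat) (h : 'rV[R]_(d + vdim d)), (0 < n)%N ->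
        let P := modeln iota mu0 theta0 n in
        let Q := modeln iota mu0 (local_param theta0 n h) n in
        Q `<< P /\
        {ae P, forall X, lne (('d (charge_of_finite_measure Q) '/d P) X)
                         = (loglik_ratio iota mu0 theta0 h X)%:E},
      forall C : set 'rV[R]_(d + vdim d), compact C ->
        cvg0_in_probability (modeln iota mu0 theta0)
          (fun n X =>
             ereal_sup [set `|LAN_remainder iota mu0 theta0 h X|%:E | h in C])
    & cvg_in_distribution (modeln iota mu0 theta0)
        (fun n X => central_seq iota mu0 theta0 X)
        (mnormal (fisher iota mu0 theta0))].
Proof.
(* The dimension is rewritten as a successor, the form in which polar coordinates, hence the
   density, are available. *)
case: d d_ge2 mu0 Hmu0 Sigma0 HSigma0 iota Hiota => // d _ mu0 Hmu0 Sigma0 _ iota Hiota th0 pdF.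
have sA := mlog_symmetric Sigma0; split.
- by move=> n h _; exact: (modeln_RN Hmu0 Hiota sA).
- by move=> C cC; exact: (LAN_remainder_cvg0 Hmu0 Hiota sA cC).
- exact: (central_seq_cvg Hmu0 Hiota sA pdF).
Qed.
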